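(* For each integer $k\ge 3$ let $\rho_k$ be the infimum of those $\rho>0$ for which $$\int_1^X\Big(\int_1^x\Delta_k(u)\,du\Big)^2dx \ll X^{\rho}$$ holds for all $X\ge1$. Then $\rho_3\le 3$, $\rho_4\le \frac{13}{4}$, $\rho_5\le\frac{17}{5}$, $\rho_6\le\frac72$.
   Context: For $k\in\mathbb N$, $d_k(n)$ denotes the number of ways of writing $n$ as an ordered product of $k$ positive integer factors, so that $\sum_{n\ge1} d_k(n)n^{-s}=\zeta^k(s)$ for $\Re s>1$, where $\zeta$ is the Riemann zeta-function. The error term in the general Dirichlet divisor problem is $$\Delta_k(x) := {\sum_{n\le x}}' d_k(n) - xP_{k-1}(\log x) - \zeta^k(0),$$ where ${\sum_{n\le x}}'$ means the last term is halved if $x\in\mathbb N$, $\zeta(0)=-\tfrac12$, and $xP_{k-1}(\log x)=\operatorname{Res}_{s=1}\zeta^k(s)x^s s^{-1}$, with $P_{k-1}$ a polynomial of degree $k-1$ whose coefficients depend on $k$. *)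

(* Defs.v *)
From Stdlib Require Import Reals List ClassicalEpsilon.
From Coquelicot Require Import Coquelicot.
Import ListNotations.
Open Scope R_scope.

Fixpoint lists_of_length (k : nat) (l : list nat) : list (list nat) :=
  match k with
  | O => [[]]
  | S k' => flat_map (fun a => map (cons a) (lists_of_length k' l)) l
  end.

(* The k-tuples of positive integers with product n; for n >= 1 every factor
   lies in {1, ..., n}. *)
Definition d (k n : nat) : nat :=
  length (filter (fun t => Nat.eqb (fold_right Nat.mul 1%nat t) n)
                 (lists_of_length k (seq 1 n))).

Definition Cexp (z : C) : C :=
  (exp (Re z) * cos (Im z), exp (Re z) * sin (Im z)).

(* x^s for real x > 0, with the real logarithm. *)
Definition Rcpow (x : R) (s : C) : C := Cexp (s * RtoC (ln x))%C.

Definition holomorphic_at (f : C -> C) (z : C) : Prop :=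
  @ex_derive C_AbsRing C_NormedModule f z.

(* By the identity theorem this determines Z on C \ {1}; the value Z 1 is
   arbitrary. *)
Definition is_riemann_zeta (Z : C -> C) : Prop :=
  (forall s : C, s <> RtoC 1 -> holomorphic_at Z s) /\
  (forall s : C, 1 < Re s ->
     @is_series C_AbsRing C_NormedModule
       (fun n : nat => Rcpow (INR (S n)) (- s)%C) (Z s)).

Definition zeta : C -> C :=
  epsilon (inhabits (fun _ : C => RtoC 0)) is_riemann_zeta.

(* a is an isolated singularity of f, and the integral of f over every small
   circle a + r e^{it}, 0 <= t <= 2 pi, equals 2 pi i c. *)
Definition is_residue (f : C -> C) (a c : C) : Prop :=
  exists r0 : R, 0 < r0 /\
    (forall z : C, 0 < Cmod (z - a)%C < r0 -> holomorphic_at f z) /\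
    (forall r : R, 0 < r < r0 ->
       @is_RInt C_R_NormedModule
         (fun t : R =>
            let w := (RtoC r * Cexp (Ci * RtoC t))%C in
            (f (a + w) * (Ci * w))%C)
         0 (2 * PI) (RtoC (2 * PI) * Ci * c)%C).

Definition residue (f : C -> C) (a : C) : C :=
  @iota C_R_CompleteNormedModule (is_residue f a).

Lemma residue_unique (f : C -> C) (a c : C) :
  is_residue f a c -> residue f a = c.
Proof.
  intros Hc. unfold residue.
  apply (@iota_unique R_AbsRing C_R_CompleteNormedModule); [| exact Hc].
  intros c' Hc'.
  destruct Hc as [r1 [Hr1 [_ H1]]], Hc' as [r2 [Hr2 [_ H2]]].
  assert (Hm : 0 < Rmin r1 r2) by now apply Rmin_glb_lt.
  pose proof (Rmin_l r1 r2) as Hl. pose proof (Rmin_r r1 r2) as Hr.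
  assert (Hh : 0 < Rmin r1 r2 / 2 < Rmin r1 r2)
    by (split; Lra.lra).
  assert (E1 := @is_RInt_unique C_R_CompleteNormedModule _ _ _ _
                  (H1 (Rmin r1 r2 / 2) ltac:(Lra.lra))).
  assert (E2 := @is_RInt_unique C_R_CompleteNormedModule _ _ _ _
                  (H2 (Rmin r1 r2 / 2) ltac:(Lra.lra))).
  assert (E : (RtoC (2 * PI) * Ci * c')%C = (RtoC (2 * PI) * Ci * c)%C)
    by (rewrite <- E1; symmetry; exact E2).
  assert (Hn : (RtoC (2 * PI) * Ci)%C <> RtoC 0).
  { intros H. apply (f_equal Im) in H. cbn in H.
    pose proof PI_RGT_0. Lra.lra. }
  replace c' with (/ (RtoC (2 * PI) * Ci) * (RtoC (2 * PI) * Ci * c'))%C.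
  - rewrite E, Cmult_assoc, Cinv_l by exact Hn. apply Cmult_1_l.
  - rewrite Cmult_assoc, Cinv_l by exact Hn. apply Cmult_1_l.
Qed.

(* For x >= 0: the sum of d_k(n) over 1 <= n <= x, the last term being halved
   when x is an integer. *)
Definition divisor_sum (k : nat) (x : R) : R :=
  sum_n_m (fun n : nat =>
             if Req_EM_T (INR n) x then INR (d k n) / 2 else INR (d k n))
          1 (Z.to_nat (Int_part x)).

(* x P_{k-1}(log x); the residue is real for x > 0, since zeta commutes with
   complex conjugation. *)
Definition main_term (k : nat) (x : R) : R :=
  Re (residue (fun s : C => zeta s ^ k * Rcpow x s / s)%C (RtoC 1)).

Definition Delta (k : nat) (x : R) : R :=
  divisor_sum k x - main_term k x - Re (zeta (RtoC 0) ^ k)%C.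

Definition admissible_exponent (k : nat) (rho : R) : Prop :=
  0 < rho /\
  exists A : R, forall X : R, 1 <= X ->
    Rabs (RInt (fun x => (RInt (Delta k) 1 x) ^ 2) 1 X) <= A * Rpower X rho.

(* Valued in Rbar, so that the infimum would be p_infty if no exponent were
   admissible. *)
Definition rho (k : nat) : Rbar := Glb_Rbar (admissible_exponent k).

(* Main.v *)
(** Integrating [Delta k] once turns the divisor sum into [sum_(n <= x) d_k(n) (x - n)], which Perron's formula
 expresses as an integral of [zeta(s)^k x^(s+1) / (s (s+1))].  Moving the line of integration to
 [Re s = sigma = 1/2 - 3/(2k) + eta] picks up the residue at 1, whose derivative in [x] is the main term, and Plancherel
 bounds the mean square of what remains by [X^(2 sigma + 3)] times the integral of [|zeta(sigma + it)|^(2k) / |s|^4].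
 That integral is finite: the functional equation bounds it by an integral of [|zeta(1 - sigma + it)|^(2k)] against
 [t^(-1 - 2 k eta)], and the moment of order 2k on [Re s = 1/2 + 3/(2k) - eta] over [U, 2U] is [O(U^(1 + 5/3 k eta))]:
 dyadic blocks of length at most [U^(1/3)] are treated by the mean value theorem for the k-th power, those up to
 [U^(2/3)] by the sixth power mean and van der Corput's third derivative bound, longer ones by the second derivative
 test.  The value [zeta(0)^k] only contributes a multiple of [x], hence [O(X^3)]. *)

Require Import Defs.
From Stdlib Require Import ZArith Reals Lra Lia Psatz List ClassicalEpsilon FunctionalExtensionality.
From Coquelicot Require Import Coquelicot.
Open Scope R_scope.

Tactic Notation "note" open_constr(l) := pose proof l.
Tactic Notation "note" open_constr(l) "as" simple_intropattern(H) := pose proof l as H.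
Tactic Notation "ub" uconstr(l) := eapply Rle_trans; [apply l|].
Tactic Notation "le" uconstr(x) := apply Rle_trans with x.
Ltac ele := eapply Rle_trans.
Ltac mul_l := apply Rmult_le_compat_l.
Ltac mul_r := apply Rmult_le_compat_r.
Ltac abs_in H := apply Rabs_le_between in H.
Ltac fld := field; lra.

(** By the functional equation the mean square on [Re s = sigma] carries the weight
    [t^(2k(1/2 - sigma) - 4)], which is [t^(-1)] exactly at [sigma = 1/2 - 3/(2k)]; the exponent
    [2 sigma + 3] is then [4 - 3/k], that is 3, 13/4, 17/5, 7/2 for [k = 3, ..., 6]. The condition
    [k <= 6] enters in all three ranges of block lengths; in the longest it reads
    [1 - sigma >= 3/4 - eta], without which the second derivative test would lose a power of [U]. In
    the middle range the cube of a block already reaches length [U], so the mean value theorem is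
    spent on the sixth power and the other [2k - 6] factors are estimated pointwise. Three classical
    tools appear in reduced form. The factor of the functional equation is never expressed by Gamma
    functions: it stays the Mellin transform of [1 - cos], and its size comes from stationary phase.
    Plancherel's theorem becomes an inequality with a numerical constant, obtained from finite
    exponential sums through Riemann sums. The horizontal sides of the contour are suppressed by a
    rational damping factor, so that linear growth of zeta is enough there. *)

Lemma PI_gt_3 : 3 < PI.
Proof. pose proof PI2_3_2. unfold PI2 in *. lra. Qed.

Notation __ := (ltac:(lra)) (only parsing).
Notation em := excluded_middle_informative (only parsing).
Notation RC := R_CompleteNormedModule (only parsing).
Notation RN := R_NormedModule (only parsing).
Notation CC := C_R_CompleteNormedModule (only parsing).
Notation CN := C_R_NormedModule (only parsing).

Create HintDb an.
#[export] Hint Extern 0 (_ < _) => lra : an.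
#[export] Hint Extern 0 (_ <= _) => lra : an.
#[export] Hint Extern 0 (_ <= _ <= _) => lra : an.
#[export] Hint Extern 0 (_ < _ < _) => lra : an.
#[export] Hint Extern 0 (_ < _ <= _) => lra : an.
#[export] Hint Extern 0 (_ <= _)%nat => lia : an.
#[export] Hint Extern 0 (_ < _)%nat => lia : an.
#[export] Hint Resolve Rmult_lt_0_compat Rmult_le_pos Rinv_0_lt_compat Rdiv_lt_0_compat Rdiv_le_0_compat pow_lt pow_le exp_pos Cmod_ge_0 Rabs_pos pos_INR Rle_0_sqr Rmin_glb_lt Cmult_neq_0 Rlt_le : an.
#[export] Hint Extern 5 (_ <> _) => (intro; lra) : an.
#[export] Hint Extern 1 (_ < Re _) => (unfold Re; simpl; lra) : an.
#[export] Hint Extern 1 (_ <= Re _) => (unfold Re; simpl; lra) : an.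
#[export] Hint Extern 1 (_ < Re _ < _) => (unfold Re; simpl; lra) : an.
#[export] Hint Extern 1 (Re _ <> _) => (unfold Re; simpl; lra) : an.
#[export] Hint Resolve Rplus_lt_le_0_compat Rplus_le_le_0_compat : an.
#[export] Hint Resolve Rmult_le_compat_l Rmult_le_compat_r Rmult_le_compat Rinv_le_contravar pow_incr Rle_Rpower_l Rplus_le_compat Rle_0_sqr : an.
#[export] Hint Extern 1 (Rmin _ _ <= _) => (ele; [apply Rmin_l|lra]) : an.
Ltac fin := solve [lra | auto 10 with an].

(** * Modulus, real part and imaginary part *)

Lemma Cmod_sub_triangle (x y : C) : Cmod (x - y)%C <= Cmod x + Cmod y.
Proof. rewrite <- (Cmod_opp y). apply Cmod_triangle. Qed.

Lemma Cmod_triangle_inv (x y : C) : Cmod x - Cmod y <= Cmod (x - y)%C.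
Proof.
 note (Cmod_triangle (x - y) y) as H.
 replace (x - y + y)%C with x in H by ring. lra.
Qed.

Lemma Cmod_sub_sym (x y : C) : Cmod (x - y)%C = Cmod (y - x)%C.
Proof. rewrite <- Cmod_opp. f_equal. ring. Qed.

Lemma Im_le_Cmod (z : C) : Rabs (Im z) <= Cmod z.
Proof. ele; [| apply Rmax_Cmod]. apply Rmax_r. Qed.

Lemma Re_le_Cmod (z : C) : Re z <= Cmod z.
Proof. ele; [apply Rle_abs | apply re_le_Cmod]. Qed.

Lemma Cmod_le_Re_Im (z : C) : Cmod z <= Rabs (Re z) + Rabs (Im z).
Proof.
 destruct z as [a b]. simpl.
 replace (a, b) with (RtoC a + Ci*RtoC b)%C
  by (unfold Cplus, Cmult, Ci, RtoC; simpl; f_equal; ring).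
 ub Cmod_triangle .
 rewrite Cmod_mult, Cmod_Ci, !Cmod_R. lra.
Qed.

Lemma Re_plus (x y : C) : Re (x + y)%C = Re x + Re y.
Proof. fin. Qed.
Lemma Re_minus (x y : C) : Re (x - y)%C = Re x - Re y.
Proof. fin. Qed.
Lemma Im_minus (x y : C) : Im (x - y)%C = Im x - Im y.
Proof. fin. Qed.

Lemma C_eq (x y : C) : Re x = Re y -> Im x = Im y -> x = y.
Proof. destruct x, y; simpl; intros; subst; reflexivity. Qed.

(** * Continuity of complex-valued functions *)

(* [d] is the distance of the source, so that functions on [R] and on [C] share the same rules. *)
Definition cont_at {A : Type} (d : A -> A -> R) (f : A -> C) (x : A) : Prop :=
 forall eps, 0 < eps -> exists del, 0 < del /\
  forall y, d x y < del -> Cmod (f y - f x)%C < eps.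

Definition dC (x y : C) : R := Cmod (y - x)%C.
Definition dR (x y : R) : R := Rabs (y - x).

Section Cont.
Context {A : Type} (d : A -> A -> R).

Lemma cont_const (c : C) x : cont_at d (fun _ => c) x.
Proof.
 intros e He. exists 1. split; [lra|]. intros y _.
 replace (c - c)%C with (RtoC 0) by ring. rewrite Cmod_0. lra.
Qed.

Lemma cont_plus (f g : A -> C) x :
 cont_at d f x -> cont_at d g x -> cont_at d (fun y => f y + g y)%C x.
Proof.
 intros Hf Hg e He.
 destruct (Hf (e/2)) as [d1 [H1 K1]]; [lra|].
 destruct (Hg (e/2)) as [d2 [H2 K2]]; [lra|].
 exists (Rmin d1 d2). split; [fin|]. intros y Hy.
 assert (d x y < d1) by (eapply Rlt_le_trans; [exact Hy | fin]).
 assert (d x y < d2) by (eapply Rlt_le_trans; [exact Hy | apply Rmin_r]).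
 replace (f y + g y - (f x + g x))%C with ((f y - f x) + (g y - g x))%C by ring.
 eapply Rle_lt_trans; [apply Cmod_triangle|].
 specialize (K1 y H). specialize (K2 y H0). lra.
Qed.

Lemma cont_mult (f g : A -> C) x :
 cont_at d f x -> cont_at d g x -> cont_at d (fun y => f y*g y)%C x.
Proof.
 intros Hf Hg e He.
 set (M := Cmod (f x) + Cmod (g x) + 1).
 assert (HM : 1 <= M) by (unfold M; note (Cmod_ge_0 (f x)); note (Cmod_ge_0 (g x)); lra).
 (* With [e'] at most 1, the three products in the splitting below add up to less than [e'*M], hence
    to less than [e]. *)
 set (e' := Rmin 1 (e/(2*M))).
 assert (He' : 0 < e') by (apply Rmin_glb_lt; [lra | fin]).
 destruct (Hf e') as [d1 [H1 K1]]; [lra|].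
 destruct (Hg e') as [d2 [H2 K2]]; [lra|].
 exists (Rmin d1 d2). split; [fin|]. intros y Hy.
 assert (d x y < d1) by (eapply Rlt_le_trans; [exact Hy | fin]).
 assert (d x y < d2) by (eapply Rlt_le_trans; [exact Hy | apply Rmin_r]).
 specialize (K1 y H). specialize (K2 y H0).
 assert (E1 : e' <= 1) by apply Rmin_l.
 assert (E2 : e'*M <= e/2).
 { replace (e/2) with (e/(2*M)*M) by fld.
  mul_r; [lra | apply Rmin_r]. }
 replace (f y*g y - f x*g x)%C
  with ((f y - f x)*(g y - g x) + (f y - f x)*g x + f x*(g y - g x))%C by ring.
 eapply Rle_lt_trans; [apply Cmod_triangle|].
 eapply Rle_lt_trans; [apply Rplus_le_compat_r, Cmod_triangle|].
 rewrite !Cmod_mult.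
 note (Cmod_ge_0 (f x)). note (Cmod_ge_0 (g x)).
 note (Cmod_ge_0 (f y - f x)).
 unfold M in *. nra.
Qed.

Lemma cont_opp (f : A -> C) x : cont_at d f x -> cont_at d (fun y => - f y)%C x.
Proof.
 intros H e He. destruct (H e He) as [d1 [H1 K1]]. exists d1; split; auto.
 intros y Hy. replace (- f y - - f x)%C with (-(f y - f x))%C by ring.
 rewrite Cmod_opp. auto.
Qed.

Lemma cont_minus (f g : A -> C) x :
 cont_at d f x -> cont_at d g x -> cont_at d (fun y => f y - g y)%C x.
Proof. intros; unfold Cminus; apply cont_plus; [|apply cont_opp]; auto. Qed.

Lemma cont_pow (f : A -> C) n x : cont_at d f x -> cont_at d (fun y => f y^n)%C x.
Proof.
 intros H. induction n as [|n IH]; simpl; [apply cont_const | apply cont_mult; auto].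
Qed.

Lemma cont_inv (f : A -> C) x :
 f x <> RtoC 0 -> cont_at d f x -> cont_at d (fun y => / f y)%C x.
Proof.
 intros Hn H e He.
 set (m := Cmod (f x)). assert (Hm : 0 < m) by (apply Cmod_gt_0; exact Hn).
 (* The first entry keeps [Cmod (f y)] above [m/2]; the second then makes
    [Cmod (f x - f y)/(Cmod (f y)*m)] smaller than [e]. *)
 set (e' := Rmin (m/2) (e*m*m/4)).
 assert (He' : 0 < e').
 { apply Rmin_glb_lt; [lra|]. fin. }
 destruct (H e' He') as [d1 [H1 K1]]. exists d1; split; auto. intros y Hy.
 specialize (K1 y Hy).
 assert (E1 : e' <= m/2) by apply Rmin_l. assert (E2 : e' <= e*m*m/4) by apply Rmin_r.
 note (Cmod_triangle_inv (f x) (f x - f y)) as T.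
 replace (f x - (f x - f y))%C with (f y) in T by ring.
 rewrite Cmod_sub_sym in T. fold m in T.
 assert (Hy2 : m/2 <= Cmod (f y)) by lra.
 assert (Hny : f y <> RtoC 0) by (intro E; rewrite E, Cmod_0 in Hy2; lra).
 replace (/ f y - / f x)%C with ((f x - f y)*/ (f y*f x))%C by (field; auto).
 rewrite Cmod_mult, Cmod_inv, Cmod_mult, Cmod_sub_sym; [|fin]. apply (Rmult_lt_reg_r (Cmod (f y)*m)); [nra|].
 rewrite Rmult_assoc, Rinv_l; [|nra]. nra.
Qed.

Lemma cont_div (f g : A -> C) x : g x <> RtoC 0 ->
 cont_at d f x -> cont_at d g x -> cont_at d (fun y => f y/g y)%C x.
Proof. intros; unfold Cdiv; apply cont_mult; [|apply cont_inv]; auto. Qed.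

Lemma cont_comp (g : C -> C) (f : A -> C) x :
 cont_at d f x -> cont_at dC g (f x) -> cont_at d (fun y => g (f y)) x.
Proof.
 intros Hf Hg e He. destruct (Hg e He) as [d1 [H1 K1]].
 destruct (Hf d1 H1) as [d2 [H2 K2]]. exists d2; split; auto.
 intros y Hy. apply K1. apply K2, Hy.
Qed.

Lemma cont_ext_loc (f g : A -> C) x :
 d x x = 0 -> (exists del, 0 < del /\ forall y, d x y < del -> f y = g y) ->
 cont_at d f x -> cont_at d g x.
Proof.
 intros Hx [d0 [H0 K0]] H e He. destruct (H e He) as [d1 [H1 K1]].
 exists (Rmin d0 d1). split; [fin|]. intros y Hy.
 rewrite <- !K0.
 - apply K1. eapply Rlt_le_trans; [exact Hy | apply Rmin_r].
 - lra.
 - eapply Rlt_le_trans; [exact Hy | fin].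
Qed.

Lemma cont_pair (f g : A -> R) x :
 cont_at d (fun y => RtoC (f y)) x -> cont_at d (fun y => RtoC (g y)) x ->
 cont_at d (fun y => (f y, g y)) x.
Proof.
 intros Hf Hg. intros e He.
 destruct (cont_plus _ _ x Hf (cont_mult _ _ x (cont_const Ci x) Hg) e He) as [d1 [H1 K1]].
 exists d1; split; auto. intros y Hy.
 replace ((f y, g y) - (f x, g x))%C with (f y + Ci*g y - (f x + Ci*g x))%C; auto.
 unfold Cminus, Cplus, Copp, Cmult, RtoC, Ci; simpl. f_equal; ring.
Qed.

End Cont.

#[export] Hint Resolve cont_const cont_plus cont_mult cont_opp cont_minus cont_pow cont_inv cont_div cont_pair : an.

Lemma cont_id x : cont_at dC (fun z => z) x.
Proof. intros e He. exists e; split; auto. Qed.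

Lemma contR_continuous (f : R -> R) x :
 continuous f x <-> cont_at dR (fun y => RtoC (f y)) x.
Proof.
 split.
 - intros H e He. destruct (proj1 (filterlim_locally f (f x)) H (mkposreal e He)) as [del K].
  exists del. split; [apply cond_pos|]. intros y Hy.
  rewrite <- RtoC_minus, Cmod_R. apply (K y). fin.
 - intros H. apply filterlim_locally. intros [e He].
  destruct (H e He) as [del [H1 K]]. exists (mkposreal del H1). intros y Hy.
  specialize (K y Hy). rewrite <- RtoC_minus, Cmod_R in K. exact K.
Qed.

Lemma cont_R_continuous (f : R -> C) x : cont_at dR f x -> @continuous R_UniformSpace C_UniformSpace f x.
Proof.
 intros H. apply filterlim_locally. intros [e He].
 destruct (H e He) as [del [H1 K]]. exists (mkposreal del H1). intros y Hy.
 specialize (K y Hy). apply C_NormedModule_mixin_compat1. exact K.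
Qed.

Lemma cont_Re {A} (d : A -> A -> R) (f : A -> C) x : cont_at d f x -> cont_at d (fun y => RtoC (Re (f y))) x.
Proof.
 intros H e He. destruct (H e He) as [del [H1 K]]. exists del; split; auto. intros y Hy.
 rewrite <- RtoC_minus, Cmod_R. eapply Rle_lt_trans; [|apply (K y Hy)].
 rewrite <- Re_minus. apply re_le_Cmod.
Qed.

Lemma cont_Im {A} (d : A -> A -> R) (f : A -> C) x : cont_at d f x -> cont_at d (fun y => RtoC (Im (f y))) x.
Proof.
 intros H e He. destruct (H e He) as [del [H1 K]]. exists del; split; auto. intros y Hy.
 rewrite <- RtoC_minus, Cmod_R. eapply Rle_lt_trans; [|apply (K y Hy)].
 rewrite <- Im_minus. apply Im_le_Cmod.
Qed.

Lemma cont_Cmod {A} (d : A -> A -> R) (f : A -> C) x : cont_at d f x -> cont_at d (fun y => RtoC (Cmod (f y))) x.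
Proof.
 intros H e He. destruct (H e He) as [del [H1 K]]. exists del; split; auto. intros y Hy.
 rewrite <- RtoC_minus, Cmod_R. eapply Rle_lt_trans; [|apply (K y Hy)].
 apply Rabs_le. split.
 - note (Cmod_triangle_inv (f x) (f y)). rewrite Cmod_sub_sym in H0. lra.
 - apply Cmod_triangle_inv.
Qed.

(** * Complex derivatives *)

(* Caratheodory's form, for which products and compositions need no limits. *)
Definition cder (f : C -> C) (z l : C) : Prop :=
 exists phi : C -> C, phi z = l /\ cont_at dC phi z /\
  forall w, (f w - f z = phi w*(w - z))%C.

Definition hol (f : C -> C) (z : C) : Prop := exists l, cder f z l.

Lemma cder_eps (f : C -> C) z l :
 cder f z l <-> forall eps, 0 < eps -> exists del, 0 < del /\ forall w,
  Cmod (w - z)%C < del -> Cmod (f w - f z - l*(w - z))%C <= eps*Cmod (w - z)%C.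
Proof.
 split.
 - intros [phi [E [Hc Hf]]] e He. destruct (Hc e He) as [d1 [H1 K1]].
  exists d1; split; auto. intros w Hw. rewrite Hf, <- E.
  replace (phi w*(w - z) - phi z*(w - z))%C with ((phi w - phi z)*(w - z))%C by ring.
  rewrite Cmod_mult. fin.
 - intros H.
  (* The slope function is the difference quotient, completed by the value [l] at the centre. *)
  exists (fun w => if em (w = z) then l else (f w - f z)/(w - z))%C.
  split; [destruct (em (z = z)); congruence|]. split.
  + intros e He. assert (He2 : 0 < e/2) by lra. destruct (H _ He2) as [d1 [H1 K1]].
   exists d1; split; auto. intros w Hw.
   destruct (em (z = z)) as [_|n]; [|congruence].
   destruct (em (w = z)) as [E|n].
   { replace (l - l)%C with (RtoC 0) by ring. rewrite Cmod_0; exact He. }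
   assert (Hnz : (w - z)%C <> RtoC 0) by (intro E; apply n; replace w with (w - z + z)%C by ring; rewrite E; ring).
   specialize (K1 w Hw). replace ((f w - f z)/(w - z) - l)%C with ((f w - f z - l*(w - z))/(w - z))%C by (field; auto).
   rewrite Cmod_div by auto. assert (0 < Cmod (w - z)) by (apply Cmod_gt_0; auto).
   apply Rle_lt_trans with (e/2); [|lra]. apply (Rmult_le_reg_r (Cmod (w - z))); auto.
   unfold Rdiv. rewrite Rmult_assoc, Rinv_l by lra. lra.
  + intros w. destruct (em (w = z)) as [E|n].
   * subst. field; lra.
   * field. intro E; apply n; replace w with (w - z + z)%C by ring; rewrite E; ring.
Qed.

Lemma is_derive_cder (f : C -> C) z l :
 @is_derive C_AbsRing C_NormedModule f z l <-> cder f z l.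
Proof.
 rewrite cder_eps. split.
 - intros [_ H] e He. specialize (H z (fun P HP => HP) (mkposreal e He)).
  destruct H as [del K]. exists del. split; [apply cond_pos|]. intros w Hw.
  specialize (K w Hw).
  replace (f w - f z - l*(w - z))%C with (f w - f z - (w - z)*l)%C by ring. exact K.
 - intros H. split; [apply is_linear_scal_l|].
  intros z' Hz'.
  assert (E : z = z') by (apply (@is_filter_lim_locally_unique C_AbsRing (AbsRing_NormedModule C_AbsRing)); exact Hz').
  rewrite <- E.
  intros [e He]. destruct (H e He) as [del [H1 K]]. exists (mkposreal del H1). intros w Hw.
  specialize (K w Hw). 
  replace (f w - f z - l*(w - z))%C with (f w - f z - (w - z)*l)%C in K by ring. exact K.
Qed.

Lemma holomorphic_hol f z : holomorphic_at f z <-> hol f z.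
Proof. split; intros [l H]; exists l; apply is_derive_cder; exact H. Qed.

Lemma cder_cont f z l : cder f z l -> cont_at dC f z.
Proof.
 intros [phi [E [Hc Hf]]].
 apply cont_ext_loc with (f := fun w => (f z + phi w*(w - z))%C).
 - unfold dC. replace (z - z)%C with (RtoC 0) by ring. apply Cmod_0.
 - exists 1. split; [lra|]. intros y _. rewrite <- Hf. ring.
 - apply cont_plus; [apply cont_const|]. apply cont_mult; auto.
  apply cont_minus; [apply cont_id | apply cont_const].
Qed.

Lemma hol_cont f z : hol f z -> cont_at dC f z.
Proof. intros [l H]. eapply cder_cont; eauto. Qed.

Lemma cder_const c z : cder (fun _ => c) z (RtoC 0).
Proof. exists (fun _ => RtoC 0). repeat split; [apply cont_const | intros; ring]. Qed.

Lemma cder_id z : cder (fun w => w) z (RtoC 1).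
Proof. exists (fun _ => RtoC 1). repeat split; [apply cont_const | intros; ring]. Qed.

Lemma cder_plus f g z l m : cder f z l -> cder g z m -> cder (fun w => f w + g w)%C z (l + m)%C.
Proof.
 intros [p [E [Hc H]]] [q [F [Kc K]]]. exists (fun w => p w + q w)%C. subst.
 repeat split; [apply cont_plus; auto|]. intros w.
 replace (f w + g w - (f z + g z))%C with ((f w - f z) + (g w - g z))%C by ring.
 rewrite H, K. ring.
Qed.

Lemma cder_mult f g z l m : cder f z l -> cder g z m -> cder (fun w => f w*g w)%C z (l*g z + f z*m)%C.
Proof.
 intros [p [E [Hc H]]] [q [F [Kc K]]].
 assert (Hg : cont_at dC g z) by (apply cder_cont with m; exists q; auto).
 exists (fun w => p w*g w + f z*q w)%C. subst.
 repeat split; [apply cont_plus; apply cont_mult; auto; apply cont_const|]. intros w.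
 replace (f w*g w - f z*g z)%C with ((f w - f z)*g w + f z*(g w - g z))%C by ring.
 rewrite H, K. ring.
Qed.

Lemma cder_comp f g z l m : cder f z l -> cder g (f z) m -> cder (fun w => g (f w)) z (m*l)%C.
Proof.
 intros Hf0 [q [F [Kc K]]].
 note (cder_cont _ _ _ Hf0) as Hfc. destruct Hf0 as [p [E [Hc H]]].
 exists (fun w => q (f w)*p w)%C. subst. repeat split.
 - apply cont_mult; auto. apply cont_comp; auto.
 - intros w. rewrite K, H. ring.
Qed.

Lemma cder_inv z : z <> RtoC 0 -> cder (fun w => / w)%C z (- / (z*z))%C.
Proof.
 intros Hz. apply cder_eps. intros e He.
 assert (Hc : cont_at dC (fun w => / w)%C z) by (apply cont_inv; [auto | apply cont_id]).
 set (m := Cmod z). assert (Hm : 0 < m) by (apply Cmod_gt_0; auto).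
 destruct (Hc (e*m)) as [d1 [H1 K1]]; [nra|].
 exists (Rmin d1 m). split; [fin|]. intros w Hw.
 assert (A1 : Cmod (w - z) < d1) by (eapply Rlt_le_trans; [exact Hw | fin]).
 assert (A2 : Cmod (w - z) < m) by (eapply Rlt_le_trans; [exact Hw | apply Rmin_r]).
 assert (Hw0 : w <> RtoC 0).
 { intro E. subst w. replace (0 - z)%C with (-z)%C in A2 by ring. rewrite Cmod_opp in A2. unfold m in A2; lra. }
 replace (/ w - / z - - / (z*z)*(w - z))%C with ((/ w - / z)*/ z*(-(w - z)))%C by (field; auto).
 rewrite !Cmod_mult, Cmod_opp, Cmod_inv by auto.
 mul_r; [fin|].
 specialize (K1 w A1). apply (Rmult_le_reg_r m); auto. rewrite Rmult_assoc, Rinv_l by lra. lra.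
Qed.

Lemma cder_ext_loc f g z l : (exists del, 0 < del /\ forall w, Cmod (w - z)%C < del -> f w = g w) ->
 cder f z l -> cder g z l.
Proof.
 intros [d0 [H0 K0]]. rewrite !cder_eps. intros H e He. destruct (H e He) as [d1 [H1 K1]].
 exists (Rmin d0 d1). split; [fin|]. intros w Hw.
 assert (Ez : f z = g z). { apply K0. replace (z - z)%C with (RtoC 0) by ring. rewrite Cmod_0; auto. }
 rewrite <- Ez, <- (K0 w).
 - apply K1. eapply Rlt_le_trans; [exact Hw | apply Rmin_r].
 - eapply Rlt_le_trans; [exact Hw | fin].
Qed.

Lemma hol_const c z : hol (fun _ => c) z.
Proof. eexists; apply cder_const. Qed.
Lemma hol_id z : hol (fun w => w) z.
Proof. eexists; apply cder_id. Qed.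
Lemma hol_plus f g z : hol f z -> hol g z -> hol (fun w => f w + g w)%C z.
Proof. intros [l H] [m K]; eexists; eapply cder_plus; eauto. Qed.
Lemma hol_mult f g z : hol f z -> hol g z -> hol (fun w => f w*g w)%C z.
Proof. intros [l H] [m K]; eexists; eapply cder_mult; eauto. Qed.
Lemma hol_comp f g z : hol f z -> hol g (f z) -> hol (fun w => g (f w)) z.
Proof. intros [l H] [m K]; eexists; eapply cder_comp; eauto. Qed.
Lemma hol_ext_loc f g z : (exists del, 0 < del /\ forall w, Cmod (w - z)%C < del -> f w = g w) ->
 hol f z -> hol g z.
Proof. intros H [l K]; exists l; eapply cder_ext_loc; eauto. Qed.
Lemma hol_ext f g z : (forall w, f w = g w) -> hol f z -> hol g z.
Proof. intros H; apply hol_ext_loc. exists 1; split; [lra | auto]. Qed.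
Lemma hol_opp f z : hol f z -> hol (fun w => - f w)%C z.
Proof.
 intros H. apply hol_ext with (f := fun w => ((-(1))*f w)%C); [intros; ring|].
 apply hol_mult; [apply hol_const | auto].
Qed.
Lemma hol_minus f g z : hol f z -> hol g z -> hol (fun w => f w - g w)%C z.
Proof. intros; unfold Cminus; apply hol_plus; [|apply hol_opp]; auto. Qed.
Lemma hol_inv f z : f z <> RtoC 0 -> hol f z -> hol (fun w => / f w)%C z.
Proof. intros Hz H. apply (hol_comp f (fun w => / w)%C); auto. eexists; apply cder_inv; auto. Qed.
Lemma hol_div f g z : g z <> RtoC 0 -> hol f z -> hol g z -> hol (fun w => f w/g w)%C z.
Proof. intros; unfold Cdiv; apply hol_mult; [|apply hol_inv]; auto. Qed.
Lemma hol_pow f n z : hol f z -> hol (fun w => f w^n)%C z.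
Proof. intros H; induction n; simpl; [apply hol_const | apply hol_mult; auto]. Qed.

#[export] Hint Resolve cont_id cont_Re cont_Im cont_Cmod hol_const hol_id hol_plus hol_mult hol_opp hol_minus hol_inv hol_div hol_pow hol_cont : an.

(** * The complex exponential and real powers *)

Lemma Cexp_plus a b : Cexp (a + b)%C = (Cexp a*Cexp b)%C.
Proof.
 unfold Cexp, Cmult, Re, Im; simpl. rewrite exp_plus, cos_plus, sin_plus. f_equal; ring.
Qed.

Lemma Cexp_0 : Cexp 0%C = RtoC 1.
Proof. unfold Cexp, RtoC; simpl. rewrite exp_0, cos_0, sin_0. f_equal; ring. Qed.

Lemma Cmod_Cexp z : Cmod (Cexp z) = exp (Re z).
Proof.
 unfold Cexp, Cmod; simpl.
 transitivity (sqrt (Rsqr (exp (Re z)))); [f_equal | apply sqrt_Rsqr; left; apply exp_pos].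
 note (sin2_cos2 (Im z)). unfold Rsqr in *.
 nra.
Qed.

Lemma Cexp_neq_0 z : Cexp z <> RtoC 0.
Proof. intro E. note (Cmod_Cexp z). rewrite E, Cmod_0 in H. note (exp_pos (Re z)). lra. Qed.

Lemma Cexp_opp z : Cexp (- z)%C = (/ Cexp z)%C.
Proof.
 note (Cexp_neq_0 z).
 replace (Cexp (- z)) with (Cexp (-z)*Cexp z/Cexp z)%C by (field; auto).
 rewrite <- Cexp_plus. replace (- z + z)%C with (RtoC 0) by ring. rewrite Cexp_0. field; auto.
Qed.

Lemma sin_le_abs x : Rabs (sin x) <= Rabs x.
Proof.
 assert (P : forall y, 0 <= y -> Rabs (sin y) <= y).
 { intros y Hy. apply Rabs_le. destruct (Rle_dec y 1).
  - destruct (Rle_lt_or_eq_dec _ _ Hy) as [H|<-]; [|rewrite sin_0; lra].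
   note (sin_lt_x y H). note PI2_1. assert (0 <= sin y) by (apply sin_ge_0; lra). lra.
  - note (SIN_bound y). lra. }
 destruct (Rle_dec 0 x).
 - rewrite (Rabs_pos_eq x) by lra. auto.
 - rewrite <- (Rabs_Ropp x), (Rabs_pos_eq (-x)), <- (Rabs_Ropp (sin x)), <- sin_neg by lra. fin.
Qed.

Lemma one_minus_cos_le x : 0 <= 1 - cos x <= x*x/2.
Proof.
 replace (1 - cos x) with (2*(sin (x/2))^2).
 - note (sin_le_abs (x/2)). assert (sin (x/2)^2 <= (x/2)^2); [|nra].
  rewrite <- (pow2_abs (sin (x/2))), <- (pow2_abs (x/2)). fin.
 - replace x with (2*(x/2)) at 2 by field. rewrite cos_2a_sin. ring.
Qed.

(** Both sides follow from [1 + x <= exp x], applied at [x] and at [-x]. *)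
Lemma exp_minus_1_le x : Rabs x <= 1/2 -> Rabs (exp x - 1 - x) <= 2*(x*x).
Proof.
 intros H. note (exp_ineq1_le x). note (exp_ineq1_le (-x)).
 rewrite exp_Ropp in H1. note (exp_pos x).
 assert (exp x*(1 - x) <= 1).
 { apply (Rmult_le_compat_r (exp x)) in H1; [|lra]. rewrite Rinv_l in H1; lra. }
 abs_in H. apply Rabs_le. nra.
Qed.

(** Real estimates for [exp], [cos] and [sin] combine to an error of at most [8*r*r] with
    [r = Cmod w]. The addition theorem then carries the derivative to every other point. *)
Lemma Cexp_der0 : cder Cexp 0%C (RtoC 1).
Proof.
 apply cder_eps. intros e He. exists (Rmin (1/4) (e/8)).
 split; [fin|]. intros w Hw.
 replace (w - 0)%C with w in*by ring.
 assert (H1 : Cmod w < 1/4) by (eapply Rlt_le_trans; [exact Hw | fin]).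
 assert (H2 : Cmod w < e/8) by (eapply Rlt_le_trans; [exact Hw | apply Rmin_r]).
 rewrite Cexp_0. set (r := Cmod w) in *.
 le (8*r*r); [|note (Cmod_ge_0 w); fold r in H; nra].
 ub Cmod_le_Re_Im.
 destruct w as [a b]. unfold Cexp, Re, Im; simpl.
 assert (Ha : Rabs a <= r) by apply (re_le_Cmod (a,b)).
 assert (Hb : Rabs b <= r) by apply (Im_le_Cmod (a,b)).
 assert (E1 := exp_minus_1_le a __).
 assert (E2 := one_minus_cos_le b).
 assert (E3 : Rabs (sin b - b) <= r*r).
 { assert (Q : forall y, 0 <= y <= 1 -> Rabs (sin y - y) <= y*y).
  { intros y Hy. destruct (Req_dec y 0) as [->|]; [rewrite sin_0, Rabs_pos_eq; lra|].
   note (sin_lt_x y __).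
   note (sin_bound y 0 __ ltac:(note PI2_1; lra)) as [S _].
   unfold sin_approx, sum_f_R0, sin_term in S; simpl in S.
   rewrite Rabs_left1 by lra. nra. }
  destruct (Rle_dec 0 b).
  - rewrite Rabs_pos_eq in Hb by lra. specialize (Q b __). nra.
  - rewrite Rabs_left1 in Hb by lra. specialize (Q (-b) __).
   rewrite sin_neg in Q. rewrite <- Rabs_Ropp. replace (-(sin b - b)) with (- sin b - - b) by ring. nra. }
 assert (Ha2 : a*a <= r*r) by (abs_in Ha; nra).
 assert (Hb2 : b*b <= r*r) by (abs_in Hb; nra).
 assert (Hea : Rabs (exp a - 1) <= 2*r).
 { abs_in E1. abs_in Ha. apply Rabs_le. nra. }
 assert (F1 : Rabs (exp a*cos b + -1 + - (1*a - 0*b)) <= 3*r*r).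
 {
  abs_in E1. abs_in Hea. apply Rabs_le. nra. }
 assert (F2 : Rabs (exp a*sin b + -0 + - (1*b + 0*a)) <= 4*r*r).
 { replace (exp a*sin b + -0 + - (1*b + 0*a)) with ((exp a - 1)*sin b + (sin b - b)) by ring.
  ub Rabs_triang. rewrite Rabs_mult.
  note (sin_le_abs b). assert (Rabs (exp a - 1)*Rabs (sin b) <= 2*r*r); [|nra].
  fin. }
 replace (- (1)) with (-1) by ring. lra.
Qed.

Lemma cder_Cexp z : cder Cexp z (Cexp z).
Proof.
 apply cder_ext_loc with (f := fun w => (Cexp z*Cexp (w - z))%C).
 { exists 1. split; [lra|]. intros w _. rewrite <- Cexp_plus. f_equal. ring. }
 assert (H : cder (fun w => Cexp (w - z)%C) z (1*(1 + 0))%C).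
 { apply (cder_comp (fun w => (w - z)%C) Cexp).
  - apply (cder_plus (fun w => w) (fun _ => (-z)%C)); [apply cder_id | apply cder_const].
  - replace (z - z)%C with (RtoC 0) by ring. apply Cexp_der0. }
 note (cder_mult _ _ _ _ _ (cder_const (Cexp z) z) H) as K. simpl in K.
 replace (0*Cexp (z - z) + Cexp z*(1*(1 + 0)))%C with (Cexp z) in K by ring. exact K.
Qed.

Lemma hol_Cexp f z : hol f z -> hol (fun w => Cexp (f w)) z.
Proof. intros. apply (hol_comp f Cexp); auto. eexists; apply cder_Cexp. Qed.

Lemma Rcpow_hol x f z : hol f z -> hol (fun w => Rcpow x (f w)) z.
Proof.
 intros. apply hol_Cexp. apply hol_mult; auto. apply hol_const.
Qed.

Lemma Cmod_Rcpow x s : 0 < x -> Cmod (Rcpow x s) = Rpower x (Re s).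
Proof.
 intros Hx. unfold Rcpow. rewrite Cmod_Cexp. unfold Rpower. f_equal.
 unfold Cmult, RtoC, Re; simpl. ring.
Qed.

Lemma Rcpow_plus x s t : Rcpow x (s + t)%C = (Rcpow x s*Rcpow x t)%C.
Proof. unfold Rcpow. rewrite <- Cexp_plus. f_equal. ring. Qed.

Lemma Rcpow_opp x s : Rcpow x (- s)%C = (/ Rcpow x s)%C.
Proof. unfold Rcpow. rewrite <- Cexp_opp. f_equal. ring. Qed.

Lemma Rcpow_mult x y s : 0 < x -> 0 < y -> Rcpow (x*y) s = (Rcpow x s*Rcpow y s)%C.
Proof. intros. unfold Rcpow. rewrite <- Cexp_plus, ln_mult, RtoC_plus by auto. f_equal. ring. Qed.

Lemma Rcpow_neq_0 x s : Rcpow x s <> RtoC 0.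
Proof. apply Cexp_neq_0. Qed.

Lemma Rcpow_0 x : Rcpow x 0%C = RtoC 1.
Proof. unfold Rcpow. replace (0*RtoC (ln x))%C with (RtoC 0) by ring. apply Cexp_0. Qed.

Lemma Rcpow_base1 s : Rcpow 1 s = RtoC 1.
Proof. unfold Rcpow. rewrite ln_1. replace (s*RtoC 0)%C with (RtoC 0) by ring. apply Cexp_0. Qed.

Lemma Cexp_RtoC x : Cexp (RtoC x) = RtoC (exp x).
Proof. unfold Cexp, RtoC; simpl. rewrite cos_0, sin_0. f_equal; ring. Qed.

Lemma Rcpow_RtoC x a : Rcpow x (RtoC a) = RtoC (Rpower x a).
Proof. unfold Rcpow. rewrite <- RtoC_mult. apply Cexp_RtoC. Qed.

Lemma Rcpow_1 x : 0 < x -> Rcpow x (RtoC 1) = RtoC x.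
Proof. intros. rewrite Rcpow_RtoC, Rpower_1; auto. Qed.

Ltac ceq := apply C_eq; unfold Re, Im; simpl; ring.

#[export] Hint Resolve hol_Cexp Rcpow_hol : an.

(** * Integrals of complex-valued functions of a real variable *)

Definition CI (f : R -> C) (a b : R) : C := @RInt CC f a b.

Definition contI (f : R -> C) (a b : R) : Prop :=
 forall t, a <= t <= b -> cont_at dR f t.

Lemma ex_CI f a b : a <= b -> contI f a b -> @ex_RInt CN f a b.
Proof.
 intros Hab H. apply (@ex_RInt_continuous CC).
 rewrite Rmin_left, Rmax_right by auto. intros z Hz. apply cont_R_continuous, H, Hz.
Qed.

Lemma CI_correct f a b : a <= b -> contI f a b -> @is_RInt CN f a b (CI f a b).
Proof. intros. apply (@RInt_correct CC). apply ex_CI; auto. Qed.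

Lemma CI_unique f a b l : @is_RInt CN f a b l -> CI f a b = l.
Proof. apply (@is_RInt_unique CC). Qed.

Lemma CI_ext f g a b : a <= b -> (forall t, a <= t <= b -> f t = g t) -> CI f a b = CI g a b.
Proof.
 intros Hab H. apply (@RInt_ext CC).
 rewrite Rmin_left, Rmax_right by auto. fin.
Qed.

Lemma CI_plus f g a b : a <= b -> contI f a b -> contI g a b ->
 CI (fun t => f t + g t)%C a b = (CI f a b + CI g a b)%C.
Proof.
 intros. apply CI_unique.
 apply (@is_RInt_plus CN f g); apply CI_correct; auto.
Qed.

Lemma CI_minus f g a b : a <= b -> contI f a b -> contI g a b ->
 CI (fun t => f t - g t)%C a b = (CI f a b - CI g a b)%C.
Proof.
 intros. apply CI_unique.
 apply (@is_RInt_minus CN f g); apply CI_correct; auto.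
Qed.

Lemma is_RInt_Re_Im (f : R -> C) a b l : @is_RInt CN f a b l <->
 is_RInt (fun t => Re (f t)) a b (Re l) /\ is_RInt (fun t => Im (f t)) a b (Im l).
Proof.
 split.
 - intros H. split; [apply (is_RInt_fct_extend_fst (U := RN) (V := RN) f) |
           apply (is_RInt_fct_extend_snd (U := RN) (V := RN) f)]; exact H.
 - intros [H1 H2]. destruct l as [l1 l2].
  apply (is_RInt_fct_extend_pair (U := RN) (V := RN) f); auto.
Qed.

(** A complex factor is not a scalar of the real module in which the integral is taken, so the
    integral is split into real and imaginary parts. *)
Lemma CI_cmult c f a b : a <= b -> contI f a b ->
 CI (fun t => c*f t)%C a b = (c*CI f a b)%C.
Proof.
 intros Hab H. apply CI_unique. apply CI_correct, is_RInt_Re_Im in H; auto. destruct H as [H1 H2].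
 apply is_RInt_Re_Im. destruct c as [c1 c2]. split; simpl.
 - apply (is_RInt_minus (fun t => c1*Re (f t)) (fun t => c2*Im (f t)));
   apply (is_RInt_scal (V := RN)); auto.
 - apply (is_RInt_plus (fun t => c1*Im (f t)) (fun t => c2*Re (f t)));
   apply (is_RInt_scal (V := RN)); auto.
Qed.

Lemma CI_const c a b : CI (fun _ => c) a b = (RtoC (b - a)*c)%C.
Proof.
 apply CI_unique. replace (RtoC (b - a)*c)%C with (@scal R_AbsRing CN (b - a) c).
 - apply is_RInt_const.
 - unfold scal; simpl. unfold prod_scal, scal; simpl. unfold mult; simpl.
  ceq.
Qed.

Lemma CI_Chasles f a b c : a <= b -> b <= c -> contI f a c ->
 (CI f a b + CI f b c = CI f a c)%C.
Proof.
 intros. apply (@RInt_Chasles CC); apply ex_CI; auto; intros t Ht; apply H1; lra.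
Qed.

Lemma contI_sub f a b c e : contI f a b -> a <= c -> e <= b -> contI f c e.
Proof. intros H ? ? t Ht. fin. Qed.

Lemma CI_le f (g : R -> R) a b : a <= b -> contI f a b -> ex_RInt g a b ->
 (forall t, a <= t <= b -> Cmod (f t) <= g t) -> Cmod (CI f a b) <= RInt g a b.
Proof.
 intros Hab Hf Hg H. rewrite Cmod_norm.
 apply (norm_RInt_le (V := CN) f g a b); auto.
 - intros x Hx. rewrite <- Cmod_norm. auto.
 - apply CI_correct; auto.
 - apply (RInt_correct (V := RC)); auto.
Qed.

Lemma CI_bound f a b M : a <= b -> contI f a b ->
 (forall t, a <= t <= b -> Cmod (f t) <= M) -> Cmod (CI f a b) <= (b - a)*M.
Proof.
 intros Hab Hf H. rewrite Cmod_norm.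
 apply (norm_RInt_le_const (V := CN) f a b); auto.
 - intros x Hx. rewrite <- Cmod_norm. auto.
 - apply CI_correct; auto.
Qed.

Lemma CI_comp_lin f u v a b : 0 < u -> a <= b -> contI f (u*a + v) (u*b + v) ->
 CI f (u*a + v) (u*b + v) = (RtoC u*CI (fun t => f (u*t + v)%R) a b)%C.
Proof.
 intros Hu Hab H.
 assert (Hc : contI (fun t => f (u*t + v)) a b).
 { intros t Ht e He. destruct (H (u*t+v) ltac:(nra) e He) as [d1 [H1 K1]].
  exists (d1/u). split; [fin|]. intros y Hy. apply K1. unfold dR in *.
  replace (u*y + v - (u*t + v)) with (u*(y - t)) by ring.
  rewrite Rabs_mult, (Rabs_pos_eq u) by lra. apply (Rmult_lt_compat_l u) in Hy; auto.
  replace (u*(d1/u)) with d1 in Hy by fld. lra. }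
 rewrite <- CI_cmult; auto. rewrite <- (@RInt_comp_lin CC).
 - apply (@RInt_ext CC). intros x _.
  unfold scal; simpl. unfold prod_scal, scal; simpl. unfold mult; simpl.
  ceq.
 - apply ex_CI; auto. nra.
Qed.

Lemma CI_opp_var f a b : a <= b -> contI f a b -> CI (fun t => f (- t)) (- b) (- a) = CI f a b.
Proof.
 intros Hab H. apply CI_unique.
 assert (K : @is_RInt CN f (- - b) (- - a) (opp (CI f a b))).
 { rewrite !Ropp_involutive. apply (is_RInt_swap (V := CN)), CI_correct; auto. }
 apply is_RInt_comp_opp in K. 
 apply is_RInt_opp in K.
 match type of K with is_RInt _ _ _ ?x => replace x with (CI f a b) in K
  by (symmetry; apply (opp_opp (G := C_AbelianGroup))) end.
 eapply is_RInt_ext; [|exact K]. intros x _. apply (opp_opp (G := C_AbelianGroup)).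
Qed.

(** * Derivatives along the real line and the fundamental theorem *)

Definition rder (f : R -> C) (t : R) (l : C) : Prop :=
 exists phi : R -> C, phi t = l /\ cont_at dR phi t /\
  forall u, (f u - f t = phi u*RtoC (u - t))%C.

Lemma cont_RtoC t : cont_at dR RtoC t.
Proof. apply (contR_continuous (fun x => x)). apply continuous_id. Qed.

Lemma rder_const c t : rder (fun _ => c) t (RtoC 0).
Proof. exists (fun _ => RtoC 0). repeat split; [fin | intros; ring]. Qed.

Lemma rder_id t : rder RtoC t (RtoC 1).
Proof. exists (fun _ => RtoC 1). repeat split; [fin | intros; rewrite RtoC_minus; ring]. Qed.

Lemma rder_plus f g t l m : rder f t l -> rder g t m -> rder (fun w => f w + g w)%C t (l + m)%C.
Proof.
 intros [p [E [Hc H]]] [q [F [Kc K]]]. exists (fun w => p w + q w)%C. subst.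
 repeat split; [fin|]. intros w.
 replace (f w + g w - (f t + g t))%C with ((f w - f t) + (g w - g t))%C by ring.
 rewrite H, K. ring.
Qed.

Lemma rder_cont f t l : rder f t l -> cont_at dR f t.
Proof.
 intros [phi [E [Hc Hf]]].
 apply cont_ext_loc with (f := fun w => (f t + phi w*(RtoC w - RtoC t))%C).
 - unfold dR. rewrite Rminus_diag. apply Rabs_R0.
 - exists 1. split; [lra|]. intros y _. rewrite <- RtoC_minus, <- Hf. ring.
 - apply cont_plus; [fin|]. apply cont_mult; auto.
  apply cont_minus; [apply cont_RtoC | fin].
Qed.

Lemma rder_mult f g t l m : rder f t l -> rder g t m -> rder (fun w => f w*g w)%C t (l*g t + f t*m)%C.
Proof.
 intros [p [E [Hc H]]] [q [F [Kc K]]].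
 assert (Hg : cont_at dR g t) by (apply rder_cont with m; exists q; auto).
 exists (fun w => p w*g w + f t*q w)%C. subst.
 repeat split; [fin|]. intros w.
 replace (f w*g w - f t*g t)%C with ((f w - f t)*g w + f t*(g w - g t))%C by ring.
 rewrite H, K. ring.
Qed.

Lemma rder_comp (f : R -> C) (g : C -> C) t l m :
 rder f t l -> cder g (f t) m -> rder (fun w => g (f w)) t (m*l)%C.
Proof.
 intros Hf0 [q [F [Kc K]]].
 note (rder_cont _ _ _ Hf0) as Hfc. destruct Hf0 as [p [E [Hc H]]].
 exists (fun w => q (f w)*p w)%C. subst. repeat split.
 - apply cont_mult; auto. apply cont_comp; auto.
 - intros w. rewrite K, H. ring.
Qed.

Lemma rder_is_derive f t l : rder f t l -> @is_derive R_AbsRing CN f t l.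
Proof.
 intros [phi [E [Hc Hf]]]. split; [apply is_linear_scal_l|].
 intros t' Ht'.
 assert (Et : t = t') by (apply (@is_filter_lim_locally_unique R_AbsRing RN); exact Ht').
 rewrite <- Et.
 intros [e He]. destruct (Hc e He) as [d1 [H1 K1]]. exists (mkposreal d1 H1). intros u Hu. rewrite <- Cmod_norm.
 match goal with |- Cmod ?x <= _ => replace x with ((phi u - phi t)*RtoC (u - t))%C end.
 - rewrite Cmod_mult, Cmod_R. fin.
 - rewrite E. transitivity ((f u - f t) - RtoC (u - t)*l)%C; [rewrite Hf; ring|].
  destruct l as [l1 l2]. destruct (f u) as [a1 a2], (f t) as [b1 b2].
  unfold minus, plus, opp, scal; simpl. unfold prod_plus, prod_opp, prod_scal; simpl.
  unfold scal, plus, opp; simpl. unfold mult, Cminus, Cplus, Copp, Cmult, RtoC; simpl.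
  ceq.
Qed.

Lemma rder_of_real (f : R -> R) t l : is_derive f t l -> rder (fun u => RtoC (f u)) t (RtoC l).
Proof.
 intros [_ H]. specialize (H t (fun P HP => HP)).
 exists (fun u => if Req_EM_T u t then RtoC l else RtoC ((f u - f t)/(u - t))).
 split; [destruct (Req_EM_T t t); congruence|]. split.
 - intros e He. destruct (H (mkposreal (e/2) __)) as [del K]. exists del.
  split; [apply cond_pos|]. intros u Hu. specialize (K u Hu).
  destruct (Req_EM_T t t) as [_|]; [|lra].
  destruct (Req_EM_T u t) as [->|n].
  { replace (l - l)%C with (RtoC 0) by ring. rewrite Cmod_0; auto. }
  rewrite <- RtoC_minus, Cmod_R.
  assert (P : 0 < Rabs (u - t)) by (apply Rabs_pos_lt; lra).
  apply Rle_lt_trans with (e/2); [|lra]. apply (Rmult_le_reg_r (Rabs (u - t))); auto.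
  rewrite <- Rabs_mult. replace (((f u - f t)/(u - t) - l)*(u - t)) with (f u - f t - (u - t)*l) by fld.
  exact K.
 - intros u. destruct (Req_EM_T u t) as [->|n].
  + ceq.
  + rewrite <- RtoC_mult, <- RtoC_minus. f_equal. field. lra.
Qed.

Lemma CI_FTC F f a b : a <= b -> (forall t, a <= t <= b -> rder F t (f t)) -> contI f a b ->
 CI f a b = (F b - F a)%C.
Proof.
 intros Hab H Hc. apply CI_unique.
 apply (@is_RInt_derive CC F f a b); rewrite Rmin_left, Rmax_right by auto.
 - intros x Hx. apply rder_is_derive; auto.
 - intros x Hx. apply cont_R_continuous; auto.
Qed.

(** * Segments, Goursat's lemma and primitives *)

Definition line (p q : C) (t : R) : C := (p + RtoC t*(q - p))%C.
Definition Seg (f : C -> C) (p q : C) : C := ((q - p)*CI (fun t => f (line p q t)) 0 1)%C.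

Lemma rder_line p q t : rder (line p q) t (q - p)%C.
Proof.
 note (rder_plus _ _ t _ _ (rder_const p t)
  (rder_mult _ _ t _ _ (rder_id t) (rder_const (q - p)%C t))) as H.
 cbv beta in H. replace (0 + (1*(q - p) + t*0))%C with (q - p)%C in H by ring. exact H.
Qed.

Lemma cont_line p q t : cont_at dR (line p q) t.
Proof. eapply rder_cont, rder_line. Qed.

Definition convexC (D : C -> Prop) : Prop :=
 forall p q t, D p -> D q -> 0 <= t <= 1 -> D (line p q t).
Definition openC (D : C -> Prop) : Prop :=
 forall z, D z -> exists r, 0 < r /\ forall w, Cmod (w - z)%C < r -> D w.
Definition contS (f : C -> C) (p q : C) : Prop :=
 forall t, 0 <= t <= 1 -> cont_at dC f (line p q t).

Lemma contS_contI f p q : contS f p q -> contI (fun t => f (line p q t)) 0 1.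
Proof. intros H t Ht. apply (cont_comp dR f (line p q)); [apply cont_line | fin]. Qed.

Lemma contS_convex f D p q : convexC D -> (forall z, D z -> cont_at dC f z) -> D p -> D q -> contS f p q.
Proof. intros HD Hf Hp Hq t Ht. fin. Qed.

Lemma Seg_rev f p q : contS f p q -> Seg f q p = (- Seg f p q)%C.
Proof.
 intros H. unfold Seg.
 assert (E : CI (fun t => f (line p q t)) 0 1 = CI (fun t => f (line q p t)) 0 1).
 { note (contS_contI _ _ _ H) as Hc.
  rewrite <- (CI_opp_var _ 0 1) by (auto; lra).
  assert (Hc2 : contI (fun t => f (line p q (- t))) (1*0 + -1) (1*1 + -1)).
  { intros t Ht. apply (cont_comp dR f (fun t => line p q (- t))); [|fin].
   intros e He. destruct (cont_line p q (-t) e He) as [d1 [H1 K1]]. exists d1; split; auto.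
   intros y Hy. apply K1. unfold dR in *. rewrite <- Rabs_Ropp. replace (- (- y - - t)) with (y - t) by ring. auto. }
  note (CI_comp_lin (fun t => f (line p q (- t))) 1 (-1) 0 1 __ __ Hc2) as E.
  replace (1*0 + -1) with (-(1)) in E by ring. replace (1*1 + -1) with (-0) in E by ring.
  rewrite E, Cmult_1_l. apply CI_ext; [lra|]. intros t Ht. f_equal. ceq. }
 rewrite E. ring.
Qed.

Lemma Seg_split f p q tau : 0 < tau < 1 -> contS f p q ->
 Seg f p q = (Seg f p (line p q tau) + Seg f (line p q tau) q)%C.
Proof.
 intros Ht H. unfold Seg. note (contS_contI _ _ _ H) as Hc.
 rewrite <- (CI_Chasles _ 0 tau 1) by (auto; lra).
 assert (E1 : CI (fun t => f (line p q t)) 0 tau = (RtoC tau*CI (fun t => f (line p (line p q tau) t)) 0 1)%C).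
 { note (CI_comp_lin (fun t => f (line p q t)) tau 0 0 1 __ __) as E.
  replace (tau*0 + 0) with 0 in E by ring. replace (tau*1 + 0) with tau in E by ring.
  rewrite E by (eapply contI_sub; [exact Hc | lra | lra]). f_equal. apply CI_ext; [lra|].
  intros t _. f_equal. ceq. }
 assert (E2 : CI (fun t => f (line p q t)) tau 1 = (RtoC (1 - tau)*CI (fun t => f (line (line p q tau) q t)) 0 1)%C).
 { note (CI_comp_lin (fun t => f (line p q t)) (1 - tau) tau 0 1 __ __) as E.
  replace ((1 - tau)*0 + tau) with tau in E by ring. replace ((1 - tau)*1 + tau) with 1 in E by ring.
  rewrite E by (eapply contI_sub; [exact Hc | lra | lra]). f_equal. apply CI_ext; [lra|].
  intros t _. f_equal. ceq. }
 rewrite E1, E2. ceq.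
Qed.

Lemma Seg_bound f p q M : contS f p q ->
 (forall t, 0 <= t <= 1 -> Cmod (f (line p q t)) <= M) -> Cmod (Seg f p q) <= Cmod (q - p)%C*M.
Proof.
 intros H HM. unfold Seg. rewrite Cmod_mult. mul_l; [fin|].
 ub (CI_bound _ 0 1 M); try lra; [apply contS_contI; auto | auto].
Qed.

Lemma Seg_minus f g p q : contS f p q -> contS g p q ->
 Seg (fun z => f z - g z)%C p q = (Seg f p q - Seg g p q)%C.
Proof.
 intros Hf Hg. unfold Seg. rewrite CI_minus by (try lra; apply contS_contI; auto). ring.
Qed.

Lemma Seg_primitive (F f : C -> C) p q : contS f p q ->
 (forall t, 0 <= t <= 1 -> cder F (line p q t) (f (line p q t))) -> Seg f p q = (F q - F p)%C.
Proof.
 intros Hc H. unfold Seg. rewrite <- CI_cmult; [|lra|apply contS_contI; auto].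
 rewrite (CI_FTC (fun t => F (line p q t))); try lra.
 - unfold line. do 2 f_equal; ring.
 - intros t Ht. rewrite Cmult_comm. apply (rder_comp (line p q) F); [apply rder_line | auto].
 - intros t Ht. apply cont_mult; [fin | apply contS_contI; auto].
Qed.

#[export] Hint Extern 0 (contI _ _ _) => (intros ? ?) : an.
#[export] Hint Extern 1 (cont_at dR _ _) => (match goal with H : contI _ _ _ |- _ => apply H end) : an.

#[export] Hint Resolve cont_RtoC cont_line contS_contI : an.

Definition Tri (f : C -> C) (p q r : C) : C := (Seg f p q + Seg f q r + Seg f r p)%C.

Lemma convex_comb D p q r s t : convexC D -> D p -> D q -> D r ->
 0 <= s -> 0 <= t -> s + t <= 1 -> D (p + RtoC s*(q - p) + RtoC t*(r - p))%C.
Proof.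
 intros HD Hp Hq Hr Hs Ht Hst. destruct (Req_dec (s + t) 0) as [E|E].
 - assert (s = 0) by lra. assert (t = 0) by lra. subst.
  replace (p + 0*(q - p) + 0*(r - p))%C with p by ring. auto.
 - replace (p + RtoC s*(q - p) + RtoC t*(r - p))%C
   with (line p (line q r (t/(s + t))) (s + t)).
  + apply HD; auto; [|lra]. apply HD; auto. split.
   * fin.
   * apply (Rmult_le_reg_r (s + t)); [lra|]. unfold Rdiv. rewrite Rmult_assoc, Rinv_l; lra.
  + apply C_eq; unfold line; simpl; field; auto.
Qed.

(** The sequence [u n - 2*K/2^n] increases and [u n + 2*K/2^n] decreases, and the supremum of the
    first lies below every term of the second. *)
Lemma geometric_cauchy (u : nat -> R) K : 0 <= K ->
 (forall n, Rabs (u (S n) - u n) <= K/2^n) ->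
 exists l, forall n, Rabs (u n - l) <= 2*K/2^n.
Proof.
 intros HK H.
 assert (Hp : forall n, 0 < 2^n) by fin.
 assert (Hs : forall n, K/2^n = 2*(K/2^S n)) by (intro n; simpl; field; specialize (Hp n); lra).
 set (v := fun n => u n - 2*K/2^n). set (w := fun n => u n + 2*K/2^n).
 assert (Hv : forall n m, v n <= v (n + m)%nat).
 { intros n m. induction m as [|m IH]; [rewrite Nat.add_0_r; lra|].
  rewrite Nat.add_succ_r. ele; [exact IH|]. unfold v.
  specialize (H (n + m)%nat). specialize (Hs (n + m)%nat). abs_in H.
  lra. }
 assert (Hw : forall n m, w (n + m)%nat <= w n).
 { intros n m. induction m as [|m IH]; [rewrite Nat.add_0_r; lra|].
  rewrite Nat.add_succ_r. ele; [|exact IH]. unfold w.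
  specialize (H (n + m)%nat). specialize (Hs (n + m)%nat). abs_in H.
  lra. }
 assert (Hvw : forall n m, v n <= w m).
 { intros n m. ub (Hv n m). rewrite Nat.add_comm.
  ele; [|apply (Hw m n)]. unfold v, w.
  assert (0 <= 2*K/2^(m + n)) by fin. lra. }
 destruct (completeness (fun x => exists n, x = v n)) as [l [L1 L2]].
 - exists (w 0%nat). intros x [n ->]. fin.
 - exists (v 0%nat). exists 0%nat; auto.
 - exists l. intros n. apply Rabs_le. split.
  + assert (l <= w n) by (apply L2; intros x [m ->]; apply Hvw). unfold w in *. lra.
  + assert (v n <= l) by (apply L1; exists n; auto). unfold v in *. lra.
Qed.

(** Each inner side is run through twice in opposite directions, the middle triangle being listed as
    [m3, m2, m1]. *)
Lemma Tri_split4 f D p q r : convexC D -> (forall z, D z -> cont_at dC f z) -> D p -> D q -> D r ->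
 let m1 := line p q (1/2) in let m2 := line p r (1/2) in let m3 := line q r (1/2) in
 Tri f p q r = (Tri f p m1 m2 + Tri f m1 q m3 + Tri f m2 m3 r + Tri f m3 m2 m1)%C.
Proof.
 intros HD Hf Hp Hq Hr m1 m2 m3. unfold Tri.
 assert (H1 : D m1) by (apply HD; auto; lra). assert (H2 : D m2) by (apply HD; auto; lra).
 assert (H3 : D m3) by (apply HD; auto; lra).
 assert (S : forall a b, D a -> D b -> contS f a b) by (intros; eapply contS_convex; eauto).
 rewrite (Seg_split f p q (1/2)) by (auto; lra).
 rewrite (Seg_split f q r (1/2)) by (auto; lra).
 rewrite (Seg_rev f p r), (Seg_split f p r (1/2)) by (auto; lra).
 fold m1 m2 m3.
 rewrite (Seg_rev f m2 m1), (Seg_rev f p m2), (Seg_rev f m3 m2), (Seg_rev f m1 m3), (Seg_rev f m2 r) by auto.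
 field; lra.
Qed.

(** This value depends only on the end points, so the affine part of a function cancels round a
    triangle in [goursat]. *)
Lemma Seg_affine a b p q : Seg (fun z => a + b*z)%C p q = (a*(q - p) + b*(q*q - p*p)/2)%C.
Proof.
 rewrite (Seg_primitive (fun z => a*z + b*z*z/2)%C).
 - ceq.
 - intros t _. fin.
 - intros t _. set (z := line p q t).
  note (cder_plus _ _ z _ _ (cder_mult _ _ z _ _ (cder_const a z) (cder_id z))
   (cder_mult _ _ z _ _ (cder_mult _ _ z _ _ (cder_mult _ _ z _ _ (cder_const b z) (cder_id z)) (cder_id z)) (cder_const (/ 2)%C z))) as K.
  cbv beta in K.
  replace (0*z + a*1 + (((0*z + b*1)*z + b*z*1)*/ 2 + b*z*z*0))%C with (a + b*z)%C in K by (field; auto).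
  exact K.
Qed.

Lemma four_pigeonhole (A B E F : C) : exists G, (G = A \/ G = B \/ G = E \/ G = F) /\
 Cmod (A + B + E + F)%C/4 <= Cmod G.
Proof.
 note (Cmod_triangle (A + B + E) F). note (Cmod_triangle (A + B) E). note (Cmod_triangle A B).
 destruct (Rle_dec (Cmod (A + B + E + F)%C/4) (Cmod A)); [exists A; auto|].
 destruct (Rle_dec (Cmod (A + B + E + F)%C/4) (Cmod B)); [exists B; auto|].
 destruct (Rle_dec (Cmod (A + B + E + F)%C/4) (Cmod E)); [exists E; auto|].
 exists F; split; auto. lra.
Qed.

(** The classical bisection argument: among four subtriangles one keeps a quarter of the integral,
    the nested triangles shrink to a point [z], and complex differentiability at [z] makes the small
    integrals too small for a nonzero start. *)
Lemma goursat f D p q r : convexC D -> (forall z, D z -> hol f z) -> D p -> D q -> D r ->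
 Tri f p q r = RtoC 0.
Proof.
 intros HD Hf Hp Hq Hr.
 assert (Hc : forall z, D z -> cont_at dC f z) by fin.
 set (P := fun s t => (p + RtoC s*(q - p) + RtoC t*(r - p))%C).
 (* A triangle similar to the given one is coded by a corner [(s, t)] in affine coordinates and a
    signed size [e]; the middle subtriangle has the opposite corner and size [-e/2]. *)
 set (T := fun x : R*R*R => let '(s, t, e) := x in Tri f (P s t) (P (s + e) t) (P s (t + e))).
 (* The invariant places all three corners in the original triangle, in the coordinates [(s, t)]. *)
 set (inv := fun x : R*R*R => let '(s, t, e) := x in
  0 <= s /\ 0 <= t /\ s + t <= 1 /\ 0 <= s + e /\ 0 <= t + e /\ s + t + e <= 1).
 assert (HP : forall s t, 0 <= s -> 0 <= t -> s + t <= 1 -> D (P s t)) by (intros; apply convex_comb; auto).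
 assert (step : forall x, exists y, inv x -> inv y /\ Cmod (T x)/4 <= Cmod (T y) /\
   Rabs (snd y) = Rabs (snd x)/2 /\ Rabs (fst (fst y) - fst (fst x)) <= Rabs (snd x)/2 /\
   Rabs (snd (fst y) - snd (fst x)) <= Rabs (snd x)/2).
 { intros [[s t] e]. destruct (em (inv (s, t, e))) as [I|n]; [|exists (s,t,e); tauto].
  note I as [I1 [I2 [I3 [I4 [I5 I6]]]]].
  note (Tri_split4 f D (P s t) (P (s+e) t) (P s (t+e)) HD Hc ltac:(apply HP; lra) ltac:(apply HP; lra) ltac:(apply HP; lra)) as E.
  replace (line (P s t) (P (s + e) t) (1/2)) with (P (s + e/2) t) in E
   by (apply C_eq; unfold P, line; simpl; field).
  replace (line (P s t) (P s (t + e)) (1/2)) with (P s (t + e/2)) in E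
   by (apply C_eq; unfold P, line; simpl; field).
  replace (line (P (s + e) t) (P s (t + e)) (1/2)) with (P (s + e/2) (t + e/2)) in E
   by (apply C_eq; unfold P, line; simpl; field).
  destruct (four_pigeonhole (T (s, t, e/2)) (T (s + e/2, t, e/2)) (T (s, t + e/2, e/2)) (T (s + e/2, t + e/2, -(e/2)))) as [G [HG1 HG2]].
  assert (ET : T (s, t, e) = Cplus (Cplus (Cplus (T (s, t, e/2)) (T (s + e/2, t, e/2))) (T (s, t + e/2, e/2))) (T (s + e/2, t + e/2, -(e/2)))).
  { unfold T. replace (s + e/2 + e/2) with (s + e) by field. replace (t + e/2 + e/2) with (t + e) by field.
   replace (s + e/2 + -(e/2)) with s by field. replace (t + e/2 + -(e/2)) with t by field. fin. }
  rewrite <- ET in HG2.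
  assert (A0 : Rabs (e/2) = Rabs e/2) by (unfold Rdiv; rewrite Rabs_mult, (Rabs_pos_eq (/2)) by lra; auto).
  note (Rabs_pos e).
  destruct HG1 as [-> | [-> | [-> | ->]]];
   eexists; intros _; (split; [|split; [exact HG2|]]); simpl;
   rewrite ?Rabs_Ropp, ?Rminus_diag, ?Rabs_R0, ?A0; unfold inv;
   try replace (s + e/2 - s) with (e/2) by ring; try replace (t + e/2 - t) with (e/2) by ring;
   rewrite ?A0; repeat split; lra. }
 destruct (choice _ step) as [nx Hnx].
 set (X := fix X n := match n with O => (0, 0, 1) | S n => nx (X n) end).
 assert (HX : forall n, inv (X n) /\ Rabs (snd (X n)) = / 2^n /\ Cmod (T (0,0,1))/4^n <= Cmod (T (X n))).
 { induction n as [|n [IH1 [IH2 IH3]]].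
  - simpl. rewrite Rabs_R1. lra.
  - change (X (S n)) with (nx (X n)). destruct (Hnx (X n) IH1) as [J1 [J2 [J3 _]]]. split; [auto|split].
   + rewrite J3, IH2. simpl. field. apply pow_nonzero; lra.
   + le (Cmod (T (0,0,1))/4^n/4); [|lra].
    right. simpl. field. apply pow_nonzero; lra. }
 assert (Hcau : forall n, Rabs (fst (fst (X (S n))) - fst (fst (X n))) <= 1/2^n /\
           Rabs (snd (fst (X (S n))) - snd (fst (X n))) <= 1/2^n).
 { intros n. destruct (HX n) as [I [E _]]. change (X (S n)) with (nx (X n)).
  destruct (Hnx (X n) I) as [_ [_ [_ [J1 J2]]]].
  assert (0 < / 2^n) by fin. lra. }
 destruct (geometric_cauchy (fun n => fst (fst (X n))) 1 __ (fun n => proj1 (Hcau n))) as [s0 Hs0].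
 destruct (geometric_cauchy (fun n => snd (fst (X n))) 1 __ (fun n => proj2 (Hcau n))) as [t0 Ht0].
 assert (small : forall e, 0 < e -> exists n, 2*1/2^n < e).
 { intros e He. destruct (pow_lt_1_zero (1/2) ltac:(rewrite Rabs_pos_eq; lra) (e/2) __) as [N HN].
  exists N. specialize (HN N (le_n N)). rewrite Rabs_pos_eq in HN by fin.
  unfold Rdiv in *. rewrite Rmult_1_l, pow_inv in HN. lra. }
 assert (HXi : forall n, 0 <= fst (fst (X n)) /\ 0 <= snd (fst (X n)) /\ fst (fst (X n)) + snd (fst (X n)) <= 1).
 { intros n. destruct (HX n) as [I _]. destruct (X n) as [[s t] e]. simpl in *. lra. }
 assert (Hst : 0 <= s0 /\ 0 <= t0 /\ s0 + t0 <= 1).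
 { repeat split; apply Rnot_lt_le; intro L.
  - destruct (small (- s0) __) as [n Hn]. specialize (Hs0 n). destruct (HXi n) as [? _]. abs_in Hs0. lra.
  - destruct (small (- t0) __) as [n Hn]. specialize (Ht0 n). destruct (HXi n) as [_ [? _]]. abs_in Ht0. lra.
  - destruct (small ((s0 + t0 - 1)/2) __) as [n Hn]. specialize (Hs0 n). specialize (Ht0 n).
   destruct (HXi n) as [_ [_ ?]]. abs_in Hs0. abs_in Ht0. lra. }
 set (z := P s0 t0). assert (Hz : D z) by (apply HP; lra).
 destruct (Hf z Hz) as [l Hl]. rewrite cder_eps in Hl.
 set (L := Cmod (q - p) + Cmod (r - p)). assert (HL : 0 <= L) by (unfold L; note (Cmod_ge_0 (q - p)); note (Cmod_ge_0 (r-p)); lra).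
 assert (HPd : forall s t s' t', Cmod (P s t - P s' t')%C <= L*(Rabs (s - s') + Rabs (t - t'))).
 { intros. replace (P s t - P s' t')%C with (RtoC (s - s')*(q - p) + RtoC (t - t')*(r - p))%C
   by ceq.
  ub Cmod_triangle. rewrite !Cmod_mult, !Cmod_R. unfold L.
  note (Rabs_pos (s - s')). note (Rabs_pos (t - t')).
  note (Cmod_ge_0 (q - p)). note (Cmod_ge_0 (r-p)). nra. }
 (* At scale [k = 1/2^n] the function differs from its affine approximation at [z] by [O(e*k)] on
    sides of length [O(k)]. The bisection loses only the factor [4^n], which is [1/(k*k)]. *)
 assert (key : forall e, 0 < e -> Cmod (T (0,0,1)) <= e*(36*L*L)).
 { intros e He. destruct (Hl e He) as [del [Hd1 Hd2]].
  destruct (small (del/(6*L + 1))) as [n Hn]; [fin|].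
  destruct (HX n) as [I [J1 J2]]. specialize (Hs0 n). specialize (Ht0 n).
  remember (X n) as x. destruct x as [[s t] h]. simpl in J1, Hs0, Ht0.
  set (k := / 2^n) in *. assert (Hk : 0 < k) by (apply Rinv_0_lt_compat, pow_lt; lra).
  replace (2*1/2^n) with (2*k) in*by (unfold k; field; apply pow_nonzero; lra).
  assert (Hnear : forall a b, Rabs (a - s) <= k -> Rabs (b - t) <= k -> Cmod (P a b - z)%C <= 6*L*k).
  { intros a b Ha Hb. ub HPd.
   replace (a - s0) with ((a - s) + (s - s0)) by ring. replace (b - t0) with ((b - t) + (t - t0)) by ring.
   note (Rabs_triang (a - s) (s - s0)). note (Rabs_triang (b - t) (t - t0)). nra. }
  assert (Hdel : 6*L*k < del).
  {
   apply (Rmult_lt_compat_r (6*L + 1)) in Hn; [|lra]. unfold Rdiv in Hn. rewrite (Rmult_assoc del), Rinv_l in Hn; lra. }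
  set (g := fun w => (f w - ((f z - l*z) + l*w))%C).
  assert (Hseg : forall a b c d', Rabs (a - s) <= k -> Rabs (b - t) <= k -> Rabs (c - s) <= k -> Rabs (d' - t) <= k ->
   0 <= a -> 0 <= b -> a + b <= 1 -> 0 <= c -> 0 <= d' -> c + d' <= 1 ->
   Rabs (c - a) <= k -> Rabs (d' - b) <= k ->
   Cmod (Seg f (P a b) (P c d') - ((f z - l*z)*(P c d' - P a b) + l*(P c d'*P c d' - P a b*P a b)/2))%C <= e*(12*L*L*(k*k))).
  { intros a b c d' A1 A2 A3 A4 B1 B2 B3 B4 B5 B6 Q1 Q2.
   assert (Caff : contS (fun w => (f z - l*z) + l*w)%C (P a b) (P c d')).
   { intros u _. fin. }
   assert (Cf : contS f (P a b) (P c d')) by (eapply contS_convex; eauto).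
   rewrite <- Seg_affine, <- Seg_minus; auto.
   ub (Seg_bound _ _ _ (e*(6*L*k))).
   - intros u Hu. fin.
   - intros u Hu.
    replace (line (P a b) (P c d') u) with (P (a + u*(c - a)) (b + u*(d' - b)))
     by ceq.
    set (w := P _ _).
    assert (Hw : Cmod (w - z)%C <= 6*L*k).
    { apply Hnear.
     - apply Rabs_le. abs_in A1. abs_in A3. nra.
     - apply Rabs_le. abs_in A2. abs_in A4. nra. }
    replace (f w - (f z - l*z + l*w))%C with (f w - f z - l*(w - z))%C by ring.
    ele; [apply Hd2; lra|]. fin.
   - assert (Cmod (P c d' - P a b) <= 2*L*k).
    { ub HPd. nra. }
    le (2*L*k*(e*(6*L*k))); [|lra].
    fin. } destruct I as [I1 [I2 [I3 [I4 [I5 I6]]]]].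
  assert (Z0 : Rabs (s - s) <= k) by (rewrite Rminus_diag, Rabs_R0; lra).
  assert (Z1 : Rabs (t - t) <= k) by (rewrite Rminus_diag, Rabs_R0; lra).
  assert (Z2 : Rabs (s + h - s) <= k) by (replace (s + h - s) with h by ring; lra).
  assert (Z3 : Rabs (t + h - t) <= k) by (replace (t + h - t) with h by ring; lra).
  assert (Z4 : Rabs (s - (s + h)) <= k) by (replace (s - (s + h)) with (-h) by ring; rewrite Rabs_Ropp; lra).
  assert (Z5 : Rabs (t - (t + h)) <= k) by (replace (t - (t + h)) with (-h) by ring; rewrite Rabs_Ropp; lra).
  note (Hseg s t (s+h) t __ __ __ __ __ __ __ __ __ __ __ __) as S1.
  note (Hseg (s+h) t s (t+h) __ __ __ __ __ __ __ __ __ __ __ __) as S2.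
  note (Hseg s (t+h) s t __ __ __ __ __ __ __ __ __ __ __ __) as S3.
  assert (TT : Cmod (T (s, t, h)) <= e*(36*L*L*(k*k))).
  { unfold T, Tri.
   match type of S1 with Cmod (Cminus ?a ?x) <= _ => match type of S2 with Cmod (Cminus ?b ?y) <= _ => match type of S3 with Cmod (Cminus ?c ?w) <= _ =>
    replace (a + b + c)%C with ((a - x) + (b - y) + (c - w))%C end end end.
   - ub Cmod_triangle. ele; [apply Rplus_le_compat_r, Cmod_triangle|]. lra.
   - field. }
  assert (K4 : Cmod (T (0,0,1))/4^n = Cmod (T (0,0,1))*(k*k)).
  { unfold k. replace 4 with (2*2) by ring. rewrite Rpow_mult_distr. field. apply pow_nonzero; lra. } apply (Rmult_le_reg_r (k*k)); [nra|]. nra. }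
 assert (E0 : Cmod (T (0,0,1)) = 0).
 { apply Rle_antisym; [|fin].
  set (eta := Cmod (T (0,0,1))) in *.
  specialize (key (eta/(2*(36*L*L + 1)))).
  assert (0 <= 36*L*L) by nra.
  assert (eta/(2*(36*L*L + 1))*(36*L*L + 1) = eta/2) by fld. nra. }
 apply Cmod_eq_0 in E0. rewrite <- E0. unfold T. f_equal; unfold P; rewrite ?Rplus_0_l; ring.
Qed.

(** Only triangles with a vertex at [b] and a side starting at [z] are involved, and holomorphy is
    not assumed. This also covers the slope function in [cauchy_formula], of which only continuity
    is known at the centre. *)
Lemma cder_primitive f b z : cont_at dC f z ->
 (exists r, 0 < r /\ forall w, Cmod (w - z)%C < r -> contS f z w /\ contS f b w /\ Tri f b z w = RtoC 0) ->
 cder (Seg f b) z (f z).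
Proof.
 intros Hc [r [Hr H]]. apply cder_eps. intros e He.
 destruct (Hc e He) as [del [Hd1 Hd2]]. exists (Rmin r del). split; [fin|]. intros w Hw.
 assert (A1 : Cmod (w - z) < r) by (eapply Rlt_le_trans; [exact Hw | fin]).
 assert (A2 : Cmod (w - z) < del) by (eapply Rlt_le_trans; [exact Hw | apply Rmin_r]).
 destruct (H w A1) as [C1 [C2 E]]. unfold Tri in E. rewrite (Seg_rev f b w) in E by auto.
 replace (Seg f b w - Seg f b z)%C with (Seg f z w).
 2:{ replace (Seg f z w) with (Seg f b z + Seg f z w + - Seg f b w + (Seg f b w - Seg f b z))%C by ring. rewrite E. ring. }
 replace (f z*(w - z))%C with (Seg (fun _ => f z) z w) by (unfold Seg; rewrite CI_const, RtoC_minus; ring).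
 rewrite <- Seg_minus; [|auto|intros t _; apply cont_const].
 rewrite Rmult_comm. apply Seg_bound.
 - intros t Ht. fin.
 - intros t Ht. left. apply Hd2. unfold dC, line. replace (z + t*(w - z) - z)%C with (RtoC t*(w - z))%C by ring.
  rewrite Cmod_mult, Cmod_R, Rabs_pos_eq by lra. note (Cmod_ge_0 (w - z)). nra.
Qed.

Lemma primitive_convex f D b : convexC D -> openC D -> (forall z, D z -> hol f z) -> D b ->
 forall z, D z -> cder (Seg f b) z (f z).
Proof.
 intros HD HO Hf Hb z Hz. apply cder_primitive; [fin|].
 destruct (HO z Hz) as [r [Hr H]]. exists r; split; auto. intros w Hw.
 assert (Hc : forall z, D z -> cont_at dC f z) by fin.
 repeat split; [eapply contS_convex; eauto | eapply contS_convex; eauto | eapply goursat; eauto].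
Qed.

(** * Cauchy's formula on circles *)

Lemma disc_convex a R : convexC (fun z => Cmod (z - a)%C < R).
Proof.
 intros p q t Hp Hq Ht.
 replace (line p q t - a)%C with (RtoC (1 - t)*(p - a) + RtoC t*(q - a))%C
  by ceq.
 eapply Rle_lt_trans; [apply Cmod_triangle|]. rewrite !Cmod_mult, !Cmod_R, !Rabs_pos_eq by lra.
 destruct (Req_dec t 0) as [->|]; [lra|]. nra.
Qed.

Lemma disc_open a R : openC (fun z => Cmod (z - a)%C < R).
Proof.
 intros z Hz. exists (R - Cmod (z - a)). split; [lra|]. intros w Hw.
 replace (w - a)%C with ((w - z) + (z - a))%C by ring.
 eapply Rle_lt_trans; [apply Cmod_triangle|]. lra.
Qed.

Definition circ (a : C) (r t : R) : C := (a + RtoC r*Cexp (Ci*RtoC t))%C.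

Lemma rder_expi t : rder (fun u => Cexp (Ci*RtoC u)%C) t (Ci*Cexp (Ci*RtoC t))%C.
Proof.
 note (rder_comp (fun u => (Ci*RtoC u)%C) Cexp t _ _
  (rder_mult _ _ t _ _ (rder_const Ci t) (rder_id t)) (cder_Cexp _)) as H. cbv beta in H.
 replace (Cexp (Ci*t)*(0*t + Ci*1))%C with (Ci*Cexp (Ci*t))%C in H by ring. exact H.
Qed.

Lemma rder_circ a r t : rder (circ a r) t (Ci*(RtoC r*Cexp (Ci*RtoC t)))%C.
Proof.
 note (rder_plus _ _ t _ _ (rder_const a t)
  (rder_mult _ _ t _ _ (rder_const (RtoC r) t) (rder_expi t))) as H. cbv beta in H.
 replace (0 + (0*Cexp (Ci*t) + r*(Ci*Cexp (Ci*t))))%C with (Ci*(r*Cexp (Ci*t)))%C in H by ring.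
 exact H.
Qed.

Lemma cont_circ a r t : cont_at dR (circ a r) t.
Proof. eapply rder_cont, rder_circ. Qed.

Lemma cont_expi t : cont_at dR (fun u => Cexp (Ci*RtoC u)%C) t.
Proof. eapply rder_cont, rder_expi. Qed.

Lemma Cmod_expi t : Cmod (Cexp (Ci*RtoC t)%C) = 1.
Proof. rewrite Cmod_Cexp. replace (Re (Ci*t)%C) with 0 by (simpl; ring). apply exp_0. Qed.

Lemma Cmod_circ a r t : 0 <= r -> Cmod (circ a r t - a)%C = r.
Proof.
 intros. unfold circ. replace (a + r*Cexp (Ci*t) - a)%C with (r*Cexp (Ci*t))%C by ring.
 rewrite Cmod_mult, Cmod_expi, Cmod_R, Rabs_pos_eq by auto. ring.
Qed.

Lemma expi_2PI : Cexp (Ci*RtoC (2*PI))%C = RtoC 1.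
Proof.
 unfold Cexp. simpl. replace (0*(2*PI) - 1*0) with 0 by ring.
 replace (0*0 + 1*(2*PI)) with (2*PI) by ring. rewrite exp_0, cos_2PI, sin_2PI.
 ceq.
Qed.

Lemma circ_2PI a r : circ a r (2*PI) = circ a r 0.
Proof.
 unfold circ. rewrite expi_2PI. replace (Ci*0)%C with (RtoC 0) by ring. rewrite Cexp_0. auto.
Qed.

Lemma arc_primitive F f a r t1 t2 : t1 <= t2 ->
 (forall t, t1 <= t <= t2 -> cder F (circ a r t) (f (circ a r t))) ->
 (forall t, t1 <= t <= t2 -> cont_at dC f (circ a r t)) ->
 CI (fun t => f (circ a r t)*(Ci*(RtoC r*Cexp (Ci*RtoC t))))%C t1 t2
 = (F (circ a r t2) - F (circ a r t1))%C.
Proof.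
 intros H12 HF Hc. rewrite (CI_FTC (fun t => F (circ a r t))); auto.
 - intros t Ht. apply (rder_comp (circ a r) F); [apply rder_circ | auto].
 - intros t Ht. apply cont_mult; [apply (cont_comp dR f (circ a r)); [apply cont_circ | auto]|].
  apply cont_mult; [fin|]. apply cont_mult; [fin | apply cont_expi].
Qed.

Lemma Cexp_pow n z : Cexp (RtoC (INR n)*z)%C = (Cexp z^n)%C.
Proof.
 induction n as [|n IH].
 - simpl. replace (0*z)%C with (RtoC 0) by ring. apply Cexp_0.
 - rewrite S_INR, RtoC_plus. simpl. rewrite <- IH, <- Cexp_plus. f_equal. ring.
Qed.

Lemma CI_negative_power r n : 0 < r -> (0 < n)%nat ->
 CI (fun t => (/ (RtoC r*Cexp (Ci*RtoC t)))^n)%C 0 (2*PI) = RtoC 0.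
Proof.
 intros Hr Hn. note PI_RGT_0.
 assert (Hn' : RtoC (INR n) <> RtoC 0) by (intro E; apply RtoC_inj in E; apply (not_0_INR n); auto; lia).
 assert (Hi : Ci <> RtoC 0) by (intro E; apply (f_equal Im) in E; simpl in E; lra).
 assert (Hr' : RtoC r <> RtoC 0) by (intro E; apply RtoC_inj in E; lra).
 set (c := ((/ r)^n)%C).
 assert (E : forall t, ((/ (RtoC r*Cexp (Ci*RtoC t)))^n)%C = (c*Cexp (- (INR n)*(Ci*t)))%C).
 { intros t. replace (/ (r*Cexp (Ci*t)))%C with (/ r*/ Cexp (Ci*t))%C by (field; auto using Cexp_neq_0).
  rewrite Cpow_mult_l. f_equal. rewrite <- Cexp_opp, <- Cexp_pow. f_equal. ring. }
 rewrite (CI_ext _ (fun t => c*Cexp (- (INR n)*(Ci*t)))%C) by (try lra; intros; apply E).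
 rewrite (CI_FTC (fun t => (c*/ (- (INR n)*Ci))*Cexp (- (INR n)*(Ci*t)))%C); [| lra | |].
 - replace (Cexp (- (INR n)*(Ci*(2*PI)%R)))%C with (RtoC 1).
  + replace (- (INR n)*(Ci*0))%C with (RtoC 0) by ring. rewrite Cexp_0. ring.
  + replace (- (INR n)*(Ci*(2*PI)%R))%C with (INR n*(- (Ci*(2*PI)%R)))%C by ring.
   rewrite Cexp_pow, Cexp_opp, expi_2PI. replace (/ 1)%C with (RtoC 1) by field. rewrite Cpow_1_l. auto.
 - intros t _.
  note (rder_mult _ _ t _ _ (rder_const (c*/ (- (INR n)*Ci))%C t)
   (rder_comp (fun u => (- (INR n)*(Ci*RtoC u))%C) Cexp t _ _
    (rder_mult _ _ t _ _ (rder_const (- INR n)%C t) (rder_mult _ _ t _ _ (rder_const Ci t) (rder_id t))) (cder_Cexp _))) as K. eapply (fun e => eq_ind _ (rder _ t) K _ e). field. auto.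
 - intros t _. apply cont_mult; [fin|]. apply (cont_comp dR Cexp).
  + fin.
  + fin.
Qed.

Lemma expi_neq r t : 0 < r -> (RtoC r*Cexp (Ci*RtoC t))%C <> RtoC 0.
Proof.
 intros Hr. apply Cmult_neq_0; [|apply Cexp_neq_0]. intro E; apply RtoC_inj in E; lra.
Qed.

Lemma circle_sub_neq r t w : 0 < r -> Cmod w < r -> (RtoC r*Cexp (Ci*RtoC t) - w)%C <> RtoC 0.
Proof.
 intros Hr Hw E. assert (E2 : (r*Cexp (Ci*t))%C = w) by (replace (r*Cexp (Ci*t))%C with (r*Cexp (Ci*t) - w + w)%C by ring; rewrite E; ring).
 rewrite <- E2, Cmod_mult, Cmod_expi, Cmod_R, Rabs_pos_eq in Hw; lra.
Qed.

Lemma Cmod_circle_sub r t w : 0 < r -> r - Cmod w <= Cmod (RtoC r*Cexp (Ci*RtoC t) - w)%C.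
Proof.
 intros Hr. ele; [|apply Cmod_triangle_inv]. rewrite Cmod_mult, Cmod_expi, Cmod_R, Rabs_pos_eq; lra.
Qed.

Lemma cont_rexpi (r t : R) : cont_at dR (fun t => RtoC r*Cexp (Ci*RtoC t))%C t.
Proof. apply cont_mult; [fin | apply cont_expi]. Qed.

#[export] Hint Resolve cont_circ cont_expi cont_rexpi : an.

(** The kernel is expanded as a geometric series in [w/e]. Negative powers integrate to 0, so the
    remainder integral [I N] is the same for all [N >= 1], while it is [O(q^N)] with
    [q = Cmod w/r < 1]; hence it vanishes. *)
Lemma circle_kernel r w : 0 < r -> Cmod w < r ->
 CI (fun t => (RtoC r*Cexp (Ci*RtoC t))/(RtoC r*Cexp (Ci*RtoC t) - w))%C 0 (2*PI) = RtoC (2*PI).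
Proof.
 intros Hr Hw. note PI_RGT_0.
 set (e := fun t => (RtoC r*Cexp (Ci*RtoC t))%C).
 assert (He : forall t, e t <> RtoC 0) by (intro; apply expi_neq; auto).
 assert (Hs : forall t, (e t - w)%C <> RtoC 0) by (intro; apply circle_sub_neq; auto).
 assert (Hce : forall t, cont_at dR e t) by (intro; apply cont_rexpi).
 assert (HcN : forall N a b, contI (fun t => (w^N*(/ e t)^N)*(e t/(e t - w)))%C a b).
 { fin. }
 set (I := fun N => CI (fun t => (w^N*(/ e t)^N)*(e t/(e t - w)))%C 0 (2*PI)).
 assert (Hstep : forall N, (0 < N)%nat -> I N = I (S N)).
 { intros N HN. unfold I.
  rewrite (CI_ext _ (fun t => w^N*(/ e t)^N + (w^S N*(/ e t)^S N)*(e t/(e t - w)))%C).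
  - rewrite CI_plus; [|lra| |apply HcN].
   + rewrite CI_cmult; [|lra|intros t _; apply cont_pow, cont_inv; auto].
    unfold e at 1. rewrite CI_negative_power by auto. ring.
   + intros t _. apply cont_mult; [apply cont_const | apply cont_pow, cont_inv; auto].
  - lra.
  - intros t _. simpl. field. auto. }
 assert (HI : forall N, I (S N) = I 1%nat) by (induction N; [auto | rewrite <- Hstep; auto; lia]).
 assert (H1 : I 1%nat = RtoC 0).
 { apply Cmod_eq_0. apply Rle_antisym; [|fin].
  set (q := Cmod w/r). assert (Hq : 0 <= q < 1).
  { unfold q. split; [fin|].
   apply (Rmult_lt_reg_r r); auto. unfold Rdiv. rewrite Rmult_assoc, Rinv_l; lra. }
  set (K := 2*PI*(r/(r - Cmod w))).
  assert (HK : 0 < K) by (apply Rmult_lt_0_compat; [lra | fin]).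
  assert (Hb : forall N, Cmod (I 1%nat) <= q^S N*K).
  { intros N. rewrite <- (HI N).
   ele; [apply (CI_bound _ 0 (2*PI) (q^S N*(r/(r - Cmod w)))); [lra | fin |]|].
   - intros t _. rewrite Cmod_mult, Cmod_mult, !Cmod_pow, Cmod_inv, Cmod_div by auto.
    assert (Ee : Cmod (e t) = r) by (unfold e; rewrite Cmod_mult, Cmod_expi, Cmod_R, Rabs_pos_eq; lra).
    rewrite Ee, <- Rpow_mult_distr.
    mul_l; [fin|]. mul_l; [lra|].
    apply Rinv_le_contravar; [lra | apply Cmod_circle_sub; auto].
   - unfold K. lra. }
  apply Rnot_lt_le. intro L.
  destruct (pow_lt_1_zero q ltac:(rewrite Rabs_pos_eq; lra) (Cmod (I 1%nat)/K) ltac:(apply Rdiv_lt_0_compat; lra)) as [N HN].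
  specialize (HN (S N) ltac:(lia)). rewrite Rabs_pos_eq in HN by fin.
  apply (Rmult_lt_compat_r K) in HN; [|auto]. unfold Rdiv in HN. rewrite Rmult_assoc, Rinv_l in HN by lra.
  specialize (Hb N). lra. }
 rewrite (CI_ext _ (fun t => RtoC 1 + (w^1*(/ e t)^1)*(e t/(e t - w)))%C).
 - rewrite CI_plus; [|lra|intros t _; apply cont_const|apply HcN]. fold (I 1%nat). rewrite H1, CI_const, Rminus_0_r. ring.
 - lra.
 - intros t _. fold (e t). field. auto.
Qed.

Lemma Seg_pp f p : Seg f p p = RtoC 0.
Proof. ceq. Qed.

(** The slope function [phi] of [h] at [z0] is holomorphic away from [z0] and continuous at [z0].
    That suffices for a primitive, so [phi] integrates to 0 along the circle; what remains of the
    kernel is evaluated by [circle_kernel]. *)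
Lemma cauchy_formula h a R r z0 : (forall z, Cmod (z - a)%C < R -> hol h z) -> 0 < r < R -> Cmod (z0 - a)%C < r ->
 CI (fun t => h (circ a r t)*((RtoC r*Cexp (Ci*RtoC t))/(circ a r t - z0)))%C 0 (2*PI)
 = (RtoC (2*PI)*h z0)%C.
Proof.
 intros Hh Hr Hz0. note PI_RGT_0.
 set (D := fun z => Cmod (z - a)%C < R).
 assert (HD : convexC D) by apply disc_convex. assert (HO : openC D) by apply disc_open.
 assert (Dz0 : D z0) by (unfold D; lra).
 destruct (Hh z0 Dz0) as [l Hl]. note Hl as [phi [E [Hc Hphi]]].
 assert (Hsub : forall z w : C, z <> w -> (z - w)%C <> RtoC 0).
 { intros z w n X. apply n. replace z with (z - w + w)%C by ring. rewrite X. ring. }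
 assert (Hphi_hol : forall z, D z -> z <> z0 -> hol phi z).
 { intros z Dz n. apply hol_ext_loc with (f := fun w => ((h w - h z0)/(w - z0))%C).
  - exists (Cmod (z - z0)). split; [apply Cmod_gt_0; auto|]. intros w Hw.
   assert (w <> z0) by (intro X; subst w; rewrite Cmod_sub_sym in Hw; lra).
   rewrite Hphi. field. auto.
  - fin. }
 assert (Hphi_c : forall z, D z -> cont_at dC phi z).
 { intros z Dz. destruct (em (z = z0)) as [->|n]; auto. fin. }
 assert (HF : forall z, D z -> cder (Seg phi z0) z (phi z)).
 { intros z Dz. apply cder_primitive; auto. destruct (HO z Dz) as [r1 [Hr1 Hball]].
  destruct (em (z = z0)) as [->|n].
  - exists r1; split; auto. intros w Hw.
   assert (contS phi z0 w) by (eapply contS_convex; eauto). repeat split; auto.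
   unfold Tri. rewrite (Seg_rev phi z0 w), Seg_pp by auto. ring.
  - assert (Hpos : 0 < Cmod (z - z0)) by (apply Cmod_gt_0; auto).
   exists (Rmin r1 (Cmod (z - z0))). split; [fin|]. intros w Hw.
   assert (W1 : D w) by (apply Hball; eapply Rlt_le_trans; [exact Hw | fin]).
   assert (W2 : Cmod (w - z) < Cmod (z - z0)) by (eapply Rlt_le_trans; [exact Hw | apply Rmin_r]).
   assert (Sg : forall p q, D p -> D q -> contS phi p q) by (intros; eapply contS_convex; eauto).
   split; [auto|]. split; [auto|].
   (* The condition [0 < ip x] describes the open half-plane bounded by the line through [z0]
      perpendicular to [z - z0]. Its part in the disc is convex and avoids [z0], so [goursat]
      applies to [phi] there. *)
   set (ip := fun x => Re ((x - z0)*Cconj (z - z0))%C).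
   set (D' := fun x => D x /\ 0 < ip x).
   assert (HD' : convexC D').
   { intros p q t [A1 A2] [B1 B2] Ht. split; [fin|].
    replace (ip (line p q t)) with ((1 - t)*ip p + t*ip q) by (unfold ip, line; simpl; ring).
    nra. }
   assert (ipz : 0 < ip z).
   { unfold ip. rewrite <- Cmod2_conj. simpl. nra. }
   assert (ipw : 0 < ip w).
   { assert (ip w = ip z + Re ((w - z)*Cconj (z - z0))%C) by (unfold ip; simpl; ring).
    note (re_le_Cmod ((w - z)*Cconj (z - z0))%C) as Q. rewrite Cmod_mult, Cmod_conj in Q.
    abs_in Q.
    assert (ip z = Cmod (z - z0)*Cmod (z - z0)) by (unfold ip; rewrite <- Cmod2_conj; simpl; ring). nra. }
   (* Shrinking the triangle towards its vertex [z0] does not change the integral: the quadrilateral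
      cut off consists of two triangles in [D']. *)
   assert (Tsplit : forall tau, 0 < tau < 1 -> Tri phi z0 z w = Tri phi z0 (line z0 z tau) (line z0 w tau)).
   { intros tau Ht. set (p' := line z0 z tau). set (q' := line z0 w tau).
    assert (Dp : D p') by (apply HD; auto; lra). assert (Dq : D q') by (apply HD; auto; lra).
    assert (Dp' : D' p'). { split; auto. replace (ip p') with (tau*ip z) by (unfold ip, p', line; simpl; ring). nra. }
    assert (Dq' : D' q'). { split; auto. replace (ip q') with (tau*ip w) by (unfold ip, q', line; simpl; ring). nra. }
    assert (Dz' : D' z) by (split; auto). assert (Dw' : D' w) by (split; auto).
    assert (Hh' : forall x, D' x -> hol phi x).
    { intros x [X1 X2]. apply Hphi_hol; auto. intro X. subst x. unfold ip in X2. simpl in X2. lra. }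
    note (goursat phi D' p' z w HD' Hh' Dp' Dz' Dw') as G1.
    note (goursat phi D' p' w q' HD' Hh' Dp' Dw' Dq') as G2.
    unfold Tri in *. rewrite (Seg_split phi z0 z tau) by auto.
    rewrite (Seg_rev phi z0 w), (Seg_split phi z0 w tau) by auto. fold p' q'.
    rewrite (Seg_rev phi p' w) in G1 by auto. rewrite (Seg_rev phi p' q') in G2 by auto.
    rewrite (Seg_rev phi q' w) in G2 by auto. rewrite (Seg_rev phi z0 q') by auto.
    replace (Seg phi z0 p' + Seg phi p' z + Seg phi z w + - (Seg phi z0 q' + Seg phi q' w))%C
     with ((Seg phi p' z + Seg phi z w + - Seg phi p' w) + (Seg phi p' w + - Seg phi q' w + - Seg phi p' q')
      + (Seg phi z0 p' + Seg phi p' q' + - Seg phi z0 q'))%C by ring.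
    rewrite G1, G2. ring. }
   destruct (Hc 1 __) as [del [Hd1 Hd2]].
   set (K := Cmod (z - z0) + Cmod (w - z0) + 1). note (Cmod_ge_0 (w - z0)).
   assert (HK : 1 < K) by (unfold K; lra).
   apply Cmod_eq_0. apply Rle_antisym; [|fin]. apply Rnot_lt_le. intro L.
   set (M := Cmod (phi z0) + 1). assert (HM : 0 < M) by (unfold M; note (Cmod_ge_0 (phi z0)); lra).
   set (eta := Cmod (Tri phi z0 z w)) in *.
   (* So small that the shrunken triangle lies where [phi] is bounded by [M] and its integral is at
      most half of [eta], which contradicts [Tsplit] if [eta] is positive. *)
   set (tau := Rmin (1/2) (Rmin (del/(2*K)) (eta/(4*K*M)))).
   assert (Ht : 0 < tau).
   { apply Rmin_glb_lt; [lra|]. fin. }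
   assert (T1 : tau <= 1/2) by apply Rmin_l.
   assert (T2 : tau*K <= del/2).
   { replace (del/2) with (del/(2*K)*K) by fld. mul_r; [lra|].
    ele; [apply Rmin_r | fin]. }
   assert (T3 : tau*(2*K*M) <= eta/2).
   { replace (eta/2) with (eta/(4*K*M)*(2*K*M)) by fld. mul_r; [nra|].
    ele; [apply Rmin_r | apply Rmin_r]. }
   set (p' := line z0 z tau). set (q' := line z0 w tau).
   assert (Ep : (p' - z0 = tau*(z - z0))%C) by ceq.
   assert (Eq : (q' - z0 = tau*(w - z0))%C) by ceq.
   assert (Np : Cmod (p' - z0) = tau*Cmod (z - z0)) by (rewrite Ep, Cmod_mult, Cmod_R, Rabs_pos_eq; lra).
   assert (Nq : Cmod (q' - z0) = tau*Cmod (w - z0)) by (rewrite Eq, Cmod_mult, Cmod_R, Rabs_pos_eq; lra).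
   assert (Dp : D p') by (apply HD; auto; lra). assert (Dq : D q') by (apply HD; auto; lra).
   assert (Bd : forall p q, D p -> D q -> Cmod (p - z0) < del -> Cmod (q - z0) < del -> Cmod (Seg phi p q) <= Cmod (q - p)*M).
   { intros p q A1 A2 A3 A4. apply Seg_bound; auto. intros t Htt.
    assert (A5 : Cmod (line p q t - z0) < del) by (apply (disc_convex z0 del p q t); auto).
    note (Hd2 _ A5). note (Cmod_triangle_inv (phi (line p q t)) (phi z0)). unfold M. lra. }
   assert (N0 : Cmod (z0 - z0) = 0) by (replace (z0 - z0)%C with (RtoC 0) by ring; apply Cmod_0).
   assert (P1 : Cmod (p' - z0) < del) by (rewrite Np; unfold K in T2; nra).
   assert (P2 : Cmod (q' - z0) < del) by (rewrite Nq; unfold K in T2; nra).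
   assert (Hfin : eta <= tau*(2*K*M)).
   { unfold eta. rewrite (Tsplit tau) by lra. fold p' q'.
    ub Cmod_triangle. ele; [apply Rplus_le_compat_r, Cmod_triangle|].
    note (Bd z0 p' Dz0 Dp __ P1) as B1. note (Bd p' q' Dp Dq P1 P2) as B2.
    note (Bd q' z0 Dq Dz0 P2 __) as B3. rewrite (Cmod_sub_sym z0 q') in B3.
    assert (B4 : Cmod (q' - p') <= Cmod (q' - z0) + Cmod (p' - z0)).
    { replace (q' - p')%C with ((q' - z0) - (p' - z0))%C by ring. apply Cmod_sub_triangle. } unfold K. nra. }
   lra. }
 assert (Dcirc : forall t, D (circ a r t)) by (intros t; unfold D; rewrite Cmod_circ; lra).
 assert (Z : CI (fun t => phi (circ a r t)*(Ci*(RtoC r*Cexp (Ci*RtoC t))))%C 0 (2*PI) = RtoC 0).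
 { rewrite (arc_primitive (Seg phi z0)) by (try lra; auto). rewrite circ_2PI. ring. }
 set (e := fun t => (RtoC r*Cexp (Ci*RtoC t))%C) in *.
 assert (Hce : forall t, cont_at dR e t) by (intro; apply cont_rexpi).
 assert (Hn : forall t, (circ a r t - z0)%C <> RtoC 0).
 { intros t. unfold circ. replace (a + r*Cexp (Ci*t) - z0)%C with (r*Cexp (Ci*t) - (z0 - a))%C by ring.
  apply circle_sub_neq; lra. }
 assert (Ck : contI (fun t => e t/(circ a r t - z0))%C 0 (2*PI)).
 { fin. }
 assert (Chk : contI (fun t => h (circ a r t)*(e t/(circ a r t - z0)))%C 0 (2*PI)).
 { intros t Ht. apply cont_mult; [|fin]. apply (cont_comp dR h); [fin | apply hol_cont, Hh, Dcirc]. }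
 assert (Hi : Ci <> RtoC 0) by (intro X; apply (f_equal Im) in X; simpl in X; lra).
 rewrite (CI_ext _ (fun t => Ci*(h (circ a r t)*(e t/(circ a r t - z0)) - h z0*(e t/(circ a r t - z0))))%C) in Z; [|lra|].
 2:{ intros t _. 
   replace (phi (circ a r t)) with ((h (circ a r t) - h z0)/(circ a r t - z0))%C by (rewrite Hphi; field; auto).
   ceq. }
 rewrite CI_cmult, CI_minus, CI_cmult in Z; auto; try lra.
 2:{ fin. }
 2:{ fin. }
 assert (Kk : CI (fun t => e t/(circ a r t - z0))%C 0 (2*PI) = RtoC (2*PI)).
 { rewrite <- (circle_kernel r (z0 - a)%C) by lra. apply CI_ext; [lra|]. intros t _. f_equal. ceq. }
 rewrite Kk in Z.
 set (X := CI _ 0 (2*PI)) in Z |- *.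
 replace X with (/ Ci*(Ci*(X - h z0*RtoC (2*PI))) + RtoC (2*PI)*h z0)%C by (field; auto).
 rewrite Z. ring.
Qed.

Lemma cauchy_bound h a R r z0 M : (forall z, Cmod (z - a)%C < R -> hol h z) -> 0 < r < R -> Cmod (z0 - a)%C < r ->
 (forall t, Cmod (h (circ a r t)) <= M) -> Cmod (h z0) <= M*(r/(r - Cmod (z0 - a)%C)).
Proof.
 intros Hh Hr Hz0 HM. note PI_RGT_0.
 note (cauchy_formula h a R r z0 Hh Hr Hz0) as E.
 assert (Hn : forall t, (circ a r t - z0)%C = (RtoC r*Cexp (Ci*RtoC t) - (z0 - a))%C) by (intro; unfold circ; ring).
 apply (Rmult_le_reg_l (2*PI)); [lra|].
 replace (2*PI*Cmod (h z0)) with (Cmod (RtoC (2*PI)*h z0)%C) by (rewrite Cmod_mult, Cmod_R, Rabs_pos_eq; lra).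
 rewrite <- E. ub (CI_bound _ 0 (2*PI) (M*(r/(r - Cmod (z0 - a))))); [lra| | |lra].
 - intros t _. apply cont_mult.
  + apply (cont_comp dR h); [fin | apply hol_cont, Hh]. rewrite Cmod_circ; lra.
  + apply cont_div; [rewrite Hn; apply circle_sub_neq; lra | fin |].
   fin.
 - intros t _. rewrite Cmod_mult. apply Rmult_le_compat; try apply Cmod_ge_0; auto.
  rewrite Hn, Cmod_div by (apply circle_sub_neq; lra).
  rewrite Cmod_mult, Cmod_expi, Cmod_R, Rabs_pos_eq, Rmult_1_r by lra.
  mul_l; [lra|]. apply Rinv_le_contravar; [lra | apply Cmod_circle_sub; lra].
Qed.

(** Two steps of the geometric expansion of Cauchy's kernel. The remainder depends on [h] only
    through the bound [M], which is what termwise differentiation of a series requires. *)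
Lemma cauchy_taylor h a R r M : (forall z, Cmod (z - a)%C < R -> hol h z) -> 0 < r < R ->
 (forall z, Cmod (z - a)%C < R -> Cmod (h z) <= M) ->
 exists c, Cmod c <= M/r /\ forall w, Cmod w <= r/2 ->
  Cmod (h (a + w)%C - h a - c*w)%C <= 2*M/(r*r)*(Cmod w*Cmod w).
Proof.
 intros Hh Hr HM. note PI_RGT_0.
 set (e := fun t => (RtoC r*Cexp (Ci*RtoC t))%C).
 assert (He : forall t, e t <> RtoC 0) by (intro; apply expi_neq; lra).
 assert (Hce : forall t, cont_at dR e t) by (intro; apply cont_rexpi).
 assert (Ne : forall t, Cmod (e t) = r) by (intro t; unfold e; rewrite Cmod_mult, Cmod_expi, Cmod_R, Rabs_pos_eq; lra).
 assert (Hcirc : forall t, Cmod (circ a r t - a) < R) by (intro; rewrite Cmod_circ; lra).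
 assert (Hch : forall t, cont_at dR (fun t => h (circ a r t)) t).
 { intros t. apply (cont_comp dR h); [fin | fin]. }
 set (I1 := CI (fun t => h (circ a r t)/e t)%C 0 (2*PI)).
 assert (P2 : RtoC (2*PI) <> RtoC 0) by (intro E; apply RtoC_inj in E; lra).
 exists (I1/RtoC (2*PI))%C. split.
 - rewrite Cmod_div, Cmod_R, Rabs_pos_eq by (auto; lra).
  apply (Rmult_le_reg_r (2*PI)); [lra|]. unfold Rdiv. rewrite Rmult_assoc, Rinv_l, Rmult_1_r by lra.
  ele; [apply (CI_bound _ 0 (2*PI) (M/r)); [lra | | ]|lra].
  + fin.
  + intros t _. rewrite Cmod_div, Ne by auto. mul_r; [fin | auto].
 - intros w Hw.
  assert (Hs : forall t, (e t - w)%C <> RtoC 0) by (intro; apply circle_sub_neq; lra).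
  assert (E1 := cauchy_formula h a R r (a + w)%C Hh Hr). replace (a + w - a)%C with w in E1 by ring.
  specialize (E1 __).
  assert (E0 := cauchy_formula h a R r a Hh Hr). replace (a - a)%C with (RtoC 0) in E0 by ring. rewrite Cmod_0 in E0.
  specialize (E0 __).
  assert (C0 : contI (fun t => h (circ a r t)*(e t/(circ a r t - a)))%C 0 (2*PI)).
  { intros t _. apply cont_mult; auto. apply cont_div; auto.
   - unfold circ. fold (e t). replace (a + e t - a)%C with (e t) by ring. auto.
   - fin. }
  assert (C1 : contI (fun t => h (circ a r t)/e t)%C 0 (2*PI)) by fin.
  assert (C2 : contI (fun t => h (circ a r t)*(/ (e t*(e t - w))))%C 0 (2*PI)).
  { fin. }
  rewrite (CI_ext _ (fun t => h (circ a r t)*(e t/(circ a r t - a)) + (w*(h (circ a r t)/e t) + (w*w)*(h (circ a r t)*(/ (e t*(e t - w))))))%C) in E1; [|lra|].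
  2:{ intros t _. unfold circ. fold (e t). field. auto. }
  rewrite CI_plus, CI_plus, !CI_cmult in E1; auto; try lra; try (intros t Ht; apply cont_mult; [fin | auto]).
  2:{ fin. }
  unfold e in E1 at 1. rewrite E0 in E1. fold I1 in E1.
  set (I2 := CI (fun t => h (circ a r t)*/ (e t*(e t - w)))%C 0 (2*PI)) in *.
  replace (h (a + w) - h a - I1/(2*PI)%R*w)%C with ((w*w*I2)/RtoC (2*PI))%C.
  2:{ replace (h (a + w)%C) with ((2*PI)%R*h a/(2*PI)%R + (w*I1 + w*w*I2)/(2*PI)%R)%C.
    - field. auto.
    - transitivity (((2*PI)%R*h (a + w))/(2*PI)%R)%C; [rewrite <- E1; field; auto | field; auto]. }
  rewrite Cmod_div, Cmod_R, Rabs_pos_eq, !Cmod_mult by (auto; lra).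
  assert (B : Cmod I2 <= (2*PI)*(M*(2/(r*r)))).
  { ele; [apply (CI_bound _ 0 (2*PI) (M*(2/(r*r)))); [lra | auto | ] | lra].
   intros t _. rewrite Cmod_mult, Cmod_inv, Cmod_mult, Ne by fin.
   apply Rmult_le_compat; auto; [fin | left; apply Rinv_0_lt_compat, Rmult_lt_0_compat; [lra | apply Cmod_gt_0; auto] |].
   replace (2/(r*r)) with (/ (r*(r/2))) by fld. apply Rinv_le_contravar; [nra|].
   mul_l; [lra|]. ele; [|apply Cmod_circle_sub; lra]. lra. }
  apply (Rmult_le_reg_r (2*PI)); [lra|]. unfold Rdiv. rewrite Rmult_assoc, Rinv_l, Rmult_1_r by lra.
  nra.
Qed.

Lemma contI_bounded f a b : a <= b -> contI f a b -> exists M, forall t, a <= t <= b -> Cmod (f t) <= M.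
Proof.
 intros Hab H. destruct (continuity_ab_maj (fun t => Cmod (f t)) a b Hab) as [tm [Hm _]].
 - intros c Hc. apply continuity_pt_filterlim. apply (contR_continuous (fun t => Cmod (f t))).
  fin.
 - exists (Cmod (f tm)). auto.
Qed.

(** Brings the angle into a compact interval, on which continuity gives a bound. *)
Lemma circ_mod_period a r t : exists u, 0 <= u <= 2*PI /\ circ a r t = circ a r u.
Proof.
 note PI_RGT_0. set (y := t/(2*PI)). exists (2*PI*frac_part y). destruct (base_fp y).
 split; [nra|].
 assert (E : t = 2*PI*frac_part y + 2*IZR (Int_part y)*PI).
 { unfold frac_part, y. field. lra. }
 unfold circ. unfold Cexp. simpl.
 rewrite !Rmult_0_l, !Rmult_0_r, !Rmult_1_l, !Rminus_0_r, !Rplus_0_l.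
 rewrite E at 1 2.
 assert (Q : forall u, sin (u + 2*IZR (Int_part y)*PI) = sin u /\ cos (u + 2*IZR (Int_part y)*PI) = cos u).
 { intros u. destruct (Z_le_dec 0 (Int_part y)).
  - rewrite <- (Z2Nat.id (Int_part y)) by lia. rewrite <- INR_IZR_INZ. split; [apply sin_period | apply cos_period].
  - rewrite <- (sin_period (u + _) (Z.to_nat (- Int_part y))), <- (cos_period (u + _) (Z.to_nat (- Int_part y))).
   rewrite INR_IZR_INZ, Z2Nat.id, opp_IZR by lia.
   split; f_equal; ring. }
 destruct (Q (2*PI*frac_part y)) as [-> ->]. fin.
Qed.

Lemma circle_bounded h a r : (forall t, cont_at dC h (circ a r t)) -> exists M, forall t, Cmod (h (circ a r t)) <= M.
Proof.
 intros H. note PI_RGT_0. destruct (contI_bounded (fun t => h (circ a r t)) 0 (2*PI)) as [M HM].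
 - lra.
 - intros t _. apply (cont_comp dR h); [fin | auto].
 - exists M. intros t. destruct (circ_mod_period a r t) as [u [Hu ->]]. auto.
Qed.

(* Dividing by [(z - a)^N] and letting N tend to infinity in Cauchy's bound replaces Taylor coefficients. *)
Lemma identity_disc h a R eps : (forall z, Cmod (z - a)%C < R -> hol h z) -> 0 < eps ->
 (forall z, Cmod (z - a)%C < eps -> h z = RtoC 0) -> forall z, Cmod (z - a)%C < R -> h z = RtoC 0.
Proof.
 intros Hh He H0 z Hz.
 destruct (Rlt_dec (Cmod (z - a)) eps) as [Hlt|Hge]; auto.
 set (r := (Cmod (z - a) + R)/2). assert (Hr : Cmod (z - a) < r < R) by (unfold r; lra).
 set (q := Cmod (z - a)) in *.
 assert (Hcirc : forall t, Cmod (circ a r t - a) < R) by (intro; rewrite Cmod_circ; lra).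
 destruct (circle_bounded h a r) as [M HM]; [fin|].
 assert (HM0 : 0 <= M) by (ele; [apply Cmod_ge_0 | apply (HM 0)]).
 assert (Hsub : forall u : C, 0 < Cmod (u - a) -> (u - a)%C <> RtoC 0) by (intros u Hu; apply Cmod_gt_0; auto).
 assert (B : forall N, Cmod (h z) <= (q/r)^N*(M*(r/(r - q)))).
 { intros N.
  note (cauchy_bound (fun u => h u/(u - a)^N)%C a R r z (M/r^N)) as K.
  assert (K' : Cmod (h z/(z - a)^N) <= M/r^N*(r/(r - Cmod (z - a)))).
  { apply K; [| lra | fold q; lra |].
   - intros u Hu. destruct (Rlt_dec (Cmod (u - a)) eps) as [L|L].
    + apply hol_ext_loc with (f := fun _ => RtoC 0); [|fin].
     exists (eps - Cmod (u - a)). split; [lra|]. intros w Hw. rewrite H0; [ceq|].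
     replace (w - a)%C with ((w - u) + (u - a))%C by ring.
     eapply Rle_lt_trans; [apply Cmod_triangle | lra].
    + apply hol_div; [apply Cpow_nz, Hsub; lra | auto |].
     fin.
   - intros t. rewrite Cmod_div, Cmod_pow, Cmod_circ; [|lra|apply Cpow_nz, Hsub; rewrite Cmod_circ; lra].
    mul_r; [fin | auto]. }
  rewrite Cmod_div, Cmod_pow in K' by (apply Cpow_nz, Hsub; fold q; lra). fold q in K'.
  assert (Hqp : 0 < q^N) by fin.
  unfold Rdiv at 1. rewrite Rpow_mult_distr, pow_inv.
  apply (Rmult_le_compat_r (q^N)) in K'; [|lra]. unfold Rdiv at 1 in K'. rewrite Rmult_assoc, Rinv_l, Rmult_1_r in K' by lra.
  lra. }
 apply Cmod_eq_0. apply Rle_antisym; [|fin]. apply Rnot_lt_le. intro L.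
 set (K := M*(r/(r - q)) + 1).
 assert (HK : 0 <= M*(r/(r - q))) by fin.
 assert (Hq : 0 <= q/r < 1).
 { split; [fin|].
  apply (Rmult_lt_reg_r r); [lra|]. unfold Rdiv. rewrite Rmult_assoc, Rinv_l; lra. }
 destruct (pow_lt_1_zero (q/r) ltac:(rewrite Rabs_pos_eq; lra) (Cmod (h z)/K) ltac:(apply Rdiv_lt_0_compat; unfold K; lra)) as [N HN].
 specialize (HN N (le_n N)). rewrite Rabs_pos_eq in HN by fin.
 specialize (B N). assert ((q/r)^N*K < Cmod (h z)).
 { apply (Rmult_lt_compat_r K) in HN; [|unfold K; lra]. unfold Rdiv at 2 in HN. rewrite Rmult_assoc, Rinv_l, Rmult_1_r in HN; [lra|nra]. } unfold K in *. nra.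
Qed.

(** * Series of holomorphic functions *)

Arguments INR : simpl never.
Notation pt x y := (@pair R R x%R y%R) (only parsing).

Fixpoint csum (a : nat -> C) (n : nat) : C :=
 match n with O => RtoC 0 | S m => (csum a m + a m)%C end.
Fixpoint rsum (a : nat -> R) (n : nat) : R :=
 match n with O => 0 | S m => rsum a m + a m end.

Definition ser (a : nat -> C) (l : C) : Prop :=
 forall eps, 0 < eps -> exists N, forall n, (N <= n)%nat -> Cmod (csum a n - l)%C < eps.

Lemma sum_n_csum (a : nat -> C) n : @sum_n C_AbelianMonoid a n = csum a (S n).
Proof.
 induction n as [|n IH].
 - ceq.
 - rewrite sum_Sn, IH. fin.
Qed.

Lemma is_series_ser a l : @is_series C_AbsRing C_NormedModule a l <-> ser a l.
Proof.
 split.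
 - intros H e He.
  (* The balls of the product structure control the modulus only up to the factor [sqrt 2], which
     the half absorbs. *)
  destruct (proj1 (filterlim_locally _ _) H (mkposreal (e/2) __)) as [N K].
  exists (S N). intros [|n] Hn; [lia|]. specialize (K n ltac:(lia)).
  rewrite <- sum_n_csum. apply C_NormedModule_mixin_compat2 in K. simpl in K.
  assert (sqrt 2 < 2). { rewrite <- (sqrt_Rsqr 2) at 2; [|lra]. apply sqrt_lt_1; unfold Rsqr; lra. }
  eapply Rlt_trans; [exact K|]. nra.
 - intros H. apply filterlim_locally. intros [e He]. destruct (H e He) as [N K].
  exists N. intros n Hn. apply C_NormedModule_mixin_compat1. 
  replace (@sum_n C_NormedModule a n) with (csum a (S n)) by (symmetry; apply sum_n_csum).
  fin.
Qed.

Lemma csum_ext a b n : (forall i, (i < n)%nat -> a i = b i) -> csum a n = csum b n.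
Proof. induction n as [|n IH]; simpl; intros H; [auto|]. rewrite IH, H by auto; auto. Qed.
Lemma rsum_ext a b n : (forall i, (i < n)%nat -> a i = b i) -> rsum a n = rsum b n.
Proof. induction n as [|n IH]; simpl; intros H; [auto|]. rewrite IH, H by auto; auto. Qed.
Lemma csum_plus a b n : csum (fun i => a i + b i)%C n = (csum a n + csum b n)%C.
Proof. induction n as [|n IH]; simpl; [ring|]. rewrite IH; ring. Qed.
Lemma csum_mult c a n : csum (fun i => c*a i)%C n = (c*csum a n)%C.
Proof. induction n as [|n IH]; simpl; [ring|]. rewrite IH; ring. Qed.
Lemma rsum_plus a b n : rsum (fun i => a i + b i) n = rsum a n + rsum b n.
Proof. induction n as [|n IH]; simpl; [ring|]. lra. Qed.
Lemma rsum_mult c a n : rsum (fun i => c*a i) n = c*rsum a n.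
Proof. induction n as [|n IH]; simpl; [ring|]. lra. Qed.
Lemma rsum_le a b n : (forall i, (i < n)%nat -> a i <= b i) -> rsum a n <= rsum b n.
Proof. induction n as [|n IH]; simpl; intros H; [lra|]. fin. Qed.
Lemma rsum_pos a n : (forall i, (i < n)%nat -> 0 <= a i) -> 0 <= rsum a n.
Proof. induction n as [|n IH]; simpl; intros H; [lra|]. fin. Qed.
Lemma rsum_const c n : rsum (fun _ => c) n = INR n*c.
Proof. induction n as [|n IH]; [rewrite INR_0; simpl; ring|]. rewrite S_INR. simpl. lra. Qed.
Lemma csum_split a n m : csum a (n + m) = (csum a n + csum (fun i => a (n + i)%nat) m)%C.
Proof. induction m as [|m IH]; [rewrite Nat.add_0_r; simpl; ring|]. rewrite Nat.add_succ_r. simpl. rewrite IH; ring. Qed.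
Lemma rsum_split a n m : rsum a (n + m) = rsum a n + rsum (fun i => a (n + i)%nat) m.
Proof. induction m as [|m IH]; [rewrite Nat.add_0_r; simpl; ring|]. rewrite Nat.add_succ_r. simpl. lra. Qed.
Lemma Cmod_csum a n : Cmod (csum a n) <= rsum (fun i => Cmod (a i)) n.
Proof.
 induction n as [|n IH]; simpl; [rewrite Cmod_0; lra|].
 ele; [apply Cmod_triangle | lra].
Qed.
Lemma rsum_mono a n m : (forall i, 0 <= a i) -> (n <= m)%nat -> rsum a n <= rsum a m.
Proof.
 intros Ha Hnm. replace m with (n + (m - n))%nat by lia. rewrite rsum_split.
 assert (0 <= rsum (fun i => a (n + i)%nat) (m - n)) by (apply rsum_pos; auto). lra.
Qed.

Definition rbounded (b : nat -> R) : Prop := (forall n, 0 <= b n) /\ exists B, forall n, rsum b n <= B.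

Lemma rbounded_ex_series b : rbounded b -> ex_series b.
Proof.
 intros [Hb [B HB]].
 assert (E : forall n, sum_n b n = rsum b (S n)).
 { induction n as [|n IH]; [rewrite sum_O; simpl; ring | rewrite sum_Sn, IH; reflexivity]. }
 destruct (ex_finite_lim_seq_incr (sum_n b) B) as [l Hl].
 - intros n. rewrite !E. apply rsum_mono; auto.
 - intros n. rewrite E. auto.
 - exists l. fin.
Qed.

Lemma ser_ex a b : (forall n, Cmod (a n) <= b n) -> rbounded b -> exists l, ser a l.
Proof.
 intros H Hb. destruct (@ex_series_le C_AbsRing C_CompleteNormedModule a b H (rbounded_ex_series b Hb)) as [l Hl].
 exists l. apply is_series_ser. fin.
Qed.

Lemma ser_unique a l l' : ser a l -> ser a l' -> l = l'.
Proof.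
 intros H H'. assert (E : (l - l')%C = RtoC 0).
 { apply Cmod_eq_0. apply Rle_antisym; [|fin]. apply Rnot_lt_le. intro L.
  destruct (H (Cmod (l - l')/2) __) as [N K]. destruct (H' (Cmod (l - l')/2) __) as [N' K'].
  specialize (K (N + N')%nat ltac:(lia)). specialize (K' (N + N')%nat ltac:(lia)).
  assert (Cmod (l - l') <= Cmod (csum a (N + N') - l') + Cmod (csum a (N + N') - l)); [|lra].
  replace (l - l')%C with ((csum a (N + N') - l') - (csum a (N + N') - l))%C by ring. apply Cmod_sub_triangle. }
 replace l with (l - l' + l')%C by ring. rewrite E; ring.
Qed.

Lemma ser_plus a b l m : ser a l -> ser b m -> ser (fun n => a n + b n)%C (l + m)%C.
Proof.
 intros H K e He. destruct (H (e/2) __) as [N HN]. destruct (K (e/2) __) as [N' KN].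
 exists (N + N')%nat. intros n Hn. rewrite csum_plus.
 replace (csum a n + csum b n - (l + m))%C with ((csum a n - l) + (csum b n - m))%C by ring.
 eapply Rle_lt_trans; [apply Cmod_triangle|]. specialize (HN n ltac:(lia)). specialize (KN n ltac:(lia)). lra.
Qed.

Lemma ser_mult c a l : ser a l -> ser (fun n => c*a n)%C (c*l)%C.
Proof.
 intros H e He. note (Cmod_ge_0 c).
 destruct (H (e/(Cmod c + 1))) as [N HN]; [fin|].
 exists N. intros n Hn. rewrite csum_mult. replace (c*csum a n - c*l)%C with (c*(csum a n - l))%C by ring.
 rewrite Cmod_mult. specialize (HN n Hn).
 apply (Rmult_lt_compat_r (Cmod c + 1)) in HN; [|lra]. unfold Rdiv in HN. rewrite Rmult_assoc, Rinv_l in HN by lra.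
 nra.
Qed.

Lemma ser_ext a b l : (forall n, a n = b n) -> ser a l -> ser b l.
Proof.
 intros E H e He. destruct (H e He) as [N HN]. exists N. intros n Hn.
 rewrite <- (csum_ext a b) by auto. auto.
Qed.

Lemma ser_bound a b l B N : ser a l -> (forall n, Cmod (a n) <= b n) -> (forall n, (N <= n)%nat -> rsum b n - rsum b N <= B) ->
 Cmod (l - csum a N)%C <= B.
Proof.
 intros H Hab HB. apply Rnot_lt_le. intro L.
 destruct (H (Cmod (l - csum a N) - B) __) as [N' K]. specialize (K (N + N')%nat ltac:(lia)).
 specialize (HB (N + N')%nat ltac:(lia)).
 assert (E : Cmod (csum a (N + N') - csum a N)%C <= B).
 { ele; [|exact HB]. rewrite csum_split, rsum_split.
  replace (csum a N + csum (fun i => a (N + i)%nat) N' - csum a N)%C with (csum (fun i => a (N + i)%nat) N') by ring.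
  ub Cmod_csum.
  assert (rsum (fun i => Cmod (a (N + i)%nat)) N' <= rsum (fun i => b (N + i)%nat) N') by (apply rsum_le; auto). lra. }
 assert (Cmod (l - csum a N) <= Cmod (csum a (N + N') - csum a N) + Cmod (csum a (N + N') - l)); [|lra].
 replace (l - csum a N)%C with ((csum a (N + N') - csum a N) - (csum a (N + N') - l))%C by ring. apply Cmod_sub_triangle.
Qed.

(** [cauchy_taylor] bounds the second order remainder of the n-th term by a fixed multiple of [M n],
    so the linear coefficients and the remainders can be summed over [n] and the series is
    differentiated term by term. *)
Lemma weierstrass (f : nat -> C -> C) (S : C -> C) (M : nat -> R) a rho : 0 < rho ->
 (forall n z, Cmod (z - a)%C < rho -> hol (f n) z) ->
 (forall n z, Cmod (z - a)%C < rho -> Cmod (f n z) <= M n) -> rbounded M ->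
 (forall z, Cmod (z - a)%C < rho -> ser (fun n => f n z) (S z)) -> hol S a.
Proof.
 intros Hr Hf HM HMb HS. set (r := rho/2).
 assert (T : forall n, exists c, Cmod c <= M n/r /\ forall w, Cmod w <= r/2 ->
  Cmod (f n (a + w)%C - f n a - c*w)%C <= 2*M n/(r*r)*(Cmod w*Cmod w)).
 { intros n. apply (cauchy_taylor (f n) a rho r (M n)); auto. unfold r; lra. }
 destruct (choice _ T) as [c Hc].
 assert (Hrp : 0 < r) by (unfold r; lra).
 destruct HMb as [M0 [B HB]].
 assert (Hb2 : rbounded (fun n => / r*M n)).
 { split; [fin|].
  exists (/ r*B). intros n. rewrite rsum_mult. fin. }
 destruct (ser_ex c _ (fun n => Rle_trans _ _ _ (proj1 (Hc n)) (Req_le _ _ (Rmult_comm _ _))) Hb2) as [l Hl].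
 exists l. apply cder_eps. intros e He.
 assert (HB0 : 0 <= B) by (apply (HB 0%nat)).
 set (K := 2*B/(r*r)). assert (HK : 0 <= K) by (apply Rmult_le_pos; [lra | fin]).
 exists (Rmin (r/2) (e/(K + 1))). split; [fin|].
 intros z Hz.
 assert (Z1 : Cmod (z - a) < r/2) by (eapply Rlt_le_trans; [exact Hz | fin]).
 assert (Z2 : Cmod (z - a) < e/(K + 1)) by (eapply Rlt_le_trans; [exact Hz | apply Rmin_r]).
 set (w := (z - a)%C) in *. assert (Ez : z = (a + w)%C) by ceq.
 assert (S1 := HS z ltac:(fold w; unfold r in *; lra)).
 assert (S0 := HS a ltac:(replace (a - a)%C with (RtoC 0) by ring; rewrite Cmod_0; lra)).
 note (ser_plus _ _ _ _ (ser_plus _ _ _ _ S1 (ser_mult (-(1))%C _ _ S0)) (ser_mult (- w)%C _ _ Hl)) as SS.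
 replace (S z - S a - l*w)%C with (S z + - (1)*S a + - w*l - csum (fun n : nat => f n z + - (1)*f n a + - w*c n) 0)%C by ceq.
 note (Cmod_ge_0 w).
 ub (ser_bound _ (fun n => (2/(r*r)*(Cmod w*Cmod w))*M n) _ (K*(Cmod w*Cmod w)) 0 SS).
 - intros n. replace (f n z + - (1)*f n a + - w*c n)%C with (f n (a + w) - f n a - c n*w)%C by (rewrite Ez; ring).
  ele; [apply (proj2 (Hc n)); lra|]. lra.
 - intros n _. rewrite !rsum_mult. simpl. unfold K. specialize (HB n).
  assert (0 <= 2/(r*r)*(Cmod w*Cmod w)) by fin. nra.
 -
  apply (Rmult_lt_compat_r (K + 1)) in Z2; [|lra]. unfold Rdiv in Z2. rewrite (Rmult_assoc e), Rinv_l in Z2 by lra. nra.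
Qed.

(** * Partial sums of powers *)

Lemma Rpower_pos x y : 0 < Rpower x y.
Proof. apply exp_pos. Qed.

(** A discrete form of comparing the sum of [n^(-1-r)] with its integral: the right side
    telescopes. *)
Lemma Rpower_decr_telescope x r : 0 < x -> 0 < r ->
 r*Rpower (x + 1) (- (1 + r)) <= Rpower x (- r) - Rpower (x + 1) (- r).
Proof.
 intros Hx Hr.
 assert (E : Rpower (x + 1) (- (1 + r)) = Rpower (x + 1) (- r)/(x + 1)).
 { replace (- (1 + r)) with (- r + - (1)) by ring. rewrite Rpower_plus, (Rpower_Ropp _ 1), Rpower_1 by lra. lra. }
 assert (F : Rpower x (- r) = Rpower (x + 1) (- r)*exp (- r*ln (x/(x + 1)))).
 { unfold Rpower. rewrite <- exp_plus. f_equal. unfold Rdiv. rewrite ln_mult, ln_Rinv by (try lra; apply Rinv_0_lt_compat; lra). ring. } note (Rpower_pos (x + 1) (- r)). set (P := Rpower (x + 1) (- r)) in *.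
 assert (L : ln (x/(x + 1)) <= - / (x + 1)).
 { note (exp_ineq1_le (- / (x + 1))). rewrite <- (ln_exp (- / (x+1))). apply ln_le; [fin|].
  replace (x/(x + 1)) with (1 + - / (x + 1)) by fld. auto. }
 note (exp_ineq1_le (- r*ln (x/(x + 1)))).
 assert (r*/ (x + 1) <= - r*ln (x/(x + 1))) by nra.
 nra.
Qed.

Lemma rsum_power_tail r N n : 0 < r -> (1 <= N)%nat -> (N <= n)%nat ->
 rsum (fun i => Rpower (INR (S i)) (- (1 + r))) n - rsum (fun i => Rpower (INR (S i)) (- (1 + r))) N
 <= Rpower (INR N) (- r)/r.
Proof.
 intros Hr HN Hn.
 assert (K : forall m, r*(rsum (fun i => Rpower (INR (S i)) (- (1 + r))) (N + m) - rsum (fun i => Rpower (INR (S i)) (- (1 + r))) N)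
  <= Rpower (INR N) (- r) - Rpower (INR (N + m)) (- r)).
 { induction m as [|m IH]; [rewrite Nat.add_0_r; lra|].
  rewrite Nat.add_succ_r. simpl rsum. 
  note (Rpower_decr_telescope (INR (N + m)) r ltac:(apply lt_0_INR; lia) Hr) as T.
  rewrite <- S_INR in T. lra. }
 specialize (K (n - N)%nat). replace (N + (n - N))%nat with n in K by lia.
 note (Rpower_pos (INR n) (- r)).
 apply (Rmult_le_reg_l r); auto. replace (r*(Rpower (INR N) (- r)/r)) with (Rpower (INR N) (-r)) by fld. lra.
Qed.

Lemma rbounded_power r : 0 < r -> rbounded (fun i => Rpower (INR (S i)) (- (1 + r))).
Proof.
 intros Hr. split; [intros; left; apply Rpower_pos|].
 exists (rsum (fun i => Rpower (INR (S i)) (- (1 + r))) 1 + Rpower (INR 1) (- r)/r). intros n.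
 destruct n as [|n].
 - simpl. rewrite INR_1. note (Rpower_pos 1 (-(1+r))). assert (0 < Rpower 1 (- r)/r) by (apply Rdiv_lt_0_compat; auto; apply Rpower_pos). lra.
 - note (rsum_power_tail r 1 (S n) Hr ltac:(lia) ltac:(lia)). lra.
Qed.

#[export] Hint Resolve Rpower_pos : an.

(** * Analytic continuation of the zeta function *)

Lemma INR_S_pos n : 0 < INR (S n).
Proof. apply lt_0_INR; lia. Qed.
Lemma INR_S_ge1 n : 1 <= INR (S n).
Proof. change 1 with (INR 1). apply le_INR; lia. Qed.
Lemma RtoC_neq0 x : x <> 0 -> RtoC x <> RtoC 0.
Proof. intros H E; apply RtoC_inj in E; auto. Qed.
Lemma Csub_neq0 (z w : C) : z <> w -> (z - w)%C <> RtoC 0.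
Proof. intros n E. apply n. replace z with (z - w + w)%C by ring. rewrite E. ring. Qed.

Lemma rder_Rcpow s x : 0 < x -> rder (fun u => Rcpow u s) x (s*Rcpow x (s - 1)%C)%C.
Proof.
 intros Hx.
 assert (D : is_derive ln x (/ x)) by (apply is_derive_ln; auto).
 note (rder_comp (fun u => (s*RtoC (ln u))%C) Cexp x _ _
  (rder_mult _ _ x _ _ (rder_const s x) (rder_of_real ln x _ D)) (cder_Cexp _)) as K.
 eapply (fun e => eq_ind _ (rder _ x) K _ e).
 unfold Cminus. rewrite Rcpow_plus, Rcpow_opp, Rcpow_1 by auto.
 rewrite RtoC_inv by lra. ceq.
Qed.

Lemma rder_shift f c t l : rder f (c + t) l -> rder (fun u => f (c + u)) t l.
Proof.
 intros [p [E [Hc H]]]. exists (fun u => p (c + u)). repeat split; auto.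
 - intros e He. destruct (Hc e He) as [d1 [H1 K1]]. exists d1; split; auto. intros y Hy. apply K1.
  unfold dR in *. replace (c + y - (c + t)) with (y - t) by ring. auto.
 - intros u. rewrite H. ceq.
Qed.

(** * The binomial series with a complex exponent *)

Fixpoint Cbin (z : C) (j : nat) : C :=
 match j with O => RtoC 1 | S i => (Cbin z i*(z - RtoC (INR i))/RtoC (INR (S i)))%C end.

Lemma Cbin_shift z j : (Cbin z (S j)*RtoC (INR (S j)) = z*Cbin (z - 1) j)%C.
Proof.
 induction j as [|j IH].
 - simpl. rewrite INR_0, INR_1. field.
 - assert (H1 : RtoC (INR (S j)) <> RtoC 0) by (apply RtoC_neq0; note (INR_S_pos j); lra).
  assert (H2 : RtoC (INR (S (S j))) <> RtoC 0) by (apply RtoC_neq0; note (INR_S_pos (S j)); lra).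
  change (Cbin z (S (S j))) with (Cbin z (S j)*(z - RtoC (INR (S j)))/RtoC (INR (S (S j))))%C.
  transitivity (Cbin z (S j)*INR (S j)*(z - INR (S j))/INR (S j))%C; [field; auto|].
  rewrite IH. simpl Cbin. rewrite S_INR in *. ceq.
Qed.

Lemma hol_Cbin f j z : hol f z -> hol (fun w => Cbin (f w) j) z.
Proof.
 intros H. induction j as [|j IH]; simpl; [fin|]. unfold Cdiv.
 fin.
Qed.

Definition taylor_rest (n : nat) (z : C) (y : R) : C :=
 (Rcpow (1 + y) z - csum (fun j => Cbin z j*RtoC (y^j)) n)%C.

Lemma rder_csum (a : nat -> R -> C) (b : nat -> C) n t : (forall i, rder (a i) t (b i)) ->
 rder (fun u => csum (fun i => a i u) n) t (csum b n).
Proof.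
 intros H. induction n as [|n IH]; simpl; [apply rder_const | apply rder_plus; auto].
Qed.

Lemma csum_succ_l a n : csum a (S n) = (a 0%nat + csum (fun i => a (S i)) n)%C.
Proof. change (S n) with (1 + n)%nat. rewrite csum_split. ceq. Qed.

Lemma rder_taylor_rest n z y : -1 < y ->
 rder (taylor_rest (S n) z) y (z*taylor_rest n (z - 1) y)%C.
Proof.
 intros Hy. unfold taylor_rest.
 assert (H1 := rder_shift (fun u => Rcpow u z) 1 y _ (rder_Rcpow z (1 + y) __)).
 assert (H2 : rder (fun u => csum (fun j => Cbin z j*RtoC (u^j))%C (S n)) y
  (csum (fun j => Cbin z j*RtoC (INR j*y^Nat.pred j))%C (S n))).
 { apply (rder_csum (fun j u => Cbin z j*RtoC (u^j))%C (fun j => Cbin z j*RtoC (INR j*y^Nat.pred j))%C). intros i.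
  note (rder_mult _ _ y _ _ (rder_const (Cbin z i) y) (rder_of_real (fun u => u^i) y (INR i*y^Nat.pred i)
   ltac:(auto_derive; [auto|]; simpl; ring))) as K.
  eapply (fun e => eq_ind _ (rder _ y) K _ e). ring. }
 note (rder_plus _ _ y _ _ H1 (rder_mult _ _ y _ _ (rder_const (-(1))%C y) H2)) as K.
 assert (E : csum (fun j => Cbin z j*RtoC (INR j*y^Nat.pred j))%C (S n) = (z*csum (fun j => Cbin (z - 1) j*RtoC (y^j)) n)%C).
 { rewrite csum_succ_l. rewrite INR_0, Rmult_0_l, Cmult_0_r, Cplus_0_l, <- csum_mult. apply csum_ext. intros i _.
  simpl Nat.pred. rewrite RtoC_mult, Cmult_assoc, Cbin_shift. ring. }
 rewrite E in K.
 match type of K with rder _ _ ?v => replace v with (z*(Rcpow (1 + y) (z - 1) - csum (fun j : nat => Cbin (z - 1) j*(y^j)%R) n))%C in K by ring end.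
 destruct K as [p [A1 [A2 A3]]]. exists p. repeat split; auto. intros u. rewrite <- A3. ring.
Qed.

Fixpoint taylor_const (n : nat) (B : R) : R :=
 match n with O => exp B | S m => B*taylor_const m (B + 1) end.

Lemma taylor_const_pos n B : 0 <= B -> 0 <= taylor_const n B.
Proof.
 revert B. induction n as [|n IH]; intros B HB; simpl; [fin|].
 fin.
Qed.

Lemma ln_1p_bounds y : 0 <= y <= 1 -> 0 <= ln (1 + y) <= 1.
Proof.
 intros Hy. split.
 - rewrite <- ln_1. apply ln_le; lra.
 - rewrite <- (ln_exp 1) at 2. apply ln_le; [lra|]. note (exp_ineq1_le 1). lra.
Qed.

Lemma taylor_rest_zero n z : taylor_rest (S n) z 0 = RtoC 0.
Proof.
 unfold taylor_rest. rewrite Rplus_0_r, Rcpow_base1, csum_succ_l. simpl.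
 assert (E : csum (fun i => (Cbin z i*(z - INR i)/INR (S i)*(0*0^i)%R)%C) n = RtoC 0).
 { induction n as [|n IH]; simpl; [auto|]. rewrite IH, Rmult_0_l. ring. }
 rewrite E. ring.
Qed.

(** The derivative of the remainder of order [n + 1] for the exponent [z] is [z] times the remainder
    of order [n] for [z - 1], and the remainder vanishes at 0. Iterating this gives Taylor's
    estimate without an explicit integral form. *)
Lemma taylor_rest_incr n z y M : 0 <= y <= 1 ->
 (forall u, 0 <= u <= y -> Cmod (z*taylor_rest n (z - 1) u)%C <= M) -> Cmod (taylor_rest (S n) z y) <= y*M.
Proof.
 intros Hy HM.
 assert (Hc : contI (fun u => z*taylor_rest n (z - 1) u)%C 0 y).
 { intros u Hu. apply cont_mult; [fin|]. apply cont_minus.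
  - apply (rder_cont _ _ _ (rder_shift (fun v => Rcpow v (z - 1)%C) 1 u _ (rder_Rcpow _ (1 + u) __))).
  - assert (Q : forall m, cont_at dR (fun u => csum (fun j => Cbin (z - 1) j*RtoC (u^j))%C m) u).
   { induction m as [|m IH]; simpl; [fin|]. apply cont_plus; auto. apply cont_mult; [fin|].
    eapply cont_ext_loc; [unfold dR; rewrite Rminus_diag; apply Rabs_R0 | | apply (cont_pow dR RtoC m u), cont_RtoC].
    exists 1; split; [lra|]. intros v _. symmetry. apply RtoC_pow. }
   apply Q. }
 note (CI_FTC (taylor_rest (S n) z) _ 0 y (proj1 Hy) (fun u Hu => rder_taylor_rest n z u __) Hc) as E.
 rewrite taylor_rest_zero in E. replace (taylor_rest (S n) z y) with (taylor_rest (S n) z y - 0)%C by ring.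
 rewrite <- E. ele; [apply (CI_bound _ 0 y M); auto; lra|]. lra.
Qed.

Lemma taylor_rest_bound n : forall B z y, Cmod z <= B -> 0 <= y <= 1 ->
 Cmod (taylor_rest n z y) <= taylor_const n B*y^n.
Proof.
 induction n as [|n IH]; intros B z y Hz Hy.
 - unfold taylor_rest. simpl. replace (Rcpow (1 + y) z - 0)%C with (Rcpow (1 + y) z) by ring.
  rewrite Cmod_Rcpow, Rmult_1_r by lra. unfold Rpower.
  note (ln_1p_bounds y Hy). note (Re_le_Cmod z). note (Cmod_ge_0 z).
  destruct (Rle_lt_dec (Re z*ln (1 + y)) B) as [H2|H2].
  + destruct H2 as [H2|H2]; [left; apply exp_increasing; auto | rewrite H2; lra].
  + nra.
 - note (Cmod_ge_0 z).
  assert (HM : forall u, 0 <= u <= y -> Cmod (z*taylor_rest n (z - 1) u)%C <= B*(taylor_const n (B + 1)*y^n)).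
  { intros u Hu. rewrite Cmod_mult. apply Rmult_le_compat; auto using Cmod_ge_0.
   ub (IH (B + 1)); try lra.
   - ub Cmod_sub_triangle. rewrite Cmod_1. lra.
   - mul_l; [apply taylor_const_pos; lra|]. fin. }
  ub (taylor_rest_incr n z y _ Hy HM). simpl. lra.
Qed.

Definition zterm (s : C) (n : nat) : C := Rcpow (INR (S n)) (- s)%C.

(* Remainder after the terms of order at most L in the expansion of (x + 1)^(1 - s) at x = n + 1. *)
Definition zrem (L : nat) (s : C) (n : nat) : C :=
 (Rcpow (INR (S (S n))) (1 - s) - csum (fun j => Cbin (1 - s) j*Rcpow (INR (S n)) (1 - s - RtoC (INR j))) (S L))%C.

Lemma zrem_taylor L s n :
 zrem L s n = (Rcpow (INR (S n)) (1 - s)*taylor_rest (S L) (1 - s) (/ INR (S n)))%C.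
Proof.
 unfold zrem, taylor_rest. note (INR_S_pos n) as H.
 replace (INR (S (S n))) with (INR (S n)*(1 + / INR (S n))) by (rewrite (S_INR (S n)); field; lra).
 assert (0 < / INR (S n)) by fin.
 rewrite Rcpow_mult by lra.
 rewrite (csum_ext (fun j => Cbin (1 - s) j*Rcpow (INR (S n)) (1 - s - RtoC (INR j)))%C
  (fun j => Rcpow (INR (S n)) (1 - s)*(Cbin (1 - s) j*RtoC ((/ INR (S n))^j)))%C).
 - rewrite csum_mult. ring.
 - intros j _. replace (1 - s - INR j)%C with ((1 - s) + - (INR j))%C by ring.
  rewrite Rcpow_plus, Rcpow_opp, Rcpow_RtoC, Rpower_pow, pow_inv, RtoC_inv by (auto; apply pow_nonzero; lra). ring.
Qed.

Lemma zrem_bound L s n B : Cmod (1 - s)%C <= B ->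
 Cmod (zrem L s n) <= taylor_const (S L) B*Rpower (INR (S n)) (- (Re s + INR L)).
Proof.
 intros HB. rewrite zrem_taylor, Cmod_mult. note (INR_S_ge1 n) as H. rewrite Cmod_Rcpow by lra.
 note (taylor_rest_bound (S L) B (1 - s)%C (/ INR (S n)) HB) as K.
 assert (Hy : 0 <= / INR (S n) <= 1).
 { split; [fin|]. rewrite <- Rinv_1. fin. }
 specialize (K Hy). note (Rpower_pos (INR (S n)) (Re (1 - s))).
 ele; [mul_l; [lra | exact K]|]. right.
 rewrite pow_inv, <- Rpower_pow, <- Rpower_Ropp by lra.
 transitivity (taylor_const (S L) B*(Rpower (INR (S n)) (Re (1 - s))*Rpower (INR (S n)) (- INR (S L)))); [ring|].
 rewrite <- Rpower_plus. do 2 f_equal. rewrite S_INR. unfold Re; simpl. ring.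
Qed.

(** Both sums are chosen by [epsilon] and have a meaning only where [zsum_spec] and [Rem_spec]
    provide convergence. *)
Definition zsum (s : C) : C := epsilon (inhabits (RtoC 0)) (ser (zterm s)).
Definition Rem (L : nat) (s : C) : C := epsilon (inhabits (RtoC 0)) (ser (zrem L s)).

Lemma Rpower_le_base1 x a b : 1 <= x -> a <= b -> Rpower x a <= Rpower x b.
Proof. intros. unfold Rpower. assert (0 <= ln x) by (rewrite <- ln_1; apply ln_le; lra).
 destruct (Rle_lt_or_eq_dec (a*ln x) (b*ln x) ltac:(nra)) as [L|E]; [left; apply exp_increasing; auto | rewrite E; lra].
Qed.

Lemma zterm_bound s n r : 1 + r <= Re s -> Cmod (zterm s n) <= Rpower (INR (S n)) (- (1 + r)).
Proof.
 intros H. unfold zterm. rewrite Cmod_Rcpow by apply INR_S_pos. apply Rpower_le_base1; [apply INR_S_ge1 | unfold Re in *; simpl; lra].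
Qed.

Lemma zsum_spec s : 1 < Re s -> ser (zterm s) (zsum s).
Proof.
 intros H. unfold zsum. apply epsilon_spec.
 apply (ser_ex _ (fun n => Rpower (INR (S n)) (- (1 + (Re s - 1))))).
 - intros n. apply zterm_bound. lra.
 - apply rbounded_power. lra.
Qed.

Lemma rbounded_scal c b : 0 <= c -> rbounded b -> rbounded (fun n => c*b n).
Proof.
 intros Hc [H [B HB]]. split; [fin|].
 exists (c*B). intros n. rewrite rsum_mult. fin.
Qed.

Lemma Rem_spec L s : 1 - INR L < Re s -> ser (zrem L s) (Rem L s).
Proof.
 intros H. unfold Rem. apply epsilon_spec.
 apply (ser_ex _ (fun n => taylor_const (S L) (Cmod (1 - s))*Rpower (INR (S n)) (- (1 + (Re s + INR L - 1))))).
 - intros n. replace (1 + (Re s + INR L - 1)) with (Re s + INR L) by ring. apply zrem_bound. lra.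
 - apply rbounded_scal; [apply taylor_const_pos, Cmod_ge_0 | apply rbounded_power; lra].
Qed.

Lemma hol_csum (a : nat -> C -> C) n z : (forall i, (i < n)%nat -> hol (a i) z) -> hol (fun w => csum (fun i => a i w) n) z.
Proof.
 induction n as [|n IH]; intros H; simpl; [fin | fin].
Qed.

Lemma hol_zterm n s : hol (fun s => zterm s n) s.
Proof. unfold zterm. fin. Qed.

Lemma hol_zrem L n s : hol (fun s => zrem L s n) s.
Proof. assert (H : hol (fun s => 1 - s)%C s) by fin.
 apply hol_minus; [fin|].
 apply (hol_csum (fun j s => Cbin (1 - s) j*Rcpow (INR (S n)) (1 - s - RtoC (INR j)))%C). intros j _.
 apply hol_mult; [apply (hol_Cbin (fun s => 1 - s)%C); auto|].
 fin.
Qed.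

Lemma Re_disc z a r : Cmod (z - a)%C < r -> Re a - r < Re z < Re a + r.
Proof. intros H. note (re_le_Cmod (z - a)). rewrite Re_minus in H0. abs_in H0. lra. Qed.

Lemma hol_zsum s : 1 < Re s -> hol zsum s.
Proof.
 intros H. set (r := (Re s - 1)/2).
 apply (weierstrass (fun n s => zterm s n) zsum (fun n => Rpower (INR (S n)) (- (1 + r))) s r).
 - unfold r; lra.
 - intros; apply hol_zterm.
 - intros n z Hz. apply zterm_bound. apply Re_disc in Hz. unfold r in *; lra.
 - apply rbounded_power; unfold r; lra.
 - intros z Hz. apply zsum_spec. apply Re_disc in Hz. unfold r in *; lra.
Qed.

Lemma hol_Rem L s : 1 - INR L < Re s -> hol (Rem L) s.
Proof.
 intros H. set (r := (Re s - (1 - INR L))/2).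
 apply (weierstrass (fun n s => zrem L s n) (Rem L)
  (fun n => taylor_const (S L) (Cmod (1 - s) + r)*Rpower (INR (S n)) (- (1 + r))) s r).
 - unfold r; lra.
 - intros; apply hol_zrem.
 - intros n z Hz. ub (zrem_bound L z n (Cmod (1 - s) + r)).
  + replace (1 - z)%C with ((1 - s) - (z - s))%C by ring. ele; [apply Cmod_sub_triangle | lra].
  + mul_l; [apply taylor_const_pos; note (Cmod_ge_0 (1 - s)); unfold r; lra|].
   apply Rpower_le_base1; [apply INR_S_ge1|]. apply Re_disc in Hz. unfold r in *; lra.
 - apply rbounded_scal; [apply taylor_const_pos; note (Cmod_ge_0 (1 - s)); unfold r; lra | apply rbounded_power; unfold r; lra].
 - intros z Hz. apply Rem_spec. apply Re_disc in Hz. unfold r in *; lra.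
Qed.

#[export] Hint Resolve INR_S_pos INR_S_ge1 RtoC_neq0 Csub_neq0 hol_csum hol_zterm rbounded_scal : an.

Lemma Rpower_small r eps : 0 < r -> 0 < eps -> exists N, forall n, (N <= n)%nat -> Rpower (INR (S n)) (- r) < eps.
Proof.
 intros Hr He. destruct (nfloor_ex (Rpower eps (- / r))) as [N HN]; [fin|].
 exists (S N). intros n Hn.
 assert (H1 : Rpower eps (- / r) < INR (S n)).
 { apply Rlt_le_trans with (INR N + 1); [lra|]. rewrite <- S_INR. apply le_INR; lia. }
 assert (H2 : eps = Rpower (Rpower eps (- / r)) (- r)).
 { rewrite Rpower_mult. replace (- / r*- r) with 1 by fld. rewrite Rpower_1; auto. }
 rewrite H2. rewrite !(Rpower_Ropp _ r). apply Rinv_lt_contravar.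
 - fin.
 - apply Rlt_Rpower_l; auto. fin.
Qed.

Lemma csum_telescope (f : nat -> C) n : csum (fun i => f (S i) - f i)%C n = (f n - f 0%nat)%C.
Proof. induction n as [|n IH]; simpl; [ring | rewrite IH; ring]. Qed.

Lemma ser_csum (a : nat -> nat -> C) (l : nat -> C) m : (forall j, (j < m)%nat -> ser (a j) (l j)) ->
 ser (fun n => csum (fun j => a j n) m) (csum l m).
Proof.
 induction m as [|m IH]; intros H; simpl.
 - intros e He. exists 0%nat. intros n _. assert (E : csum (fun _ => RtoC 0) n = RtoC 0) by (clear; induction n; simpl; [auto | rewrite IHn; ring]).
  rewrite E. replace (0 - 0)%C with (RtoC 0) by ring. rewrite Cmod_0; auto.
 - apply ser_plus; auto.
Qed.

Lemma zrem_as_zterm L s n : zrem L s n =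
 ((Rcpow (INR (S (S n))) (1 - s) - Rcpow (INR (S n)) (1 - s)) + -(1)*csum (fun j => Cbin (1 - s) (S j)*zterm (s + RtoC (INR j)) n) L)%C.
Proof.
 unfold zrem. rewrite csum_succ_l. simpl Cbin at 1. rewrite INR_0.
 replace (1 - s - 0)%C with (1 - s)%C by ring.
 rewrite (csum_ext (fun i => Cbin (1 - s) (S i)*Rcpow (INR (S n)) (1 - s - INR (S i)))%C (fun j => Cbin (1 - s) (S j)*zterm (s + RtoC (INR j)) n)%C).
 - ring.
 - intros j _. unfold zterm. do 2 f_equal. rewrite S_INR, RtoC_plus. ring.
Qed.

(** The binomial expansions of [(n + 2)^(1-s)] about [n + 1] are summed over [n]; the differences of
    powers telescope to -1 and the other terms are values of zeta at [s, s + 1, ...]. *)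
Lemma zeta_recursion L s : 1 < Re s ->
 (Rem L s = -(1) - csum (fun j => Cbin (1 - s) (S j)*zsum (s + RtoC (INR j))) L)%C.
Proof.
 intros Hs.
 assert (H1 : ser (fun n => Rcpow (INR (S (S n))) (1 - s) - Rcpow (INR (S n)) (1 - s))%C (-(1))%C).
 { intros e He. destruct (Rpower_small (Re s - 1) e __ He) as [N HN]. exists N. intros n Hn.
  rewrite (csum_telescope (fun n => Rcpow (INR (S n)) (1 - s)%C)).
  rewrite INR_1, Rcpow_base1. replace (Rcpow (INR (S n)) (1 - s) - 1 - - (1))%C with (Rcpow (INR (S n)) (1 - s)) by ring.
  rewrite Cmod_Rcpow by apply INR_S_pos. replace (Re (1 - s)%C) with (- (Re s - 1)) by (unfold Re; simpl; ring). auto. }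
 assert (H2 : ser (fun n => csum (fun j => Cbin (1 - s) (S j)*zterm (s + RtoC (INR j)) n) L)%C
   (csum (fun j => Cbin (1 - s) (S j)*zsum (s + RtoC (INR j)))%C L)).
 { apply (ser_csum (fun j n => Cbin (1 - s) (S j)*zterm (s + RtoC (INR j)) n)%C). intros j _.
  apply ser_mult, zsum_spec. unfold Re; simpl. note (pos_INR j). unfold Re in Hs. lra. }
 note (ser_plus _ _ _ _ H1 (ser_mult (-(1))%C _ _ H2)) as H3.
 apply (ser_ext _ (zrem L s)) in H3; [|intros; rewrite zrem_as_zterm; auto].
 rewrite (ser_unique _ _ _ (Rem_spec L s ltac:(note (pos_INR L); lra)) H3). ring.
Qed.

(* (s - 1) zeta(s) on Re s > 1 - m, by induction on m; multiplying by s - 1 removes the apparent poles at 0, -1, ... *)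
Lemma xi_exists m : exists X : C -> C, (forall s, 1 - INR m < Re s -> hol X s) /\
 (forall s, 1 < Re s -> X s = ((s - 1)*zsum s)%C).
Proof.
 induction m as [|m [X [HX1 HX2]]].
 - exists (fun s => (s - 1)*zsum s)%C. split; auto. intros s Hs. rewrite INR_0 in Hs.
  apply hol_mult; [fin | apply hol_zsum; lra].
 - exists (fun s => 1 - csum (fun i => Cbin (1 - s) (S i)/RtoC (INR (S (S i)))*X (s + RtoC (INR (S i)))) m + Rem (S m) s)%C.
  split.
  + intros s Hs. rewrite S_INR in Hs.
   assert (H1 : hol (fun s => 1 - s)%C s) by fin.
   apply hol_plus; [apply hol_minus; [fin|]|].
   * apply (hol_csum (fun i s => Cbin (1 - s) (S i)/RtoC (INR (S (S i)))*X (s + RtoC (INR (S i))))%C). intros i _.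
    apply hol_mult.
    -- apply hol_mult; [apply (hol_Cbin (fun s => 1 - s)%C); auto | fin].
    -- apply (hol_comp (fun s => s + RtoC (INR (S i)))%C X); [fin|].
     apply HX1. note (INR_S_ge1 i). unfold Re in *; simpl. lra.
   * apply hol_Rem. rewrite S_INR. lra.
  + intros s Hs. rewrite zeta_recursion, csum_succ_l by auto.
   rewrite INR_0. replace (s + 0)%C with s by ring.
   assert (E : csum (fun i => Cbin (1 - s) (S i)/RtoC (INR (S (S i)))*X (s + RtoC (INR (S i))))%C m
    = (-(1)*csum (fun i => Cbin (1 - s) (S (S i))*zsum (s + RtoC (INR (S i)))) m)%C).
   { rewrite <- csum_mult. apply csum_ext. intros i _.
    rewrite HX2 by (note (INR_S_ge1 i); unfold Re in *; simpl; lra).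
    ceq. }
   rewrite E. simpl Cbin at 2. rewrite INR_0, INR_1. field.
Qed.

(** A disc centred far to the right reaches [s] without leaving the half-plane, and a smaller
    concentric disc lies in [Re s > 1]. *)
Lemma identity_half f c : (forall s, c < Re s -> hol f s) -> (forall s, 1 < Re s -> f s = RtoC 0) ->
 forall s, c < Re s -> f s = RtoC 0.
Proof.
 intros Hf H0 s Hs. set (A := 2 + Rabs (Re s) + Rabs c).
 note (Rle_abs (Re s)). note (Rabs_pos c). note (Rabs_pos (Re s)).
 apply (identity_disc f (A, Im s) (A - c) (A - 1)); [| unfold A; lra | |].
 - intros z Hz. apply Hf. apply Re_disc in Hz. unfold Re at 1 in Hz; simpl in Hz. lra.
 - intros z Hz. apply H0. apply Re_disc in Hz. unfold Re at 1 in Hz; simpl in Hz. lra.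
 - replace (s - (A, Im s))%C with (RtoC (Re s - A)) by ceq.
  rewrite Cmod_R, Rabs_left1; unfold A; lra.
Qed.

Lemma Cmod_lt_sqr z r : 0 < r -> Re z*Re z + Im z*Im z < r*r -> Cmod z < r.
Proof.
 intros Hr H. note (Cmod2_alt z). nra.
Qed.

Lemma Im_disc z a r : Cmod (z - a)%C < r -> Im a - r < Im z < Im a + r.
Proof. intros H. note (Im_le_Cmod (z - a)). rewrite Im_minus in H0. abs_in H0. lra. Qed.

(** Chains of discs avoiding 1. A point off the real axis is reached by a disc tangent to that axis
    at 2; a real point left of 1 is then reached from a disc centred above it. *)
Lemma identity_punctured f : (forall s, s <> RtoC 1 -> hol f s) -> (forall s, 1 < Re s -> f s = RtoC 0) ->
 forall s, s <> RtoC 1 -> f s = RtoC 0.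
Proof.
 intros Hf H0.
 assert (Hup : forall s, 0 < Rabs (Im s) -> f s = RtoC 0).
 { intros s Hs. set (y := Im s) in *. set (x := Re s).
  set (sg := if Rlt_dec 0 y then 1 else -1).
  assert (Esg : Rabs y = sg*y /\ sg*sg = 1).
  { unfold sg. destruct (Rlt_dec 0 y); (split; [first [rewrite Rabs_pos_eq by lra | rewrite Rabs_left1 by lra]; ring | ring]). }
  destruct Esg as [Ea E1].
  (* The circle tangent at 2 that passes through [s] has radius [Y - 1]; the larger radius puts [s]
     inside. *)
  set (Y := ((x - 2)*(x - 2) + y*y)/(2*Rabs y) + 1).
  assert (HY : 1 <= Y). { unfold Y. assert (0 <= ((x - 2)*(x - 2) + y*y)/(2*Rabs y)); [|lra].
   apply Rmult_le_pos; [note (Rle_0_sqr (x - 2)); note (Rle_0_sqr y); unfold Rsqr in *; lra | fin]. }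
  apply (identity_disc f (2, sg*Y) Y 1); [| lra | |].
  - intros z Hz. apply Hf. intro E. subst z. apply Im_disc in Hz. unfold Im in Hz; simpl in Hz.
   nra.
  - intros z Hz. apply H0. apply Re_disc in Hz. unfold Re at 1 in Hz; simpl in Hz. lra.
  - apply Cmod_lt_sqr; [lra|]. unfold Re, Im; simpl. fold (Re s) (Im s). fold x y.
   assert (K : 2*Rabs y*(Y - 1) = (x - 2)*(x - 2) + y*y) by (unfold Y; field; lra).
   nra. }
 intros s Hs. destruct (Rlt_dec 0 (Rabs (Im s))) as [L|L]; auto.
 assert (Ey : Im s = 0). { destruct (Req_dec (Im s) 0); auto. exfalso. apply L. apply Rabs_pos_lt; auto. }
 destruct (Rlt_dec 1 (Re s)) as [L1|L1]; auto.
 assert (Lx : Re s < 1). { destruct (Req_dec (Re s) 1) as [E|E]; [|lra]. exfalso. apply Hs. apply C_eq; auto. }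
 set (d := 1 - Re s).
 apply (identity_disc f (Re s, d/2) (3*d/4) (d/2)); [| unfold d; lra | |].
 - intros z Hz. apply Hf. intro E. subst z. apply Re_disc in Hz. unfold Re at 1 3, RtoC in Hz; simpl in Hz.
  unfold d in *. lra.
 - intros z Hz. apply Hup. apply Im_disc in Hz. unfold Im at 1 in Hz; simpl in Hz. rewrite Rabs_pos_eq; lra.
 - apply Cmod_lt_sqr; [unfold d; lra|]. unfold Re, Im in *; simpl. unfold d. nra.
Qed.

Lemma zsum_is_series s : 1 < Re s -> @is_series C_AbsRing C_NormedModule (fun n => Rcpow (INR (S n)) (- s)%C) (zsum s).
Proof. intros. apply is_series_ser. apply zsum_spec; auto. Qed.

(** The functions on the half-planes of [xi_exists] agree on overlaps by [identity_half] and are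
    glued. The second clause is the explicit form from which all estimates start. *)
Lemma zeta_exists : exists Z : C -> C, is_riemann_zeta Z /\
 (forall s, 0 < Re s -> s <> RtoC 1 -> Z s = ((1 + Rem 1 s)/(s - 1))%C).
Proof.
 destruct (choice _ xi_exists) as [X HX].
 assert (Hxi1 : forall s, 1 < Re s -> (1 + Rem 1 s = (s - 1)*zsum s)%C).
 { intros s Hs. rewrite zeta_recursion by auto. simpl. rewrite INR_0, INR_1. replace (s + 0)%C with s by ring. field. }
 assert (Hagree : forall m m' s, (m <= m')%nat -> 1 - INR m < Re s -> X m s = X m' s).
 { intros m m' s Hm Hs. note (le_INR _ _ Hm).
  assert (E : (X m s - X m' s)%C = RtoC 0).
  { apply (identity_half (fun s => X m s - X m' s)%C (1 - INR m)); auto.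
   - intros z Hz. apply hol_minus; apply HX; lra.
   - intros z Hz. rewrite !(proj2 (HX _)) by auto. ring. }
  replace (X m s) with (X m s - X m' s + X m' s)%C by ring. rewrite E. ring. }
 (* An index whose half-plane contains [s]. *)
 set (mm := fun s : C => S (Z.to_nat (up (1 - Re s)))).
 assert (Hmm : forall s, 1 - INR (mm s) < Re s).
 { intros s. unfold mm. rewrite S_INR. destruct (archimed (1 - Re s)) as [A1 _].
  rewrite INR_IZR_INZ. assert (IZR (up (1 - Re s)) <= IZR (Z.of_nat (Z.to_nat (up (1 - Re s))))) by (apply IZR_le; lia). lra. }
 exists (fun s => X (mm s) s/(s - 1))%C. split; [split|].
 - intros s Hs. apply holomorphic_hol.
  (* Since [mm] jumps, the glued function is compared near [s] with one branch, whose half-plane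
     contains the whole unit disc about [s]. *)
  apply hol_ext_loc with (f := fun z => (X (S (mm s)) z/(z - 1))%C).
  + exists 1. split; [lra|]. intros w Hw. f_equal.
   note (Hmm s). apply Re_disc in Hw.
   assert (R1 : 1 - INR (S (mm s)) < Re w) by (rewrite S_INR; lra).
   destruct (Nat.le_ge_cases (S (mm s)) (mm w)) as [L|L]; [fin | symmetry; apply Hagree; auto].
  + apply hol_div; [fin | | fin].
   apply HX. rewrite S_INR. note (Hmm s). lra.
 - intros s Hs. rewrite (proj2 (HX _)) by auto.
  replace ((s - 1)*zsum s/(s - 1))%C with (zsum s); [apply zsum_is_series; auto|].
  field. apply Csub_neq0. intro E. subst s. unfold Re in Hs; simpl in Hs. lra.
 - intros s Hs Hs1. f_equal.
  assert (E : (X (S (mm s)) s - (1 + Rem 1 s))%C = RtoC 0).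
  { apply (identity_half (fun s0 => X (S (mm s)) s0 - (1 + Rem 1 s0))%C 0); auto.
   - intros z Hz. apply hol_minus; [apply HX; unfold mm; rewrite !S_INR; match goal with |- context [INR ?k] => note (pos_INR k) end; lra|].
    apply hol_plus; [fin | apply hol_Rem; rewrite INR_1; lra].
   - intros z Hz. rewrite (proj2 (HX _)), Hxi1 by auto. ring. }
  rewrite (Hagree (mm s) (S (mm s))) by fin.
  replace (X (S (mm s)) s) with (X (S (mm s)) s - (1 + Rem 1 s) + (1 + Rem 1 s))%C by ring. rewrite E. ring.
Qed.

Lemma zeta_spec : is_riemann_zeta zeta.
Proof. unfold zeta. apply epsilon_spec. destruct zeta_exists as [Z [H _]]. exists Z; auto. Qed.

Lemma hol_zeta s : s <> RtoC 1 -> hol zeta s.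
Proof. intros. apply holomorphic_hol. apply (proj1 zeta_spec); auto. Qed.

Lemma zeta_eq s : 0 < Re s -> s <> RtoC 1 -> zeta s = ((1 + Rem 1 s)/(s - 1))%C.
Proof.
 intros H0 H1. destruct zeta_exists as [Z [[HZ1 HZ2] HZ3]]. rewrite <- HZ3 by auto.
 destruct zeta_spec as [K1 K2].
 assert (E : (zeta s - Z s)%C = RtoC 0).
 { apply (identity_punctured (fun s => zeta s - Z s)%C); auto.
  - intros z Hz. apply hol_minus; apply holomorphic_hol; auto.
  - intros z Hz. specialize (HZ2 z Hz). specialize (K2 z Hz). apply is_series_ser in HZ2. apply is_series_ser in K2.
   rewrite (ser_unique _ _ _ K2 HZ2). ring. }
 replace (zeta s) with (zeta s - Z s + Z s)%C by ring. rewrite E. ring.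
Qed.

(** Unlike [zrem_bound] the dependence on [s] is explicit: the factor [1 - s] cancels the
    denominator in [zeta_eq], and only [Cmod s] is left. *)
Lemma zrem1_bound s n : 0 < Re s -> Cmod (zrem 1 s n) <= Cmod (1 - s)%C*Cmod s*Rpower (INR (S n)) (- (1 + Re s)).
Proof.
 intros Hs. rewrite zrem_taylor, Cmod_mult, Cmod_Rcpow by apply INR_S_pos.
 note (INR_S_ge1 n) as H. set (x := INR (S n)) in *.
 assert (Hy : 0 <= / x <= 1).
 { split; [fin|]. rewrite <- Rinv_1. fin. }
 assert (T : Cmod (taylor_rest 2 (1 - s) (/ x)) <= / x*(Cmod (1 - s)*(/ x*Cmod s))).
 { apply taylor_rest_incr; auto. intros u Hu. rewrite Cmod_mult. mul_l; [fin|].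
  replace (1 - s - 1)%C with (- s)%C by ring.
  le (u*Cmod s); [|fin].
  apply taylor_rest_incr; [lra|]. intros v Hv. rewrite Cmod_mult, Cmod_opp.
  rewrite <- (Rmult_1_r (Cmod s)) at 2. mul_l; [fin|].
  unfold taylor_rest. simpl. replace (Rcpow (1 + v) (- s - 1) - 0)%C with (Rcpow (1 + v) (- s - 1)) by ring.
  rewrite Cmod_Rcpow by lra. replace 1 with (Rpower (1 + v) 0) at 3 by (apply Rpower_O; lra).
  apply Rpower_le_base1; [lra|]. unfold Re in *; simpl. lra. }
 note (Rpower_pos x (Re (1 - s))).
 ele; [mul_l; [lra | exact T]|]. right.
 replace (- (1 + Re s)) with (Re (1 - s)%C + (- (1) + - (1))) by (unfold Re; simpl; ring).
 rewrite !Rpower_plus, !(Rpower_Ropp _ 1), !Rpower_1 by lra. ring.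
Qed.

(** The first [N] terms of the series for [Rem 1] telescope into the partial sum and the main term,
    so the difference is the tail of that series divided by [s - 1]. *)
Lemma zeta_approx s N : 0 < Re s -> s <> RtoC 1 -> (1 <= N)%nat ->
 Cmod (zeta s - csum (zterm s) N - Rcpow (INR (S N)) (1 - s)/(s - 1))%C <= Cmod s*Rpower (INR N) (- Re s)/Re s.
Proof.
 intros Hs H1 HN.
 assert (Hn : (s - 1)%C <> RtoC 0) by fin.
 assert (Hp : csum (zrem 1 s) N = (Rcpow (INR (S N)) (1 - s) - 1 - (1 - s)*csum (zterm s) N)%C).
 { rewrite (csum_ext _ (fun n => (Rcpow (INR (S (S n))) (1 - s) - Rcpow (INR (S n)) (1 - s)) + (-(1 - s))*zterm s n)%C).
  - rewrite csum_plus, csum_mult, (csum_telescope (fun n => Rcpow (INR (S n)) (1 - s)%C)), INR_1, Rcpow_base1. ring.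
  - intros n _. rewrite zrem_as_zterm. simpl. rewrite INR_0, INR_1. replace (s + 0)%C with s by ring. field. }
 replace (zeta s - csum (zterm s) N - Rcpow (INR (S N)) (1 - s)/(s - 1))%C with ((Rem 1 s - csum (zrem 1 s) N)/(s - 1))%C.
 2:{ rewrite Hp, zeta_eq by auto. field. auto. }
 rewrite Cmod_div by auto. rewrite (Cmod_sub_sym s 1).
 assert (Hm : 0 < Cmod (1 - s)) by (rewrite Cmod_sub_sym; apply Cmod_gt_0; auto).
 apply (Rmult_le_reg_r (Cmod (1 - s))); auto. unfold Rdiv at 1. rewrite Rmult_assoc, Rinv_l, Rmult_1_r by lra.
 replace (Cmod s*Rpower (INR N) (- Re s)/Re s*Cmod (1 - s)) with (Cmod (1 - s)*Cmod s*(Rpower (INR N) (- Re s)/Re s)) by lra.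
 apply (ser_bound _ (fun n => Cmod (1 - s)*Cmod s*Rpower (INR (S n)) (- (1 + Re s)))).
 - apply Rem_spec. rewrite INR_1. lra.
 - intros n. apply zrem1_bound; auto.
 - intros n Hn'. rewrite !rsum_mult, <- Rmult_minus_distr_l. apply Rmult_le_compat_l.
  + fin.
  + apply rsum_power_tail; auto.
Qed.

#[export] Hint Resolve hol_zeta : an.

(** * Residues and Perron's formula *)

Lemma Seg_primitive_convex f D b p q : convexC D -> openC D -> (forall z, D z -> hol f z) -> D b -> D p -> D q ->
 Seg f p q = (Seg f b q - Seg f b p)%C.
Proof.
 intros HD HO Hf Hb Hp Hq. apply Seg_primitive.
 - eapply contS_convex; eauto. fin.
 - intros t Ht. eapply primitive_convex; eauto.
Qed.

Definition arc (f : C -> C) (a : C) (r t1 t2 : R) : C :=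
 CI (fun t => f (circ a r t)*(Ci*(RtoC r*Cexp (Ci*RtoC t))))%C t1 t2.

(** The chord, the arc and the two connecting segments form a closed path in a convex domain where
    [f] has a primitive. *)
Lemma sector f D a r t1 t2 P Q : convexC D -> openC D -> (forall z, D z -> hol f z) -> D P -> D Q ->
 t1 <= t2 -> (forall t, t1 <= t <= t2 -> D (circ a r t)) ->
 Seg f P Q = (Seg f (circ a r t2) Q + arc f a r t1 t2 - Seg f (circ a r t1) P)%C.
Proof.
 intros HD HO Hf HP HQ Ht Hc. unfold arc.
 assert (S : forall p q, D p -> D q -> Seg f p q = (Seg f P q - Seg f P p)%C)
  by (intros; eapply Seg_primitive_convex; eauto).
 rewrite (arc_primitive (Seg f P)); auto.
 - rewrite (S P Q), (S (circ a r t2) Q), (S (circ a r t1) P) by (auto; apply Hc; lra). ring.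
 - intros t Htt. eapply primitive_convex; eauto.
 - fin.
Qed.

Lemma Re_line p q t : Re (line p q t) = (1 - t)*Re p + t*Re q.
Proof. unfold line, Re; simpl; ring. Qed.
Lemma Im_line p q t : Im (line p q t) = (1 - t)*Im p + t*Im q.
Proof. unfold line, Im; simpl; ring. Qed.

Definition box (a b c d : R) (z : C) : Prop := a < Re z < b /\ c < Im z < d.

Lemma box_convex a b c d : convexC (box a b c d).
Proof.
 intros p q t [P1 P2] [Q1 Q2] Ht. unfold box. rewrite Re_line, Im_line.
 assert (K : forall u v lo hi, lo < u < hi -> lo < v < hi -> lo < (1 - t)*u + t*v < hi).
 { intros. destruct (Req_dec t 0) as [->|]; [lra|]. nra. }
 fin.
Qed.

Lemma box_open a b c d : openC (box a b c d).
Proof.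
 intros z [H1 H2]. set (r := Rmin (Rmin (Re z - a) (b - Re z)) (Rmin (Im z - c) (d - Im z))).
 exists r. split; [repeat apply Rmin_glb_lt; lra|]. intros w Hw.
 note (Re_disc _ _ _ Hw). note (Im_disc _ _ _ Hw).
 assert (r <= Re z - a) by (ele; [apply Rmin_l | fin]).
 assert (r <= b - Re z) by (ele; [apply Rmin_l | apply Rmin_r]).
 assert (r <= Im z - c) by (ele; [apply Rmin_r | fin]).
 assert (r <= d - Im z) by (ele; [apply Rmin_r | apply Rmin_r]).
 unfold box. lra.
Qed.

Lemma Re_circ a r t : Re (circ a r t) = Re a + r*cos t.
Proof. unfold circ, Cexp, Re; simpl. replace (0*t - 1*0) with 0 by ring. replace (0*0 + 1*t) with t by ring. rewrite exp_0. ring. Qed.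
Lemma Im_circ a r t : Im (circ a r t) = Im a + r*sin t.
Proof. unfold circ, Cexp, Im, Re; simpl. replace (0*t - 1*0) with 0 by ring. replace (0*0 + 1*t) with t by ring. rewrite exp_0. ring. Qed.

Definition rect (f : C -> C) (x1 x2 T : R) : C :=
 (Seg f (pt x1 (- T)) (pt x2 (- T)) + Seg f (pt x2 (- T)) (pt x2 T) + Seg f (pt x2 T) (pt x1 T) + Seg f (pt x1 T) (pt x1 (- T)))%C.

(** Rectangle and circle are compared in five sectors, each inside a convex box that avoids the
    pole; the connecting segments cancel. The circle need not lie inside the rectangle, so the
    radius can be chosen freely. *)
Lemma rect_residue f al be a x1 x2 T r : (forall z, al < Re z < be -> z <> RtoC a -> hol f z) ->
 al < x1 < a -> a < x2 < be -> 0 < T -> 0 < r -> al < a - r -> a + r < be ->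
 rect f x1 x2 T = arc f (RtoC a) r 0 (2*PI).
Proof.
 intros Hf Hx1 Hx2 HT Hr Hal Hbe. note PI_RGT_0.
 set (Y := T + r + 1).
 assert (Hol : forall (D : C -> Prop), (forall z, D z -> al < Re z < be /\ z <> RtoC a) -> forall z, D z -> hol f z).
 { intros D HD z Hz. destruct (HD z Hz). auto. }
 assert (Hsin : forall t, -1 <= sin t <= 1) by (intro; apply SIN_bound).
 assert (Hcos : forall t, -1 <= cos t <= 1) by (intro; apply COS_bound).
 assert (Bc : forall t, al < a + r*cos t < be) by (intro t; specialize (Hcos t); nra).
 assert (Bs : forall t, - Y < 0 + r*sin t < Y) by (intro t; specialize (Hsin t); unfold Y; nra).
 assert (cpos1 : forall t, 0 <= t <= PI/4 -> 0 < cos t) by (intros; apply cos_gt_0; lra).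
 assert (cpos2 : forall t, 7*PI/4 <= t <= 2*PI -> 0 < cos t).
 { intros. replace t with (- (2*PI - t) + 2*INR 1*PI) by (rewrite INR_1; ring).
  rewrite cos_period, cos_neg. fin. }
 assert (spos : forall t, PI/4 <= t <= 3*PI/4 -> 0 < sin t) by (intros; apply sin_gt_0; lra).
 assert (cneg : forall t, 3*PI/4 <= t <= 5*PI/4 -> cos t < 0) by (intros; apply cos_lt_0; lra).
 assert (sneg : forall t, 5*PI/4 <= t <= 7*PI/4 -> sin t < 0) by (intros; apply sin_lt_0; lra).
 set (DR := box a be (- Y) Y). set (DL := box al a (- Y) Y). set (DU := box al be 0 Y). set (DD := box al be (- Y) 0).
 assert (ne : forall z, (Re z <> a \/ Im z <> 0) -> z <> RtoC a) by (intros z [K|K] E; subst z; apply K; reflexivity).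
 assert (HR : forall z, DR z -> hol f z) by (apply Hol; intros z [A B]; split; [lra | fin]).
 assert (HL : forall z, DL z -> hol f z) by (apply Hol; intros z [A B]; split; [lra | fin]).
 assert (HU : forall z, DU z -> hol f z) by (apply Hol; intros z [A B]; split; [lra | fin]).
 assert (HDn : forall z, DD z -> hol f z) by (apply Hol; intros z [A B]; split; [lra | fin]).
 assert (in_box : forall a b c d x y, a < x < b -> c < y < d -> box a b c d (x, y)) by (intros; split; auto).
 assert (circ_box : forall a' b c d t, a' < a + r*cos t < b -> c < 0 + r*sin t < d -> box a' b c d (circ (RtoC a) r t)).
 { intros. split; [rewrite Re_circ | rewrite Im_circ]; auto. }
 (* Quarter turns centred on the axes, each on one side of a line through the pole; the right one is
    cut at angle 0, where the parametrisation of the circle starts. *)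
 note (sector f DR (RtoC a) r (7*PI/4) (2*PI) (pt x2 (- T)) (pt x2 0)) as S1.
 note (sector f DR (RtoC a) r 0 (PI/4) (pt x2 0) (pt x2 T)) as S2.
 note (sector f DU (RtoC a) r (PI/4) (3*PI/4) (pt x2 T) (pt x1 T)) as S3.
 note (sector f DL (RtoC a) r (3*PI/4) (5*PI/4) (pt x1 T) (pt x1 (- T))) as S4.
 note (sector f DD (RtoC a) r (5*PI/4) (7*PI/4) (pt x1 (- T)) (pt x2 (- T))) as S5.
 rewrite circ_2PI in S1.
 assert (SR : Seg f (pt x2 (- T)) (pt x2 T) = (Seg f (pt x2 (- T)) (pt x2 0) + Seg f (pt x2 0) (pt x2 T))%C).
 { replace (pt x2 0) with (line (pt x2 (- T)) (pt x2 T) (1/2)) by (apply C_eq; unfold line; simpl; field).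
  apply Seg_split; [lra|]. apply (contS_convex f DR); [apply box_convex | fin | |]; apply in_box; unfold Y; lra. }
 unfold rect. rewrite SR.
 rewrite S1, S2, S3, S4, S5; auto; try apply box_convex; try apply box_open; try lra;
  try (apply in_box; unfold Y; lra).
 - assert (Hcont : contI (fun t => f (circ (RtoC a) r t)*(Ci*(RtoC r*Cexp (Ci*RtoC t))))%C 0 (2*PI)).
  { intros t _. apply cont_mult; [|fin].
   apply (cont_comp dR f); [fin|]. apply hol_cont, Hf; [rewrite Re_circ; apply Bc|].
   intro E. note (Cmod_circ (RtoC a) r t __) as Q. rewrite E in Q.
   replace (a - a)%C with (RtoC 0) in Q by ring. rewrite Cmod_0 in Q. lra. }
  unfold arc.
  rewrite <- (CI_Chasles _ 0 (PI/4) (2*PI)) by (auto; lra).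
  rewrite <- (CI_Chasles _ (PI/4) (3*PI/4) (2*PI)) by (try lra; eapply contI_sub; eauto; lra).
  rewrite <- (CI_Chasles _ (3*PI/4) (5*PI/4) (2*PI)) by (try lra; eapply contI_sub; eauto; lra).
  rewrite <- (CI_Chasles _ (5*PI/4) (7*PI/4) (2*PI)) by (try lra; eapply contI_sub; eauto; lra).
  ring.
 - intros t Ht. apply circ_box; auto. specialize (Bs t). specialize (sneg t Ht). nra.
 - intros t Ht. apply circ_box; auto. specialize (Bc t). specialize (cneg t Ht). nra.
 - intros t Ht. apply circ_box; auto. specialize (Bs t). specialize (spos t Ht). nra.
 - intros t Ht. apply circ_box; auto. specialize (Bc t). specialize (cpos1 t Ht). nra.
 - intros t Ht. apply circ_box; auto. specialize (Bc t). specialize (cpos2 t Ht). nra.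
Qed.

Lemma rect_regular f al be x1 x2 T : (forall z, al < Re z < be -> hol f z) ->
 al < x1 < be -> al < x2 < be -> 0 < T -> rect f x1 x2 T = RtoC 0.
Proof.
 intros Hf H1 H2 HT. unfold rect.
 set (D := box al be (- T - 1) (T + 1)).
 assert (S : forall p q, D p -> D q -> Seg f p q = (Seg f (pt x1 (- T)) q - Seg f (pt x1 (- T)) p)%C).
 { intros. apply (Seg_primitive_convex f D); auto; [apply box_convex | apply box_open | intros z [A B]; auto |].
  split; unfold Re, Im; simpl; lra. }
 assert (P1 : D (pt x1 (- T))) by (split; unfold Re, Im; simpl; lra). assert (P2 : D (pt x2 (- T))) by (split; unfold Re, Im; simpl; lra).
 assert (P3 : D (pt x2 T)) by (split; unfold Re, Im; simpl; lra). assert (P4 : D (pt x1 T)) by (split; unfold Re, Im; simpl; lra).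
 rewrite (S _ _ P2 P3), (S _ _ P3 P4), (S _ _ P4 P1), Seg_pp. ring.
Qed.

Lemma arc_simple_pole h al be a r : (forall z, al < Re z < be -> hol h z) -> al < a - 2*r -> a + 2*r < be -> 0 < r ->
 arc (fun s => h s/(s - RtoC a))%C (RtoC a) r 0 (2*PI) = (RtoC (2*PI)*Ci*h (RtoC a))%C.
Proof.
 intros Hh H1 H2 Hr. note PI_RGT_0.
 assert (Hd : forall z, Cmod (z - a) < 2*r -> hol h z).
 { intros z Hz. apply Hh. apply Re_disc in Hz. change (Re (RtoC a)) with a in Hz. lra. }
 note (cauchy_formula h (RtoC a) (2*r) r (RtoC a) Hd __) as E.
 replace (a - a)%C with (RtoC 0) in E by ring. rewrite Cmod_0 in E. specialize (E Hr).
 unfold arc.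
 assert (Hne : forall t, (circ a r t - a)%C <> RtoC 0).
 { intros t. unfold circ. replace (a + r*Cexp (Ci*t) - a)%C with (r*Cexp (Ci*t))%C by ring. apply expi_neq; auto. }
 rewrite (CI_ext _ (fun t => Ci*(h (circ a r t)*(RtoC r*Cexp (Ci*RtoC t)/(circ a r t - a))))%C).
 - rewrite CI_cmult, E; [ring | lra |]. intros t _. apply cont_mult.
  + apply (cont_comp dR h); [apply cont_circ|]. apply hol_cont, Hd. rewrite Cmod_circ; lra.
  + apply cont_div; [auto | apply cont_rexpi | apply cont_minus; [apply cont_circ | apply cont_const]].
 - lra.
 - intros t _. ceq.
Qed.

Lemma line_Re_const x y1 y2 t : Re (line (x, y1) (x, y2) t) = x.
Proof. unfold line, Re; simpl; ring. Qed.
Lemma Cmod_horiz x1 x2 y : Cmod ((x2, y) - (x1, y))%C = Rabs (x2 - x1).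
Proof. replace ((x2, y) - (x1, y))%C with (RtoC (x2 - x1)) by ceq. apply Cmod_R. Qed.
Lemma Cmod_vert x y1 y2 : Cmod ((x, y2) - (x, y1))%C = Rabs (y2 - y1).
Proof.
 replace ((x, y2) - (x, y1))%C with (Ci*RtoC (y2 - y1))%C by ceq.
 rewrite Cmod_mult, Cmod_Ci, Cmod_R. ring.
Qed.

(** The kernel of the first Riesz mean: along a vertical line it yields [max (y - 1) 0] instead of a
    step function, and its integral converges absolutely. *)
Definition perron_kernel (y : R) (s : C) : C := (Rcpow y (s + 1)/(s*(s + 1)))%C.

Lemma perron_kernel_bound y s d : 0 < y -> 0 < d -> d <= Cmod s -> d <= Cmod (s + 1)%C ->
 Cmod (perron_kernel y s) <= Rpower y (Re s + 1)/(d*d).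
Proof.
 intros Hy Hd H1 H2. unfold perron_kernel.
 assert (s <> RtoC 0) by (intro E; rewrite E, Cmod_0 in H1; lra).
 assert ((s + 1)%C <> RtoC 0) by (intro E; rewrite E, Cmod_0 in H2; lra).
 rewrite Cmod_div, Cmod_mult, Cmod_Rcpow by (auto; apply Cmult_neq_0; auto).
 mul_l; [fin|]. fin.
Qed.

Lemma hol_perron y s : s <> RtoC 0 -> s <> RtoC (-1) -> hol (perron_kernel y) s.
Proof.
 intros H1 H2. apply hol_div.
 - apply Cmult_neq_0; auto. intro E. apply H2. replace s with (s + 1 - 1)%C by ring. rewrite E. apply C_eq; simpl; ring.
 - fin.
 - fin.
Qed.

Lemma neq_of_Re (s : C) x : Re s <> x -> s <> RtoC x.
Proof. intros H E; apply H; rewrite E; auto. Qed.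
Lemma neq_of_Im (s : C) x : Im s <> 0 -> s <> RtoC x.
Proof. intros H E; apply H; rewrite E; auto. Qed.

Lemma Seg_bound_h f x1 x2 y M : (forall x, Rmin x1 x2 <= x <= Rmax x1 x2 -> hol f (x, y) /\ Cmod (f (x, y)) <= M) ->
 Cmod (Seg f (x1, y) (x2, y)) <= Rabs (x2 - x1)*M.
Proof.
 intros H. assert (E : forall t, line (x1, y) (x2, y) t = (x1 + t*(x2 - x1), y)) by (intro; apply C_eq; unfold line; simpl; ring).
 assert (B : forall t, 0 <= t <= 1 -> Rmin x1 x2 <= x1 + t*(x2 - x1) <= Rmax x1 x2).
 { intros t Ht. unfold Rmin, Rmax. destruct (Rle_dec x1 x2); nra. }
 rewrite <- (Cmod_horiz x1 x2 y). apply Seg_bound.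
 - intros t Ht. rewrite E. apply hol_cont. apply (proj1 (H _ (B t Ht))).
 - intros t Ht. rewrite E. apply (proj2 (H _ (B t Ht))).
Qed.

Lemma Seg_bound_v f x y1 y2 M : (forall y, Rmin y1 y2 <= y <= Rmax y1 y2 -> hol f (x, y) /\ Cmod (f (x, y)) <= M) ->
 Cmod (Seg f (x, y1) (x, y2)) <= Rabs (y2 - y1)*M.
Proof.
 intros H. assert (E : forall t, line (x, y1) (x, y2) t = (x, y1 + t*(y2 - y1))) by (intro; apply C_eq; unfold line; simpl; ring).
 assert (B : forall t, 0 <= t <= 1 -> Rmin y1 y2 <= y1 + t*(y2 - y1) <= Rmax y1 y2).
 { intros t Ht. unfold Rmin, Rmax. destruct (Rle_dec y1 y2); nra. }
 rewrite <- (Cmod_vert x y1 y2). apply Seg_bound.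
 - intros t Ht. rewrite E. apply hol_cont. apply (proj1 (H _ (B t Ht))).
 - intros t Ht. rewrite E. apply (proj2 (H _ (B t Ht))).
Qed.

(** For [y <= 1] the contour is closed to the right, where there is no pole; for [y > 1] it is
    closed to the left, across the poles 0 and -1 with residues [y] and -1. *)
Lemma perron y c T : 0 < y -> 0 < c -> 1 <= T ->
 Cmod (Seg (perron_kernel y) (pt c (- T)) (pt c T) - RtoC (2*PI)*Ci*RtoC (Rmax (y - 1) 0))%C
 <= (2*c + 8)*Rpower y (c + 1)/T.
Proof.
 intros Hy Hc HT. note (Rpower_pos y (c + 1)) as HP. set (P := Rpower y (c + 1)) in *. set (f := perron_kernel y).
 assert (HI : forall x v, 1 <= Rabs v -> hol f (x, v)).
 { intros x v Hv. apply hol_perron; apply neq_of_Im; unfold Im; simpl; intro E; rewrite E, Rabs_R0 in Hv; lra. }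
 assert (BI : forall x v, Rabs v = T -> Rpower y (x + 1) <= P -> Cmod (f (x, v)) <= P/(T*T)).
 { intros x v Hv Hx. ele; [apply (perron_kernel_bound y (x, v) T); auto; try lra|].
  - rewrite <- Hv. apply (Im_le_Cmod (x, v)).
  - rewrite <- Hv. note (Im_le_Cmod ((x, v) + 1)%C) as Q. unfold Im in Q; simpl in Q. rewrite Rplus_0_r in Q. exact Q.
  - mul_r; [fin | fin]. }
 destruct (Rle_dec y 1) as [Hy1|Hy1].
 - rewrite Rmax_right by lra.
  assert (Hmon : forall x, c <= x -> Rpower y (x + 1) <= P).
  { intros x Hx. unfold P, Rpower. assert (ln y <= 0) by (rewrite <- ln_1; apply ln_le; lra).
   destruct (Rle_lt_or_eq_dec ((x + 1)*ln y) ((c + 1)*ln y) ltac:(nra)) as [L|E]; [left; apply exp_increasing; auto | rewrite E; lra]. }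
  (* With the far side at distance [T] every added side has length [O(T)] and carries an integrand
     [O(P/(T*T))]. *)
  set (X := c + T).
  assert (Z : rect f c X T = RtoC 0).
  { apply (rect_regular f 0 (X + 1)); unfold X; try lra. intros z Hz. apply hol_perron; apply neq_of_Re; lra. }
  unfold rect in Z.
  assert (Hfv : forall x v, 0 < x -> hol f (x, v)) by (intros; apply hol_perron; apply neq_of_Re; unfold Re; simpl; lra).
  assert (E : Seg f (pt c T) (pt c (- T)) = (- Seg f (pt c (- T)) (pt c T))%C).
  { apply Seg_rev. intros t Ht. apply hol_cont, hol_perron; apply neq_of_Re; rewrite line_Re_const; lra. }
  rewrite E in Z.
  replace (Seg f (pt c (- T)) (pt c T) - RtoC (2*PI)*Ci*RtoC 0)%C with (Seg f (pt c (- T)) (pt X (- T)) + Seg f (pt X (- T)) (pt X T) + Seg f (pt X T) (pt c T))%C.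
  2:{ replace (Seg f (pt c (- T)) (pt X (- T)) + Seg f (pt X (- T)) (pt X T) + Seg f (pt X T) (pt c T))%C
     with (Seg f (pt c (- T)) (pt X (- T)) + Seg f (pt X (- T)) (pt X T) + Seg f (pt X T) (pt c T) + - Seg f (pt c (- T)) (pt c T) + Seg f (pt c (- T)) (pt c T))%C by ring.
    rewrite Z. ring. }
  ub Cmod_triangle. ele; [apply Rplus_le_compat_r, Cmod_triangle|].
  assert (B1 : Cmod (Seg f (pt c (- T)) (pt X (- T))) <= Rabs (X - c)*(P/(T*T))).
  { apply Seg_bound_h. intros x Hx. rewrite Rmin_left, Rmax_right in Hx by (unfold X; lra). split; [fin|].
   apply BI; [rewrite Rabs_Ropp, Rabs_pos_eq; lra | fin]. }
  assert (B2 : Cmod (Seg f (pt X (- T)) (pt X T)) <= Rabs (T - - T)*(P/(T*T))).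
  { apply Seg_bound_v. intros v Hv. split; [apply Hfv; unfold X; lra|].
   ele; [apply (perron_kernel_bound y (X, v) T); auto; try lra|].
   - note (Re_le_Cmod (X, v)) as Q. unfold Re in Q; simpl in Q. unfold X in *; lra.
   - note (Re_le_Cmod ((X, v) + 1)%C) as Q. unfold Re in Q; simpl in Q. unfold X in *; lra.
   - mul_r; [fin | apply Hmon; unfold X; simpl; lra]. }
  assert (B3 : Cmod (Seg f (pt X T) (pt c T)) <= Rabs (c - X)*(P/(T*T))).
  { apply Seg_bound_h. intros x Hx. rewrite Rmin_right, Rmax_left in Hx by (unfold X; lra). split; [fin|].
   apply BI; [rewrite Rabs_pos_eq; lra | fin]. }
  unfold X in B1, B3. replace (c + T - c) with T in B1 by ring. replace (c - (c + T)) with (- T) in B3 by ring.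
  rewrite Rabs_Ropp in B3. rewrite Rabs_pos_eq in B1, B2, B3 by lra.
  replace ((T - - T)*(P/(T*T))) with (2*(P/T)) in B2 by fld.
  replace (T*(P/(T*T))) with (P/T) in B1, B3 by fld.
  assert (0 < P/T) by fin. fold X in B1, B2, B3. nra.
 - rewrite Rmax_left by lra.
  assert (Hmon : forall x, x <= c -> Rpower y (x + 1) <= P) by (intros; apply Rpower_le_base1; lra).
  set (X := - (T + 2)).
  (* [rect_residue] treats one pole at a time, so the line [Re s = -1/2] separates the two. *)
  assert (R1 : rect f (-1/2) c T = (RtoC (2*PI)*Ci*RtoC y)%C).
  { rewrite (rect_residue f (-1) (c + 1) 0 (-1/2) c T (1/4)) by (try lra; intros z Hz Hz0; apply hol_perron; auto; apply neq_of_Re; lra).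
   note (arc_simple_pole (fun s => Rcpow y (s + 1)/(s + 1))%C (-1) (c + 1) 0 (1/4)) as A.
   cbv beta in A. rewrite Cplus_0_l, Rcpow_1 in A by auto.
   replace (RtoC (2*PI)*Ci*RtoC y)%C with (RtoC (2*PI)*Ci*(RtoC y/1))%C by field.
   rewrite <- A; try lra.
   - apply CI_ext; [note PI_RGT_0; lra|]. intros t _. unfold f, perron_kernel.
    set (w := circ 0 (1/4) t).
    assert (Hw : Cmod (w - 0) = 1/4) by (apply Cmod_circ; lra).
    assert (w <> RtoC 0) by (intro E; rewrite E in Hw; replace (0 - 0)%C with (RtoC 0) in Hw by ring; rewrite Cmod_0 in Hw; lra).
    assert ((w + 1)%C <> RtoC 0).
    { intro E. replace (w - 0)%C with ((w + 1) - 1)%C in Hw by ring. rewrite E in Hw. replace (0 - 1)%C with (-(1))%C in Hw by ring.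
     rewrite Cmod_opp, Cmod_1 in Hw. lra. } field. auto.
   - intros z Hz. apply hol_div; [|fin | fin].
    intro E. apply (f_equal Re) in E. unfold Re in *; simpl in E. lra. }
  assert (R2 : rect f X (-1/2) T = (RtoC (2*PI)*Ci*-(1))%C).
  { rewrite (rect_residue f (X - 1) 0 (-1) X (-1/2) T (1/4)) by (unfold X; try lra; intros z Hz Hz0; apply hol_perron; auto; apply neq_of_Re; lra).
   note (arc_simple_pole (fun s => Rcpow y (s + 1)/s)%C (X - 1) 0 (-1) (1/4)) as A.
   cbv beta in A. replace (-1 + 1)%C with (RtoC 0) in A by ceq. rewrite Rcpow_0 in A.
   replace (RtoC (2*PI)*Ci*-(1))%C with (RtoC (2*PI)*Ci*(RtoC 1/RtoC (-1)))%C
    by fld.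
   rewrite <- A; try lra; try (unfold X; lra).
   - apply CI_ext; [note PI_RGT_0; lra|]. intros t _. unfold f, perron_kernel.
    set (w := circ (RtoC (-1)) (1/4) t).
    assert (Hw : Cmod (w - RtoC (-1)) = 1/4) by (apply Cmod_circ; lra).
    replace (w - RtoC (-1))%C with (w + 1)%C in*by ceq.
    assert (w <> RtoC 0) by (intro E; rewrite E in Hw; rewrite Cplus_0_l, Cmod_1 in Hw; lra).
    assert ((w + 1)%C <> RtoC 0) by (intro E; rewrite E, Cmod_0 in Hw; lra).
    field. auto.
   - intros z Hz. apply hol_div; [apply neq_of_Re; lra | fin | fin]. }
  unfold rect in R1, R2.
  assert (E : Seg f (pt (-1/2) T) (pt (-1/2) (- T)) = (- Seg f (pt (-1/2) (- T)) (pt (-1/2) T))%C).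
  { apply Seg_rev. intros t Ht. apply hol_cont, hol_perron; apply neq_of_Re; rewrite line_Re_const; lra. }
  rewrite E in R1.
  replace (Seg f (pt c (- T)) (pt c T) - RtoC (2*PI)*Ci*RtoC (y - 1))%C
   with (- (Seg f (pt (-1/2) (- T)) (pt c (- T)) + Seg f (pt c T) (pt (-1/2) T) + Seg f (pt X (- T)) (pt (-1/2) (- T)) + Seg f (pt (-1/2) T) (pt X T) + Seg f (pt X T) (pt X (- T))))%C.
  2:{ rewrite RtoC_minus. replace (RtoC (2*PI)*Ci*(y - 1))%C with (RtoC (2*PI)*Ci*y + RtoC (2*PI)*Ci*- (1))%C by ring.
    rewrite <- R1, <- R2. ring. }
  rewrite Cmod_opp.
  assert (B1 : Cmod (Seg f (pt (-1/2) (- T)) (pt c (- T))) <= Rabs (c - -1/2)*(P/(T*T))).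
  { apply Seg_bound_h. intros x Hx. rewrite Rmin_left, Rmax_right in Hx by lra. split; [apply HI; rewrite Rabs_Ropp, Rabs_pos_eq; lra|].
   apply BI; [rewrite Rabs_Ropp, Rabs_pos_eq; lra | fin]. }
  assert (B2 : Cmod (Seg f (pt c T) (pt (-1/2) T)) <= Rabs (-1/2 - c)*(P/(T*T))).
  { apply Seg_bound_h. intros x Hx. rewrite Rmin_right, Rmax_left in Hx by lra. split; [apply HI; rewrite Rabs_pos_eq; lra|].
   apply BI; [rewrite Rabs_pos_eq; lra | fin]. }
  assert (B3 : Cmod (Seg f (pt X (- T)) (pt (-1/2) (- T))) <= Rabs (-1/2 - X)*(P/(T*T))).
  { apply Seg_bound_h. intros x Hx. rewrite Rmin_left, Rmax_right in Hx by (unfold X; lra). split; [apply HI; rewrite Rabs_Ropp, Rabs_pos_eq; lra|].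
   apply BI; [rewrite Rabs_Ropp, Rabs_pos_eq; lra | fin]. }
  assert (B4 : Cmod (Seg f (pt (-1/2) T) (pt X T)) <= Rabs (X - -1/2)*(P/(T*T))).
  { apply Seg_bound_h. intros x Hx. rewrite Rmin_right, Rmax_left in Hx by (unfold X; lra). split; [apply HI; rewrite Rabs_pos_eq; lra|].
   apply BI; [rewrite Rabs_pos_eq; lra | fin]. }
  assert (B5 : Cmod (Seg f (pt X T) (pt X (- T))) <= Rabs (- T - T)*(P/(T*T))).
  { apply Seg_bound_v. intros v Hv. split; [apply hol_perron; apply neq_of_Re; unfold X, Re; simpl; lra|].
   ele; [apply (perron_kernel_bound y (X, v) T); auto; try lra|].
   - note (re_le_Cmod (X, v)) as Q. unfold Re in Q; simpl in Q. rewrite Rabs_left1 in Q; unfold X in *; lra.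
   - note (re_le_Cmod ((X, v) + 1)%C) as Q. unfold Re in Q; simpl in Q. rewrite Rabs_left1 in Q; unfold X in *; lra.
   - mul_r; [fin | apply Hmon; unfold X; simpl; lra]. }
  rewrite (Rabs_pos_eq (c - -1/2)) in B1 by lra. rewrite (Rabs_left1 (-1/2 - c)) in B2 by lra.
  rewrite (Rabs_pos_eq (-1/2 - X)) in B3 by (unfold X; lra). rewrite (Rabs_left1 (X - -1/2)) in B4 by (unfold X; lra).
  rewrite (Rabs_left1 (- T - T)) in B5 by lra.
  set (Q := P/(T*T)) in *. assert (HQ : 0 < Q) by (apply Rdiv_lt_0_compat; nra).
  replace ((2*c + 8)*P/T) with ((2*c + 8)*T*Q) by (unfold Q; field; lra).
  match goal with |- ?l <= _ => assert (l <= (2*(c + T + 2) + 2*T)*Q) end.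
  { note (Cmod_triangle (Seg f (pt (-1/2) (- T)) (pt c (- T)) + Seg f (pt c T) (pt (-1/2) T) + Seg f (pt X (- T)) (pt (-1/2) (- T)) + Seg f (pt (-1/2) T) (pt X T))%C (Seg f (pt X T) (pt X (- T)))).
   note (Cmod_triangle (Seg f (pt (-1/2) (- T)) (pt c (- T)) + Seg f (pt c T) (pt (-1/2) T) + Seg f (pt X (- T)) (pt (-1/2) (- T)))%C (Seg f (pt (-1/2) T) (pt X T))).
   note (Cmod_triangle (Seg f (pt (-1/2) (- T)) (pt c (- T)) + Seg f (pt c T) (pt (-1/2) T))%C (Seg f (pt X (- T)) (pt (-1/2) (- T)))).
   note (Cmod_triangle (Seg f (pt (-1/2) (- T)) (pt c (- T))) (Seg f (pt c T) (pt (-1/2) T))).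
   unfold X in *. nra. }
  assert ((2*(c + T + 2) + 2*T)*Q <= (2*c + 8)*T*Q); [|lra]. mul_r; nra.
Qed.

#[export] Hint Resolve hol_perron neq_of_Re neq_of_Im : an.

(** * Exponential sums *)

Definition ei (x : R) : C := Cexp (Ci*RtoC x).

Lemma ei_eq x : ei x = (cos x, sin x).
Proof.
 unfold ei, Cexp. simpl. replace (0*x - 1*0) with 0 by ring. replace (0*0 + 1*x) with x by ring.
 rewrite exp_0. ceq.
Qed.
Lemma ei_plus x y : ei (x + y) = (ei x*ei y)%C.
Proof. unfold ei. rewrite <- Cexp_plus, RtoC_plus. f_equal. ring. Qed.
Lemma ei_mod x : Cmod (ei x) = 1.
Proof. apply Cmod_expi. Qed.
Lemma ei_opp x : ei (- x) = Cconj (ei x).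
Proof. rewrite !ei_eq. rewrite cos_neg, sin_neg. auto. Qed.

(* c = 1/(1 - e^{iy}) *)
Lemma kl_coeff y : sin (y/2) <> 0 ->
 ((1 - ei y)*pt (1/2) (cos (y/2)/(2*sin (y/2))) = 1)%C.
Proof.
 intros H. rewrite ei_eq. set (a := y/2) in *. replace y with (2*a) by (unfold a; field).
 rewrite cos_2a_sin, sin_2a. note (sin2_cos2 a) as E.
 apply C_eq; unfold Re, Im; simpl.
 - transitivity (sin a*sin a + cos a*cos a); [field; auto | auto].
 - field. auto.
Qed.

Lemma cot_decr a b : 0 < a <= b -> b < PI -> cos b/sin b <= cos a/sin a.
Proof.
 intros H1 H2. assert (0 < sin a) by (apply sin_gt_0; lra). assert (0 < sin b) by (apply sin_gt_0; lra).
 assert (0 <= sin (b - a)) by (apply sin_ge_0; lra). rewrite sin_minus in H3.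
 apply (Rmult_le_reg_r (sin a*sin b)); [nra|].
 replace (cos b/sin b*(sin a*sin b)) with (cos b*sin a) by fld.
 replace (cos a/sin a*(sin a*sin b)) with (cos a*sin b) by fld. lra.
Qed.

Lemma sin_lower x : 0 <= x <= PI/2 -> x/3 <= sin x.
Proof.
 intros H. destruct (Rle_dec x (6/5)) as [L|L].
 - 
  note (sin_bound x 0 __ __) as [S _].
  unfold sin_approx, sum_f_R0, sin_term in S; simpl in S. unfold INR in S. nra.
 - note PI_4. assert (sin (6/5) <= sin x) by (apply sin_incr_1; lra).
  note (sin_bound (6/5) 0 __ __) as [S _].
  unfold sin_approx, sum_f_R0, sin_term in S; simpl in S. unfold INR in S. lra.
Qed.

Lemma sin_lower_sym th x : 0 < th -> th <= x <= 2*PI - th -> th/6 <= sin (x/2).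
Proof.
 intros Ht H. destruct (Rle_dec x PI).
 - note (sin_lower (x/2) __). lra.
 - replace (x/2) with (PI - (PI - x/2)) by ring. rewrite sin_PI_x. note (sin_lower (PI - x/2) __). lra.
Qed.

(** The Kusmin-Landau argument: each term equals the difference of two consecutive terms times
    [1/(1 - e^(iy))], where [y] is the difference of the phases. The real part of this coefficient
    is 1/2 and its imaginary part half a cotangent, which is monotone here, so partial summation
    leaves a multiple of the extreme values. *)
Lemma kusmin_landau_core (F : nat -> R) th L : 0 < th <= 1 ->
 (forall n, (n < L)%nat -> th <= F (S n) - F n <= 2*PI - th) ->
 (forall n, (S n < L)%nat -> F (S n) - F n <= F (S (S n)) - F (S n)) ->
 Cmod (csum (fun n => ei (F n)) L) <= 16/th.
Proof.
 intros Ht Hd Hm.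
 destruct L as [|L]; [simpl; rewrite Cmod_0; left; apply Rdiv_lt_0_compat; lra|].
 set (a := fun n => (F (S n) - F n)/2).
 set (c := fun n => (1/2, cos (a n)/(2*sin (a n))) : C).
 assert (Hs : forall n, (n <= L)%nat -> th/6 <= sin (a n)) by (intros; apply sin_lower_sym; [lra | fin]).
 assert (Ec : forall n, (n <= L)%nat -> ei (F n) = ((ei (F n) - ei (F (S n)))*c n)%C).
 { intros n Hn. replace (F (S n)) with (F n + (F (S n) - F n)) at 1 by ring. rewrite ei_plus.
  transitivity (ei (F n)*((1 - ei (F (S n) - F n))*c n))%C; [|ring]. rewrite kl_coeff; [ring|]. specialize (Hs n Hn). unfold a in Hs. lra. }
 set (k := fun n => cos (a n)/sin (a n)).
 assert (Hk : forall n, (n < L)%nat -> k (S n) <= k n).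
 { intros n Hn. apply cot_decr; unfold a; [|specialize (Hd (S n) ltac:(lia)); lra].
  specialize (Hd n ltac:(lia)). specialize (Hm n ltac:(lia)). lra. }
 assert (Bk : forall n, (n <= L)%nat -> Rabs (k n) <= 6/th).
 { intros n Hn. unfold k, Rdiv. rewrite Rabs_mult. specialize (Hs n Hn).
  rewrite (Rabs_pos_eq (/ sin (a n))) by fin.
  assert (Rabs (cos (a n)) <= 1) by (apply Rabs_le, COS_bound).
  le (1*/ sin (a n)); [fin|].
  rewrite Rmult_1_l. replace (6*/ th) with (/ (th/6)) by fld. fin. }
 assert (Bc : forall n, (n <= L)%nat -> Cmod (c n) <= 1/2 + 3/th).
 { intros n Hn. ub Cmod_le_Re_Im. unfold c, Re, Im; simpl.
  replace (cos (a n)/(2*sin (a n))) with (k n/2) by (unfold k; field; specialize (Hs n Hn); lra).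
  unfold Rdiv at 2. rewrite Rabs_mult, (Rabs_pos_eq (1/2)), (Rabs_pos_eq (/2)) by lra. specialize (Bk n Hn).
  lra. }
 (* summation by parts *)
 assert (Hab : forall m, (m <= L)%nat ->
  csum (fun n => ei (F n)) (S m) = (ei (F 0%nat)*c 0%nat - ei (F (S m))*c m + csum (fun n => ei (F (S n))*(c (S n) - c n)) m)%C).
 { induction m as [|m IH]; intros Hm'.
  - simpl. rewrite (Ec 0%nat) at 1 by lia. ring.
  - change (csum (fun n => ei (F n)) (S (S m))) with (csum (fun n => ei (F n)) (S m) + ei (F (S m)))%C.
   rewrite IH by lia. rewrite (Ec (S m)) at 2 by lia. ceq. }
 rewrite (Hab L) by lia.
 assert (Bs : Cmod (csum (fun n => ei (F (S n))*(c (S n) - c n))%C L) <= (k 0%nat - k L)/2).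
 { ub Cmod_csum.
  assert (Q : forall m, (m <= L)%nat -> rsum (fun i => Cmod (ei (F (S i))*(c (S i) - c i))) m <= (k 0%nat - k m)/2).
  { induction m as [|m IH]; intros Hm'; simpl; [lra|]. specialize (IH ltac:(lia)).
   rewrite Cmod_mult, ei_mod.
   replace (c (S m) - c m)%C with (Ci*RtoC ((k (S m) - k m)/2))%C.
   - rewrite Cmod_mult, Cmod_Ci, Cmod_R, Rabs_left1; [|specialize (Hk m ltac:(lia)); lra]. lra.
   - unfold c, k. note (Hs m ltac:(lia)). note (Hs (S m) ltac:(lia)). apply C_eq; unfold Re, Im; simpl; field; lra. }
  fin. }
 ub Cmod_triangle. ele; [apply Rplus_le_compat_r, Cmod_sub_triangle|].
 rewrite !Cmod_mult, !ei_mod. note (Bc 0%nat ltac:(lia)). note (Bc L ltac:(lia)).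
 note (Bk 0%nat ltac:(lia)) as B0. note (Bk L ltac:(lia)) as B1. abs_in B0. abs_in B1.
 assert (1 <= 1/th) by (apply (Rmult_le_reg_r th); [lra|]; unfold Rdiv; rewrite Rmult_assoc, Rinv_l; lra).
 lra.
Qed.

Lemma monotone_split (P : nat -> Prop) L : (forall n m, (n <= m)%nat -> (m < L)%nat -> P n -> P m) ->
 exists c, (c <= L)%nat /\ (forall n, (n < c)%nat -> ~ P n) /\ (forall n, (c <= n)%nat -> (n < L)%nat -> P n).
Proof.
 induction L as [|L IH]; intros H.
 - exists 0%nat. repeat split; intros; lia.
 - destruct IH as [c [H1 [H2 H3]]]; [intros; eapply H; eauto; lia|].
  destruct (em (P L)) as [p|n].
  + exists c. split; [lia|]. split; [auto|]. intros n Hn Hl. destruct (Nat.eq_dec n L) as [->|]; auto. fin.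
  + exists (S L). split; [lia|]. split; [|fin]. intros n0 Hn0 Hp. apply n. eapply H; [| |exact Hp]; lia.
Qed.

(** * Second differences and van der Corput's second derivative test *)

Definition dif (F : nat -> R) (n : nat) : R := F (S n) - F n.

Lemma dif_mono F lam L : 0 < lam -> (forall n, (S n < L)%nat -> lam <= dif F (S n) - dif F n) ->
 forall n m, (n <= m)%nat -> (m < L)%nat -> dif F n + lam*INR (m - n) <= dif F m.
Proof.
 intros Hl H n m Hnm. induction Hnm as [|m Hnm IH]; intros Hm.
 - rewrite Nat.sub_diag, INR_0. lra.
 - specialize (IH ltac:(lia)). specialize (H m Hm). rewrite Nat.sub_succ_l, S_INR by lia. lra.
Qed.

Lemma csum_ei_trivial F n : Cmod (csum (fun i => ei (F i)) n) <= INR n.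
Proof.
 ub Cmod_csum. rewrite (rsum_ext _ (fun _ => 1)) by (intros; apply ei_mod). rewrite rsum_const. lra.
Qed.

Lemma ei_period x (k : Z) : ei (x + 2*PI*IZR k) = ei x.
Proof.
 assert (P : forall y (n : nat), ei (y + 2*PI*INR n) = ei y).
 { intros y n. rewrite !ei_eq. replace (y + 2*PI*INR n) with (y + 2*INR n*PI) by ring. rewrite cos_period, sin_period. auto. }
 destruct (Z_le_dec 0 k).
 - rewrite <- (Z2Nat.id k), <- INR_IZR_INZ by auto. apply P.
 - rewrite <- (P (x + 2*PI*IZR k) (Z.to_nat (- k))). f_equal. rewrite INR_IZR_INZ, Z2Nat.id, opp_IZR by lia. ring.
Qed.

(** The differences within [th] of a multiple of [2*PI] are few, because they grow by at least [lam]
    each time; these terms are counted. The others satisfy the hypotheses of [kusmin_landau_core]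
    once multiples of [2*PI] are subtracted from the phase. *)
Lemma period_block (F : nat -> R) lam th L (k : Z) : 0 < lam -> 0 < th <= 1 ->
 (forall n, (S n < L)%nat -> lam <= dif F (S n) - dif F n) ->
 (forall n, (n < L)%nat -> 2*PI*IZR k - th <= dif F n < 2*PI*IZR k + 2*PI - th) ->
 Cmod (csum (fun n => ei (F n)) L) <= 2*th/lam + 1 + 16/th.
Proof.
 intros Hl Ht Hm Hd. note (dif_mono F lam L Hl Hm) as Mono.
 destruct (monotone_split (fun n => 2*PI*IZR k + th <= dif F n) L) as [c [C1 [C2 C3]]].
 { intros n m Hnm HmL Hn. specialize (Mono n m Hnm HmL). note (pos_INR (m - n)). nra. }
 replace L with (c + (L - c))%nat by lia. rewrite csum_split.
 ub Cmod_triangle. apply Rplus_le_compat.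
 - ub csum_ei_trivial. destruct c as [|c].
  + fin.
  + rewrite S_INR. apply Rplus_le_compat_r. specialize (Mono 0%nat c ltac:(lia) ltac:(lia)).
   rewrite Nat.sub_0_r in Mono. specialize (C2 c ltac:(lia)). specialize (Hd 0%nat ltac:(lia)).
   apply (Rmult_le_reg_l lam); auto. replace (lam*(2*th/lam)) with (2*th) by fld. lra.
 - set (G := fun n => F (c + n)%nat - INR n*(2*PI*IZR k)).
  rewrite (csum_ext _ (fun n => ei (G n))).
  + apply kusmin_landau_core; auto.
   * intros n Hn. unfold G. rewrite S_INR. specialize (C3 (c + n)%nat ltac:(lia) ltac:(lia)). specialize (Hd (c + n)%nat ltac:(lia)).
    unfold dif in *. rewrite Nat.add_succ_r. lra.
   * intros n Hn. unfold G. rewrite !S_INR, !Nat.add_succ_r. specialize (Hm (c + n)%nat ltac:(lia)). unfold dif in Hm. lra.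
  + intros n _. unfold G. rewrite <- (ei_period (F (c + n)%nat) (- (Z.of_nat n*k))).
   f_equal. rewrite opp_IZR, mult_IZR, <- INR_IZR_INZ. ring.
Qed.

(** The differences increase, so the indices belonging to one period are consecutive and
    [period_block] applies to each run. *)
Lemma periods (lam th : R) (K : nat) : 0 < lam -> 0 < th <= 1 -> forall (F : nat -> R) (L : nat) (k : Z),
 (forall n, (S n < L)%nat -> lam <= dif F (S n) - dif F n) ->
 (forall n, (n < L)%nat -> 2*PI*IZR k - th <= dif F n < 2*PI*IZR k - th + 2*PI*INR K) ->
 Cmod (csum (fun n => ei (F n)) L) <= INR K*(2*th/lam + 1 + 16/th).
Proof.
 intros Hl Ht.
 induction K as [|K IH]; intros F L k Hm Hd.
 - destruct L as [|L]; [simpl; rewrite Cmod_0, INR_0; lra|]. specialize (Hd 0%nat ltac:(lia)). rewrite INR_0 in Hd. lra.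
 - note (dif_mono F lam L Hl Hm) as Mono.
  destruct (monotone_split (fun n => 2*PI*IZR k + 2*PI - th <= dif F n) L) as [c [C1 [C2 C3]]].
  { intros n m Hnm HmL Hn. specialize (Mono n m Hnm HmL). note (pos_INR (m - n)). nra. }
  replace L with (c + (L - c))%nat by lia. rewrite csum_split, S_INR, Rmult_plus_distr_r, Rmult_1_l, Rplus_comm.
  ub Cmod_triangle. rewrite Rplus_comm. rewrite Rplus_comm at 1. apply Rplus_le_compat.
  + apply (period_block F lam th c k); auto.
   * fin.
   * intros n Hn. specialize (Hd n ltac:(lia)). specialize (C2 n Hn). lra.
  + apply (IH (fun n => F (c + n)%nat) (L - c)%nat (k + 1)%Z).
   * intros n Hn. specialize (Hm (c + n)%nat ltac:(lia)). unfold dif in *. rewrite !Nat.add_succ_r. auto.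
   * intros n Hn. specialize (Hd (c + n)%nat ltac:(lia)). specialize (C3 (c + n)%nat ltac:(lia) ltac:(lia)).
    rewrite S_INR in Hd. rewrite plus_IZR. unfold dif in *. rewrite Nat.add_succ_r. lra.
Qed.

(** Second differences replace the second derivative, so no extension of the phase to real arguments
    is required. *)
Lemma second_derivative_test (F : nat -> R) lam h L : 0 < lam <= 1 -> 1 <= h ->
 (forall n, (S n < L)%nat -> lam <= dif F (S n) - dif F n <= h*lam) ->
 Cmod (csum (fun n => ei (F n)) L) <= (h*lam*INR L + 3)*(19/sqrt lam).
Proof.
 intros Hl Hh Hm. note PI_RGT_0. note PI2_3_2.
 (* This balances the counted terms [th/lam] against the Kusmin-Landau bound [1/th]. *)
 set (th := sqrt lam).
 assert (Ht : 0 < th <= 1). { split; [apply sqrt_lt_R0; lra|]. rewrite <- sqrt_1. apply sqrt_le_1; lra. }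
 assert (Hth : th*th = lam) by (apply sqrt_sqrt; lra).
 assert (HB : 2*th/lam + 1 + 16/th <= 19/th).
 { rewrite <- Hth. replace (2*th/(th*th)) with (2/th) by fld.
  assert (1 <= 1/th) by (apply (Rmult_le_reg_r th); [lra|]; unfold Rdiv; rewrite Rmult_assoc, Rinv_l; lra). lra. }
 destruct L as [|L]; [simpl; rewrite Cmod_0, INR_0; apply Rmult_le_pos; [lra | fin]|].
 set (k := Int_part ((dif F 0%nat + th)/(2*PI))).
 destruct (base_Int_part ((dif F 0%nat + th)/(2*PI))) as [K1 K2]. fold k in K1, K2.
 assert (K1' : 2*PI*IZR k - th <= dif F 0%nat).
 { apply (Rmult_le_compat_l (2*PI)) in K1; [|lra]. replace (2*PI*((dif F 0%nat + th)/(2*PI))) with (dif F 0%nat + th) in K1 by fld. lra. }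
 assert (K2' : dif F 0%nat < 2*PI*IZR k - th + 2*PI).
 { assert ((dif F 0%nat + th)/(2*PI) < IZR k + 1) by lra. apply (Rmult_lt_compat_l (2*PI)) in H1; [|lra].
  replace (2*PI*((dif F 0%nat + th)/(2*PI))) with (dif F 0%nat + th) in H1 by fld. lra. }
 assert (Up : forall n, (n < S L)%nat -> dif F 0%nat <= dif F n <= dif F 0%nat + h*lam*INR n).
 { induction n as [|n IH]; intros Hn; [rewrite INR_0; lra|]. specialize (IH ltac:(lia)). specialize (Hm n Hn). rewrite S_INR. nra. }
 (* The differences start in the period of [k] and rise by at most [h*lam*L]; two extra periods
    cover the partial ones at both ends. *)
 destruct (nfloor_ex (h*lam*INR (S L)/(2*PI))) as [m Hmf].
 { fin. }
 ub (periods lam th (m + 2) __ Ht F (S L) k).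
 - intros n Hn. apply Hm; auto.
 - intros n Hn. specialize (Up n Hn). rewrite plus_INR. replace (INR 2) with 2 by fin.
  assert (h*lam*INR n <= 2*PI*(INR m + 1)).
  { le (h*lam*INR (S L)); [mul_l; [nra | apply le_INR; lia]|].
   destruct Hmf as [_ Hmf]. apply Rlt_le in Hmf. apply (Rmult_le_compat_l (2*PI)) in Hmf; [|lra].
   replace (2*PI*(h*lam*INR (S L)/(2*PI))) with (h*lam*INR (S L)) in Hmf by fld. lra. }
  lra.
 - assert (0 < 2*th/lam + 1 + 16/th) by fin.
  apply Rmult_le_compat; auto; [fin | lra |].
  rewrite plus_INR. replace (INR 2) with 2 by fin.
  assert (INR m <= h*lam*INR (S L)).
  { ub Hmf. rewrite <- (Rmult_1_r (h*lam*INR (S L))) at 2. apply Rmult_le_compat_l.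
   - fin.
   - rewrite <- Rinv_1. fin. }
  lra.
Qed.

Lemma csum_zero n : csum (fun _ => RtoC 0) n = RtoC 0.
Proof. induction n as [|n IH]; simpl; [auto | rewrite IH; ring]. Qed.

Lemma csum_comm (a : nat -> nat -> C) n m :
 csum (fun i => csum (fun j => a i j) m) n = csum (fun j => csum (fun i => a i j) n) m.
Proof.
 induction n as [|n IH]; simpl; [symmetry; apply csum_zero|]. rewrite IH, <- csum_plus. auto.
Qed.

Lemma csum_extend f n m : (n <= m)%nat -> (forall i, (n <= i)%nat -> f i = RtoC 0) -> csum f m = csum f n.
Proof.
 intros H Hz. replace m with (n + (m - n))%nat by lia. rewrite csum_split.
 rewrite (csum_ext (fun i => f (n + i)%nat) (fun _ => RtoC 0)) by fin. rewrite csum_zero. ring.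
Qed.

Lemma csum_shift g h K : csum (fun m => if (h <=? m)%nat then g (m - h)%nat else RtoC 0) (h + K) = csum g K.
Proof.
 rewrite csum_split, (csum_ext _ (fun _ => RtoC 0) h), csum_zero.
 - rewrite (csum_ext _ g); [ring|]. intros i _. rewrite (proj2 (Nat.leb_le h (h + i))) by lia. f_equal. lia.
 - intros i Hi. rewrite (proj2 (Nat.leb_gt h i)) by lia. auto.
Qed.

Lemma Cconj_csum a n : Cconj (csum a n) = csum (fun i => Cconj (a i)) n.
Proof. induction n as [|n IH]; simpl; [ceq | rewrite <- IH; apply C_eq; simpl; ring]. Qed.

Lemma Cmod_sqr_conj z : RtoC (Cmod z*Cmod z) = (z*Cconj z)%C.
Proof. rewrite <- Cmod2_conj. ceq. Qed.

Lemma rsum_Cmod_cs (a : nat -> R) n : (rsum a n)*(rsum a n) <= INR n*rsum (fun i => a i*a i) n.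
Proof.
 induction n as [|n IH]; [simpl; rewrite INR_0; lra|]. rewrite S_INR. simpl.
 set (s := rsum a n) in *. set (q := rsum (fun i => a i*a i) n) in *.
 destruct n as [|n]; [unfold s, q; simpl; rewrite INR_0; lra|].
 note (INR_S_pos n). set (N := INR (S n)) in *.
 assert (0 <= (s - N*a (S n))*(s - N*a (S n))) by apply Rle_0_sqr.
 nra.
Qed.

Lemma RtoC_rsum a n : RtoC (rsum a n) = csum (fun i => RtoC (a i)) n.
Proof. induction n as [|n IH]; simpl; [auto | rewrite RtoC_plus, IH; auto]. Qed.

(** The inequality of Weyl and van der Corput: the sum is averaged over [H] shifts of the sequence
    extended by 0, and the square produces correlations of the sequence with its shifts. *)
Lemma weyl_vdc (F : nat -> R) L H : (1 <= H <= L)%nat ->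
 Cmod (csum (fun n => ei (F n)) L)*Cmod (csum (fun n => ei (F n)) L)
 <= 2*INR L/INR H*(INR L + 2*rsum (fun j => Cmod (csum (fun n => ei (F (n + S j)%nat - F n)) (L - S j))) (H - 1)).
Proof.
 intros [H1 H2].
 set (zz := fun n => if (n <? L)%nat then ei (F n) else RtoC 0).
 set (S0 := csum (fun n => ei (F n)) L).
 set (M := (L + H)%nat).
 (* The sequence moved to the right by [h]; the [M] positions hold every shift completely. *)
 set (u := fun m h => if (h <=? m)%nat then zz (m - h)%nat else RtoC 0).
 assert (Hzz : forall n, (L <= n)%nat -> zz n = RtoC 0) by (intros n Hn; unfold zz; rewrite (proj2 (Nat.ltb_ge n L)); auto).
 assert (Hzz1 : forall n, (n < L)%nat -> zz n = ei (F n)) by (intros n Hn; unfold zz; rewrite (proj2 (Nat.ltb_lt n L)); auto).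
 assert (Ezz : csum zz L = S0) by (apply csum_ext; auto).
 assert (E1 : forall h, (h < H)%nat -> csum (fun m => u m h) M = S0).
 { intros h Hh. unfold u, M. replace (L + H)%nat with (h + (L + H - h))%nat by lia.
  rewrite (csum_shift zz h), (csum_extend zz L); auto. lia. }
 set (cc := fun j => csum (fun n => zz (n + j)%nat*Cconj (zz n))%C L).
 assert (E2 : forall h h', (h <= h')%nat -> (h' < H)%nat -> csum (fun m => u m h*Cconj (u m h'))%C M = cc (h' - h)%nat).
 { intros h h' Hh Hh'.
  rewrite (csum_ext _ (fun m => if (h' <=? m)%nat then (fun n => zz (n + (h' - h))%nat*Cconj (zz n))%C (m - h')%nat else RtoC 0)).
  - unfold M. replace (L + H)%nat with (h' + (L + H - h'))%nat by lia.
   rewrite (csum_shift (fun n => zz (n + (h' - h))%nat*Cconj (zz n))%C h'). apply csum_extend; [lia|].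
   intros i Hi. rewrite (Hzz i Hi). ceq.
  - intros m _. unfold u. destruct (Nat.leb_spec h' m).
   + rewrite (proj2 (Nat.leb_le h m)) by lia. do 2 f_equal. lia.
   + ceq. }
 set (c := fun j => Cmod (cc j)).
 assert (E3 : forall h h', (h < H)%nat -> (h' < H)%nat -> Cmod (csum (fun m => u m h*Cconj (u m h'))%C M) = c (if (h <=? h')%nat then (h' - h)%nat else (h - h')%nat)).
 { intros h h' Hh Hh'. destruct (Nat.leb_spec h h').
  - rewrite E2; auto.
  - rewrite <- Cmod_conj, Cconj_csum. unfold c. rewrite <- (E2 h' h) by lia. f_equal. apply csum_ext. intros m _. ceq. }
 assert (Cpos : forall j, 0 <= c j) by (intro; apply Cmod_ge_0).
 set (W := c 0%nat + 2*rsum (fun j => c (S j)) (H - 1)).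
 (* In a row of correlations the shift 0 occurs once and every other shift at most twice. *)
 assert (E4 : forall h, (h < H)%nat -> rsum (fun h' => c (if (h <=? h')%nat then (h' - h)%nat else (h - h')%nat)) H <= W).
 { intros h Hh. replace H with (h + (1 + (H - h - 1)))%nat at 1 by lia. rewrite rsum_split, rsum_split.
  unfold W. assert (A1 : rsum (fun i => c (if (h <=? i)%nat then (i - h)%nat else (h - i)%nat)) h <= rsum (fun j => c (S j)) (H - 1)).
  { rewrite (rsum_ext _ (fun i => c (h - i)%nat)) by (intros i Hi; rewrite (proj2 (Nat.leb_gt h i)) by lia; auto).
   assert (R : forall k, rsum (fun i => c (k - i)%nat) k = rsum (fun j => c (S j)) k).
   { induction k as [|k IH]; [auto|].
    assert (Rl : forall (b : nat -> R) n, rsum b (S n) = b 0%nat + rsum (fun i => b (S i)) n)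
     by (intros b n; change (S n) with (1 + n)%nat; rewrite rsum_split; simpl; ring).
    change (rsum (fun i => c (S k - i)%nat) k + c (S k - k)%nat) with (rsum (fun i => c (S k - i)%nat) (S k)).
    rewrite Rl. simpl rsum at 2. rewrite <- IH. rewrite Nat.sub_0_r.
    rewrite (rsum_ext (fun i => c (S k - S i)%nat) (fun i => c (k - i)%nat)) by fin. ring. }
   rewrite R. apply rsum_mono; auto. lia. }
  assert (A2 : rsum (fun i => c (if (h <=? h + i)%nat then (h + i - h)%nat else (h - (h + i))%nat)) 1 = c 0%nat).
  { simpl. rewrite Nat.add_0_r, Nat.leb_refl, Nat.sub_diag. ring. }
  assert (A3 : rsum (fun i => c (if (h <=? h + (1 + i))%nat then (h + (1 + i) - h)%nat else (h - (h + (1 + i)))%nat)) (H - h - 1) <= rsum (fun j => c (S j)) (H - 1)).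
  { rewrite (rsum_ext _ (fun j => c (S j))) by (intros i Hi; rewrite (proj2 (Nat.leb_le h (h + (1 + i)))) by lia; f_equal; lia).
   apply rsum_mono; auto. lia. }
  lra. }
 assert (HH : 0 < INR H) by (apply lt_0_INR; lia).
 assert (HL : INR H <= INR L) by (apply le_INR; lia).
 (* H S0 = sum_m sum_h u m h, then Cauchy-Schwarz in m *)
 assert (E5 : (INR H*Cmod S0)*(INR H*Cmod S0) <= INR M*(INR H*W)).
 { assert (E : (RtoC (INR H)*S0 = csum (fun m => csum (fun h => u m h) H) M)%C).
  { rewrite csum_comm. rewrite (csum_ext _ (fun _ => S0)) by auto. generalize H. intro n. induction n as [|n IH]; [rewrite INR_0; simpl; ring|]. rewrite S_INR, RtoC_plus. simpl. rewrite <- IH. ring. }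
  assert (E' : INR H*Cmod S0 = Cmod (csum (fun m => csum (fun h => u m h) H) M)) by (rewrite <- E, Cmod_mult, Cmod_R, Rabs_pos_eq; lra).
  rewrite E'. note (Cmod_csum (fun m => csum (fun h => u m h) H) M) as T.
  note (Cmod_ge_0 (csum (fun m => csum (fun h => u m h) H) M)).
  ele; [apply Rmult_le_compat; [auto|auto|exact T|exact T]|].
  ub rsum_Cmod_cs. mul_l; [fin|].
  set (Q := rsum (fun i => Cmod (csum (fun h => u i h) H)*Cmod (csum (fun h => u i h) H)) M).
  assert (HQ : 0 <= Q) by (apply rsum_pos; intros; apply Rmult_le_pos; apply Cmod_ge_0).
  rewrite <- (Rabs_pos_eq Q) by auto. rewrite <- Cmod_R. unfold Q. rewrite RtoC_rsum.
  rewrite (csum_ext _ (fun m => csum (fun h => csum (fun h' => u m h*Cconj (u m h'))%C H) H)).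
  2:{ intros m _. rewrite Cmod_sqr_conj, Cconj_csum.
    rewrite (csum_ext (fun h => csum (fun h' => u m h*Cconj (u m h'))%C H) (fun h => csum (fun i => Cconj (u m i)) H*u m h)%C).
    - rewrite csum_mult. apply Cmult_comm.
    - intros h _. rewrite csum_mult. ceq. }
  rewrite csum_comm. ub Cmod_csum.
  rewrite <- (rsum_const W H). apply rsum_le. intros h Hh.
  rewrite csum_comm. ub Cmod_csum. ele; [|apply (E4 h Hh)].
  apply rsum_le. intros h' Hh'. rewrite <- E3 by auto. lra. }
 assert (c0 : c 0%nat = INR L).
 { unfold c, cc. rewrite (csum_ext _ (fun _ => RtoC 1)).
  - assert (K : forall n, csum (fun _ => RtoC 1) n = RtoC (INR n)) by (induction n as [|n IH]; [fin | rewrite S_INR, RtoC_plus; simpl; rewrite IH; auto]).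
   rewrite K, Cmod_R, Rabs_pos_eq; auto. lra.
  - intros n Hn. rewrite Nat.add_0_r, Hzz1 by auto. rewrite <- Cmod_sqr_conj, ei_mod. ceq. }
 assert (cS : forall j, c (S j) = Cmod (csum (fun n => ei (F (n + S j)%nat - F n)) (L - S j))).
 { intros j. unfold c, cc. f_equal.
  rewrite (csum_extend _ (L - S j) L); [| lia |].
  - apply csum_ext. intros n Hn. rewrite !Hzz1 by lia. rewrite <- ei_opp, <- ei_plus. f_equal. 
  - intros i Hi. rewrite (Hzz (i + S j)%nat) by lia. ring. }
 unfold W in E5. rewrite c0, (rsum_ext _ _ _ (fun j _ => cS j)) in E5.
 set (V := INR L + _) in *.
 assert (HM : INR M <= 2*INR L) by (unfold M; rewrite plus_INR; lra).
 assert (HV : 0 <= V). { unfold V. assert (0 <= rsum (fun j => Cmod (csum (fun n => ei (F (n + S j)%nat - F n)) (L - S j))) (H - 1)) by (apply rsum_pos; intros; apply Cmod_ge_0). lra. }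
 apply (Rmult_le_reg_l (INR H*INR H)); [nra|].
 replace (INR H*INR H*(2*INR L/INR H*V)) with (2*INR L*(INR H*V)) by fld.
 ele; [|mul_r; [nra | exact HM]]. lra.
Qed.

(** The second difference of [ln] about [x], with the sign changed. *)
Definition lnq (x : R) : R := - ln (1 - / (x*x)).

Lemma ln_second_diff x : 0 < x -> ln (x + 2) - 2*ln (x + 1) + ln x = - lnq (x + 1).
Proof.
 intros Hx. unfold lnq.
 replace (1 - / ((x + 1)*(x + 1))) with (((x + 2)*x)*/ ((x + 1)*(x + 1))) by fld.
 rewrite ln_mult, ln_mult, ln_Rinv, ln_mult; try lra; try nra. fin.
Qed.

Lemma lnq_bounds x : 2 <= x -> / (x*x) <= lnq x <= 2*/ (x*x).
Proof.
 intros Hx. unfold lnq. set (y := / (x*x)).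
 assert (Hy : 0 < y <= 1/4). { unfold y. split; [fin|]. replace (1/4) with (/ 4) by field. apply Rinv_le_contravar; nra. }
 split.
 - note (exp_ineq1_le (- y)). assert (ln (1 - y) <= - y); [|lra]. rewrite <- (ln_exp (- y)). apply ln_le; lra.
 - note (exp_ineq1_le (2*y)). assert (- (2*y) <= ln (1 - y)); [|lra].
  rewrite <- (ln_exp (- (2*y))). apply ln_le; [fin|]. rewrite exp_Ropp.
  note (exp_pos (2*y)). apply (Rmult_le_reg_r (exp (2*y))); auto. rewrite Rinv_l by lra. nra.
Qed.

(** The mean value theorem for [lnq], whose derivative is [-2/(u(u^2 - 1))]. It plays the part of
    the third derivative of [ln]. *)
Lemma lnq_diff x j : 2 <= x -> 0 <= j -> 2*j/((x + j)*(x + j)*(x + j)) <= lnq x - lnq (x + j) <= 2*j/((x - 1)*(x - 1)*(x - 1)).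
Proof.
 intros Hx Hj. destruct (Req_dec j 0) as [->|Hj0].
 { rewrite Rplus_0_r. lra. }
 assert (D : forall u, x <= u -> is_derive lnq u (- (2/(u*(u*u - 1))))).
 { intros u Hu. unfold lnq. assert (0 < 1 - / (u*u)). { assert (/ (u*u) <= / 4) by (apply Rinv_le_contravar; nra). lra. }
  auto_derive.
  - fin.
  - field. nra. }
 destruct (MVT_gen lnq x (x + j) (fun u => - (2/(u*(u*u - 1))))) as [xi [H1 H2]].
 - intros u Hu. rewrite Rmin_left in Hu by lra. fin.
 - intros u Hu. rewrite Rmin_left in Hu by lra. apply continuity_pt_filterlim. apply (ex_derive_continuous lnq). exists (- (2/(u*(u*u - 1)))). fin.
 - rewrite Rmin_left, Rmax_right in H1 by lra.
  replace (lnq x - lnq (x + j)) with (2*j/(xi*(xi*xi - 1))).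
  2:{ lra. }
  split; unfold Rdiv; mul_l; try lra; apply Rinv_le_contravar.
  + nra.
  + assert (xi*(xi*xi) <= (x + j)*((x + j)*(x + j))) by (apply Rmult_le_compat; nra). nra.
  + fin.
  + assert ((x - 1)*((x - 1)*(x - 1)) <= xi*(xi*xi - 1)) by (apply Rmult_le_compat; nra). lra.
Qed.

Lemma csum_ei_conj F n : Cmod (csum (fun i => ei (- F i)) n) = Cmod (csum (fun i => ei (F i)) n).
Proof.
 rewrite <- Cmod_conj, Cconj_csum. f_equal. apply csum_ext. intros i _. rewrite <- ei_opp, Ropp_involutive. auto.
Qed.

(** The second derivative test with [lam = t/(4 N^2)] and [h = 8]; conjugation makes the second
    differences positive. *)
Lemma zeta_sum_second t (N L : nat) : (1 <= N)%nat -> (L <= N)%nat -> 0 < t <= 4*(INR N*INR N) ->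
 Cmod (csum (fun n => ei (t*ln (INR (N + n)))) L) <= 76*sqrt t + 114*INR N/sqrt t.
Proof.
 intros HN HL Ht. rewrite <- csum_ei_conj.
 assert (HN1 : 1 <= INR N) by (change 1 with (INR 1); apply le_INR; auto).
 set (lam := t/(4*(INR N*INR N))).
 assert (Hl : 0 < lam <= 1). { unfold lam. split; [fin|]. apply (Rmult_le_reg_r (4*(INR N*INR N))); [nra|]. unfold Rdiv. rewrite Rmult_assoc, Rinv_l; nra. }
 assert (Hs : 0 < sqrt t) by (apply sqrt_lt_R0; lra). assert (Hs2 : sqrt t*sqrt t = t) by (apply sqrt_sqrt; lra).
 ub (second_derivative_test (fun n => - (t*ln (INR (N + n)))) lam 8 L Hl __).
 - intros n Hn. unfold dif.
  replace (INR (N + S (S n))) with (INR (N + n) + 2) by (rewrite !Nat.add_succ_r, !S_INR; ring).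
  replace (INR (N + S n)) with (INR (N + n) + 1) by (rewrite Nat.add_succ_r, S_INR; ring).
  set (x := INR (N + n)). assert (Hx : INR N <= x) by (apply le_INR; lia).
  assert (Hx2 : x + 2 <= 2*INR N). { unfold x. replace 2 with (INR 2) at 1 2 by fin. rewrite <- plus_INR, <- mult_INR. apply le_INR. lia. }
  match goal with |- lam <= ?e <= _ => replace e with (t*lnq (x + 1)) by (replace (lnq (x + 1)) with (- (ln (x + 2) - 2*ln (x + 1) + ln x)) by (rewrite ln_second_diff by lra; ring); ring) end.
  destruct (lnq_bounds (x + 1) __) as [Q1 Q2].
  assert (R1 : / (4*(INR N*INR N)) <= / ((x + 1)*(x + 1))) by (apply Rinv_le_contravar; nra).
  assert (R2 : / ((x + 1)*(x + 1)) <= / (INR N*INR N)) by fin.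
  split.
  + unfold lam, Rdiv. nra.
  + replace (8*lam) with (t*(2*/ (INR N*INR N))) by (unfold lam; field; lra). nra.
 - assert (Es : sqrt lam = sqrt t/(2*INR N)).
  { unfold lam. rewrite sqrt_div by nra. replace (4*(INR N*INR N)) with ((2*INR N)*(2*INR N)) by ring. rewrite sqrt_square by lra. auto. }
  rewrite Es.
  assert (HLN : INR L <= INR N) by (apply le_INR; auto).
  le ((8*lam*INR N + 3)*(19/(sqrt t/(2*INR N)))).
  + fin.
  + right. unfold lam. rewrite <- Hs2 at 1. field; lra.
Qed.

Lemma rsum_inv_sqrt n : rsum (fun j => / sqrt (INR (S j))) n <= 2*sqrt (INR n).
Proof.
 induction n as [|n IH]; [simpl; rewrite INR_0, sqrt_0; lra|]. simpl rsum.
 note (pos_INR n). set (a := sqrt (INR n)) in *.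
 assert (Ha2 : a*a = INR n) by (apply sqrt_sqrt; auto).
 note (INR_S_pos n). set (b := sqrt (INR (S n))) in *. assert (Hb : 0 < b) by (apply sqrt_lt_R0; auto).
 assert (Hb2 : b*b = INR n + 1) by (unfold b; rewrite sqrt_sqrt by lra; apply S_INR).
 assert (/ b <= 2*(b - a)); [|lra]. apply (Rmult_le_reg_l b); auto. rewrite Rinv_r by lra. nra.
Qed.

(** After the Weyl shift by [J] the phase has second differences of order [t*J/N^3], so the second
    derivative test applies to every correlation. The sum over [J] then uses [rsum_inv_sqrt]. *)
Lemma zeta_sum_third_raw t (N L H : nat) : (1 <= H <= L)%nat -> (L <= N)%nat -> 0 < t -> t*INR H <= 4*(INR N*INR N*INR N) ->
 Cmod (csum (fun n => ei (t*ln (INR (N + n)))) L)*Cmod (csum (fun n => ei (t*ln (INR (N + n)))) L)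
 <= 2*(INR N*INR N)/INR H + 304*sqrt (t*INR H*INR N) + 912*(INR N*INR N*sqrt (INR N))/sqrt (t*INR H).
Proof.
 intros HH HL Ht Hcond.
 assert (HN1 : 1 <= INR N) by (change 1 with (INR 1); apply le_INR; lia).
 assert (HH1 : 1 <= INR H) by (change 1 with (INR 1); apply le_INR; lia).
 assert (HLN : INR L <= INR N) by (apply le_INR; auto). note (pos_INR L).
 set (rN := sqrt (INR N)). assert (HrN : 0 < rN) by (apply sqrt_lt_R0; lra). assert (HrN2 : rN*rN = INR N) by (apply sqrt_sqrt; lra).
 set (rt := sqrt t). assert (Hrt : 0 < rt) by (apply sqrt_lt_R0; lra). assert (Hrt2 : rt*rt = t) by (apply sqrt_sqrt; lra).
 set (rH := sqrt (INR H)). assert (HrH : 0 < rH) by (apply sqrt_lt_R0; lra). assert (HrH2 : rH*rH = INR H) by (apply sqrt_sqrt; lra).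
 ub (weyl_vdc (fun n => t*ln (INR (N + n))) L H HH).
 assert (Bj : forall j, (j < H - 1)%nat -> Cmod (csum (fun n => ei (t*ln (INR (N + (n + S j))) - t*ln (INR (N + n)))) (L - S j))
  <= 76*(rt*rH/rN) + 114*(INR N*rN)/rt*/ sqrt (INR (S j))).
 { intros j Hj. set (J := INR (S j)). assert (HJ : 1 <= J) by apply INR_S_ge1.
  assert (HJH : J <= INR H) by (apply le_INR; lia).
  set (rJ := sqrt J). assert (HrJ : 0 < rJ) by (apply sqrt_lt_R0; lra). assert (HrJ2 : rJ*rJ = J) by (apply sqrt_sqrt; lra).
  assert (HrJH : rJ <= rH) by nra.
  set (lam := t*J/(4*(INR N*INR N*INR N))).
  assert (HN3 : 0 < 4*(INR N*INR N*INR N)) by fin.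
  assert (Hl : 0 < lam <= 1). { unfold lam. split; [fin|]. apply (Rmult_le_reg_r (4*(INR N*INR N*INR N))); [nra|]. unfold Rdiv. rewrite Rmult_assoc, Rinv_l by lra. nra. }
  ub (second_derivative_test (fun n => t*ln (INR (N + (n + S j))) - t*ln (INR (N + n))) lam 8 (L - S j) Hl __).
  - intros n Hn. unfold dif.
   replace (INR (N + (S (S n) + S j))) with (INR (N + n) + J + 2) by (unfold J; rewrite !plus_INR, !S_INR; ring).
   replace (INR (N + (S n + S j))) with (INR (N + n) + J + 1) by (unfold J; rewrite !plus_INR, !S_INR; ring).
   replace (INR (N + (n + S j))) with (INR (N + n) + J) by (unfold J; rewrite !plus_INR, !S_INR; ring).
   replace (INR (N + S (S n))) with (INR (N + n) + 2) by (rewrite !plus_INR, !S_INR; ring).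
   replace (INR (N + S n)) with (INR (N + n) + 1) by (rewrite !plus_INR, !S_INR; ring).
   set (x := INR (N + n)). assert (Hx : INR N <= x) by (apply le_INR; lia).
   assert (Hx2 : x + J + 2 <= 2*INR N).
   { unfold x, J. replace 2 with (INR 2) by fin. rewrite <- !plus_INR, <- mult_INR. apply le_INR. lia. }
   match goal with |- lam <= ?e <= _ => replace e with (t*(lnq (x + 1) - lnq (x + 1 + J))) end.
   2:{ replace (lnq (x + 1)) with (- (ln (x + 2) - 2*ln (x + 1) + ln x)) by (rewrite ln_second_diff by lra; ring).
     replace (lnq (x + 1 + J)) with (- (ln (x + J + 2) - 2*ln (x + J + 1) + ln (x + J))) by (rewrite ln_second_diff by lra; replace (x + J + 1) with (x + 1 + J) by ring; ring).
     ring. }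
   destruct (lnq_diff (x + 1) J __ __) as [Q1 Q2].
   assert (C1 : (x + 1 + J)*(x + 1 + J)*(x + 1 + J) <= 8*(INR N*INR N*INR N)).
   { replace (8*(INR N*INR N*INR N)) with ((2*INR N)*(2*INR N)*(2*INR N)) by ring.
    fin. }
   split.
   + unfold lam. replace (t*J/(4*(INR N*INR N*INR N))) with (t*(2*J/(8*(INR N*INR N*INR N)))) by fld.
    mul_l; [lra|]. ele; [|exact Q1]. unfold Rdiv. fin.
   + unfold lam. replace (8*(t*J/(4*(INR N*INR N*INR N)))) with (t*(2*J/(INR N*INR N*INR N))) by fld.
    mul_l; [lra|]. ele; [exact Q2|]. unfold Rdiv. fin.
  - assert (Es : sqrt lam = rt*rJ/(2*(INR N*rN))).
   { apply sqrt_lem_1; [lra | fin |].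
    unfold lam. rewrite <- Hrt2, <- HrJ2. rewrite <- HrN2. field. lra. }
   rewrite Es.
   assert (INR (L - S j) <= INR N) by (apply le_INR; lia).
   le ((8*lam*INR N + 3)*(19/(rt*rJ/(2*(INR N*rN))))).
   + fin.
   + replace ((8*lam*INR N + 3)*(19/(rt*rJ/(2*(INR N*rN))))) with (76*(rt*rJ/rN) + 114*(INR N*rN)/rt*/ rJ).
    * unfold Rdiv. fin.
    * unfold lam. rewrite <- Hrt2, <- HrJ2, <- HrN2. field. lra. }
 assert (SJ : rsum (fun j => Cmod (csum (fun n => ei (t*ln (INR (N + (n + S j))) - t*ln (INR (N + n)))) (L - S j))) (H - 1)
  <= 76*(rt*rH/rN)*INR H + 228*(INR N*rN)/rt*rH).
 { ele; [apply rsum_le; exact Bj|]. rewrite rsum_plus, rsum_const, rsum_mult. apply Rplus_le_compat.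
  - rewrite Rmult_comm. mul_l; [|apply le_INR; lia]. fin.
  - replace (228*(INR N*rN)/rt*rH) with (114*(INR N*rN)/rt*(2*rH)) by lra. apply Rmult_le_compat_l.
   + fin.
   + ub rsum_inv_sqrt. mul_l; [lra|]. apply sqrt_le_1; [fin | lra |]. apply le_INR; lia. }
 set (SS := rsum _ _) in *.
 assert (HSS : 0 <= SS) by (apply rsum_pos; intros; apply Cmod_ge_0).
 assert (E1 : sqrt (t*INR H*INR N) = rt*rH*rN).
 { rewrite !sqrt_mult; try lra; try nra. auto. }
 assert (E2 : sqrt (t*INR H) = rt*rH) by (rewrite sqrt_mult by lra; auto).
 rewrite E1, E2.
 le (2*INR N/INR H*(INR N + 2*(76*(rt*rH/rN)*INR H + 228*(INR N*rN)/rt*rH))).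
 - apply Rmult_le_compat; try lra.
  + fin.
  + mul_r; [fin | lra].
 - right. rewrite <- HrN2, <- HrH2. field. lra.
Qed.

Lemma zeta_sum_third v t (N L : nat) : 1 <= v -> v <= INR N <= v*v -> v*v*v <= t <= 2*(v*v*v) -> (L <= N)%nat ->
 Cmod (csum (fun n => ei (t*ln (INR (N + n)))) L)*Cmod (csum (fun n => ei (t*ln (INR (N + n)))) L) <= 3000*(INR N*v).
Proof.
 intros Hv HN Ht HL.
 assert (Hx1 : 1 <= INR N/v) by (apply (Rmult_le_reg_r v); [lra|]; unfold Rdiv; rewrite Rmult_assoc, Rinv_l; lra).
 (* For [t] of order [v^3] the terms [N^2/H] and [sqrt (t*H*N)] balance at [H = N/v], where both are
    of order [N*v]. *)
 destruct (nfloor_ex (INR N/v) __) as [H [F1 F2]].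
 assert (HH : (1 <= H)%nat) by (destruct H; [rewrite INR_0 in F2; lra | lia]).
 assert (HH1 : 1 <= INR H) by (change 1 with (INR 1); apply le_INR; lia).
 assert (F1' : INR H*v <= INR N). { apply (Rmult_le_compat_r v) in F1; [|lra]. unfold Rdiv in F1. rewrite Rmult_assoc, Rinv_l in F1; lra. }
 assert (F2' : INR N <= 2*(INR H*v)). { assert (INR N/v <= 2*INR H) by lra. apply (Rmult_le_compat_r v) in H0; [|lra]. unfold Rdiv in H0. rewrite Rmult_assoc, Rinv_l in H0; lra. }
 destruct (le_lt_dec H L) as [HLH|HLH].
 - assert (v3 : 0 < v*v*v) by fin.
  ele; [apply (zeta_sum_third_raw t N L H); auto; try lra|].
  +
   assert (v*v*INR N <= INR N*INR N*INR N) by fin. nra.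
  + assert (B1 : 2*(INR N*INR N)/INR H <= 4*(INR N*v)).
   { apply (Rmult_le_reg_r (INR H)); [lra|]. unfold Rdiv. rewrite Rmult_assoc, Rinv_l by lra. nra. }
   assert (B2 : sqrt (t*INR H*INR N) <= 2*(INR N*v)).
   { rewrite <- (sqrt_square (2*(INR N*v))) by nra. apply sqrt_le_1_alt.
    le (2*(v*v*v)*INR H*INR N); [fin|].
    nra. }
   assert (B3 : (INR N*INR N*sqrt (INR N))/sqrt (t*INR H) <= 2*(INR N*v)).
   { assert (P : 0 < t*INR H) by nra.
    assert (Q : v*sqrt (INR N) <= 2*sqrt (t*INR H)).
    { rewrite <- (sqrt_square v), <- (sqrt_square 2) by lra. rewrite <- !sqrt_mult by nra. apply sqrt_le_1_alt.
     nra. }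
    assert (S : 0 < sqrt (t*INR H)) by (apply sqrt_lt_R0; auto).
    apply (Rmult_le_reg_r (sqrt (t*INR H))); auto. unfold Rdiv. rewrite Rmult_assoc, Rinv_l, Rmult_1_r by lra.
    note (sqrt_pos (INR N)).
    le (INR N*(v*v)*sqrt (INR N)); [fin|].
    assert (INR N*v*(v*sqrt (INR N)) <= INR N*v*(2*sqrt (t*INR H))) by fin. nra. }
   nra.
 (* A sum shorter than [H] is bounded by its length: [L*v <= N] and [N <= v*v] suffice. *)
 - assert (HLl : INR L <= INR H) by (apply le_INR; lia).
  note (csum_ei_trivial (fun n => t*ln (INR (N + n))) L) as T.
  note (Cmod_ge_0 (csum (fun n => ei (t*ln (INR (N + n)))) L)).
  nra.
Qed.

(** * A mean value inequality for exponential sums *)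

Fixpoint lsum {A : Type} (f : A -> C) (l : list A) : C :=
 match l with nil => RtoC 0 | cons x l => (f x + lsum f l)%C end.
Fixpoint lsr {A : Type} (f : A -> R) (l : list A) : R :=
 match l with nil => 0 | cons x l => f x + lsr f l end.

Section Lsum.
Context {A : Type}.

Lemma lsum_ext (f g : A -> C) l : (forall x, In x l -> f x = g x) -> lsum f l = lsum g l.
Proof. induction l as [|x l IH]; simpl; intros H; [auto|]. rewrite H, IH by auto. auto. Qed.
Lemma lsr_ext (f g : A -> R) l : (forall x, In x l -> f x = g x) -> lsr f l = lsr g l.
Proof. induction l as [|x l IH]; simpl; intros H; [auto|]. rewrite H, IH by auto. auto. Qed.
Lemma lsum_mult c (f : A -> C) l : lsum (fun x => c*f x)%C l = (c*lsum f l)%C.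
Proof. induction l as [|x l IH]; simpl; [ring | rewrite IH; ring]. Qed.
Lemma lsr_mult c (f : A -> R) l : lsr (fun x => c*f x) l = c*lsr f l.
Proof. induction l as [|x l IH]; simpl; [ring | lra]. Qed.
Lemma lsum_plus (f g : A -> C) l : lsum (fun x => f x + g x)%C l = (lsum f l + lsum g l)%C.
Proof. induction l as [|x l IH]; simpl; [ring | rewrite IH; ring]. Qed.
Lemma lsr_plus (f g : A -> R) l : lsr (fun x => f x + g x) l = lsr f l + lsr g l.
Proof. induction l as [|x l IH]; simpl; [ring | lra]. Qed.
Lemma lsr_le (f g : A -> R) l : (forall x, In x l -> f x <= g x) -> lsr f l <= lsr g l.
Proof. induction l as [|x l IH]; simpl; intros H; [lra|]. fin. Qed.
Lemma Cmod_lsum (f : A -> C) l : Cmod (lsum f l) <= lsr (fun x => Cmod (f x)) l.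
Proof. induction l as [|x l IH]; simpl; [rewrite Cmod_0; lra|]. ele; [apply Cmod_triangle | lra]. Qed.
Lemma lsum_app (f : A -> C) l l' : lsum f (l ++ l') = (lsum f l + lsum f l')%C.
Proof. induction l as [|x l IH]; simpl; [ring | rewrite IH; ring]. Qed.
Lemma lsr_app (f : A -> R) l l' : lsr f (l ++ l') = lsr f l + lsr f l'.
Proof. induction l as [|x l IH]; simpl; [ring | lra]. Qed.
Lemma Cconj_lsum (f : A -> C) l : Cconj (lsum f l) = lsum (fun x => Cconj (f x)) l.
Proof. induction l as [|x l IH]; simpl; [ceq | rewrite <- IH; apply C_eq; simpl; ring]. Qed.
Lemma RtoC_lsr (f : A -> R) l : RtoC (lsr f l) = lsum (fun x => RtoC (f x)) l.
Proof. induction l as [|x l IH]; simpl; [auto | rewrite RtoC_plus, IH; auto]. Qed.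
Lemma lsr_const c (l : list A) : lsr (fun _ => c) l = INR (length l)*c.
Proof. induction l as [|x l IH]; [simpl; rewrite INR_0; ring | cbn [length]; rewrite S_INR; simpl; rewrite IH; ring]. Qed.

Lemma cont_lsum {B} (d : B -> B -> R) (f : A -> B -> C) l b : (forall x, In x l -> cont_at d (f x) b) ->
 cont_at d (fun b => lsum (fun x => f x b) l) b.
Proof. induction l as [|x l IH]; simpl; intros H; [fin | fin]. Qed.

Lemma CI_lsum (f : A -> R -> C) l a b : a <= b -> (forall x, In x l -> contI (f x) a b) ->
 CI (fun t => lsum (fun x => f x t) l) a b = lsum (fun x => CI (f x) a b) l.
Proof.
 intros Hab. induction l as [|x l IH]; simpl; intros H.
 - rewrite CI_const. ring.
 - rewrite CI_plus; auto; [rewrite IH; auto|].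
  intros t Ht. apply cont_lsum. intros y Hy. apply H; auto.
Qed.

End Lsum.

Lemma lsr_swap {A B} (f : A -> B -> R) l l' : lsr (fun x => lsr (fun y => f x y) l') l = lsr (fun y => lsr (fun x => f x y) l) l'.
Proof.
 induction l as [|x l IH]; simpl.
 - induction l' as [|y l' IH]; simpl; [auto | lra].
 - rewrite IH, <- lsr_plus. auto.
Qed.


Lemma CI_RtoC (f : R -> R) a b : a <= b -> contI (fun t => RtoC (f t)) a b -> CI (fun t => RtoC (f t)) a b = RtoC (RInt f a b).
Proof.
 intros Hab H. apply CI_unique. apply is_RInt_Re_Im.
 note (CI_correct _ _ _ Hab H) as K. apply is_RInt_Re_Im in K. destruct K as [K1 K2]. split.
 - apply (RInt_correct (V := RC)). eexists; exact K1.
 - note (@is_RInt_const RN a b 0) as K0.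
  rewrite Rmult_0_r in K0. fin.
Qed.

Lemma ei_0 : ei 0 = RtoC 1.
Proof. unfold ei. replace (Ci*0)%C with (RtoC 0) by ring. apply Cexp_0. Qed.

Lemma rder_ei u v : rder (fun v => ei (u*v)) v (Ci*RtoC u*ei (u*v))%C.
Proof.
 unfold ei.
 note (rder_comp (fun w => (Ci*RtoC (u*w))%C) Cexp v _ _
  (rder_mult _ _ v _ _ (rder_const Ci v) (rder_of_real (fun w => u*w) v u ltac:(auto_derive; auto; ring))) (cder_Cexp _)) as K. eapply (fun e => eq_ind _ (rder _ v) K _ e). ring.
Qed.

Lemma cont_ei u v : cont_at dR (fun v => ei (u*v)) v.
Proof. eapply rder_cont, rder_ei. Qed.

Lemma fejer_half L u : 0 < L -> u <> 0 ->
 CI (fun v => RtoC (1 - v/(2*L))*ei (u*v))%C 0 (2*L)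
 = (Ci/RtoC u - (ei (u*(2*L)) - 1)/RtoC (2*L*(u*u)))%C.
Proof.
 intros HL Hu.
 assert (Hcr : forall v, cont_at dR (fun v => RtoC (1 - v/(2*L))) v).
 { intro v. apply (contR_continuous (fun v => 1 - v/(2*L))). apply (ex_derive_continuous (fun v => 1 - v/(2*L))). auto_derive; lra. }
 rewrite (CI_FTC (fun v => RtoC (1 - v/(2*L))*(- Ci/RtoC u*ei (u*v)) + (- / RtoC (2*L*(u*u)))*ei (u*v))%C).
 - replace (1 - 2*L/(2*L)) with 0 by fld. replace (1 - 0/(2*L)) with 1 by fld.
  rewrite (Rmult_0_r u), ei_0. field. split; apply RtoC_neq0; auto. repeat (apply Rmult_integral_contrapositive_currified; try lra).
 - lra.
 - intros v _.
  note (rder_plus _ _ v _ _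
   (rder_mult _ _ v _ _ (rder_of_real (fun v => 1 - v/(2*L)) v (- / (2*L)) ltac:(auto_derive; [lra | lra]))
    (rder_mult _ _ v _ _ (rder_const (- Ci/RtoC u)%C v) (rder_ei u v)))
   (rder_mult _ _ v _ _ (rder_const (- / RtoC (2*L*(u*u)))%C v) (rder_ei u v))) as K. eapply (fun e => eq_ind _ (rder _ v) K _ e).
  set (w := RtoC (1 - v/(2*L))).
  assert (Hu' : RtoC u <> RtoC 0) by fin. assert (HL' : RtoC L <> RtoC 0) by fin.
  rewrite RtoC_opp, RtoC_inv, !RtoC_mult by lra.
  transitivity (- (Ci*Ci)*w*ei (u*v))%C; [field; auto | ceq].
 - intros v _. apply cont_mult; auto. apply cont_ei.
Qed.

(** The Fourier transform at [u] of the triangular weight on [[-2L, 2L]], folded onto positive [v];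
    up to scaling this is the Fejer kernel. *)
Definition fejer L u : C := CI (fun v => RtoC (1 - v/(2*L))*(ei (u*v) + ei (- u*v)))%C 0 (2*L).

(** The trivial bound [2*L] and the bound [2/(L*u^2)] from the explicit integral are merged into one
    Lorentzian. *)
Lemma fejer_bound L u : 0 < L -> Cmod (fejer L u) <= 4*L/(1 + (L*u)*(L*u)).
Proof.
 intros HL.
 assert (Hcr : forall v, cont_at dR (fun v => RtoC (1 - v/(2*L))) v).
 { intro v. apply (contR_continuous (fun v => 1 - v/(2*L))). apply (ex_derive_continuous (fun v => 1 - v/(2*L))). auto_derive; lra. }
 assert (Htriv : Cmod (fejer L u) <= 2*L).
 { unfold fejer. ub (CI_le _ (fun v => 2*(1 - v/(2*L)))).
  - lra.
  - intros v _. apply cont_mult; auto. apply cont_plus; apply cont_ei.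
  - apply (ex_RInt_continuous (V := RC)). intros v _. apply (ex_derive_continuous (fun v => 2*(1 - v/(2*L)))). auto_derive; lra.
  - intros v Hv. rewrite Cmod_mult, Cmod_R, Rabs_pos_eq.
   + rewrite Rmult_comm. apply Rmult_le_compat_r.
    * assert (v/(2*L) <= 1); [|lra]. apply (Rmult_le_reg_r (2*L)); [lra|]. unfold Rdiv. rewrite Rmult_assoc, Rinv_l; lra.
    * ub Cmod_triangle. rewrite !ei_mod. lra.
   + assert (v/(2*L) <= 1); [|lra]. apply (Rmult_le_reg_r (2*L)); [lra|]. unfold Rdiv. rewrite Rmult_assoc, Rinv_l; lra.
  - right. apply is_RInt_unique.
   assert (K : is_RInt (fun v => 2*(1 - v/(2*L))) 0 (2*L) (minus (2*(2*L) - (2*L)*(2*L)/(2*L)) (2*0 - 0*0/(2*L)))).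
   { apply (is_RInt_derive (fun v => 2*v - v*v/(2*L))).
    + intros v _. auto_derive; [lra | lra].
    + intros v _. apply (ex_derive_continuous (fun v => 2*(1 - v/(2*L)))). auto_derive; lra. }
   match type of K with is_RInt _ _ _ ?x => replace x with (2*L) in K by (unfold minus, plus, opp; simpl; field; lra) end. exact K. }
 assert (Hden : 0 < 1 + L*u*(L*u)) by nra.
 apply (Rmult_le_reg_r (1 + L*u*(L*u))); auto. unfold Rdiv. rewrite (Rmult_assoc (4*L)), Rinv_l, Rmult_1_r by lra.
 destruct (Req_dec u 0) as [->|Hu]; [lra|].
 assert (Hu2 : 0 < u*u) by nra.
 assert (B : Cmod (fejer L u) <= 2/(L*(u*u))).
 { unfold fejer.
  rewrite (CI_ext _ (fun v => RtoC (1 - v/(2*L))*ei (u*v) + RtoC (1 - v/(2*L))*ei (- u*v))%C) by (try lra; intros; ring).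
  rewrite CI_plus; [|lra| |]; try (intros v _; apply cont_mult; auto; apply cont_ei).
  rewrite !fejer_half by lra.
  replace (2*L*(- u*- u)) with (2*L*(u*u)) by ring.
  assert (Hu' : RtoC u <> RtoC 0) by fin.
  assert (Hd : RtoC (2*L*(u*u)) <> RtoC 0) by fin.
  replace (Ci/RtoC u - (ei (u*(2*L)) - 1)/RtoC (2*L*(u*u)) + (Ci/RtoC (- u) - (ei (- u*(2*L)) - 1)/RtoC (2*L*(u*u))))%C
   with (- ((ei (u*(2*L)) - 1) + (ei (- u*(2*L)) - 1))/RtoC (2*L*(u*u)))%C by (rewrite RtoC_opp; field; auto).
  rewrite Cmod_div, Cmod_opp, Cmod_R, Rabs_pos_eq by fin.
  replace (2/(L*(u*u))) with (4/(2*L*(u*u))) by fld.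
  mul_r; [fin|].
  ub Cmod_triangle.
  note (Cmod_sub_triangle (ei (u*(2*L))) 1). note (Cmod_sub_triangle (ei (- u*(2*L))) 1).
  rewrite !ei_mod, Cmod_1 in *. lra. }
 assert (L*L*(u*u)*Cmod (fejer L u) <= 2*L); [|lra].
 replace (2*L) with (L*L*(u*u)*(2/(L*(u*u)))) by fld. nra.
Qed.

Definition wave {A} (a : A -> C) (lam : A -> R) (l : list A) (v : R) : C := lsum (fun x => a x*ei (lam x*v))%C l.

Lemma cont_wave {A} (a : A -> C) lam l v : cont_at dR (wave a lam l) v.
Proof. apply (cont_lsum dR (fun x v => a x*ei (lam x*v))%C). intros x _. apply cont_mult; [fin | apply cont_ei]. Qed.

Lemma cont_opp_arg (f : R -> C) v : cont_at dR f (- v) -> cont_at dR (fun v => f (- v)) v.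
Proof.
 intros H e He. destruct (H e He) as [d [H1 K]]. exists d; split; auto. intros y Hy. apply K. unfold dR in *.
 rewrite <- Rabs_Ropp. replace (- (- y - - v)) with (y - v) by ring. auto.
Qed.

Lemma contR_mult (f g : R -> R) v : cont_at dR (fun v => RtoC (f v)) v -> cont_at dR (fun v => RtoC (g v)) v -> cont_at dR (fun v => RtoC (f v*g v)) v.
Proof.
 intros. apply cont_ext_loc with (f := fun v => (RtoC (f v)*RtoC (g v))%C).
 - unfold dR. rewrite Rminus_diag. apply Rabs_R0.
 - exists 1; split; [lra|]. intros y _. rewrite RtoC_mult. auto.
 - fin.
Qed.

Lemma contR_plus (f g : R -> R) v : cont_at dR (fun v => RtoC (f v)) v -> cont_at dR (fun v => RtoC (g v)) v -> cont_at dR (fun v => RtoC (f v + g v)) v.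
Proof.
 intros. apply cont_ext_loc with (f := fun v => (RtoC (f v) + RtoC (g v))%C).
 - unfold dR. rewrite Rminus_diag. apply Rabs_R0.
 - exists 1; split; [lra|]. intros y _. rewrite RtoC_plus. auto.
 - fin.
Qed.

Lemma contR_ex_RInt (f : R -> R) a b : a <= b -> contI (fun v => RtoC (f v)) a b -> ex_RInt f a b.
Proof.
 intros Hab H. apply (ex_RInt_continuous (V := RC)). rewrite Rmin_left, Rmax_right by auto.
 intros z Hz. apply contR_continuous, H, Hz.
Qed.

#[export] Hint Resolve cont_ei cont_wave contR_mult contR_plus contR_ex_RInt cont_lsum cont_opp_arg : an.

(** The triangular weight is at least 1/2 on [[-L, L]]. Expanding the weighted square gives a form
    in the coefficients with Fejer kernel entries, and a symmetric kernel is controlled by its row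
    sums. *)
Lemma mean_value {A} (a : A -> C) (lam : A -> R) (l : list A) L B : 0 < L ->
 (forall x, In x l -> lsr (fun y => 4*L/(1 + (L*(lam x - lam y))*(L*(lam x - lam y)))) l <= B) ->
 RInt (fun v => Cmod (wave a lam l v)*Cmod (wave a lam l v)) (- L) L <= 2*B*lsr (fun x => Cmod (a x)*Cmod (a x)) l.
Proof.
 intros HL HB. set (W := wave a lam l). set (m := fun v => Cmod (W v)*Cmod (W v)).
 assert (Cm : forall v, cont_at dR (fun v => RtoC (m v)) v) by (intro v; apply contR_mult; apply cont_Cmod, cont_wave).
 assert (Cm' : forall v, cont_at dR (fun v => RtoC (m (- v))) v) by (intro v; apply (cont_opp_arg (fun v => RtoC (m v))), Cm).
 set (w := fun v => 1 - v/(2*L)).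
 assert (Cw : forall v, cont_at dR (fun v => RtoC (w v)) v).
 { intro v. apply (contR_continuous w). apply (ex_derive_continuous w). unfold w. auto_derive; lra. }
 set (Q := RInt (fun v => w v*(m v + m (- v))) 0 (2*L)).
 assert (CQ : forall v, cont_at dR (fun v => RtoC (w v*(m v + m (- v)))) v) by fin.
 assert (mpos : forall v, 0 <= m v) by (intro; unfold m; apply Rmult_le_pos; apply Cmod_ge_0).
 assert (wpos : forall v, 0 <= v <= 2*L -> 0 <= w v).
 { intros v Hv. unfold w. assert (v/(2*L) <= 1); [|lra]. apply (Rmult_le_reg_r (2*L)); [lra|]. unfold Rdiv. rewrite Rmult_assoc, Rinv_l; lra. }
 assert (S1 : RInt m (- L) L <= 2*Q).
 { assert (E : forall x y, x <= y -> ex_RInt m x y) by fin.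
  rewrite <- (RInt_Chasles (V := RC) m (- L) 0 L) by fin.
  assert (E0 : RInt m (- L) 0 = RInt (fun v => m (- v)) 0 L).
  { symmetry. apply is_RInt_unique.
   assert (K : is_RInt m (- 0) (- L) (opp (RInt m (- L) 0))).
   { rewrite Ropp_0. apply (is_RInt_swap (V := RN)). apply (RInt_correct (V := RC)). fin. }
   apply is_RInt_comp_opp in K. apply is_RInt_opp in K. rewrite opp_opp in K.
   eapply is_RInt_ext; [|exact K]. intros x _. unfold opp; simpl. ring. }
  rewrite E0. unfold plus; simpl.
  assert (X1 : ex_RInt (fun v => m (- v)) 0 L) by fin.
  replace (RInt (fun v => m (- v)) 0 L + RInt m 0 L) with (RInt (fun v => m (- v) + m v) 0 L)
   by (apply (RInt_plus (V := RC)); auto; apply E; lra).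
  assert (XQ : forall x y, x <= y -> ex_RInt (fun v => w v*(m v + m (- v))) x y) by fin.
  unfold Q. rewrite <- (RInt_Chasles (V := RC) _ 0 L (2*L)) by fin. unfold plus; simpl.
  assert (0 <= RInt (fun v => w v*(m v + m (- v))) L (2*L)).
  { apply RInt_ge_0; [lra | fin |]. fin. }
  assert (RInt (fun v => m (- v) + m v) 0 L <= 2*RInt (fun v => w v*(m v + m (- v))) 0 L); [|lra].
  replace (2*RInt (fun v => w v*(m v + m (- v))) 0 L) with (RInt (fun v => 2*(w v*(m v + m (- v)))) 0 L)
   by (apply (RInt_scal (V := RC)); apply XQ; lra).
  apply RInt_le; [lra | fin | fin |].
  intros x Hx. note (mpos x). note (mpos (- x)).
  assert (1/2 <= w x). { unfold w. assert (x/(2*L) <= 1/2); [|lra]. apply (Rmult_le_reg_r (2*L)); [lra|]. unfold Rdiv. rewrite Rmult_assoc, Rinv_l; lra. }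
  nra. }
 assert (S2 : Q <= B*lsr (fun x => Cmod (a x)*Cmod (a x)) l).
 { assert (EQ : RtoC Q = lsum (fun x => lsum (fun y => (a x*Cconj (a y))*fejer L (lam x - lam y)) l)%C l).
  { unfold Q. rewrite <- CI_RtoC by (try lra; intros v _; apply CQ).
   assert (Em : forall v, RtoC (m v) = lsum (fun x => lsum (fun y => (a x*Cconj (a y))*ei ((lam x - lam y)*v)) l)%C l).
   { intros v. unfold m. rewrite Cmod_sqr_conj. unfold W, wave. rewrite Cconj_lsum.
    rewrite Cmult_comm, <- lsum_mult. apply lsum_ext. intros x _.
    rewrite Cmult_comm, <- lsum_mult. apply lsum_ext. intros y _.
    replace ((lam x - lam y)*v) with (lam x*v + - (lam y*v)) by ring. rewrite ei_plus, ei_opp.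
    ceq. }
   rewrite (CI_ext _ (fun v => lsum (fun x => lsum (fun y => (a x*Cconj (a y))*(RtoC (w v)*(ei ((lam x - lam y)*v) + ei (- (lam x - lam y)*v)))) l) l)%C); [|lra|].
   2:{ intros v _. rewrite RtoC_mult, RtoC_plus, !Em, <- lsum_plus, <- lsum_mult. apply lsum_ext. intros x _.
     rewrite <- lsum_plus, <- lsum_mult. apply lsum_ext. intros y _.
     replace ((lam x - lam y)*- v) with (- (lam x - lam y)*v) by ring. ring. }
   assert (Ck : forall x y v, cont_at dR (fun v => (a x*Cconj (a y))*(RtoC (w v)*(ei ((lam x - lam y)*v) + ei (- (lam x - lam y)*v))))%C v).
   { fin. }
   rewrite CI_lsum; [|lra|fin].
   apply lsum_ext. intros x _. rewrite CI_lsum; [|lra|fin]. apply lsum_ext. intros y _.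
   rewrite CI_cmult; [fin | lra |]. fin. }
  set (kk := fun x y => 4*L/(1 + L*(lam x - lam y)*(L*(lam x - lam y)))).
  assert (kpos : forall x y, 0 <= kk x y).
  { intros. unfold kk. note (Rle_0_sqr (L*(lam x - lam y))). fin. }
  assert (ksym : forall x y, kk x y = kk y x) by (intros; unfold kk; do 2 f_equal; ring).
  le (Cmod (RtoC Q)); [rewrite Cmod_R; apply Rle_abs|]. rewrite EQ.
  ub Cmod_lsum.
  (* The product of two coefficients is replaced by the mean of their squares; by symmetry both
     halves reduce to row sums. *)
  le (lsr (fun x => lsr (fun y => (Cmod (a x)*Cmod (a x))/2*kk x y + (Cmod (a y)*Cmod (a y))/2*kk y x) l) l).
  { apply lsr_le. intros x _. ub Cmod_lsum. apply lsr_le. intros y _.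
   rewrite !Cmod_mult, Cmod_conj. note (fejer_bound L (lam x - lam y) HL) as Fb.
   rewrite (ksym y x).
   le (Cmod (a x)*Cmod (a y)*kk x y); [fin|].
   assert (Cmod (a x)*Cmod (a y) <= (Cmod (a x)*Cmod (a x))/2 + (Cmod (a y)*Cmod (a y))/2) by (note (Rle_0_sqr (Cmod (a x) - Cmod (a y))); unfold Rsqr in *; lra).
   specialize (kpos x y). nra. }
  rewrite (lsr_ext _ (fun x => lsr (fun y => (Cmod (a x)*Cmod (a x))/2*kk x y) l + lsr (fun y => (Cmod (a y)*Cmod (a y))/2*kk y x) l)) by (intros; apply lsr_plus).
  rewrite lsr_plus. rewrite (lsr_swap (fun x y => Cmod (a y)*Cmod (a y)/2*kk y x)).
  assert (Half : lsr (fun x => lsr (fun y => Cmod (a x)*Cmod (a x)/2*kk x y) l) l <= B/2*lsr (fun x => Cmod (a x)*Cmod (a x)) l).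
  { rewrite <- lsr_mult. apply lsr_le. intros x Hx. rewrite lsr_mult. specialize (HB x Hx). fold (kk x) in HB.
   nra. }
  lra. }
 lra.
Qed.

(** * The divisor bound *)

Definition divs (n : nat) : list nat := filter (fun d => Nat.eqb (n mod d) 0) (seq 1 n).
Definition tau (n : nat) : nat := length (divs n).

Lemma in_divs n d : (1 <= n)%nat -> In d (divs n) <-> Nat.divide d n.
Proof.
 intros Hn. unfold divs. rewrite filter_In, in_seq, Nat.eqb_eq. split.
 - intros [H1 H2]. apply Nat.mod_divide; [lia | auto].
 - intros H. assert (d <> 0%nat) by (intro E; subst; destruct H as [q Hq]; lia). split.
  + apply Nat.divide_pos_le in H; lia.
  + apply Nat.mod_divide; auto.
Qed.

Lemma NoDup_divs n : NoDup (divs n).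
Proof. apply NoDup_filter, seq_NoDup. Qed.

Definition nprime (p : nat) : Prop := (2 <= p)%nat /\ forall d, Nat.divide d p -> d = 1%nat \/ d = p.

(** A divisor is either coprime to [p], and then Gauss's lemma removes one factor [p] from the
    multiple, or it has a factor [p] that can be split off. *)
Lemma divisor_prime_power p a m d : nprime p -> Nat.divide d (p^a*m) ->
 exists i e, (i <= a)%nat /\ Nat.divide e m /\ d = (p^i*e)%nat.
Proof.
 intros [Hp1 Hp2]. revert d. induction a as [|a IH]; intros d Hd.
 - exists 0%nat, d. simpl in Hd. rewrite Nat.add_0_r in Hd. simpl. repeat split; auto; lia.
 - destruct (Hp2 (Nat.gcd d p) (Nat.gcd_divide_r d p)) as [E|E].
  + replace (p^S a*m)%nat with (p*(p^a*m))%nat in Hd by (simpl; ring).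
   destruct (IH d (Nat.gauss d p (p^a*m) Hd E)) as [i [e [H1 [H2 H3]]]]. exists i, e. fin.
  + assert (Hpd : Nat.divide p d) by (rewrite <- E; apply Nat.gcd_divide_l).
   destruct Hpd as [d' Ed]. subst d.
   assert (Hd' : Nat.divide d' (p^a*m)).
   { destruct Hd as [q Hq]. exists q. simpl in Hq. nia. }
   destruct (IH d' Hd') as [i [e [H1 [H2 H3]]]]. exists (S i), e. repeat split; auto; [lia|]. subst d'. simpl. ring.
Qed.

Lemma flat_map_length_const {A B} (f : A -> list B) l k : (forall x, length (f x) = k) -> length (flat_map f l) = (length l*k)%nat.
Proof. intros H. induction l as [|x l IH]; simpl; [auto|]. rewrite length_app, H, IH. auto. Qed.

Lemma tau_prime_power p a m : nprime p -> (1 <= m)%nat -> (tau (p^a*m) <= (a + 1)*tau m)%nat.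
Proof.
 intros Hp Hm.
 assert (Hn : (1 <= p^a*m)%nat) by (destruct Hp; assert (p^a <> 0)%nat by (apply Nat.pow_nonzero; lia); nia). replace (a + 1)%nat with (length (seq 0 (a + 1))) by apply length_seq.
 rewrite <- (flat_map_length_const (fun i => map (fun e => p^i*e)%nat (divs m))) by (intros; apply length_map).
 apply NoDup_incl_length; [apply NoDup_divs|]. intros d Hd. apply in_divs in Hd; auto.
 destruct (divisor_prime_power p a m d Hp Hd) as [i [e [H1 [H2 H3]]]].
 apply in_flat_map. exists i. split; [apply in_seq; lia|]. apply in_map_iff. exists e. split; auto. apply in_divs; auto.
Qed.

Lemma split_prime_power p n : (2 <= p)%nat -> (1 <= n)%nat -> exists a m, n = (p^a*m)%nat /\ ~ Nat.divide p m /\ (1 <= m)%nat.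
Proof.
 intros Hp. induction n as [n IH] using lt_wf_ind. intros Hn.
 destruct (em (Nat.divide p n)) as [[q Hq]|H].
 - destruct (IH q) as [a [m [E [H1 H2]]]]; [nia | nia |]. exists (S a), m. repeat split; auto. subst. simpl. ring.
 - exists 0%nat, n. repeat split; auto. simpl. lia.
Qed.

Definition rough (q n : nat) : Prop := forall d, (2 <= d)%nat -> Nat.divide d n -> (q <= d)%nat.

Lemma least_divisor n : (2 <= n)%nat -> exists p, (2 <= p)%nat /\ Nat.divide p n /\ rough p n.
Proof.
 intros Hn. destruct (dec_inh_nat_subset_has_unique_least_element (fun p => (2 <= p)%nat /\ Nat.divide p n)) as [p [[[H1 H2] H3] _]].
 - intros k. destruct (em ((2 <= k)%nat /\ Nat.divide k n)); auto.
 - exists n. split; auto. apply Nat.divide_refl.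
 - exists p. repeat split; auto. intros d Hd Hdn. fin.
Qed.

Lemma rough_prime p n : (2 <= p)%nat -> rough p n -> Nat.divide p n -> nprime p.
Proof.
 intros Hp Hr Hd. split; auto. intros d Hdp. destruct (le_lt_dec 2 d).
 - assert (p <= d)%nat by (apply Hr; auto; eapply Nat.divide_trans; eauto).
  apply Nat.divide_pos_le in Hdp; lia.
 - destruct Hdp as [q Hq]. destruct d as [|[|d]]; [lia | auto | lia].
Qed.

Lemma rough_divide q n m : rough q n -> Nat.divide m n -> rough q m.
Proof. intros H Hm d H1 H2. apply H; auto. eapply Nat.divide_trans; eauto. Qed.

(** For primes [p >= 2^K] one has [(a + 1)^K <= 2^(a*K) <= p^a], so such primes cost no constant. *)
Lemma tau_rough K P n : (2^K <= P)%nat -> rough P n -> (1 <= n)%nat -> (tau n^K <= n)%nat.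
Proof.
 intros HP. induction n as [n IH] using lt_wf_ind. intros Hr Hn.
 destruct (Nat.eq_dec n 1) as [->|]; [unfold tau, divs; simpl; rewrite Nat.pow_1_l; auto|].
 destruct (least_divisor n ltac:(lia)) as [p [H1 [H2 H3]]].
 note (rough_prime p n H1 H3 H2) as Hp.
 destruct (split_prime_power p n H1 Hn) as [a [m [E [H4 H5]]]].
 assert (Ha : (1 <= a)%nat). { destruct a; [|lia]. exfalso. simpl in E. rewrite Nat.add_0_r in E. subst; auto. }
 assert (Hpa : (2 <= p^a)%nat). { destruct a; [lia|]. simpl. assert (p^a <> 0)%nat by (apply Nat.pow_nonzero; lia). nia. }
 assert (IHm : (tau m^K <= m)%nat).
 { apply IH; [nia | | auto]. apply (rough_divide P n); auto. exists (p^a)%nat. auto. }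
 assert (Hpp : (P <= p)%nat) by fin.
 rewrite E. eapply Nat.le_trans; [apply Nat.pow_le_mono_l, tau_prime_power; auto|].
 rewrite Nat.pow_mul_l. apply Nat.mul_le_mono; auto.
 assert (Q : (a + 1 <= 2^a)%nat). { clear. induction a as [|a IH]; simpl; [lia|]. fin. }
 eapply Nat.le_trans; [apply Nat.pow_le_mono_l, Q|]. rewrite <- Nat.pow_mul_r, Nat.mul_comm, Nat.pow_mul_r.
 apply Nat.pow_le_mono_l. lia.
Qed.

(** From [1 + x <= exp x] at [x = a/(2*K)], together with [exp (1/2) <= 2]. *)
Lemma pow_exp_bound (K a : nat) : (1 <= K)%nat -> INR (a + 1)^K <= (2*INR K)^K*2^a.
Proof.
 intros HK. assert (HK1 : 1 <= INR K) by (change 1 with (INR 1); apply le_INR; auto).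
 assert (H1 : INR (a + 1) <= 2*INR K*exp (INR a/(2*INR K))).
 { note (exp_ineq1_le (INR a/(2*INR K))). rewrite plus_INR, INR_1.
  le (2*INR K*(1 + INR a/(2*INR K))); [|nra].
  replace (2*INR K*(1 + INR a/(2*INR K))) with (2*INR K + INR a) by fld. lra. }
 ele; [apply pow_incr; split; [fin | exact H1]|]. rewrite Rpow_mult_distr.
 mul_l; [fin|].
 assert (E : forall (x : R) (n : nat), exp x^n = exp (INR n*x)).
 { intros x n. induction n as [|n IH]; [rewrite INR_0, Rmult_0_l, exp_0; auto|]. rewrite S_INR. simpl. rewrite IH, <- exp_plus. f_equal; ring. }
 rewrite E. replace (INR K*(INR a/(2*INR K))) with (INR a*(1/2)) by fld.
 rewrite <- E. apply pow_incr. split; [fin|].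
 assert (exp (1/2)*exp (1/2) <= 3) by (rewrite <- exp_plus; replace (1/2 + 1/2) with 1 by field; apply exp_le_3).
 nra.
Qed.

(** The bound with constant 1 for [2^K]-rough numbers is extended downwards: admitting one more
    possible prime [q] as a divisor multiplies the constant by at most [(2*K)^K], and there are
    finitely many [q] below [2^K]. *)
Lemma tau_bound K : (1 <= K)%nat -> exists B, 1 <= B /\ forall n, (1 <= n)%nat -> INR (tau n)^K <= B*INR n.
Proof.
 intros HK. set (P := (2^K)%nat).
 assert (Hq : forall j, (j <= P - 2)%nat -> exists B, 1 <= B /\ forall n, (1 <= n)%nat -> rough (P - j) n -> INR (tau n)^K <= B*INR n).
 { induction j as [|j IH]; intros Hj.
  - exists 1. split; [lra|]. intros n Hn Hr. rewrite Nat.sub_0_r in Hr. rewrite Rmult_1_l, <- pow_INR. apply le_INR.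
   apply (tau_rough K P); auto.
  - destruct (IH ltac:(lia)) as [B [HB H]]. set (q := (P - S j)%nat) in *.
   assert (HK1 : 1 <= INR K) by (change 1 with (INR 1); apply le_INR; auto).
   assert (HC : 1 <= (2*INR K)^K) by (apply pow_R1_Rle; lra).
   exists ((2*INR K)^K*B). split; [nra|]. intros n Hn Hr.
   assert (Hup : forall m, rough q m -> ~ Nat.divide q m -> rough (P - j) m).
   { intros m Hm Hnq d Hd Hdm. specialize (Hm d Hd Hdm). destruct (Nat.eq_dec d q) as [->|]; [contradiction|]. fin. }
   destruct (em (Nat.divide q n)) as [Hd|Hd].
   + assert (Hq2 : (2 <= q)%nat) by fin.
    destruct (split_prime_power q n Hq2 Hn) as [a [m [E [H4 H5]]]].
    assert (Hm : rough q m) by (apply (rough_divide q n); auto; exists (q^a)%nat; auto).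
    note (tau_prime_power q a m (rough_prime q n Hq2 Hr Hd) H5) as T. rewrite <- E in T.
    apply le_INR in T. rewrite mult_INR in T.
    ele; [apply pow_incr; split; [fin | exact T]|]. rewrite Rpow_mult_distr.
    note (pow_exp_bound K a HK) as PE.
    assert (Q2 : 2^a <= INR (q^a)). { rewrite pow_INR. apply pow_incr. split; [lra|]. replace 2 with (INR 2) by fin. apply le_INR; auto. }
    rewrite E, mult_INR.
    le ((2*INR K)^K*2^a*(B*INR m)).
    * fin.
    * replace ((2*INR K)^K*B*(INR (q^a)*INR m)) with ((2*INR K)^K*(B*INR m)*INR (q^a)) by ring.
     replace ((2*INR K)^K*2^a*(B*INR m)) with ((2*INR K)^K*(B*INR m)*2^a) by ring.
     fin.
   + specialize (H n Hn (Hup n Hr Hd)). assert (0 <= B*INR n) by fin. nra. }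
 destruct (Hq (P - 2)%nat ltac:(lia)) as [B [HB H]]. exists B. split; auto. intros n Hn. apply H; auto.
 intros d Hd _. lia.
Qed.

(** * Tuples of factors and powers of Dirichlet sums *)

Definition tprod (t : list nat) : nat := fold_right Nat.mul 1%nat t.

Lemma in_lists k l t : In t (lists_of_length k l) <-> length t = k /\ (forall x, In x t -> In x l).
Proof.
 revert t. induction k as [|k IH]; intros t; simpl.
 - split.
  + intros [<-|[]]. split; auto. intros x [].
  + intros [H _]. destruct t; [auto | discriminate].
 - rewrite in_flat_map. split.
  + intros [a [Ha H]]. apply in_map_iff in H. destruct H as [t' [<- Ht']]. apply IH in Ht'. destruct Ht' as [E F].
   split; [simpl; auto|]. intros x [<-|Hx]; auto.
  + intros [H1 H2]. destruct t as [|a t]; [discriminate|]. exists a. split; [apply H2; left; auto|].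
   apply in_map. apply IH. split; [fin|]. intros x Hx. apply H2. right; auto.
Qed.

Lemma length_lists k l : length (lists_of_length k l) = (length l^k)%nat.
Proof.
 induction k as [|k IH]; simpl; [auto|].
 apply flat_map_length_const. intros x. rewrite length_map. auto.
Qed.

Lemma NoDup_lists k l : NoDup l -> NoDup (lists_of_length k l).
Proof.
 intros Hl. induction k as [|k IH]; simpl; [repeat constructor; auto|].
 assert (G : forall l', NoDup l' -> NoDup (flat_map (fun a => map (cons a) (lists_of_length k l)) l')).
 { induction l' as [|a l' IH']; simpl; intros H; [constructor|]. inversion H; subst.
  apply NoDup_app; [apply NoDup_map_NoDup_ForallPairs; auto; intros x y _ _ E; inversion E; auto | auto |].
  intros t Ht Ht'. apply in_map_iff in Ht. destruct Ht as [t' [<- _]]. apply in_flat_map in Ht'. destruct Ht' as [b [Hb Hb']].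
  apply in_map_iff in Hb'. destruct Hb' as [t'' [E _]]. inversion E; subst. fin. }
 fin.
Qed.

Lemma tprod_divide t x : In x t -> Nat.divide x (tprod t).
Proof.
 induction t as [|a t IH]; intros H; [destruct H|]. simpl. destruct H as [<-|H].
 - exists (tprod t). ring.
 - apply Nat.divide_mul_r. auto.
Qed.

Lemma tprod_pos t : (forall x, In x t -> (1 <= x)%nat) -> (1 <= tprod t)%nat.
Proof.
 induction t as [|a t IH]; simpl; intros H; [lia|]. note (H a (or_introl eq_refl)). assert (1 <= tprod t)%nat by auto. fin.
Qed.

(** Every entry of such a tuple divides [m]. *)
Lemma tuple_count k l m : NoDup l -> (1 <= m)%nat ->
 (length (filter (fun t => Nat.eqb (tprod t) m) (lists_of_length k l)) <= tau m^k)%nat.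
Proof.
 intros Hl Hm. unfold tau. rewrite <- length_lists. apply NoDup_incl_length; [apply NoDup_filter, NoDup_lists; auto|].
 intros t Ht. apply filter_In in Ht. destruct Ht as [H1 H2]. apply Nat.eqb_eq in H2. apply in_lists in H1. destruct H1 as [H1 _].
 apply in_lists. split; auto. intros x Hx. apply in_divs; auto. rewrite <- H2. apply tprod_divide; auto.
Qed.

Lemma lsum_flat_map {A B} (f : B -> C) (g : A -> list B) l : lsum f (flat_map g l) = lsum (fun x => lsum f (g x)) l.
Proof. induction l as [|x l IH]; simpl; [auto|]. rewrite lsum_app, IH. auto. Qed.
Lemma lsum_map {A B} (f : B -> C) (g : A -> B) l : lsum f (map g l) = lsum (fun x => f (g x)) l.
Proof. induction l as [|x l IH]; simpl; [auto|]. rewrite IH. auto. Qed.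

Lemma lsum_pow (f : nat -> C) k l : (lsum f l^k)%C = lsum (fun t => fold_right (fun n z => f n*z)%C (RtoC 1) t) (lists_of_length k l).
Proof.
 induction k as [|k IH]; simpl; [ring|].
 rewrite lsum_flat_map, IH.
 rewrite (lsum_ext (fun x => lsum _ (map (cons x) (lists_of_length k l))) (fun a => lsum (fun t => fold_right (fun n z => f n*z)%C (RtoC 1) t) (lists_of_length k l)*f a)%C).
 - rewrite lsum_mult. ring.
 - intros a _. rewrite lsum_map. simpl. rewrite lsum_mult. apply Cmult_comm.
Qed.

Lemma csum_seq (f : nat -> C) a n : lsum f (seq a n) = csum (fun i => f (a + i)%nat) n.
Proof.
 revert a. induction n as [|n IH]; intros a; [auto|]. simpl seq. cbn [lsum]. rewrite IH, csum_succ_l, Nat.add_0_r. f_equal.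
 apply csum_ext. intros i _. f_equal. lia.
Qed.

Lemma fold_power (s : C) t : (forall x, In x t -> (1 <= x)%nat) ->
 fold_right (fun n z => Rcpow (INR n) s*z)%C (RtoC 1) t = Rcpow (INR (tprod t)) s.
Proof.
 induction t as [|a t IH]; intros H; simpl.
 - rewrite INR_1, Rcpow_base1. auto.
 - rewrite IH by (intros; apply H; right; auto). rewrite mult_INR, Rcpow_mult; auto.
  + apply lt_0_INR. apply H. left; auto.
  + apply lt_0_INR. apply tprod_pos. intros; apply H; right; auto.
Qed.

Lemma lsr_by_value {A} (p : A -> nat) (g : nat -> R) (l : list A) M : (forall x, In x l -> (p x < M)%nat) ->
 lsr (fun x => g (p x)) l = rsum (fun m => INR (length (filter (fun x => Nat.eqb (p x) m) l))*g m) M.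
Proof.
 induction l as [|x l IH]; intros H; simpl.
 - rewrite (rsum_ext _ (fun _ => 0)); [rewrite rsum_const; ring|]. intros; rewrite INR_0; ring.
 - rewrite IH by (intros; apply H; right; auto).
  assert (E : forall n b, (n < b)%nat -> rsum (fun m => (if Nat.eqb n m then 1 else 0)*g m) b = g n).
  { intros n b. induction b as [|b IHb]; intros Hb; [lia|]. simpl. destruct (Nat.eq_dec n b) as [->|ne].
   - rewrite Nat.eqb_refl. rewrite (rsum_ext _ (fun _ => 0)); [rewrite rsum_const; ring|].
    intros i Hi. rewrite (proj2 (Nat.eqb_neq b i)) by lia. ring.
   - rewrite IHb by lia. rewrite (proj2 (Nat.eqb_neq n b)) by lia. ring. }
  rewrite <- (E (p x) M) at 1 by (apply H; left; auto). rewrite <- rsum_plus. apply rsum_ext. intros m _.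
  destruct (Nat.eqb (p x) m); cbn [length]; rewrite ?S_INR; ring.
Qed.

(** * Dyadic blocks of the zeta function *)

Definition block (sg : R) (N : nat) (t : R) : C := csum (fun i => Rcpow (INR (N + i)) (- pt sg t)%C) N.

Lemma Rcpow_ei x sg t : 0 < x -> Rcpow x (- pt sg t)%C = (RtoC (Rpower x (- sg))*ei (- ln x*t))%C.
Proof.
 intros Hx. rewrite <- Rcpow_RtoC. unfold Rcpow, ei. rewrite <- Cexp_plus. f_equal.
 ceq.
Qed.

Lemma atan_bounds x : - 2 < atan x < 2.
Proof. note (atan_bound x). note PI_4. lra. Qed.

Lemma atan_increment a b : a <= b -> (b - a)/(1 + Rmax (a*a) (b*b)) <= atan b - atan a.
Proof.
 intros Hab. destruct (Req_dec a b) as [->|ne]; [lra|].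
 destruct (MVT_gen atan a b (fun u => / (1 + u*u))) as [xi [H1 H2]].
 - intros u _. apply is_derive_atan.
 - intros u _. apply continuity_pt_filterlim. apply (ex_derive_continuous atan). exists (/ (1 + u*u)). apply is_derive_atan.
 - rewrite Rmin_left, Rmax_right in H1 by lra. rewrite H2.
  unfold Rdiv. rewrite Rmult_comm. mul_r; [lra|]. apply Rinv_le_contravar; [nra|].
  apply Rplus_le_compat_l. destruct (Rle_dec 0 xi).
  + ele; [|apply Rmax_r]. nra.
  + ele; [|apply Rmax_l]. nra.
Qed.

(** Away from [m = p] each term is at most [1/x] times an increment of [atan (x*(m - p))].
    Increments over a double step telescope to four arctangents, each of modulus below 2. *)
Lemma lorentz_sum x (p M : nat) : 0 < x ->
 rsum (fun m => / (1 + (x*(INR p - INR m))*(x*(INR p - INR m)))) M <= 1 + 8/x.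
Proof.
 intros Hx. set (ph := fun m : R => atan (x*(m - INR p))).
 assert (mono : forall a b, a <= b -> ph a <= ph b).
 { intros a b H. destruct (Req_dec a b) as [->|]; [lra|]. left. apply atan_increasing. nra. }
 assert (T : forall m : nat, / (1 + (x*(INR p - INR m))*(x*(INR p - INR m))) <= (if Nat.eqb p m then 1 else 0) + / x*(ph (INR m + 1) - ph (INR m - 1))).
 { intros m. assert (Hp1 := mono (INR m - 1) (INR m + 1) __). assert (0 < / x) by fin.
  destruct (Nat.eqb_spec p m) as [->|ne].
  - rewrite Rminus_diag, Rmult_0_r, Rmult_0_l, Rplus_0_r, Rinv_1. nra.
  - rewrite Rplus_0_l. apply (Rmult_le_reg_l x); auto. replace (x*(/ x*(ph (INR m + 1) - ph (INR m - 1)))) with (ph (INR m + 1) - ph (INR m - 1)) by fld.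
   destruct (le_lt_dec p m).
   + assert (H1 : INR p + 1 <= INR m) by (rewrite <- S_INR; apply le_INR; lia).
    le (ph (INR m) - ph (INR m - 1)); [|note (mono (INR m) (INR m + 1) __); lra]. ele; [|apply atan_increment; nra].
    replace (x*(INR m - INR p) - x*(INR m - 1 - INR p)) with x by ring. mul_l; [lra|]. apply Rinv_le_contravar.
    * eapply Rlt_le_trans; [|apply Rplus_le_compat_l, Rmax_l]. fin.
    * apply Rplus_le_compat_l. apply Rmax_lub; [|lra].
     nra.
   + assert (H1 : INR m + 1 <= INR p) by (rewrite <- S_INR; apply le_INR; lia).
    le (ph (INR m + 1) - ph (INR m)); [|note (mono (INR m - 1) (INR m) __); lra]. ele; [|apply atan_increment; nra].
    replace (x*(INR m + 1 - INR p) - x*(INR m - INR p)) with x by ring. mul_l; [lra|]. apply Rinv_le_contravar.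
    * eapply Rlt_le_trans; [|apply Rplus_le_compat_l, Rmax_l]. match goal with |- 0 < 1 + ?z * ?z => note (Rle_0_sqr z); unfold Rsqr in *; lra end.
    * apply Rplus_le_compat_l. apply Rmax_lub; [lra|].
     nra. }
 ele; [apply rsum_le; intros m _; apply T|]. rewrite rsum_plus, rsum_mult.
 assert (S1 : rsum (fun m => if Nat.eqb p m then 1 else 0) M <= 1).
 { assert (Q : forall M, rsum (fun m => if Nat.eqb p m then 1 else 0) M = if Nat.ltb p M then 1 else 0).
  { induction M0 as [|k IH]; [auto|]. simpl rsum. destruct (Nat.ltb_spec p k), (Nat.eqb_spec p k), (Nat.ltb_spec p (S k)); try lia; lra. }
  rewrite Q. destruct (Nat.ltb p M); lra. }
 assert (S2 : rsum (fun m => ph (INR m + 1) - ph (INR m - 1)) M <= 8).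
 { assert (Q : forall M, rsum (fun m => ph (INR m + 1) - ph (INR m - 1)) M = ph (INR M) + ph (INR M - 1) - ph 0 - ph (-1)).
  { induction M0 as [|k IH]; [simpl; rewrite INR_0; replace (0 - 1) with (-1) by ring; ring|].
   simpl rsum. rewrite IH, S_INR. replace (INR k + 1 - 1) with (INR k) by ring. ring. }
  rewrite Q. unfold ph. note (atan_bounds (x*(INR M - INR p))). note (atan_bounds (x*(INR M - 1 - INR p))).
  note (atan_bounds (x*(0 - INR p))). note (atan_bounds (x*(-1 - INR p))). lra. }
 assert (0 < / x) by fin. nra.
Qed.

(** The slope of [ln] on [[1, M]] is at least [1/M]. *)
Lemma ln_diff_lower a b M : 1 <= a <= M -> 1 <= b <= M -> (a - b)*(a - b)/(M*M) <= (ln a - ln b)*(ln a - ln b).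
Proof.
 intros Ha Hb.
 assert (K : forall u v, 1 <= u <= v -> v <= M -> (v - u)/M <= ln v - ln u).
 { intros u v Hu Hv. rewrite <- ln_div by lra.
  assert (E : ln (u/v) = - ln (v/u)) by (rewrite !ln_div by lra; ring).
  note (exp_ineq1_le (ln (u/v))) as X. rewrite exp_ln in X by fin.
  assert ((v - u)/M <= 1 - u/v); [|lra].
  replace (1 - u/v) with ((v - u)/v) by fld. unfold Rdiv. fin. }
 replace ((a - b)*(a - b)/(M*M)) with (((a - b)/M)*((a - b)/M)) by fld.
 destruct (Rle_dec a b).
 - specialize (K a b __ __). assert (0 <= (b - a)/M) by fin.
  nra.
 - fin.
Qed.

Lemma tprod_le t M : (forall x, In x t -> (x <= M)%nat) -> (tprod t <= M^length t)%nat.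
Proof.
 induction t as [|a t IH]; simpl; intros H; [auto|]. apply Nat.mul_le_mono; [fin | fin].
Qed.
Lemma tprod_ge t M : (forall x, In x t -> (M <= x)%nat) -> (M^length t <= tprod t)%nat.
Proof.
 induction t as [|a t IH]; simpl; intros H; [auto|]. apply Nat.mul_le_mono; [fin | fin].
Qed.

Lemma block_pow_wave k N sg c v : (1 <= N)%nat ->
 (block sg N (c + v)^k)%C = wave (fun t => RtoC (Rpower (INR (tprod t)) (- sg))*ei (- ln (INR (tprod t))*c))%C
  (fun t => - ln (INR (tprod t))) (lists_of_length k (seq N N)) v.
Proof.
 intros HN. unfold block. rewrite <- (csum_seq (fun n => Rcpow (INR n) (- pt sg (c + v)))%C), lsum_pow.
 apply lsum_ext. intros t Ht. apply in_lists in Ht. destruct Ht as [_ Ht].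
 assert (Hpos : forall x, In x t -> (1 <= x)%nat) by (intros x Hx; apply Ht, in_seq in Hx; lia).
 rewrite fold_power by auto. rewrite Rcpow_ei by (apply lt_0_INR, tprod_pos; auto).
 rewrite <- Cmult_assoc, <- ei_plus. do 2 f_equal. ring.
Qed.

Lemma cont_Rcpow_t x sg t : 0 < x -> cont_at dR (fun t => Rcpow x (- pt sg t)%C) t.
Proof.
 intros Hx. apply cont_ext_loc with (f := fun t => (RtoC (Rpower x (- sg))*ei (- ln x*t))%C).
 - unfold dR. rewrite Rminus_diag. apply Rabs_R0.
 - exists 1; split; [lra|]. intros. rewrite Rcpow_ei; auto.
 - fin.
Qed.

Lemma cont_csum {B} (d : B -> B -> R) (f : nat -> B -> C) n b : (forall i, (i < n)%nat -> cont_at d (f i) b) ->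
 cont_at d (fun b => csum (fun i => f i b) n) b.
Proof. induction n as [|n IH]; simpl; intros H; [fin | fin]. Qed.

Lemma cont_block sg N t : (1 <= N)%nat -> cont_at dR (block sg N) t.
Proof.
 intros HN. apply (cont_csum dR (fun i t => Rcpow (INR (N + i)) (- pt sg t)%C)). intros i _. apply cont_Rcpow_t. apply lt_0_INR; lia.
Qed.

Lemma contR_pow (f : R -> R) n v : cont_at dR (fun v => RtoC (f v)) v -> cont_at dR (fun v => RtoC (f v^n)) v.
Proof.
 intros. induction n as [|n IH]; simpl; [fin | fin].
Qed.

(** The k-th power of the block is an exponential sum over k-tuples with frequencies [-ln] of their
    products, centred at [3*U/2]. In the row sums of [mean_value] the tuples are grouped by product:
    at most [Q] share a product, and the logarithms of distinct products up to [A] are spaced by at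
    least [1/A]. *)
Lemma block_moment k N sg U Q : (1 <= N)%nat -> 0 < U ->
 (forall m, (1 <= m <= (2*N)^k)%nat -> INR (tau m^k) <= Q) -> 0 <= sg ->
 RInt (fun t => Cmod (block sg N t)^(2*k)) U (2*U)
 <= 2*(Q*(2*U + 32*INR ((2*N)^k)))*(INR (N^k)*Rpower (INR (N^k)) (- (2*sg))).
Proof.
 intros HN HU HQ Hsg.
 set (l := lists_of_length k (seq N N)). set (lam := fun t => - ln (INR (tprod t))).
 set (c := 3*U/2). set (L := U/2).
 set (a := fun t => (RtoC (Rpower (INR (tprod t)) (- sg))*ei (- ln (INR (tprod t))*c))%C).
 set (A := ((2*N)^k)%nat).
 assert (HA : (1 <= A)%nat) by (unfold A; assert ((2*N)^k <> 0)%nat by (apply Nat.pow_nonzero; lia); lia).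
 assert (HAr : 1 <= INR A) by (change 1 with (INR 1); apply le_INR; auto).
 assert (Hl : forall t, In t l -> (1 <= tprod t <= A)%nat /\ (N^k <= tprod t)%nat).
 { intros t Ht. apply in_lists in Ht. destruct Ht as [H1 H2].
  assert (B1 : forall x, In x t -> (N <= x)%nat) by (intros x Hx; apply H2, in_seq in Hx; lia).
  assert (B2 : forall x, In x t -> (x <= 2*N)%nat) by (intros x Hx; apply H2, in_seq in Hx; lia).
  split; [split|].
  - apply tprod_pos. intros x Hx. specialize (B1 x Hx). lia.
  - unfold A. rewrite <- H1. apply tprod_le; auto.
  - rewrite <- H1. apply tprod_ge; auto. }
 assert (E : RInt (fun t => Cmod (block sg N t)^(2*k)) U (2*U) = RInt (fun v => Cmod (wave a lam l v)*Cmod (wave a lam l v)) (- L) L).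
 { assert (Hex : ex_RInt (fun t => Cmod (block sg N t)^(2*k)) (1*- L + c) (1*L + c)).
  { apply contR_ex_RInt; [unfold L; lra|]. intros t _. apply (contR_pow (fun t => Cmod (block sg N t))), cont_Cmod, cont_block; auto. }
  note (RInt_comp_lin (V := RC) (fun t => Cmod (block sg N t)^(2*k)) 1 c (- L) L Hex) as R.
  replace (1*- L + c) with U in R by (unfold L, c; field). replace (1*L + c) with (2*U) in R by (unfold L, c; field).
  rewrite <- R. apply RInt_ext. intros v _. unfold scal; simpl. rewrite Rmult_1_l.
  unfold a, lam, l. rewrite <- (block_pow_wave k N sg c v) by auto. replace (1*v + c) with (c + v) by ring.
  rewrite Nat.add_0_r, Cmod_pow, <- pow_add. auto. }
 rewrite E.
 ub (mean_value a lam l L (Q*(2*U + 32*INR A))).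
 - unfold L; lra.
 - intros x Hx. destruct (Hl x Hx) as [[P1 P2] _].
  set (p := tprod x) in *. set (g := fun m => 4*L/(1 + L*(ln (INR m) - ln (INR p))*(L*(ln (INR m) - ln (INR p))))).
  rewrite (lsr_ext _ (fun y => g (tprod y))) by (intros y _; unfold g, lam; fold p; do 2 f_equal; ring).
  rewrite (lsr_by_value tprod g l (S A)) by (intros y Hy; destruct (Hl y Hy); lia).
  assert (gpos : forall m, 0 <= g m).
  { intros m. left. apply Rdiv_lt_0_compat; [unfold L; lra|]. note (Rle_0_sqr (L*(ln (INR m) - ln (INR p)))). fin. }
  assert (HQ0 : 0 <= Q) by (ele; [apply pos_INR | apply (HQ 1%nat); lia]).
  assert (Hx0 : 0 < L/INR A) by (apply Rdiv_lt_0_compat; unfold L; lra).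
  (* With the least slope [1/A] in place of [ln] the row sum becomes a Lorentzian sum of step
     [L/A]. *)
  le (rsum (fun m => Q*(4*L)*/ (1 + (L/INR A*(INR p - INR m))*(L/INR A*(INR p - INR m)))) (S A)).
  + apply rsum_le. intros m Hm. destruct m as [|m].
   (* No tuple has product 0, so the meaningless value of [ln] at 0 is multiplied by 0. *)
   * replace (length (filter (fun t => Nat.eqb (tprod t) 0) l)) with 0%nat.
    -- rewrite INR_0, Rmult_0_l. apply Rmult_le_pos; [unfold L; nra|]. left; apply Rinv_0_lt_compat.
     nra.
    -- destruct (filter _ l) as [|t l'] eqn:Ef; auto.
     assert (In t (filter (fun t => Nat.eqb (tprod t) 0) l)) by (rewrite Ef; left; auto).
     apply filter_In in H. destruct H as [H1 H2]. apply Nat.eqb_eq in H2. destruct (Hl t H1). lia.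
   * assert (Cnt : INR (length (filter (fun t => Nat.eqb (tprod t) (S m)) l)) <= Q).
    { ele; [apply le_INR, tuple_count; [apply seq_NoDup | lia]|]. fin. }
    rewrite Rmult_assoc. apply Rmult_le_compat; auto; [fin|].
    unfold g, Rdiv. mul_l; [unfold L; lra|].
    assert (D : (INR p - INR (S m))*(INR p - INR (S m))/(INR A*INR A) <= (ln (INR p) - ln (INR (S m)))*(ln (INR p) - ln (INR (S m)))).
    { apply ln_diff_lower; split; try (change 1 with (INR 1)); apply le_INR; lia. }
    apply Rinv_le_contravar.
    { match goal with |- 0 < 1 + ?z * ?z => note (Rle_0_sqr z); unfold Rsqr in *; lra end. }
    replace (L*/ INR A*(INR p - INR (S m))*(L*/ INR A*(INR p - INR (S m)))) with (L*L*((INR p - INR (S m))*(INR p - INR (S m))/(INR A*INR A))) by fld.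
    nra.
  + rewrite rsum_mult. note (lorentz_sum (L/INR A) p (S A) Hx0) as LS.
   le (Q*(4*L)*(1 + 8/(L/INR A))); [mul_l; auto; unfold L; nra|].
   right. unfold L. field. lra.
 - apply Rmult_le_compat_l.
  { apply Rmult_le_pos; [lra|]. apply Rmult_le_pos; [ele; [apply pos_INR | apply (HQ 1%nat); lia] | lra]. }
  assert (Hlen : length l = (N^k)%nat) by (unfold l; rewrite length_lists, length_seq; auto).
  rewrite <- Hlen, <- lsr_const. apply lsr_le. intros t Ht. destruct (Hl t Ht) as [_ P3].
  unfold a. rewrite Cmod_mult, ei_mod, Rmult_1_r, Cmod_R, Rabs_pos_eq by fin.
  rewrite <- Rpower_plus. replace (- sg + - sg) with (- (2*sg)) by ring. rewrite Hlen.
  assert (0 < INR (N^k)) by (apply lt_0_INR; assert (N^k <> 0)%nat by (apply Nat.pow_nonzero; lia); lia).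
  rewrite !(Rpower_Ropp _ (2*sg)). apply Rinv_le_contravar; [fin|].
  apply Rle_Rpower_l; [lra|]. split; [lra | apply le_INR; auto].
Qed.

Lemma abel_bound (b : nat -> R) (z : nat -> C) n M : (forall i, 0 <= b (S i) <= b i) ->
 (forall m, (m <= n)%nat -> Cmod (csum z m) <= M) -> Cmod (csum (fun i => RtoC (b i)*z i)%C n) <= b 0%nat*M.
Proof.
 intros Hb HM.
 assert (E : forall m, csum (fun i => RtoC (b i)*z i)%C m = (RtoC (b m)*csum z m + csum (fun i => RtoC (b i - b (S i))*csum z (S i)) m)%C).
 { induction m as [|m IH]; [ceq|].
  change (csum (fun i => RtoC (b i)*z i) (S m))%C with (csum (fun i => RtoC (b i)*z i) m + RtoC (b m)*z m)%C. rewrite IH. ceq. }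
 rewrite E. ub Cmod_triangle. rewrite Cmod_mult, Cmod_R.
 assert (bpos : forall i, 0 <= b i) by (intro i; specialize (Hb i); lra).
 rewrite Rabs_pos_eq by auto.
 assert (M0 : 0 <= M) by (ele; [apply Cmod_ge_0 | apply (HM 0%nat); lia]).
 assert (S : Cmod (csum (fun i => RtoC (b i - b (S i))*csum z (S i))%C n) <= (b 0%nat - b n)*M).
 { ub Cmod_csum.
  assert (Q : forall m, (m <= n)%nat -> rsum (fun i => Cmod (RtoC (b i - b (S i))*csum z (S i))) m <= (b 0%nat - b m)*M).
  { induction m as [|m IH]; intros Hm; [fin|].
   change (rsum (fun i => Cmod (RtoC (b i - b (S i))*csum z (S i))) (S m)) with (rsum (fun i => Cmod (RtoC (b i - b (S i))*csum z (S i))) m + Cmod (RtoC (b m - b (S m))*csum z (S m))).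
   specialize (IH ltac:(lia)). rewrite Cmod_mult, Cmod_R, Rabs_pos_eq by (specialize (Hb m); lra).
   specialize (HM (S m) Hm). specialize (Hb m). nra. }
  fin. }
 specialize (HM n (le_n n)). specialize (bpos n). nra.
Qed.

(** Partial summation removes the decreasing weights [n^(-sg)]; conjugation only changes the sign of
    the phase. *)
Lemma block_sup sg N t M : (1 <= N)%nat -> 0 <= sg ->
 (forall m, (m <= N)%nat -> Cmod (csum (fun n => ei (t*ln (INR (N + n)))) m) <= M) -> Cmod (block sg N t) <= Rpower (INR N) (- sg)*M.
Proof.
 intros HN Hsg HM. unfold block.
 rewrite (csum_ext _ (fun i => RtoC (Rpower (INR (N + i)) (- sg))*ei (- (t*ln (INR (N + i)))))%C).
 - replace (Rpower (INR N) (- sg)) with (Rpower (INR (N + 0)) (- sg)) by (rewrite Nat.add_0_r; auto).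
  apply (abel_bound (fun i => Rpower (INR (N + i)) (- sg))).
  + intros i. split; [fin|]. rewrite !(Rpower_Ropp _ sg). apply Rinv_le_contravar; [fin|].
   apply Rle_Rpower_l; auto. split; [apply lt_0_INR; lia | apply le_INR; lia].
  + intros m Hm. rewrite (csum_ei_conj (fun n => t*ln (INR (N + n)))). auto.
 - intros i _. rewrite Rcpow_ei by (apply lt_0_INR; lia). do 2 f_equal. ring.
Qed.

#[export] Hint Resolve contR_pow cont_csum cont_block cont_Rcpow_t : an.

(** * The moment of order 2k of the zeta function *)

Lemma exp_le a b : a <= b -> exp a <= exp b.
Proof. intros [H| ->]; [left; apply exp_increasing; auto | lra]. Qed.

Lemma exp_pow x n : exp x^n = exp (INR n*x).
Proof. induction n as [|n IH]; [rewrite INR_0, Rmult_0_l, exp_0; auto|]. rewrite S_INR. simpl. rewrite IH, <- exp_plus. f_equal; ring. Qed.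

Lemma pow_exp_ln x n : 0 < x -> x^n = exp (INR n*ln x).
Proof. intros. rewrite <- exp_pow, exp_ln; auto. Qed.

(** [tau_bound] with exponent [k*q], where [1/q <= eps], followed by a q-th root. *)
Lemma tau_small k eps : (1 <= k)%nat -> 0 < eps -> exists B, 1 <= B /\
 forall X m, 1 <= X -> (1 <= m)%nat -> INR m <= X -> INR (tau m^k) <= B*Rpower X eps.
Proof.
 intros Hk He. destruct (nfloor_ex (/ eps)) as [q0 [_ Hq]]; [fin|].
 set (q := S q0). assert (Hq1 : / eps < INR q) by (unfold q; rewrite S_INR; auto).
 assert (Hq0 : 0 < INR q) by apply INR_S_pos.
 assert (Hqe : / INR q <= eps). { rewrite <- (Rinv_inv eps). fin. }
 destruct (tau_bound (k*q) ltac:(unfold q; nia)) as [B [HB H]]. exists B. split; auto. intros X m HX Hm HmX.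
 specialize (H m Hm). rewrite pow_mult in H. rewrite pow_INR. set (y := INR (tau m)^k) in *.
 apply Rnot_lt_le. intro L.
 assert (HP : 1 <= Rpower X (/ INR q)). { rewrite <- (Rpower_O X) by lra. apply Rpower_le_base1; auto. fin. }
 assert (L1 : B*Rpower X (/ INR q) < y). { eapply Rle_lt_trans; [|exact L]. mul_l; [lra|]. apply Rpower_le_base1; auto. }
 assert (L2' : (B*Rpower X (/ INR q))^q < y^q).
 { assert (G : forall n a b, 0 < a < b -> a^S n < b^S n).
  { induction n as [|n IH]; intros a b Hab; [lra|]. specialize (IH a b Hab). change (a*a^S n < b*b^S n).
   assert (0 < a^S n) by fin. nra. }
  unfold q. fin. }
 rewrite Rpow_mult_distr in L2'. rewrite <- (Rpower_pow q (Rpower X (/ INR q))), Rpower_mult in L2' by lra.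
 rewrite Rinv_l, Rpower_1 in L2' by lra.
 assert (B <= B^q). { simpl. assert (1 <= B^q0) by (apply pow_R1_Rle; auto). nra. }
 nra.
Qed.

Lemma dyadic_exponent x : 1 <= x -> exists J, x < 2^J <= 2*x /\ (1 <= J)%nat.
Proof.
 intros Hx. destruct (Pow_x_infinity 2 ltac:(rewrite Rabs_pos_eq; lra) (x + 1)) as [N HN].
 destruct (dec_inh_nat_subset_has_unique_least_element (fun J => x < 2^J)) as [J [[H1 H2] _]].
 - intros n. lra.
 - exists N. specialize (HN N (le_n N)). rewrite Rabs_pos_eq in HN by fin. lra.
 - exists J. destruct J as [|J]; [lra|]. split; [|lia]. split; auto. simpl.
  assert (2^J <= x); [|lra]. apply Rnot_lt_le. intro L. specialize (H2 J L). lia.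
Qed.

Section Moment.
Variables (k : nat) (eta eps : R).
Hypothesis (Hk : (3 <= k <= 6)%nat) (Heta : 0 < eta <= 1/20) (Heps : 0 < eps).
Let sg : R := 1/2 + 3/(2*INR k) - eta.

Lemma k_bounds : 3 <= INR k <= 6.
Proof.
 destruct Hk as [H1 H2]. apply le_INR in H1, H2. replace (INR 3) with 3 in H1 by (unfold INR; ring).
 replace (INR 6) with 6 in H2 by (unfold INR; ring). lra.
Qed.

Lemma sg_bounds : 3/4 - eta <= sg <= 1 - eta.
Proof.
 note k_bounds. unfold sg.
 assert (1/4 <= 3/(2*INR k) <= 1/2); [|lra].
 split; apply (Rmult_le_reg_r (2*INR k)); try lra; replace (3/(2*INR k)*(2*INR k)) with 3 by fld; lra.
Qed.

(** The exponent of [N] in the factor [N^k * N^(-2 k sg)] of [block_moment]. *)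
Lemma sg_k : INR k*(1 - 2*sg) = -3 + 2*INR k*eta.
Proof. note k_bounds. unfold sg. field. lra. Qed.

Lemma block_cont_int N p a b : (1 <= N)%nat -> a <= b -> ex_RInt (fun t => Cmod (block sg N t)^p) a b.
Proof.
 fin.
Qed.

(** With [U = v^3], the mean value of the k-th power is about [(U + N^k) N^(-3 + 2 k eta)]. For
    [N <= v] the first part is at most [U] up to the loss in [eta], and so is the second because
    [k - 3 <= 3]. *)
Lemma block_case1 : exists B, 0 <= B /\ forall v N, 1 <= v -> (1 <= N)%nat -> INR N <= v ->
 RInt (fun t => Cmod (block sg N t)^(2*k)) (v^3) (2*v^3) <= B*exp ((3 + 4*INR k*eta + eps)*ln v).
Proof.
 note k_bounds as Kb. note sg_bounds as Sb. note sg_k as Sk.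
 destruct (tau_small k (eps/6) ltac:(lia) __) as [B0 [HB0 Htau]].
 (* Here [2^k <= 64] and [2050 = 2 + 32*64]; products of tuples are at most [64*v^6], which explains
    [eps/6]. *)
 exists (2*(B0*Rpower 64 (eps/6))*2050). split.
 { fin. }
 intros v N Hv HN HNv.
 set (lv := ln v). set (lN := ln (INR N)).
 assert (HN1 : 1 <= INR N) by (change 1 with (INR 1); apply le_INR; auto).
 assert (HlN : 0 <= lN) by (unfold lN; rewrite <- ln_1; apply ln_le; lra).
 assert (Hl : lN <= lv) by (apply ln_le; lra).
 assert (Ev3 : v^3 = exp (3*lv)) by (rewrite pow_exp_ln by lra; f_equal; unfold INR; fold lv; ring).
 set (Q := B0*Rpower (64*v^6) (eps/6)).
 assert (EQ : Q = B0*Rpower 64 (eps/6)*exp (eps*lv)).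
 { unfold Q. rewrite <- Rpower_mult_distr; [|lra|fin]. rewrite Rmult_assoc. do 2 f_equal.
  rewrite <- (Rpower_pow 6 v), Rpower_mult by lra. unfold Rpower. fold lv. f_equal. unfold INR. field. }
 assert (H2N : INR ((2*N)^k) <= 64*INR N^k).
 { rewrite pow_INR, mult_INR, Rpow_mult_distr. mul_r; [fin|].
  replace 64 with (2^6) by ring. apply Rle_pow; [lra | lia]. }
 assert (ENk : INR N^k = exp (INR k*lN)) by (apply pow_exp_ln; lra).
 ub (block_moment k N sg (v^3) Q HN).
 - apply pow_lt; lra.
 - intros m [Hm1 Hm2]. apply Htau; auto.
  + assert (1 <= v^6) by (apply pow_R1_Rle; lra). lra.
  + ele; [apply le_INR; exact Hm2|]. ele; [exact H2N|]. mul_l; [lra|].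
   le (v^k); [apply pow_incr; lra | apply Rle_pow; [lra | lia]].
 - lra.
 - assert (E1 : INR (N^k)*Rpower (INR (N^k)) (- (2*sg)) = exp ((-3 + 2*INR k*eta)*lN)).
  { rewrite pow_INR, ENk. unfold Rpower. rewrite ln_exp, <- exp_plus. f_equal. nra. }
  rewrite E1, EQ, Ev3. set (B1 := B0*Rpower 64 (eps/6)). assert (HB1 : 0 < B1) by (unfold B1; note (Rpower_pos 64 (eps/6)); nra).
  assert (Hke : 0 <= INR k*eta) by nra.
  assert (T1 : exp (3*lv)*exp ((-3 + 2*INR k*eta)*lN) <= exp ((3 + 4*INR k*eta)*lv)).
  { rewrite <- exp_plus. apply exp_le. nra. }
  assert (T2 : exp (INR k*lN)*exp ((-3 + 2*INR k*eta)*lN) <= exp ((3 + 4*INR k*eta)*lv)).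
  { rewrite <- exp_plus. apply exp_le. nra. }
  replace (exp ((3 + 4*INR k*eta + eps)*lv)) with (exp (eps*lv)*exp ((3 + 4*INR k*eta)*lv)) by (rewrite <- exp_plus; f_equal; ring).
  le (2*(B1*exp (eps*lv))*((2*exp (3*lv) + 32*(64*exp (INR k*lN)))*exp ((-3 + 2*INR k*eta)*lN))).
  + rewrite <- (Rmult_assoc 2), (Rmult_assoc (2*_)). fin.
  + replace (2*B1*2050*(exp (eps*lv)*exp ((3 + 4*INR k*eta)*lv))) with (2*(B1*exp (eps*lv))*(2050*exp ((3 + 4*INR k*eta)*lv))) by ring.
   fin.
Qed.

(** Of the [2k] factors six go into the mean value of the cube, which costs [N^3] since [N^3 >= U];
    the others are bounded by [zeta_sum_third]. All powers of [N] combine to [N^(2 k eta)] and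
    [v^(k - 3)] remains, which is at most [v^3] because [k <= 6]. *)
Lemma block_case2 : exists B, 0 <= B /\ forall v N, 1 <= v -> (1 <= N)%nat -> v <= INR N <= v*v ->
 RInt (fun t => Cmod (block sg N t)^(2*k)) (v^3) (2*v^3) <= B*exp ((3 + 4*INR k*eta + eps)*ln v).
Proof.
 note k_bounds as Kb. note sg_bounds as Sb. note sg_k as Sk.
 destruct (tau_small 3 (eps/6) ltac:(lia) __) as [B0 [HB0 Htau]].
 (* The factor [3000^3] bounds the constant of [zeta_sum_third] to the power [k - 3], and
    [258 = 2 + 32*8], since [v^3 <= N^3] in this range. *)
 exists (3000^3*(2*(B0*Rpower 8 (eps/6))*258)). split.
 { fin. }
 intros v N Hv HN HNv.
 set (lv := ln v). set (lN := ln (INR N)).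
 assert (Hl1 : lv <= lN) by (apply ln_le; lra).
 assert (Hl2 : lN <= 2*lv). { unfold lN, lv. replace (2*ln v) with (ln v + ln v) by ring. rewrite <- ln_mult by lra. apply ln_le; lra. }
 assert (Ev3 : v^3 = exp (3*lv)) by (rewrite pow_exp_ln by lra; f_equal; unfold INR; fold lv; ring).
 assert (EN3 : INR N^3 = exp (3*lN)) by (rewrite pow_exp_ln by lra; replace (INR 3) with 3 by (unfold INR; ring); reflexivity).
 set (Q := B0*Rpower (8*v^6) (eps/6)).
 assert (EQ : Q = B0*Rpower 8 (eps/6)*exp (eps*lv)).
 { unfold Q. rewrite <- Rpower_mult_distr; [|lra|fin]. rewrite Rmult_assoc. do 2 f_equal.
  rewrite <- (Rpower_pow 6 v), Rpower_mult by lra. unfold Rpower. fold lv. f_equal. unfold INR. field. }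
 assert (H2N : INR ((2*N)^3) = 8*INR N^3) by (rewrite pow_INR, mult_INR; replace (INR 2) with 2 by fin; ring).
 set (M2 := Rpower (INR N) (- (2*sg))*(3000*(INR N*v))).
 assert (Hsup : forall t, v^3 <= t <= 2*v^3 -> Cmod (block sg N t)^2 <= M2).
 { intros t Ht. set (M := sqrt (3000*(INR N*v))).
  assert (Hp : 0 <= 3000*(INR N*v)) by nra.
  assert (S : Cmod (block sg N t) <= Rpower (INR N) (- sg)*M).
  { apply block_sup; [auto | lra |]. intros m Hm.
   assert (Z := zeta_sum_third v t N m Hv HNv ltac:(simpl in Ht; lra) Hm).
   rewrite <- (sqrt_square (Cmod _)) by apply Cmod_ge_0. apply sqrt_le_1_alt. exact Z. }
  note (Cmod_ge_0 (block sg N t)).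
  le ((Rpower (INR N) (- sg)*M)^2); [nra|]. right. unfold M2, M.
  rewrite Rpow_mult_distr. replace (sqrt (3000*(INR N*v))^2) with (3000*(INR N*v)) by (simpl; rewrite Rmult_1_r, sqrt_sqrt; auto).
  f_equal. simpl. rewrite Rmult_1_r, <- Rpower_plus. f_equal. ring. }
 assert (HM2 : M2 = 3000*exp ((1 - 2*sg)*lN + lv)).
 { unfold M2, Rpower. fold lN. rewrite <- (exp_ln (INR N)) at 1 by lra. fold lN. rewrite <- (exp_ln v) at 1 by lra. fold lv.
  replace (exp (- (2*sg)*lN)*(3000*(exp lN*exp lv))) with (3000*(exp (- (2*sg)*lN)*(exp lN*exp lv))) by ring.
  rewrite <- !exp_plus. do 2 f_equal. ring. }
 assert (HM20 : 0 <= M2) by (rewrite HM2; note (exp_pos ((1 - 2*sg)*lN + lv)); lra).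
 assert (Hv3 : 0 < v^3) by fin.
 le (M2^(k - 3)*RInt (fun t => Cmod (block sg N t)^(2*3)) (v^3) (2*v^3)).
 - rewrite <- (RInt_scal (V := RC)) by fin.
  apply RInt_le; [lra | fin | fin |].
  intros t Ht. unfold scal; simpl; unfold mult; simpl.
  replace (k + (k + 0))%nat with (2*(k - 3) + 6)%nat by lia. rewrite pow_add, pow_mult. fin.
 - assert (BM := block_moment 3 N sg (v^3) Q HN Hv3).
  assert (E1 : INR (N^3)*Rpower (INR (N^3)) (- (2*sg)) = exp (3*(1 - 2*sg)*lN)).
  { rewrite pow_INR, EN3. unfold Rpower. rewrite ln_exp, <- exp_plus. f_equal. ring. }
  assert (BM' : RInt (fun t => Cmod (block sg N t)^(2*3)) (v^3) (2*v^3) <= 2*(Q*(2*v^3 + 32*INR ((2*N)^3)))*(INR (N^3)*Rpower (INR (N^3)) (- (2*sg)))).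
  { apply BM; [|lra]. intros m [Hm1 Hm2]. apply Htau; auto.
   + assert (1 <= v^6) by (apply pow_R1_Rle; lra). lra.
   + ele; [apply le_INR; exact Hm2|]. rewrite H2N.
    replace (v^6) with ((v*v)^3) by ring. fin. } rewrite E1, EQ, H2N, EN3, Ev3 in BM'. set (B1 := B0*Rpower 8 (eps/6)) in *. assert (HB1 : 0 < B1) by (unfold B1; note (Rpower_pos 8 (eps/6)); nra).
  assert (Hvn : exp (3*lv) <= exp (3*lN)) by (apply exp_le; lra).
  assert (BM2 : RInt (fun t => Cmod (block sg N t)^(2*3)) (v^3) (2*v^3) <= 2*(B1*exp (eps*lv))*258*(exp (3*lN)*exp (3*(1 - 2*sg)*lN))).
  { rewrite Ev3. ele; [exact BM'|].
   replace (2*(B1*exp (eps*lv))*258*(exp (3*lN)*exp (3*(1 - 2*sg)*lN))) with (2*((B1*exp (eps*lv))*(258*exp (3*lN)))*exp (3*(1 - 2*sg)*lN)) by ring.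
   fin. }
  assert (HMk : M2^(k - 3) <= 3000^3*exp ((INR k - 3)*((1 - 2*sg)*lN + lv))).
  { rewrite HM2, Rpow_mult_distr, exp_pow, minus_INR by lia. replace (INR 3) with 3 by (unfold INR; ring).
   mul_r; [fin|]. apply Rle_pow; [lra | lia]. }
  assert (HI0 : 0 <= RInt (fun t => Cmod (block sg N t)^(2*3)) (v^3) (2*v^3)).
  { apply RInt_ge_0; [lra | fin |]. fin. }
  ele; [apply Rmult_le_compat; [fin | auto | exact HMk | exact BM2]|].
  replace (3000^3*exp ((INR k - 3)*((1 - 2*sg)*lN + lv))*(2*(B1*exp (eps*lv))*258*(exp (3*lN)*exp (3*(1 - 2*sg)*lN))))
   with (3000^3*(2*B1*258)*(exp (eps*lv)*(exp ((INR k - 3)*((1 - 2*sg)*lN + lv))*(exp (3*lN)*exp (3*(1 - 2*sg)*lN))))) by ring.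
  mul_l; [lra|].
  rewrite <- !exp_plus. apply exp_le. assert (0 <= INR k*eta) by nra. nra.
Qed.

(** The second derivative test gives [N^(-sg) (U^(1/2) + N U^(-1/2))] pointwise. With [N >= U^(2/3)]
    the first part is harmless because [sg >= 3/4 - eta]; with [N <= 2 U^(3/2)] the second is,
    because [1 - sg <= 1/4 + eta]. *)
Lemma block_case3 : exists B, 0 <= B /\ forall v N, 1 <= v -> (1 <= N)%nat -> v*v <= INR N <= 2*exp (9/2*ln v) ->
 RInt (fun t => Cmod (block sg N t)^(2*k)) (v^3) (2*v^3) <= B*exp ((3 + 4*INR k*eta + eps)*ln v).
Proof. note sg_bounds as Sb.
 (* The pointwise constant is [152 + 3*114], below 500, and [2k <= 12]. *)
 exists (500^12). split; [lra|]. intros v N Hv HN HNv.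
 set (lv := ln v). set (lN := ln (INR N)).
 assert (HN1 : 1 <= INR N) by nra.
 assert (Hlv : 0 <= lv) by (unfold lv; rewrite <- ln_1; apply ln_le; lra).
 assert (Hl1 : 2*lv <= lN). { unfold lN, lv. replace (2*ln v) with (ln v + ln v) by ring. rewrite <- ln_mult by lra. apply ln_le; nra. }
 assert (Hln2 : ln 2 <= 1). { rewrite <- (ln_exp 1). apply ln_le; [lra|]. note (exp_ineq1_le 1). lra. }
 assert (Hl2 : lN <= 1 + 9/2*lv).
 { le (ln (2*exp (9/2*lv))); [apply ln_le; [lra | apply HNv]|]. rewrite ln_mult, ln_exp by (try lra; apply exp_pos). lra. }
 set (w := exp (3/2*lv)). assert (Hw : 0 < w) by apply exp_pos.
 assert (Ew : w*w = v^3). { unfold w. rewrite <- exp_plus, pow_exp_ln by lra. f_equal. unfold INR. fold lv. field. }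
 assert (Hv3 : 0 < v^3) by fin.
 assert (Hsup : forall t, v^3 <= t <= 2*v^3 -> Cmod (block sg N t) <= 500*exp (2*eta*lv)).
 { intros t Ht.
  assert (Hs1 : w <= sqrt t) by (rewrite <- (sqrt_square w) by lra; apply sqrt_le_1_alt; lra).
  assert (Hs2 : sqrt t <= 2*w) by (rewrite <- (sqrt_square (2*w)) by lra; apply sqrt_le_1_alt; nra).
  assert (S : Cmod (block sg N t) <= Rpower (INR N) (- sg)*(152*w + 114*(INR N/w))).
  { apply block_sup; [auto | lra |]. intros m Hm.
   ele; [apply zeta_sum_second; auto; split; [lra|]|].
   - nra.
   - unfold Rdiv. rewrite Rmult_assoc. fin. }
  ele; [exact S|]. unfold Rpower. fold lN.
  replace (INR N/w) with (exp (lN - 3/2*lv)) by (unfold Rminus; rewrite exp_plus, exp_Ropp; unfold lN; rewrite exp_ln by lra; auto).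
  unfold w. rewrite Rmult_plus_distr_l.
  replace (exp (- sg*lN)*(152*exp (3/2*lv))) with (152*exp (- sg*lN + 3/2*lv)) by (rewrite exp_plus; ring).
  replace (exp (- sg*lN)*(114*exp (lN - 3/2*lv))) with (114*exp (- sg*lN + (lN - 3/2*lv))) by (rewrite exp_plus; ring).
  assert (E1 : exp (- sg*lN + 3/2*lv) <= exp (2*eta*lv)) by (apply exp_le; nra).
  assert (E2 : exp (- sg*lN + (lN - 3/2*lv)) <= 3*exp (2*eta*lv)).
  { le (exp (1 + 2*eta*lv)).
   - apply exp_le. nra.
   - rewrite exp_plus. mul_r; [fin | apply exp_le_3]. }
  note (exp_pos (2*eta*lv)). lra. }
 le (RInt (fun _ => (500*exp (2*eta*lv))^(2*k)) (v^3) (2*v^3)).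
 - apply RInt_le; [lra | fin | fin |]. fin.
 - rewrite RInt_const. unfold scal; simpl; unfold mult; simpl. replace (2*(v*(v*(v*1))) - v*(v*(v*1))) with (v^3) by lra.
  replace (k + (k + 0))%nat with (2*k)%nat by lia. rewrite Rpow_mult_distr, exp_pow, mult_INR. replace (INR 2) with 2 by fin.
  rewrite pow_exp_ln by lra. fold lv. replace (INR 3) with 3 by (unfold INR; ring).
  assert (P : 500^(2*k) <= 500^12) by (apply Rle_pow; [lra | lia]).
  replace (exp (3*lv)*(500^(2*k)*exp (2*INR k*(2*eta*lv)))) with (500^(2*k)*exp (3*lv + 2*INR k*(2*eta*lv))) by (rewrite exp_plus; ring).
  apply Rmult_le_compat; auto; [fin | fin |]. apply exp_le. nra.
Qed.

Lemma block_moment_bound : exists B, 0 <= B /\ forall v N, 1 <= v -> (1 <= N)%nat -> INR N <= 2*exp (9/2*ln v) ->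
 RInt (fun t => Cmod (block sg N t)^(2*k)) (v^3) (2*v^3) <= B*exp ((3 + 4*INR k*eta + eps)*ln v).
Proof.
 destruct block_case1 as [B1 [P1 H1]]. destruct block_case2 as [B2 [P2 H2]]. destruct block_case3 as [B3 [P3 H3]].
 exists (B1 + B2 + B3). split; [lra|]. intros v N Hv HN HNv.
 note (exp_pos ((3 + 4*INR k*eta + eps)*ln v)).
 destruct (Rle_dec (INR N) v); [ele; [apply H1; auto | nra]|].
 destruct (Rle_dec (INR N) (v*v)); [ele; [apply H2; auto; lra | nra]|].
 ele; [apply H3; auto; lra | nra].
Qed.

(** The index [i] stands for the integer [i + 1], hence the shift by 1: block [j] holds the integers
    from [2^j] to [2^(j+1) - 1]. *)
Lemma csum_dyadic (f : nat -> C) J : csum f (2^J - 1) = csum (fun j => csum (fun i => f (2^j + i - 1)%nat) (2^j)) J.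
Proof.
 induction J as [|J IH]; [auto|].
 assert (2^J <> 0)%nat by (apply Nat.pow_nonzero; lia).
 replace (2^S J - 1)%nat with ((2^J - 1) + 2^J)%nat by (simpl; lia).
 rewrite csum_split, IH. cbn [csum]. f_equal. apply csum_ext. intros i _. f_equal. lia.
Qed.

(** The Dirichlet series is cut near [U^(3/2)]: the error [|s| N^(-sg)] is then bounded since
    [sg >= 2/3], and the main term [N^(1-s)/(s-1)] is bounded since [1 - sg <= 2/3]. *)
Lemma zeta_by_blocks v t J : 1 <= v -> v^3 <= t <= 2*v^3 -> exp (9/2*ln v) < 2^J <= 2*exp (9/2*ln v) -> (1 <= J)%nat ->
 Cmod (zeta (pt sg t)) <= 20 + rsum (fun j => Cmod (block sg (2^j) t)) J.
Proof.
 intros Hv Ht HJ HJ1. note sg_bounds as Sb. set (lv := ln v) in *.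
 assert (Hlv : 0 <= lv) by (unfold lv; rewrite <- ln_1; apply ln_le; lra).
 assert (Hv3 : 1 <= v^3) by nra.
 set (s := pt sg t : C). assert (Res : Re s = sg) by auto.
 assert (Hs1 : s <> RtoC 1) by (intro E; apply (f_equal Im) in E; unfold s in E; simpl in E; lra).
 set (N := (2^J - 1)%nat).
 assert (H2J : (2 <= 2^J)%nat) by (destruct J; [lia|]; simpl; assert (2^J <> 0)%nat by (apply Nat.pow_nonzero; lia); lia).
 assert (EJ : INR (2^J) = 2^J) by (rewrite pow_INR; replace (INR 2) with 2 by fin; auto).
 assert (ESN : S N = (2^J)%nat) by (unfold N; lia).
 note (zeta_approx s N __ Hs1 ltac:(unfold N; lia)) as Z. rewrite ESN, EJ, Res in Z.
 assert (Ev3 : v^3 = exp (3*lv)) by (rewrite pow_exp_ln by lra; f_equal; unfold INR; fold lv; ring).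
 assert (Cs : Cmod s <= 3*exp (3*lv)).
 { ub Cmod_le_Re_Im. unfold s, Re, Im; simpl. rewrite !Rabs_pos_eq by lra. lra. }
 assert (T1 : Cmod s*Rpower (INR N) (- sg)/sg <= 10).
 { assert (HNl : exp (9/2*lv)/2 <= INR N).
  { unfold N. rewrite minus_INR, EJ, INR_1 by lia. assert (2 <= 2^J) by (rewrite <- EJ; replace 2 with (INR 2) by fin; apply le_INR; auto). lra. }
  assert (P : Rpower (INR N) (- sg) <= 2*exp (- sg*(9/2*lv))).
  {
   le (Rpower (exp (9/2*lv)/2) (- sg)).
   - rewrite !(Rpower_Ropp _ sg). fin.
   - unfold Rpower. replace (exp (9/2*lv)/2) with (exp (9/2*lv)*/ 2) by lra. rewrite ln_mult, ln_exp, ln_Rinv by lra.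
    replace (- sg*(9/2*lv + - ln 2)) with (sg*ln 2 + - sg*(9/2*lv)) by ring. rewrite exp_plus.
    mul_r; [fin|]. rewrite <- (exp_ln 2) at 2 by lra. apply exp_le.
    assert (0 < ln 2) by (rewrite <- ln_1; apply ln_increasing; lra). nra. }
  apply (Rmult_le_reg_r sg); [lra|]. unfold Rdiv. rewrite Rmult_assoc, Rinv_l, Rmult_1_r by lra.
  le (3*exp (3*lv)*(2*exp (- sg*(9/2*lv)))).
  - fin.
  - replace (3*exp (3*lv)*(2*exp (- sg*(9/2*lv)))) with (6*exp (3*lv + - sg*(9/2*lv))) by (rewrite exp_plus; ring).
   assert (exp (3*lv + - sg*(9/2*lv)) <= exp 0) by (apply exp_le; nra). rewrite exp_0 in H. lra. }
 assert (T2 : Cmod (Rcpow (2^J) (1 - s)/(s - 1))%C <= 10).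
 { rewrite Cmod_div by fin. rewrite Cmod_Rcpow by lra.
  assert (D : exp (3*lv) <= Cmod (s - 1)). { ele; [|apply Im_le_Cmod]. rewrite Rabs_pos_eq; simpl in *; lra. }
  assert (Nn : Rpower (2^J) (Re (1 - s)) <= 2*exp (3*lv)).
  {
   le (Rpower (2*exp (9/2*lv)) (1 - sg)); [fin|].
   unfold Rpower. rewrite ln_mult, ln_exp by lra.
   le (exp (ln 2 + 3*lv)); [|rewrite exp_plus, exp_ln by lra; lra].
   apply exp_le. assert (0 < ln 2) by (rewrite <- ln_1; apply ln_increasing; lra).
   nra. } apply (Rmult_le_reg_r (Cmod (s - 1))); [lra|]. unfold Rdiv. rewrite Rmult_assoc, Rinv_l by lra. lra. }
 assert (T3 : Cmod (csum (zterm s) N) <= rsum (fun j => Cmod (block sg (2^j) t)) J).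
 { unfold N. rewrite csum_dyadic. ub Cmod_csum. apply rsum_le. intros j _. right. f_equal. apply csum_ext. intros i _. unfold zterm. f_equal.
  assert (2^j <> 0)%nat by (apply Nat.pow_nonzero; lia). f_equal. lia. }
 assert (Cmod (zeta s) <= Cmod (zeta s - csum (zterm s) N - Rcpow (2^J) (1 - s)/(s - 1))%C + Cmod (csum (zterm s) N) + Cmod (Rcpow (2^J) (1 - s)/(s - 1))%C).
 { replace (zeta s) with ((zeta s - csum (zterm s) N - Rcpow (2^J) (1 - s)/(s - 1)) + csum (zterm s) N + Rcpow (2^J) (1 - s)/(s - 1))%C at 1 by ring.
  ub Cmod_triangle. apply Rplus_le_compat_r. apply Cmod_triangle. }
 lra.
Qed.

(** A crude form through the largest term; losing a power of [n] is harmless because the number of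
    blocks is logarithmic. The last summand covers [0^0 = 1]. *)
Lemma rsum_power_mean (a : nat -> R) n p : (forall i, 0 <= a i) -> rsum a n^p <= INR n^p*rsum (fun i => a i^p) n + (if Nat.eqb n 0 then 1 else 0).
Proof.
 intros Ha. destruct n as [|n].
 - destruct p; simpl; lra.
 - rewrite Rplus_0_r.
  assert (M : exists i, (i < S n)%nat /\ forall j, (j < S n)%nat -> a j <= a i).
  { induction n as [|n [i [Hi IH]]]; [exists 0%nat; split; [lia|]; intros j Hj; replace j with 0%nat by lia; lra|].
   destruct (Rle_dec (a (S n)) (a i)).
   - exists i. split; [lia|]. intros j Hj. destruct (Nat.eq_dec j (S n)) as [->|]; auto. fin.
   - exists (S n). split; [lia|]. intros j Hj. destruct (Nat.eq_dec j (S n)) as [->|]; [lra|]. specialize (IH j ltac:(lia)). lra. }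
  destruct M as [i [Hi HM]].
  le ((INR (S n)*a i)^p).
  + apply pow_incr. split; [apply rsum_pos; auto|]. rewrite <- rsum_const. apply rsum_le; auto.
  + rewrite Rpow_mult_distr.
   assert (G : forall m, (i < m)%nat -> a i^p <= rsum (fun i => a i^p) m).
   { induction m as [|m IH]; intros Hm; [lia|]. simpl. assert (0 <= rsum (fun i => a i^p) m) by (apply rsum_pos; intros; apply pow_le; auto).
    assert (0 <= a m^p) by fin. destruct (Nat.eq_dec i m) as [->|]; [lra|]. specialize (IH ltac:(lia)). lra. }
   fin.
Qed.

Lemma ex_RInt_rsum (f : nat -> R -> R) n a b : (forall i, ex_RInt (f i) a b) -> ex_RInt (fun t => rsum (fun i => f i t) n) a b.
Proof.
 intros H. induction n as [|n IH]; simpl; [apply ex_RInt_const | apply (ex_RInt_plus (V := RN)); auto].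
Qed.
Lemma RInt_rsum (f : nat -> R -> R) n a b : (forall i, ex_RInt (f i) a b) -> RInt (fun t => rsum (fun i => f i t) n) a b = rsum (fun i => RInt (f i) a b) n.
Proof.
 intros H. induction n as [|n IH]; simpl.
 - rewrite RInt_const. unfold scal; simpl; unfold mult; simpl. ring.
 - rewrite (RInt_plus (V := RC)); [unfold plus; simpl; rewrite IH; auto | apply ex_RInt_rsum; auto | auto].
Qed.

Lemma cont_zeta_line x t : x <> 1 -> cont_at dR (fun t => zeta (pt x t)) t.
Proof.
 intros Hx. apply (cont_comp dR zeta (fun t => pt x t)).
 - fin.
 - apply hol_cont, hol_zeta. intro E. apply Hx. apply (f_equal Re) in E. exact E.
Qed.

Lemma zeta_moment : exists B, 0 <= B /\ forall v, 1 <= v ->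
 RInt (fun t => Cmod (zeta (pt sg t))^(2*k)) (v^3) (2*v^3) <= B*exp ((3 + 4*INR k*eta + 2*eps)*ln v).
Proof.
 note k_bounds as Kb. note sg_bounds as Sb.
 destruct block_moment_bound as [B [HB H]].
 (* There are [O(ln v)] blocks, bounded by [A*exp (eps/13*ln v)]; splitting into blocks costs the
    power [2k + 1 <= 13] of their number. *)
 set (c := 13/eps). set (A := 1 + 9*(c + 1)).
 assert (Hc : 0 < c) by (apply Rdiv_lt_0_compat; lra).
 exists (2^13*(20^12 + A^13*B)). split.
 { assert (0 <= A^13) by (apply pow_le; unfold A; lra). nra. }
 intros v Hv. set (lv := ln v).
 assert (Hlv : 0 <= lv) by (unfold lv; rewrite <- ln_1; apply ln_le; lra).
 destruct (dyadic_exponent (exp (9/2*lv))) as [J [HJ HJ1]]; [rewrite <- exp_0; apply exp_le; lra|].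
 assert (Hv3 : 0 < v^3) by fin.
 assert (HJb : INR J <= 1 + 9*lv).
 { assert (L : INR J*ln 2 <= ln 2 + 9/2*lv). { rewrite <- ln_pow by lra. le (ln (2*exp (9/2*lv))); [apply ln_le; [lra | lra]|].
   rewrite ln_mult, ln_exp by lra. lra. }
  note ln_lt_2. nra. }
 assert (HJ2 : INR J <= A*exp (eps/13*lv)).
 { note (exp_ineq1_le (eps/13*lv)) as X.
  assert (lv <= c*exp (eps/13*lv)). { replace lv with (c*(eps/13*lv)) at 1 by (unfold c; field; lra). fin. } unfold A. nra. }
 set (b := fun j t => Cmod (block sg (2^j) t)).
 assert (Hpow1 : forall j, (1 <= 2^j)%nat) by (intro j; assert (2^j <> 0)%nat by (apply Nat.pow_nonzero; lia); lia).
 assert (bex : forall j, ex_RInt (fun t => b j t^(2*k)) (v^3) (2*v^3)) by (intro j; apply block_cont_int; auto; lra).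
 assert (Pt : forall t, v^3 <= t <= 2*v^3 -> Cmod (zeta (pt sg t))^(2*k) <= 2^12*(20^12 + INR J^(2*k)*rsum (fun j => b j t^(2*k)) J)).
 { intros t Ht. note (zeta_by_blocks v t J Hv Ht HJ HJ1) as Z.
  set (y := rsum (fun j => Cmod (block sg (2^j) t)) J) in *.
  assert (Hy : 0 <= y) by (apply rsum_pos; intros; apply Cmod_ge_0).
  assert (PM := rsum_power_mean (fun j => b j t) J (2*k) (fun j => Cmod_ge_0 _)).
  replace (Nat.eqb J 0) with false in PM by (symmetry; apply Nat.eqb_neq; lia). rewrite Rplus_0_r in PM.
  le ((20 + y)^(2*k)); [fin|].
  le (2^(2*k)*(20^(2*k) + y^(2*k))).
  - rewrite Rmult_plus_distr_l, <- !Rpow_mult_distr. assert (0 <= (2*20)^(2*k)) by fin. assert (0 <= (2*y)^(2*k)) by fin.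
   destruct (Rle_dec y 20).
   + assert ((20 + y)^(2*k) <= (2*20)^(2*k)) by fin. lra.
   + assert ((20 + y)^(2*k) <= (2*y)^(2*k)) by fin. lra.
  - assert (0 <= y^(2*k)) by fin. assert (0 <= 20^(2*k)) by fin.
   apply Rmult_le_compat; [fin | lra | apply Rle_pow; [lra | lia] |].
   apply Rplus_le_compat; [apply Rle_pow; [lra | lia] | auto]. }
 assert (Hsum : rsum (fun j => RInt (fun t => b j t^(2*k)) (v^3) (2*v^3)) J <= INR J*(B*exp ((3 + 4*INR k*eta + eps)*lv))).
 { rewrite <- rsum_const. apply rsum_le. intros j Hj. apply H; auto.
  rewrite pow_INR. le (2^J); [apply Rle_pow; [lra | lia] | apply HJ]. }
 assert (EXR : ex_RInt (fun t => 2^12*(20^12 + INR J^(2*k)*rsum (fun j => b j t^(2*k)) J)) (v^3) (2*v^3)).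
 { apply (ex_RInt_scal (V := RN) (fun t => 20^12 + INR J^(2*k)*rsum (fun j => b j t^(2*k)) J)).
  apply (ex_RInt_plus (V := RN) (fun _ => 20^12)); [fin|].
  apply (ex_RInt_scal (V := RN) (fun t => rsum (fun j => b j t^(2*k)) J)). apply ex_RInt_rsum; auto. }
 le (RInt (fun t => 2^12*(20^12 + INR J^(2*k)*rsum (fun j => b j t^(2*k)) J)) (v^3) (2*v^3)).
 - apply RInt_le; auto; [lra | | fin].
  apply contR_ex_RInt; [lra|]. intros t _. apply (contR_pow (fun t => Cmod (zeta (pt sg t)))). apply cont_Cmod, cont_zeta_line. lra.
 - replace (RInt (fun t => 2^12*(20^12 + INR J^(2*k)*rsum (fun j => b j t^(2*k)) J)) (v^3) (2*v^3))
   with (2^12*(v^3*20^12 + INR J^(2*k)*rsum (fun j => RInt (fun t => b j t^(2*k)) (v^3) (2*v^3)) J)).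
  2:{ rewrite <- RInt_rsum by auto. symmetry. apply is_RInt_unique.
    apply (is_RInt_scal (V := RN) (fun t => 20^12 + INR J^(2*k)*rsum (fun j => b j t^(2*k)) J)).
    apply (is_RInt_plus (V := RN) (fun _ => 20^12)).
    - replace (v^3) with (2*v^3 - v^3) at 3 by ring. apply (is_RInt_const (V := RN)).
    - apply (is_RInt_scal (V := RN) (fun t => rsum (fun j => b j t^(2*k)) J)). apply (RInt_correct (V := RC)). apply ex_RInt_rsum; auto. }
  assert (Ev3 : v^3 <= exp ((3 + 4*INR k*eta + 2*eps)*lv)).
  { rewrite pow_exp_ln by lra. fold lv. replace (INR 3) with 3 by (unfold INR; ring). apply exp_le. assert (0 <= INR k*eta) by nra. nra. }
  assert (HJp : INR J^(2*k)*INR J <= A^13*exp (eps*lv)).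
  { replace (INR J^(2*k)*INR J) with (INR J^(2*k + 1)) by (rewrite pow_add; simpl; ring).
   assert (1 <= INR J) by (change 1 with (INR 1); apply le_INR; auto).
   le (INR J^13); [apply Rle_pow; [auto | lia]|].
   le ((A*exp (eps/13*lv))^13); [fin|]. rewrite Rpow_mult_distr, exp_pow. right. do 2 f_equal. unfold INR. field. }
  set (E := exp ((3 + 4*INR k*eta + 2*eps)*lv)) in *.
  assert (EE : exp (eps*lv)*exp ((3 + 4*INR k*eta + eps)*lv) = E) by (unfold E; rewrite <- exp_plus; f_equal; ring).
  assert (I2 : INR J^(2*k)*rsum (fun j => RInt (fun t => b j t^(2*k)) (v^3) (2*v^3)) J <= A^13*B*E).
  { le (INR J^(2*k)*(INR J*(B*exp ((3 + 4*INR k*eta + eps)*lv)))); [fin|].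
   replace (INR J^(2*k)*(INR J*(B*exp ((3 + 4*INR k*eta + eps)*lv)))) with ((INR J^(2*k)*INR J)*(B*exp ((3 + 4*INR k*eta + eps)*lv))) by ring.
   le (A^13*exp (eps*lv)*(B*exp ((3 + 4*INR k*eta + eps)*lv))).
   - mul_r; auto. apply Rmult_le_pos; auto. left; apply exp_pos.
   - nra. }
  assert (X : 0 <= 20^12*E + A^13*B*E). { apply Rplus_le_le_0_compat; [nra|]. apply Rmult_le_pos; [|lra]. apply Rmult_le_pos; auto. apply pow_le; unfold A; lra. }
  lra.
Qed.

End Moment.

#[export] Hint Resolve cont_zeta_line : an.

(** * Mellin integrals *)

Lemma Cmod_scal_line w t : 0 <= t <= 1 -> Cmod (line 0 w t) <= Cmod w.
Proof.
 intros Ht. replace (line 0 w t) with (RtoC t*w)%C by ceq.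
 rewrite Cmod_mult, Cmod_R, Rabs_pos_eq by lra. note (Cmod_ge_0 w). nra.
Qed.

Lemma Cexp_sub1_bound w : Cmod (Cexp w - 1)%C <= Cmod w*exp (Cmod w).
Proof.
 replace (Cexp w - 1)%C with (Seg Cexp 0 w).
 - replace (Cmod w) with (Cmod (w - 0)%C) at 1 by (f_equal; ring). apply Seg_bound.
  + intros t _. fin.
  + intros t Ht. rewrite Cmod_Cexp.
   assert (K : Re (line 0 w t) <= Cmod w) by (ele; [apply Re_le_Cmod | apply Cmod_scal_line; auto]).
   destruct K as [K|K]; [left; apply exp_increasing; auto | rewrite K; lra].
 - rewrite (Seg_primitive Cexp Cexp), Cexp_0; auto.
  + intros t _. fin.
  + intros t _. apply cder_Cexp.
Qed.

Lemma Cexp_taylor w : Cmod (Cexp w - 1 - w)%C <= Cmod w*(Cmod w*exp (Cmod w)).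
Proof.
 assert (Hd : forall z, cder (fun z => Cexp z - z)%C z (Cexp z - 1)%C).
 { intros z. apply (cder_plus Cexp (fun z => - z)%C); [apply cder_Cexp|].
  assert (K := cder_mult (fun _ => RtoC (-1)) (fun z => z) z _ _ (cder_const _ z) (cder_id z)).
  eapply cder_ext_loc in K. 2:{ exists 1. split; [lra|]. intros u _. instantiate (1 := fun z => (- z)%C). ceq. }
  eapply (fun e => eq_ind _ (cder _ z) K _ e). ceq. }
 assert (Hc : forall t, cont_at dC (fun z => Cexp z - 1)%C (line 0 w t)).
 { fin. }
 replace (Cexp w - 1 - w)%C with (Seg (fun z => Cexp z - 1)%C 0 w).
 - replace (Cmod w) with (Cmod (w - 0)%C) at 1 by (f_equal; ring). apply Seg_bound.
  + intros t _. auto.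
  + intros t Ht. ub Cexp_sub1_bound. note (Cmod_scal_line w t Ht) as K.
   apply Rmult_le_compat; auto; [fin | fin |].
   destruct K as [K|K]; [left; apply exp_increasing; auto | rewrite K; lra].
 - rewrite (Seg_primitive (fun z => Cexp z - z)%C); [rewrite Cexp_0; ring | intros t _; auto | auto].
Qed.

(** Differentiation under the integral sign. The error of [Cexp_taylor] is quadratic in the
    increment, uniformly for [t] in the compact interval. *)
Lemma cder_CI_exp (g phi : R -> C) a b s : a <= b -> contI g a b -> contI phi a b ->
 cder (fun s => CI (fun t => g t*Cexp (phi t*s))%C a b) s (CI (fun t => g t*phi t*Cexp (phi t*s))%C a b).
Proof.
 intros Hab Hg Hp.
 assert (Hc : forall z, contI (fun t => Cexp (phi t*z))%C a b).
 { intros z t Ht. apply (cont_comp _ Cexp); [fin | fin]. }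
 destruct (contI_bounded g a b Hab Hg) as [M HM]. destruct (contI_bounded phi a b Hab Hp) as [P HP].
 assert (M0 : 0 <= M) by (ele; [apply Cmod_ge_0 | apply (HM a); lra]).
 assert (P0 : 0 <= P) by (ele; [apply Cmod_ge_0 | apply (HP a); lra]).
 set (K := M*exp (P*Cmod s)*(P*(P*exp P))).
 assert (K0 : 0 <= K). { unfold K. fin. }
 apply cder_eps. intros eps He.
 assert (D : 0 < (b - a)*K + 1) by nra.
 exists (Rmin 1 (eps/((b - a)*K + 1))). split.
 { fin. }
 intros w Hw. set (h := (w - s)%C) in *.
 assert (H1 : Cmod h <= 1) by (note (Rmin_l 1 (eps/((b - a)*K + 1))); lra).
 assert (H2 : Cmod h*((b - a)*K + 1) <= eps).
 { note (Rmin_r 1 (eps/((b - a)*K + 1))). le (eps/((b - a)*K + 1)*((b - a)*K + 1)); [fin | right; field; lra]. }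
 note (Cmod_ge_0 h) as Hh.
 replace (_ - _ - _)%C with (CI (fun t => g t*Cexp (phi t*s)*(Cexp (phi t*h) - 1 - phi t*h))%C a b).
 - ub (CI_bound _ a b (K*(Cmod h*Cmod h))); auto.
  + intros t Ht. apply cont_mult; [apply cont_mult; [apply Hg | apply Hc]; auto|].
   apply cont_minus; [apply cont_minus; [apply Hc; auto | apply cont_const] | apply cont_mult; [apply Hp; auto | apply cont_const]].
  + intros t Ht. rewrite !Cmod_mult, Cmod_Cexp. specialize (HP t Ht). note (Cmod_ge_0 s).
   assert (E1 : exp (Re (phi t*s)%C) <= exp (P*Cmod s)).
   { assert (Q : Re (phi t*s)%C <= P*Cmod s) by (ub Re_le_Cmod; rewrite Cmod_mult; nra).
    destruct Q as [Q|Q]; [left; apply exp_increasing; auto | rewrite Q; lra]. }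
   assert (E2 : Cmod (phi t*h)%C <= P*Cmod h) by (rewrite Cmod_mult; nra).
   assert (E3 : exp (Cmod (phi t*h)%C) <= exp P).
   { assert (Q : Cmod (phi t*h)%C <= P) by nra. destruct Q as [Q|Q]; [left; apply exp_increasing; auto | rewrite Q; lra]. }
   assert (E4 : Cmod (Cexp (phi t*h) - 1 - phi t*h)%C <= P*Cmod h*(P*Cmod h*exp P)).
   { ub Cexp_taylor. note (Cmod_ge_0 (phi t*h)%C). note (exp_pos (Cmod (phi t*h)%C)).
    apply Rmult_le_compat; [auto | nra | auto |]. apply Rmult_le_compat; lra. }
   unfold K. replace (M*exp (P*Cmod s)*(P*(P*exp P))*(Cmod h*Cmod h)) with (M*exp (P*Cmod s)*(P*Cmod h*(P*Cmod h*exp P))) by ring.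
   apply Rmult_le_compat; [apply Rmult_le_pos; [apply Cmod_ge_0 | left; apply exp_pos] | apply Cmod_ge_0 | | auto].
   apply Rmult_le_compat; [apply Cmod_ge_0 | left; apply exp_pos | auto | auto].
  + nra.
 - assert (Hgs : contI (fun t => g t*Cexp (phi t*s))%C a b) by (intros t Ht; apply cont_mult; [fin | apply Hc]; auto).
  assert (Hgw : contI (fun t => g t*Cexp (phi t*w))%C a b) by (intros t Ht; apply cont_mult; [fin | apply Hc]; auto).
  assert (Hd : contI (fun t => g t*phi t*Cexp (phi t*s))%C a b) by (intros t Ht; apply cont_mult; [fin | apply Hc]; auto).
  rewrite (Cmult_comm (CI _ a b) h), <- (CI_cmult h), <- CI_minus, <- CI_minus; auto.
  + apply CI_ext; auto. intros t Ht. replace (phi t*w)%C with (phi t*s + phi t*h)%C by (unfold h; ring). rewrite Cexp_plus. ring.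
  + fin.
  + fin.
Qed.

Lemma is_derive_Rpower y x : 0 < x -> is_derive (fun u => Rpower u y) x (y*Rpower x (y - 1)).
Proof. intros. apply is_derive_Reals, derivable_pt_lim_power; auto. Qed.

Lemma cont_Rpower y x : 0 < x -> cont_at dR (fun u => RtoC (Rpower u y)) x.
Proof. intros H. apply contR_continuous. apply (ex_derive_continuous (fun u => Rpower u y)). eexists. apply is_derive_Rpower; auto. Qed.

Lemma is_RInt_Rpower K r a b : 0 < a <= b -> r <> 0 ->
 is_RInt (fun w => K*Rpower w (- (1 + r))) a b (K*((Rpower a (- r) - Rpower b (- r))/r)).
Proof.
 intros Hab Hr.
 replace (K*_) with (minus (- (K/r)*Rpower b (- r)) (- (K/r)*Rpower a (- r))) by (unfold minus, plus, opp; simpl; field; auto).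
 apply (is_RInt_derive (V := RC) (fun w => - (K/r)*Rpower w (- r))).
 - intros x Hx. rewrite Rmin_left, Rmax_right in Hx by lra.
  replace (K*Rpower x (- (1 + r))) with (scal (- (K/r)) (- r*Rpower x (- r - 1))).
  + apply (is_derive_scal (fun w => Rpower w (- r))). apply is_derive_Rpower; lra.
  + unfold scal; simpl; unfold mult; simpl. replace (- r - 1) with (- (1 + r)) by ring. field; auto.
 - intros x Hx. rewrite Rmin_left, Rmax_right in Hx by lra.
  apply (continuous_mult (fun _ => K)); [apply continuous_const|]. apply contR_continuous, cont_Rpower; lra.
Qed.

Lemma CI_power_bound f K r a b : 0 < a <= b -> r <> 0 -> contI f a b ->
 (forall w, a <= w <= b -> Cmod (f w) <= K*Rpower w (- (1 + r))) ->
 Cmod (CI f a b) <= K*((Rpower a (- r) - Rpower b (- r))/r).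
Proof.
 intros Hab Hr Hc Hb. assert (I := is_RInt_Rpower K r a b Hab Hr).
 rewrite <- (is_RInt_unique _ _ _ _ I). apply CI_le; auto; [lra | eexists; exact I].
Qed.

Lemma cont_ln x : 0 < x -> cont_at dR (fun u => RtoC (ln u)) x.
Proof. intros H. apply contR_continuous. apply (ex_derive_continuous ln). eexists. apply is_derive_Reals, derivable_pt_lim_ln; auto. Qed.

Lemma cont_Rcpow_base s x : 0 < x -> cont_at dR (fun u => Rcpow u s) x.
Proof. intros H. exact (rder_cont _ _ _ (rder_Rcpow s x H)). Qed.

Lemma hol_CI_Rcpow (h : R -> C) (c : C) a b s : 0 < a <= b -> contI h a b ->
 hol (fun s => CI (fun w => h w*Rcpow w (c*s))%C a b) s.
Proof.
 intros Hab Hh. assert (K := cder_CI_exp h (fun w => c*RtoC (ln w))%C a b s __ Hh).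
 eexists. eapply cder_ext_loc; [|apply K].
 - exists 1. split; [lra|]. intros z _. apply CI_ext; [lra|]. intros t Ht. unfold Rcpow. do 2 f_equal. ring.
 - intros t Ht. apply cont_mult; [fin | apply cont_ln; lra].
Qed.

Lemma Rpower_anti_base x y r : 0 < x <= y -> 0 <= r -> Rpower y (- r) <= Rpower x (- r).
Proof.
 intros H Hr. rewrite !Rpower_Ropp. fin.
Qed.

(** The integral to infinity is cut at the integers into a series of holomorphic functions, so that
    [weierstrass] yields holomorphy. The second clause is the truncation error. *)
Lemma tail_integral (h : R -> C) beta K : 0 <= K -> (forall w, 1 <= w -> cont_at dR h w) ->
 (forall w, 1 <= w -> Cmod (h w) <= K*Rpower w (- beta)) ->
 exists T : C -> C, (forall s, 1 - beta < Re s -> hol T s) /\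
 forall s b, 1 - beta < Re s -> 1 <= b ->
  Cmod (T s - CI (fun w => h w*Rcpow w (-(1)*s))%C 1 b)%C <= K*Rpower b (- (beta + Re s - 1))/(beta + Re s - 1).
Proof.
 intros HK Hc Hb.
 assert (Hci : forall s a b, 1 <= a -> contI (fun w => h w*Rcpow w (-(1)*s))%C a b).
 { intros s a b Ha t Ht. apply cont_mult; [fin | apply cont_Rcpow_base; lra]. }
 assert (Hbd : forall s w, 1 <= w -> Cmod (h w*Rcpow w (-(1)*s))%C <= K*Rpower w (- (1 + (beta + Re s - 1)))).
 { intros s w Hw. rewrite Cmod_mult, Cmod_Rcpow by lra. replace (Re (-(1)*s)%C) with (- Re s) by (unfold Re; simpl; ring).
  replace (- (1 + (beta + Re s - 1))) with (- beta + - Re s) by ring. rewrite Rpower_plus, <- Rmult_assoc.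
  fin. }
 set (a := fun s n => CI (fun w => h w*Rcpow w (-(1)*s))%C (INR (S n)) (INR (S (S n)))).
 assert (Ha : forall s r n, 0 < r <= beta + Re s - 1 -> Cmod (a s n) <= K*Rpower (INR (S n)) (- (1 + r))).
 { intros s r n Hr. note (INR_S_ge1 n).
  ub (CI_bound _ _ _ (K*Rpower (INR (S n)) (- (1 + r)))).
  - rewrite (S_INR (S n)); lra.
  - fin.
  - intros t Ht. ele; [apply Hbd; lra|]. mul_l; auto.
   ele; [apply Rpower_anti_base; [|lra]; split; [|apply (proj1 Ht)]; lra|]. apply Rpower_le_base1; lra.
  - rewrite (S_INR (S n)). lra. }
 assert (Hs : forall s N, csum (a s) N = CI (fun w => h w*Rcpow w (-(1)*s))%C 1 (INR (S N))).
 { intros s N. induction N as [|N IH].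
  - symmetry. apply CI_unique. apply (is_RInt_point (V := CN)).
  - simpl csum. rewrite IH. unfold a. note (INR_S_ge1 N). rewrite CI_Chasles; auto; [rewrite (S_INR (S N)); lra | fin]. }
 set (T := fun s => epsilon (inhabits (RtoC 0)) (ser (a s))).
 assert (HT : forall s, 1 - beta < Re s -> ser (a s) (T s)).
 { intros s H. apply epsilon_spec. apply (ser_ex _ (fun n => K*Rpower (INR (S n)) (- (1 + (beta + Re s - 1))))).
  - fin.
  - apply rbounded_scal; auto. apply rbounded_power; lra. }
 exists T. split.
 - intros s H. set (r := (beta + Re s - 1)/2). assert (Hr : 0 < r) by (unfold r; lra).
  apply (weierstrass (fun n s => a s n) T (fun n => K*Rpower (INR (S n)) (- (1 + r))) s r); auto.
  + intros n z Hz. unfold a. apply hol_CI_Rcpow; [|intros t Ht; apply Hc; note (INR_S_ge1 n); lra].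
   note (INR_S_ge1 n). rewrite (S_INR (S n)). lra.
  + intros n z Hz. apply Ha. apply Re_disc in Hz. unfold r in *; lra.
  + apply rbounded_scal; auto. apply rbounded_power; auto.
  + intros z Hz. apply HT. apply Re_disc in Hz. unfold r in *; lra.
 - intros s b H Hb1. set (r := beta + Re s - 1). assert (Hr : 0 < r) by (unfold r; lra).
  apply le_epsilon. intros eps He. destruct (HT s H eps He) as [N HN].
  destruct (nfloor_ex b __) as [m [_ Hm]].
  set (n := max N m). specialize (HN n ltac:(unfold n; lia)). rewrite Hs in HN.
  assert (Hbn : b <= INR (S n)). { rewrite S_INR. assert (INR m <= INR n) by (apply le_INR; unfold n; lia). lra. }
  rewrite Cmod_sub_sym in HN.
  rewrite <- (CI_Chasles _ 1 b (INR (S n))) in HN; [|auto|auto|fin].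
  set (u := CI _ b (INR (S n))) in HN.
  assert (Hu : Cmod u <= K*Rpower b (- r)/r).
  { ele; [apply (CI_power_bound _ K r); [lra | lra | fin |]|].
   - fin.
   - unfold Rdiv. rewrite Rmult_assoc. mul_l; auto. mul_r; [fin|].
    note (Rpower_pos (INR (S n)) (- r)). lra. }
  match goal with |- Cmod (T s - ?v)%C <= _ => replace (T s - v)%C with ((T s - (v + u)) + u)%C by ring end.
  ub Cmod_triangle. lra.
Qed.

#[export] Hint Resolve cont_Rpower cont_ln cont_Rcpow_base : an.

(** * A Fourier series *)

Lemma derive_dominated (f g f' g' : R -> R) a b : a <= b -> (forall x, a <= x <= b -> is_derive f x (f' x)) ->
 (forall x, a <= x <= b -> is_derive g x (g' x)) -> (forall x, a <= x <= b -> Rabs (f' x) <= g' x) ->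
 Rabs (f b - f a) <= g b - g a.
Proof.
 intros Hab Hf Hg H.
 assert (Mono : forall k k', (forall x, a <= x <= b -> is_derive k x (k' x)) -> (forall x, a <= x <= b -> 0 <= k' x) -> k a <= k b).
 { intros k k' Hk H0. destruct (MVT_gen k a b k') as [c [Hc E]]; rewrite ?Rmin_left, ?Rmax_right in*by lra.
  - fin.
  - intros x Hx. apply derivable_continuous_pt. exists (k' x). apply is_derive_Reals, Hk; lra.
  - specialize (H0 c Hc). nra. }
 assert (H1 := Mono (fun x => g x - f x) (fun x => g' x - f' x)). assert (H2 := Mono (fun x => g x + f x) (fun x => g' x + f' x)).
 apply Rabs_le. split.
 - assert (g a + f a <= g b + f b); [|lra]. apply H2.
  + intros x Hx. apply (is_derive_plus (V := RN)); auto.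
  + intros x Hx. specialize (H x Hx). abs_in H. lra.
 - assert (g a - f a <= g b - f b); [|lra]. apply H1.
  + intros x Hx. apply (is_derive_minus (V := RN)); auto.
  + intros x Hx. specialize (H x Hx). abs_in H. lra.
Qed.

Lemma is_derive_rsum (a : nat -> R -> R) (a' : nat -> R) n x : (forall i, is_derive (a i) x (a' i)) ->
 is_derive (fun x => rsum (fun i => a i x) n) x (rsum a' n).
Proof.
 intros H. induction n as [|n IH]; simpl; [apply (is_derive_const (V := RN) 0)|].
 apply (is_derive_plus (V := RN)); auto.
Qed.

Lemma sin_INR_PI n : sin (INR n*PI) = 0.
Proof. apply sin_eq_0_1. exists (Z.of_nat n). rewrite INR_IZR_INZ. auto. Qed.

(** Normalised so that the sum of [hwave (m*u)/m^2] over [m >= 1] is [u(1 - u)/2] on [[0, 1]]. *)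
Definition hwave (v : R) : R := (1 - cos (2*PI*v))/(2*(PI*PI)).

Definition fourier (M : nat) (u : R) : R := rsum (fun i => hwave (INR (S i)*u)/(INR (S i)*INR (S i))) M.

Definition fourier' (M : nat) (u : R) : R := rsum (fun i => sin (2*PI*(INR (S i)*u))/(PI*INR (S i))) M.

Lemma fourier_derive M u : is_derive (fourier M) u (fourier' M u).
Proof.
 apply is_derive_rsum. intros i. unfold hwave. note (INR_S_pos i). note PI_RGT_0. auto_derive; [auto|]. field. lra.
Qed.

Lemma fourier'_derive M u : is_derive (fourier' M) u (rsum (fun i => 2*cos (2*PI*(INR (S i)*u))) M).
Proof. apply is_derive_rsum. intros i. note (INR_S_pos i). note PI_RGT_0. auto_derive; [auto|]. field. lra. Qed.

Lemma dirichlet_kernel M u : (1 + rsum (fun i => 2*cos (2*PI*(INR (S i)*u))) M)*sin (PI*u) = sin ((2*INR M + 1)*(PI*u)).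
Proof.
 induction M as [|M IH]; [rewrite INR_0; simpl; rewrite Rplus_0_r, Rmult_1_l; f_equal; ring|].
 cbn [rsum]. rewrite <- Rplus_assoc, Rmult_plus_distr_r, IH. rewrite !S_INR.
 replace ((2*INR M + 1)*(PI*u)) with (2*PI*((INR M + 1)*u) - PI*u) by ring.
 replace ((2*(INR M + 1) + 1)*(PI*u)) with (2*PI*((INR M + 1)*u) + PI*u) by ring.
 rewrite sin_minus, sin_plus. ring.
Qed.

Lemma sinPI_lower v : 0 < v <= 1/2 -> v <= sin (PI*v) /\ 0 < sin (PI*v).
Proof.
 intros H. assert (3 < PI) by (note PI2_3_2; unfold PI2 in *; lra).
 note (sin_lower (PI*v)) as K. nra.
Qed.

(* The derivative of the left hand side is the Dirichlet kernel, integrated by parts down from 1/2. *)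
Lemma fourier'_bound M v : 0 < v <= 1/2 -> Rabs (fourier' M v - (1 - 2*v)/2) <= 1/((2*INR M + 1)*v).
Proof.
 intros Hv. note PI_gt_3 as H3.
 set (N := 2*INR M + 1). assert (HN : 1 <= N) by (unfold N; note (pos_INR M); lra).
 destruct (sinPI_lower v Hv) as [Sv Sp].
 set (w := fun v => (fourier' M v - (1 - 2*v)/2) + cos (N*(PI*v))/(N*PI*sin (PI*v))).
 assert (B : Rabs (w (1/2) - w v) <= - / (N*PI*sin (PI*(1/2))) - - / (N*PI*sin (PI*v))).
 { apply (derive_dominated w (fun v => - / (N*PI*sin (PI*v))) (fun v => - (cos (N*(PI*v))*cos (PI*v)/(N*(sin (PI*v)*sin (PI*v)))))
   (fun v => cos (PI*v)/(N*(sin (PI*v)*sin (PI*v))))); [lra | | |].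
  - intros x Hx. destruct (sinPI_lower x __) as [_ Sx]. unfold w.
   assert (D := dirichlet_kernel M x). fold N in D.
   assert (D1 := fourier'_derive M x). set (S := rsum _ M) in *.
   assert (D2 : is_derive (fun v => - ((1 - 2*v)/2) + cos (N*(PI*v))/(N*PI*sin (PI*v))) x
    (1 + (- (sin (N*(PI*x))/sin (PI*x)) - cos (N*(PI*x))*cos (PI*x)/(N*(sin (PI*x)*sin (PI*x)))))).
   { auto_derive; [|(field; lra)]. fin. }
   assert (D3 := is_derive_plus (V := RN) _ _ _ _ _ D1 D2). unfold plus in D3; simpl in D3.
   eapply is_derive_ext; [|eapply (fun e => eq_ind _ (is_derive _ x) D3 _ e)].
   + intros y. lra.
   + rewrite <- D. unfold Rdiv. rewrite (Rmult_assoc (1 + S)), Rinv_r by lra. lra.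
  - intros x Hx. destruct (sinPI_lower x __) as [_ Sx]. auto_derive; [|(field; lra)].
   fin.
  - intros x Hx. destruct (sinPI_lower x __) as [_ Sx].
   assert (C0 : 0 <= cos (PI*x)) by (apply cos_ge_0; nra).
   unfold Rdiv. rewrite Rabs_Ropp, !Rabs_mult, (Rabs_pos_eq (cos (PI*x))) by auto.
   assert (P : 0 < / (N*(sin (PI*x)*sin (PI*x)))) by fin.
   rewrite (Rabs_pos_eq (/ _)) by lra. mul_r; [lra|].
   assert (Rabs (cos (N*(PI*x))) <= 1) by (apply Rabs_le, COS_bound). nra. }
 assert (W0 : w (1/2) = 0).
 { unfold w. replace (N*(PI*(1/2))) with (INR M*PI + PI/2) by (unfold N; field).
  rewrite cos_plus, cos_PI2, sin_PI2, sin_INR_PI. replace (fourier' M (1/2)) with 0; [lra|].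
  unfold fourier'. rewrite (rsum_ext _ (fun _ => 0)); [rewrite rsum_const; ring|]. intros i _.
  replace (2*PI*(INR (S i)*(1/2))) with (INR (S i)*PI) by field. rewrite sin_INR_PI. lra. }
 rewrite W0 in B. replace (PI*(1/2)) with (PI/2) in B by field. rewrite sin_PI2 in B.
 assert (Q : 0 < / (N*PI*sin (PI*v))) by fin.
 assert (Q1 : 0 < / (N*PI*1)) by fin.
 assert (E : Rabs (cos (N*(PI*v))/(N*PI*sin (PI*v))) <= / (N*PI*sin (PI*v))).
 { unfold Rdiv. rewrite Rabs_mult, (Rabs_pos_eq (/ _)) by lra.
  assert (Rabs (cos (N*(PI*v))) <= 1) by (apply Rabs_le, COS_bound). nra. }
 replace (fourier' M v - (1 - 2*v)/2) with (- (0 - w v) - cos (N*(PI*v))/(N*PI*sin (PI*v))) by (unfold w; ring).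
 ub Rabs_triang. rewrite !Rabs_Ropp.
 le (2*/ (N*PI*sin (PI*v))); [lra|].
 le (2*/ (N*2*v)); [|right; field; lra].
 fin.
Qed.

Lemma hwave_bound v : 0 <= hwave v <= 1 /\ hwave v <= v*v.
Proof. note PI_gt_3 as H3. unfold hwave.
 destruct (one_minus_cos_le (2*PI*v)) as [H1 H2]. note (COS_bound (2*PI*v)).
 assert (P : 0 < 2*(PI*PI)) by nra. repeat split.
 - fin.
 - apply Rmult_le_reg_r with (2*(PI*PI)); auto. unfold Rdiv. rewrite Rmult_assoc, Rinv_l by lra. nra.
 - apply Rmult_le_reg_r with (2*(PI*PI)); auto. unfold Rdiv. rewrite Rmult_assoc, Rinv_l by lra. nra.
Qed.

(** As [hwave v] is at most 1 and at most [v^2], it is at most [2 v^2/(1 + v^2)], and the sum is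
    controlled by [lorentz_sum] with step [u]. *)
Lemma fourier_small M u : 0 < u <= 1 -> 0 <= fourier M u <= 18*u.
Proof.
 intros Hu. split.
 - apply rsum_pos. intros i _. destruct (hwave_bound (INR (S i)*u)) as [[? _] _].
  fin.
 - le (2*(u*u)*rsum (fun m => / (1 + (u*(INR 0 - INR m))*(u*(INR 0 - INR m)))) (1 + M)).
  + rewrite rsum_split, Rmult_plus_distr_l.
   le (2*(u*u)*rsum (fun i => / (1 + (u*(INR 0 - INR (1 + i)))*(u*(INR 0 - INR (1 + i))))) M).
   * rewrite <- rsum_mult. apply rsum_le. intros i _. change (1 + i)%nat with (S i). rewrite INR_0. note (INR_S_pos i) as Hm. set (m := INR (S i)) in *.
    destruct (hwave_bound (m*u)) as [[H0 H1] H2].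
    set (y := m*u*(m*u)) in *.
    assert (Hh : hwave (m*u) <= 2*y/(1 + y)).
    { apply Rmult_le_reg_r with (1 + y); [lra|]. replace (2*y/(1 + y)*(1 + y)) with (2*y) by fld. nra. }
    le (2*y/(1 + y)/(m*m)).
    -- mul_r; auto. fin.
    -- right. unfold y. field. nra.
   * simpl rsum. rewrite INR_0. assert (0 <= 2*(u*u)*(0 + / (1 + u*(0 - 0)*(u*(0 - 0))))); [|lra].
    fin.
  + note (lorentz_sum u 0 (1 + M) __) as L.
   le (2*(u*u)*(1 + 8/u)); [nra|].
   replace (2*(u*u)*(1 + 8/u)) with (2*(u*u) + 16*u) by fld. nra.
Qed.

(** Up to [1/K] the estimate [O(u)] already suffices. Beyond, [fourier'_bound] with [K*K] terms
    bounds the derivative of the error by [1/K]. *)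
Lemma fourier_half K u : (2 <= K)%nat -> 0 <= u <= 1/2 ->
 Rabs (fourier (K*K) u - u*(1 - u)/2) <= 20*u /\ Rabs (fourier (K*K) u - u*(1 - u)/2) <= 20/INR K.
Proof.
 intros HK Hu. assert (HK2 : 2 <= INR K) by (replace 2 with (INR 2) by fin; apply le_INR; auto).
 set (M := (K*K)%nat). assert (EM : INR M = INR K*INR K) by (unfold M; apply mult_INR).
 assert (S0 : forall v, 0 <= v <= 1/2 -> Rabs (fourier M v - v*(1 - v)/2) <= 19*v).
 { intros v [[Hv| <-] Hv2].
  - destruct (fourier_small M v __). apply Rabs_le. nra.
  - replace (fourier M 0) with 0; [rewrite Rmult_0_l; unfold Rdiv; rewrite Rmult_0_l, Rminus_0_r, Rabs_R0; lra|].
   unfold fourier. rewrite (rsum_ext _ (fun _ => 0)); [rewrite rsum_const; ring|]. intros i _. unfold hwave. rewrite !Rmult_0_r, cos_0. lra. }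
 note (S0 u Hu) as Su. split; [lra|].
 assert (HiK : 0 < / INR K <= 1/2). { split; [fin|]. replace (1/2) with (/ 2) by field. fin. }
 assert (IK : / INR K*INR K = 1) by fld.
 destruct (Rle_dec u (/ INR K)) as [Hk|Hk]; [lra|].
 assert (D : Rabs ((fourier M u - u*(1 - u)/2) - (fourier M (/ INR K) - / INR K*(1 - / INR K)/2)) <= 1/INR K*u - 1/INR K*/ INR K).
 { apply (derive_dominated (fun u => fourier M u - u*(1 - u)/2) (fun u => 1/INR K*u) (fun u => fourier' M u - (1 - 2*u)/2) (fun _ => 1/INR K)); [lra | | |].
  - intros x Hx. apply (is_derive_minus (V := RN)); [apply fourier_derive|]. auto_derive; [auto|field].
  - intros x Hx. auto_derive; [auto|]. ring.
  - intros x Hx. ele; [apply fourier'_bound; lra|]. mul_l; [lra|].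
   apply Rinv_le_contravar; [lra|]. nra. }
 specialize (S0 (/ INR K) __).
 match type of D with Rabs (?a - ?b) <= _ => assert (Rabs a <= Rabs b + Rabs (a - b)) by (replace a with (b + (a - b)) at 1 by ring; apply Rabs_triang) end.
 nra.
Qed.

Lemma hwave_period (m n : nat) u : hwave (INR m*(INR n + u)) = hwave (INR m*u).
Proof.
 unfold hwave. replace (2*PI*(INR m*(INR n + u))) with (2*PI*(INR m*u) + 2*INR (m*n)*PI) by (rewrite mult_INR; ring).
 rewrite cos_period. auto.
Qed.

(** Periodicity and the symmetry [u -> 1 - u] reduce this to [fourier_half]. Both bounds are kept
    because they are interpolated near 0 in [functional_equation_left]. *)
Lemma fourier_approx K n x : (2 <= K)%nat -> INR n <= x <= INR n + 1 ->
 Rabs (fourier (K*K) x - (x - INR n)*(INR n + 1 - x)/2) <= 20*(x - INR n) /\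
 Rabs (fourier (K*K) x - (x - INR n)*(INR n + 1 - x)/2) <= 20/INR K.
Proof.
 intros HK Hx. set (u := x - INR n). replace (INR n + 1 - x) with (1 - u) by (unfold u; ring).
 replace (fourier (K*K) x) with (fourier (K*K) u).
 2:{ apply rsum_ext. intros i _. rewrite <- (hwave_period (S i) n u). do 2 f_equal. unfold u; ring. }
 assert (Hu : 0 <= u <= 1) by (unfold u; lra).
 destruct (Rle_dec u (1/2)) as [H|H]; [apply fourier_half; auto; lra|].
 destruct (fourier_half K (1 - u) HK __) as [H1 H2].
 replace (fourier (K*K) u) with (fourier (K*K) (1 - u)).
 2:{ apply rsum_ext. intros i _. unfold hwave.
  replace (2*PI*(INR (S i)*(1 - u))) with (- (2*PI*(INR (S i)*u)) + 2*INR (S i)*PI) by ring. rewrite cos_period, cos_neg. auto. }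
 replace (u*(1 - u)) with ((1 - u)*(1 - (1 - u))) by ring. lra.
Qed.

(** * The functional equation *)

Definition nfl (x : R) : nat := Z.to_nat (Int_part x).

Lemma nfl_spec x : 0 <= x -> INR (nfl x) <= x < INR (nfl x) + 1.
Proof.
 intros Hx. destruct (base_Int_part x) as [H1 H2]. unfold nfl.
 assert (0 <= Int_part x)%Z. { assert (-1 < Int_part x)%Z by (apply lt_IZR; simpl; lra). lia. }
 rewrite INR_IZR_INZ, Z2Nat.id by auto. lra.
Qed.

Lemma nfl_unique x n : INR n <= x < INR n + 1 -> nfl x = n.
Proof.
 intros H. assert (H0 : 0 <= x) by (note (pos_INR n); lra). note (nfl_spec x H0).
 assert (nfl x < S n)%nat by (apply INR_lt; rewrite S_INR; lra).
 assert (n < S (nfl x))%nat by (apply INR_lt; rewrite S_INR; lra). lia.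
Qed.

(** The parabola [u(1 - u)/2] of the Fourier series, moved to [[n, n + 1]]. *)
Definition saw (n : nat) (u : R) : R := (u - INR n)*(INR n + 1 - u)/2.
Definition sawtooth (u : R) : R := saw (nfl u) u.

Lemma sawtooth_eq n u : INR n <= u <= INR n + 1 -> sawtooth u = saw n u.
Proof.
 intros [H1 [H2|H2]].
 - unfold sawtooth. rewrite (nfl_unique u n); auto.
 - unfold sawtooth. rewrite (nfl_unique u (S n)); [|rewrite S_INR; lra]. unfold saw. rewrite S_INR, H2. field.
Qed.

Lemma sawtooth_bound u : 0 <= u -> 0 <= sawtooth u <= 1.
Proof. intros H. note (nfl_spec u H). unfold sawtooth, saw. nra. Qed.

Lemma cont_fourier M x : cont_at dR (fun u => RtoC (fourier M u)) x.
Proof. apply contR_continuous, (ex_derive_continuous (fourier M)). eexists. apply fourier_derive. Qed.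

(** The sawtooth is a uniform limit of the partial sums [fourier (K*K)], which spares a case
    distinction at the integers. *)
Lemma cont_sawtooth x : 0 < x -> cont_at dR (fun u => RtoC (sawtooth u)) x.
Proof.
 intros Hx eps He. destruct (nfloor_ex (80/eps)) as [K0 [_ HK]]; [fin|].
 set (K := (K0 + 2)%nat). assert (HKI : 80/eps < INR K) by (unfold K; rewrite plus_INR; replace (INR 2) with 2 by fin; lra).
 assert (P80 : 0 < 80/eps) by fin.
 assert (HKe : 20/INR K < eps/4). { apply Rmult_lt_reg_r with (INR K); [lra|]. replace (20/INR K*INR K) with 20 by fld.
  apply Rmult_lt_compat_l with (r := eps/4) in HKI; [|lra]. replace (eps/4*(80/eps)) with 20 in HKI by fld. lra. }
 destruct (cont_fourier (K*K) x (eps/2) __) as [del [Hd H]].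
 exists (Rmin del x). split; [fin|]. intros y Hy. unfold dR in Hy.
 note (Rmin_l del x). note (Rmin_r del x). apply Rabs_def2 in Hy as Hy'.
 assert (Q : forall z, 0 <= z -> Rabs (fourier (K*K) z - sawtooth z) <= 20/INR K).
 { intros z Hz. note (nfl_spec z Hz). apply (fourier_approx K (nfl z) z); [fin | lra]. }
 note (Q x __) as Q1. note (Q y __) as Q2. specialize (H y ltac:(unfold dR; lra)).
 rewrite <- RtoC_minus, Cmod_R in *. apply Rabs_def2 in H. abs_in Q1. abs_in Q2. apply Rabs_def1; lra.
Qed.

Lemma Rcpow_sub1 x s : 0 < x -> Rcpow x (s + 1)%C = (RtoC x*Rcpow x s)%C.
Proof. intros H. rewrite Rcpow_plus, Rcpow_1; auto. ceq. Qed.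

Lemma rder_lin c e x : rder (fun u => RtoC (c*u + e)) x (RtoC c).
Proof. apply rder_of_real. auto_derive; [auto|ring]. Qed.

Lemma C_eq_of_small (x y : C) : (forall eps, 0 < eps -> Cmod (x - y)%C <= eps) -> x = y.
Proof.
 intros H. replace x with (x - y + y)%C by ring. replace (x - y)%C with (RtoC 0); [ring|]. symmetry. apply Cmod_eq_0.
 apply Rle_antisym; [|fin]. apply le_epsilon. fin.
Qed.

(** Euler-Maclaurin summation on one interval. The antiderivative [W] results from two integrations
    by parts, and [saw n] vanishes at both ends. *)
Lemma saw_integral n s : (1 <= n)%nat -> s <> RtoC 1 ->
 (s*(s + 1)*CI (fun u => RtoC (sawtooth u)*Rcpow u (-(1)*(s + 2)))%C (INR n) (INR (S n)) =
 RtoC (/ 2)*(Rcpow (INR n) (- s) + Rcpow (INR (S n)) (- s)) - (Rcpow (INR (S n)) (1 - s) - Rcpow (INR n) (1 - s))/(1 - s))%C.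
Proof.
 intros Hn Hs. assert (Hn0 : 1 <= INR n) by (rewrite <- INR_1; apply le_INR; auto). rewrite S_INR.
 assert (Hs1 : (1 - s)%C <> RtoC 0) by fin.
 set (W := fun u => (- s*(RtoC (saw n u)*Rcpow u (- s - 1)) + (- RtoC (INR n + / 2 - u)*Rcpow u (- s)) + - / (1 - s)*Rcpow u (1 - s))%C).
 assert (Hc : contI (fun u => s*(s + 1)*(RtoC (saw n u)*Rcpow u (- s - 1 - 1)))%C (INR n) (INR n + 1)).
 { intros u Hu. apply cont_mult; [fin|]. apply cont_mult; [|fin].
  apply contR_continuous. apply (ex_derive_continuous (saw n)). unfold saw. auto_derive; auto. }
 rewrite (CI_ext _ (fun u => RtoC (saw n u)*Rcpow u (- s - 1 - 1))%C); [| lra |].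
 2:{ intros t Ht. rewrite (sawtooth_eq n t) by auto. do 2 f_equal. ceq. }
 rewrite <- CI_cmult; [|lra|].
 2:{ intros u Hu. apply cont_mult; [|fin].
  apply contR_continuous. apply (ex_derive_continuous (saw n)). unfold saw. auto_derive; auto. }
 rewrite (CI_FTC W _ (INR n) (INR n + 1)); [| lra | | fin].
 - unfold W. replace (saw n (INR n + 1)) with 0 by (unfold saw; field). replace (saw n (INR n)) with 0 by (unfold saw; field).
  replace (INR n + / 2 - (INR n + 1)) with (- / 2) by field. ceq.
 - intros x Hx.
  assert (D1 : rder (fun u => RtoC (saw n u)) x (RtoC (INR n + / 2 - x))).
  { apply rder_of_real. unfold saw. auto_derive; [auto|field]. }
  assert (D2 : rder (fun u => - RtoC (INR n + / 2 - u))%C x (RtoC 1)).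
  { replace (fun u => - RtoC (INR n + / 2 - u))%C with (fun u => RtoC (1*u + (- INR n - / 2))).
   - apply rder_lin.
   - apply functional_extensionality. intros u. ceq. }
  assert (K := rder_plus _ _ _ _ _ (rder_plus _ _ _ _ _ (rder_mult _ _ _ _ _ (rder_const (- s)%C x) (rder_mult _ _ _ _ _ D1 (rder_Rcpow (- s - 1) x __)))
   (rder_mult _ _ _ _ _ D2 (rder_Rcpow (- s) x __))) (rder_mult _ _ _ _ _ (rder_const (- / (1 - s))%C x) (rder_Rcpow (1 - s) x __))). eapply (fun e => eq_ind _ (rder _ x) K _ e).
  replace (1 - s - 1)%C with (- s)%C by ring. set (Z := Rcpow x (- s - 1)%C). field. auto.
Qed.

(** Euler-Maclaurin summation to second order. The integral [T] is holomorphic for [Re s > -1], so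
    the formula can be continued across [Re s = 0] to a strip where the Fourier series may be
    inserted. *)
Lemma sawtooth_tail : exists T : C -> C, (forall s, -1 < Re s -> hol T s) /\
 (forall s b, -1 < Re s -> 1 <= b ->
  Cmod (T s - CI (fun u => RtoC (sawtooth u)*Rcpow u (-(1)*(s + 2)))%C 1 b)%C <= Rpower b (- (Re s + 1))/(Re s + 1)) /\
 (forall s, 0 < Re s -> s <> RtoC 1 -> zeta s = (s*(s + 1)*T s - (s + 1)/(2*(1 - s)))%C).
Proof.
 destruct (tail_integral (fun u => RtoC (sawtooth u)) 0 1 __) as [T0 [H1 H2]].
 { intros w Hw. apply cont_sawtooth; lra. }
 { intros w Hw. rewrite Ropp_0, Rpower_O, Cmod_R by lra. destruct (sawtooth_bound w __). rewrite Rabs_pos_eq; lra. }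
 exists (fun s => T0 (s + 2)%C). assert (E2 : forall s, Re (s + 2)%C = Re s + 2) by fin.
 assert (HT : forall s b, -1 < Re s -> 1 <= b ->
  Cmod (T0 (s + 2) - CI (fun u => RtoC (sawtooth u)*Rcpow u (-(1)*(s + 2)))%C 1 b)%C <= Rpower b (- (Re s + 1))/(Re s + 1)).
 { intros s b Hs Hb. specialize (H2 (s + 2)%C b). rewrite E2 in H2. specialize (H2 __ Hb). rewrite Rmult_1_l in H2.
  replace (0 + (Re s + 2) - 1) with (Re s + 1) in H2 by ring. auto. }
 split; [|split; [fin|]].
 - intros s Hs. apply (hol_comp (fun s => s + 2)%C T0); [fin|]. apply H1. rewrite E2; lra.
 - intros s Hs Hs1.
  assert (SS : forall N, (s*(s + 1)*CI (fun u => RtoC (sawtooth u)*Rcpow u (-(1)*(s + 2)))%C 1 (INR (S N)) =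
   csum (zterm s) N + Rcpow (INR (S N)) (1 - s)/(s - 1) + RtoC (/ 2)*Rcpow (INR (S N)) (- s) + (s + 1)/(2*(1 - s)))%C).
  { intros N. assert (Hci : forall a b, 1 <= a -> contI (fun u => RtoC (sawtooth u)*Rcpow u (-(1)*(s + 2)))%C a b).
   { intros a b Ha t Ht. apply cont_mult; [apply cont_sawtooth; lra | fin]. }
   induction N as [|N IH].
   - replace (CI _ 1 1) with (RtoC 0) by (symmetry; apply CI_unique, (is_RInt_point (V := CN))).
    rewrite !Rcpow_base1. simpl csum. replace (RtoC (/ 2)) with (/ 2)%C by (rewrite RtoC_inv; auto; lra). field. fin.
   - note (INR_S_ge1 N). rewrite <- (CI_Chasles _ 1 (INR (S N)) (INR (S (S N)))); [|auto|rewrite (S_INR (S N)); lra|fin].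
    rewrite Cmult_plus_distr_l, IH, saw_integral by fin. change (csum (zterm s) (S N)) with (csum (zterm s) N + Rcpow (INR (S N)) (- s))%C.
    replace (RtoC (/ 2)) with (/ 2)%C by (rewrite RtoC_inv; auto; lra). field. fin. }
  apply C_eq_of_small. intros eps He.
  set (c := Cmod (s*(s + 1))%C). assert (Hc : 0 <= c) by apply Cmod_ge_0.
  set (A := Cmod s/Re s + 1 + c/(Re s + 1)).
  assert (HA : 0 < A). { unfold A. assert (0 <= Cmod s/Re s) by fin. fin. }
  destruct (Rpower_small (Re s) (eps/A) Hs) as [N0 HN]; [fin|].
  set (N := S N0). specialize (HN N0 (le_n _)).
  assert (HNA : Rpower (INR N) (- Re s)*A < eps). { apply Rmult_lt_compat_r with (r := A) in HN; auto. replace (eps/A*A) with eps in HN by fld. auto. }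
  assert (HN1 : 1 <= INR N) by apply INR_S_ge1.
  assert (Z := zeta_approx s N Hs Hs1 ltac:(unfold N; lia)). specialize (SS N). specialize (HT s (INR (S N)) __ (INR_S_ge1 N)).
  set (I := CI _ 1 (INR (S N))) in *.
  assert (PN : Rpower (INR (S N)) (- Re s) <= Rpower (INR N) (- Re s)) by (apply Rpower_anti_base; [rewrite S_INR; lra | lra]).
  assert (PN2 : Rpower (INR (S N)) (- (Re s + 1)) <= Rpower (INR N) (- Re s)).
  { ele; [apply Rpower_le_base1; [fin|] | apply PN]. lra. }
  replace (zeta s - (s*(s + 1)*T0 (s + 2) - (s + 1)/(2*(1 - s))))%C with
   ((zeta s - csum (zterm s) N - Rcpow (INR (S N)) (1 - s)/(s - 1)) - RtoC (/ 2)*Rcpow (INR (S N)) (- s) - s*(s + 1)*(T0 (s + 2) - I))%C.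
  2:{ replace (s*(s + 1)*(T0 (s + 2) - I))%C with (s*(s + 1)*T0 (s + 2) - s*(s + 1)*I)%C by ring. rewrite SS. ring. }
  ub Cmod_sub_triangle. ele; [apply Rplus_le_compat_r, Cmod_sub_triangle|].
  rewrite (Cmod_mult (RtoC _)), (Cmod_mult (s*(s + 1))%C), Cmod_R, Rabs_pos_eq, Cmod_Rcpow by (try lra; apply INR_S_pos). fold c.
  replace (Re (- s)%C) with (- Re s) by auto.
  ele; [|left; apply HNA]. unfold A. set (p := Rpower (INR N) (- Re s)) in *.
  assert (c*Cmod (T0 (s + 2) - I)%C <= p*(c/(Re s + 1))).
  { replace (p*(c/(Re s + 1))) with (c*(p/(Re s + 1))) by lra. mul_l; auto.
   ub HT. mul_r; auto. fin. }
  assert (0 < p) by apply Rpower_pos. lra.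
Qed.

#[export] Hint Resolve cont_fourier cont_sawtooth : an.

(** The integral over the positive half-line. The condition [a*K <= 1] says that [a] is at most
    [1/K], and the two ends move independently. *)
Definition improper (f : R -> C) (l : C) : Prop := forall eps, 0 < eps ->
 exists K, 1 <= K /\ forall a b, 0 < a -> a*K <= 1 -> K <= b -> Cmod (CI f a b - l)%C <= eps.

Definition cont_pos (f : R -> C) : Prop := forall u, 0 < u -> cont_at dR f u.

Lemma cont_pos_I f a b : cont_pos f -> 0 < a -> contI f a b.
Proof. fin. Qed.

Lemma improper_plus f g l m : cont_pos f -> cont_pos g -> improper f l -> improper g m -> improper (fun u => f u + g u)%C (l + m)%C.
Proof.
 intros Cf Cg Hf Hg eps He. destruct (Hf (eps/2) __) as [K1 [A1 B1]]. destruct (Hg (eps/2) __) as [K2 [A2 B2]].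
 exists (K1 + K2). split; [lra|]. intros a b Ha Hk Hb. assert (a*K1 <= 1 /\ a*K2 <= 1) by nra.
 assert (a <= b) by nra.
 rewrite CI_plus by (auto using cont_pos_I).
 replace (CI f a b + CI g a b - (l + m))%C with ((CI f a b - l) + (CI g a b - m))%C by ring.
 ub Cmod_triangle. specialize (B1 a b Ha). specialize (B2 a b Ha). lra.
Qed.

Lemma improper_csum (f : nat -> R -> C) (l : nat -> C) M : (forall i, cont_pos (f i)) -> (forall i, improper (f i) (l i)) ->
 improper (fun u => csum (fun i => f i u) M) (csum l M).
Proof.
 intros Cf H. induction M as [|M IH].
 - intros eps He. exists 1. split; [lra|]. intros a b Ha Hk Hb. simpl. rewrite CI_const, Cmult_0_r.
  replace (RtoC 0 - RtoC 0)%C with (RtoC 0) by ring. rewrite Cmod_0. lra.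
 - apply improper_plus; auto. intros u Hu. apply cont_csum. intros i _. apply Cf; auto.
Qed.

Lemma cont_comp_lin (f : R -> C) m c u : cont_at dR f (m*u + c) -> cont_at dR (fun u => f (m*u + c)) u.
Proof.
 intros H eps He. destruct (H eps He) as [del [Hd Q]]. exists (del/(Rabs m + 1)). note (Rabs_pos m).
 split; [fin|]. intros y Hy. apply Q. unfold dR in *.
 replace (m*y + c - (m*u + c)) with (m*(y - u)) by ring. rewrite Rabs_mult.
 apply Rmult_lt_compat_r with (r := Rabs m + 1) in Hy; [|lra]. replace (del/(Rabs m + 1)*(Rabs m + 1)) with del in Hy by fld. nra.
Qed.

Lemma improper_scale f l m : 1 <= m -> cont_pos f -> improper f l -> improper (fun u => RtoC m*f (m*u)%R)%C l.
Proof.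
 intros Hm Cf Hf eps He. destruct (Hf eps He) as [K [A B]]. exists (m*K). split; [nra|].
 intros a b Ha Hk Hb. assert (1 <= m*K) by nra. assert (a <= b) by nra.
 assert (E : CI (fun u => RtoC m*f (m*u)%R)%C a b = CI f (m*a) (m*b)).
 { assert (Q := CI_comp_lin f m 0 a b __ H0). rewrite !Rplus_0_r in Q. rewrite Q by (apply cont_pos_I; auto; nra).
  rewrite <- CI_cmult; auto.
  - apply CI_ext; auto. intros t _. do 2 f_equal. ring.
  - intros t Ht. apply (cont_comp_lin f m 0). fin. }
 rewrite E. apply B; nra.
Qed.

Lemma improper_close f g l m B : cont_pos f -> cont_pos g -> improper f l -> improper g m ->
 (forall a b, 0 < a <= 1 -> 1 <= b -> Cmod (CI (fun u => f u - g u)%C a b) <= B) -> Cmod (l - m)%C <= B.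
Proof.
 intros Cf Cg Hf Hg H. apply le_epsilon. intros e He. destruct (Hf (e/2) __) as [K1 [A1 B1]]. destruct (Hg (e/2) __) as [K2 [A2 B2]].
 set (K := K1 + K2). assert (HK : 1 <= K) by (unfold K; lra). assert (IK : / K*K = 1) by fld.
 assert (P : 0 < / K <= 1). { nra. }
 specialize (H (/ K) K __ HK).
 rewrite CI_minus in H by (try (apply cont_pos_I; auto; lra); lra).
 assert (Cmod (CI f (/ K) K - l)%C <= e/2) by (apply B1; unfold K in *; nra).
 assert (Cmod (CI g (/ K) K - m)%C <= e/2) by (apply B2; unfold K in *; nra).
 replace (l - m)%C with ((CI f (/ K) K - CI g (/ K) K) - (CI f (/ K) K - l) + (CI g (/ K) K - m))%C by ring.
 ub Cmod_triangle. ele; [apply Rplus_le_compat_r, Cmod_sub_triangle|]. lra.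
Qed.

Lemma Rpower_small_real r eps : 0 < r -> 0 < eps -> exists K, 1 <= K /\ forall x, K <= x -> Rpower x (- r) <= eps.
Proof.
 intros Hr He. exists (Rmax 1 (Rpower eps (- / r))). split; [apply Rmax_l|]. intros x Hx. note (Rmax_r 1 (Rpower eps (- / r))). note (Rpower_pos eps (- / r)).
 ele; [apply (Rpower_anti_base (Rpower eps (- / r))); lra|]. rewrite Rpower_mult.
 replace (- / r*- r) with 1 by fld. rewrite Rpower_1; lra.
Qed.

(** * Mellin transforms of the wave, its Fourier sums and the sawtooth *)

Lemma cont_hwave u : cont_at dR (fun u => RtoC (hwave u)) u.
Proof. apply contR_continuous, (ex_derive_continuous hwave). unfold hwave. auto_derive. auto. Qed.

Lemma Rpower_base_1 y : Rpower 1 y = 1.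
Proof. unfold Rpower. rewrite ln_1, Rmult_0_r. apply exp_0. Qed.

(** The integrand of the Mellin transform of [h] at [-1 - s]. *)
Definition mell (h : R -> R) (s : C) (u : R) : C := (RtoC (h u)*Rcpow u (-(1)*(s + 2)))%C.

Lemma cont_mell h s : (forall u, 0 < u -> cont_at dR (fun u => RtoC (h u)) u) -> cont_pos (mell h s).
Proof. intros H u Hu. apply cont_mult; [auto | fin]. Qed.

Lemma scal_C (r : R) (z : C) : scal (V := CN) r z = (RtoC r*z)%C.
Proof. unfold scal; simpl. unfold prod_scal, scal; simpl. unfold mult; simpl. ceq. Qed.

Lemma CI_invert (f : R -> C) X : 1 <= X -> cont_pos f ->
 CI f (/ X) 1 = CI (fun w => RtoC (/ (w*w))*f (/ w)%R)%C 1 X.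
Proof.
 intros HX Hf.
 assert (I : @is_RInt CC (fun w => scal (- / (w*w)) (f (/ w)) : C) 1 X (RInt (V := CC) f (/ 1) (/ X))).
 { apply (is_RInt_comp (V := CC) f Rinv (fun w => - / (w*w))); rewrite Rmin_left, Rmax_right by auto; intros x Hx.
  - apply cont_R_continuous, Hf, Rinv_0_lt_compat; lra.
  - split; [auto_derive; [lra | lra]|]. apply (ex_derive_continuous (fun w => - / (w*w))). auto_derive. nra. }
 rewrite Rinv_1 in I. assert (PX : 0 < / X <= 1). { split; [fin|]. rewrite <- Rinv_1. fin. }
 assert (J := CI_correct f (/ X) 1 __ (cont_pos_I _ _ _ Hf (proj1 PX))).
 apply (is_RInt_swap (V := CN)) in J. apply (is_RInt_unique (V := CC)) in J. rewrite J in I.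
 apply (is_RInt_opp (V := CN)) in I. apply CI_unique in I. symmetry. etransitivity; [|etransitivity; [exact I|]].
 - apply CI_ext; auto. intros t Ht. rewrite <- (scal_opp_l (V := CN)), scal_C. do 2 f_equal. unfold opp; simpl. ring.
 - apply (opp_opp (G := CN)).
Qed.

(** The wave is bounded at infinity and [O(u^2)] at 0, so its transform exists for [-1 < Re s < 1].
    The substitution [u -> 1/u] turns the part near 0 into a second tail integral. *)
Lemma mell_hwave : exists G : C -> C, (forall s, -1 < Re s < 1 -> hol G s) /\ (forall s, -1 < Re s < 1 -> improper (mell hwave s) (G s)).
Proof.
 destruct (tail_integral (fun u => RtoC (hwave u)) 0 1 __) as [T1 [H1 B1]].
 { intros w Hw. apply cont_hwave. }
 { intros w Hw. rewrite Ropp_0, Rpower_O, Cmod_R by lra. destruct (hwave_bound w). rewrite Rabs_pos_eq; lra. }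
 destruct (tail_integral (fun u => RtoC (hwave (/ u))) 2 1 __) as [T0 [H0 B0]].
 { intros w Hw. apply contR_continuous, (ex_derive_continuous (fun u => hwave (/ u))). unfold hwave. auto_derive. lra. }
 { intros w Hw. rewrite Cmod_R. destruct (hwave_bound (/ w)) as [? B]. rewrite Rabs_pos_eq by lra. rewrite Rmult_1_l, Rpower_Ropp.
  replace 2 with (INR 2) by fin. rewrite Rpower_pow by lra. replace (w^2) with (w*w) by ring. rewrite Rinv_mult. auto. }
 exists (fun s => T1 (s + 2)%C + T0 (-(1)*s)%C)%C.
 assert (E2 : forall s, Re (s + 2)%C = Re s + 2) by fin.
 assert (E1 : forall s, Re (-(1)*s)%C = - Re s) by (intros; unfold Re; simpl; ring).
 split.
 - intros s Hs. apply hol_plus.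
  + apply (hol_comp (fun s => s + 2)%C T1); [fin|]. apply H1. rewrite E2; lra.
  + apply (hol_comp (fun s => -(1)*s)%C T0); [fin|]. apply H0. rewrite E1; lra.
 - intros s Hs eps He.
  destruct (Rpower_small_real (Re s + 1) (eps/2*(Re s + 1))) as [K1 [A1 Q1]]; [lra | nra|].
  destruct (Rpower_small_real (1 - Re s) (eps/2*(1 - Re s))) as [K2 [A2 Q2]]; [lra | nra|].
  exists (K1 + K2). split; [lra|]. intros a b Ha Hk Hb. assert (Ha1 : a <= 1) by nra.
  assert (Cm : cont_pos (mell hwave s)) by (apply cont_mell; intros; apply cont_hwave).
  rewrite <- (CI_Chasles _ a 1 b) by (try lra; apply cont_pos_I; auto).
  specialize (B1 (s + 2)%C b ltac:(rewrite E2; lra) __). rewrite E2 in B1. replace (0 + (Re s + 2) - 1) with (Re s + 1) in B1 by ring.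
  assert (Hia : K2 <= / a). { apply Rmult_le_reg_r with a; auto. rewrite Rinv_l by lra. nra. }
  specialize (B0 (-(1)*s)%C (/ a) ltac:(rewrite E1; lra) __). rewrite E1 in B0. replace (2 + - Re s - 1) with (1 - Re s) in B0 by ring.
  specialize (Q1 b __). specialize (Q2 (/ a) Hia).
  assert (B1' : Cmod (T1 (s + 2) - CI (mell hwave s) 1 b)%C <= eps/2).
  { ub B1. apply Rmult_le_reg_r with (Re s + 1); [lra|].
   replace (1*Rpower b (- (Re s + 1))/(Re s + 1)*(Re s + 1)) with (Rpower b (- (Re s + 1))) by fld. lra. }
  assert (E : CI (mell hwave s) a 1 = CI (fun w => RtoC (hwave (/ w))*Rcpow w (-(1)*(-(1)*s)))%C 1 (/ a)).
  { rewrite <- (Rinv_inv a) at 1. rewrite CI_invert; auto; [|lra]. apply CI_ext; [lra|]. intros w Hw. unfold mell.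
   replace (Rcpow (/ w) (-(1)*(s + 2))) with (Rcpow w (-(1)*(-(1)*s))*RtoC (w*w))%C.
   - rewrite (Cmult_comm (Rcpow _ _) (RtoC (w*w))), (Cmult_assoc (RtoC (hwave _))), Cmult_assoc. f_equal.
    rewrite <- !RtoC_mult. f_equal. field; lra.
   - replace (RtoC (w*w)) with (Rcpow w (RtoC 1 + RtoC 1)%C) by (rewrite Rcpow_plus, Rcpow_1 by lra; rewrite RtoC_mult; auto).
    rewrite <- Rcpow_plus. unfold Rcpow. f_equal. rewrite ln_Rinv by lra. ceq. }
  rewrite E. match goal with |- Cmod (?p + ?q - (?t1 + ?t0))%C <= _ => replace (p + q - (t1 + t0))%C with (- (t0 - p) - (t1 - q))%C by ring end.
  ub Cmod_sub_triangle. rewrite Cmod_opp.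
  match goal with |- ?x + ?y <= _ => assert (x <= eps/2); [|assert (y <= eps/2) by exact B1'; lra] end.
  ub B0. apply Rmult_le_reg_r with (1 - Re s); [lra|].
  replace (1*Rpower (/ a) (- (1 - Re s))/(1 - Re s)*(1 - Re s)) with (Rpower (/ a) (- (1 - Re s))) by fld. lra.
Qed.

Lemma improper_cmult c f l : cont_pos f -> improper f l -> improper (fun u => c*f u)%C (c*l)%C.
Proof.
 intros Cf Hf eps He. note (Cmod_ge_0 c). destruct (Hf (eps/(Cmod c + 1))) as [K [A B]]; [fin|].
 exists K. split; auto. intros a b Ha Hk Hb. assert (a <= b) by nra.
 rewrite CI_cmult by (auto using cont_pos_I). replace (c*CI f a b - c*l)%C with (c*(CI f a b - l))%C by ring. rewrite Cmod_mult.
 specialize (B a b Ha Hk Hb).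
 apply Rmult_le_compat_r with (r := Cmod c + 1) in B; [|lra]. replace (eps/(Cmod c + 1)*(Cmod c + 1)) with eps in B by fld. nra.
Qed.

Lemma improper_ext f g l : (forall u, 0 < u -> f u = g u) -> improper f l -> improper g l.
Proof.
 intros E H eps He. destruct (H eps He) as [K [A B]]. exists K. split; auto. intros a b Ha Hk Hb.
 rewrite (CI_ext g f) by (try nra; intros t Ht; symmetry; apply E; lra). auto.
Qed.

(** Scaling the variable by [m] multiplies the transform of the wave by a power of [m], altogether
    [m^(s-1)] for the m-th term; a partial sum of the series for [zeta (1 - s)] results. *)
Lemma mell_fourier G s M : -1 < Re s < 1 -> improper (mell hwave s) (G s) ->
 improper (mell (fourier M) s) (csum (zterm (1 - s)) M*G s)%C.
Proof.
 intros Hs HG. assert (Cm : cont_pos (mell hwave s)) by (apply cont_mell; intros; apply cont_hwave).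
 assert (Cs : forall m, 0 < m -> cont_pos (fun u => RtoC m*mell hwave s (m*u)%R)%C).
 { intros m Hm u Hu. apply cont_mult; [fin|]. replace (fun u => mell hwave s (m*u)) with (fun u => mell hwave s (m*u + 0)) by (apply functional_extensionality; intros; rewrite Rplus_0_r; auto).
  apply cont_comp_lin. fin. }
 replace (csum (zterm (1 - s)) M*G s)%C with (csum (fun i => zterm (1 - s) i*G s)%C M).
 2:{ rewrite Cmult_comm, <- csum_mult. apply csum_ext. intros; ring. }
 apply (improper_ext (fun u => csum (fun i => zterm (1 - s) i*(RtoC (INR (S i))*mell hwave s (INR (S i)*u)%R))%C M)).
 - intros u Hu. unfold mell at 2. unfold fourier. induction M as [|M IH]; [ceq|]. cbn [csum rsum]. rewrite IH, RtoC_plus, Cmult_plus_distr_r.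
  unfold mell, zterm. note (INR_S_pos M) as Hm. set (m := INR (S M)) in *. rewrite Rcpow_mult by auto.
  replace (RtoC (hwave (m*u)/(m*m))) with (RtoC (hwave (m*u))*RtoC (/ (m*m)))%C by (rewrite <- RtoC_mult; auto).
  replace (RtoC (/ (m*m))) with (Rcpow m (- (1 - s))*(RtoC m*Rcpow m (-(1)*(s + 2))))%C; [ring|].
  rewrite <- (Rcpow_1 m) by auto. rewrite <- !Rcpow_plus. replace (- (1 - s) + (1 + -(1)*(s + 2)))%C with (RtoC (-2)) by ceq.
  rewrite Rcpow_RtoC. change (-2) with (Ropp 2) || replace (-2) with (- (2)) by lra. rewrite Rpower_Ropp. replace 2 with (INR 2) by fin. rewrite Rpower_pow by auto. do 2 f_equal. ring.
 - apply improper_csum.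
  + intros i u Hu. apply cont_mult; [fin | apply Cs; auto; apply INR_S_pos].
  + intros i. apply improper_cmult; [fin|]. apply improper_scale; auto. fin.
Qed.

(** On [(0, 1]] the sawtooth is [u(1 - u)/2] and its Mellin integral is elementary; it converges at
    0 because [Re s < 0]. *)
Lemma mell_sawtooth T s : -1 < Re s < 0 ->
 (forall b, 1 <= b -> Cmod (T s - CI (mell sawtooth s) 1 b)%C <= Rpower b (- (Re s + 1))/(Re s + 1)) ->
 improper (mell sawtooth s) (T s + RtoC (/ 2)*(- / s - / (1 - s)))%C.
Proof.
 intros Hs HT eps He.
 assert (S0 : s <> RtoC 0) by fin. assert (S1 : (1 - s)%C <> RtoC 0) by (apply Csub_neq0; intro E; rewrite <- E in Hs; unfold Re in Hs; simpl in Hs; lra).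
 set (c := Cmod (/ s)%C + Cmod (/ (1 - s))%C). assert (Hc : 0 <= c) by (unfold c; note (Cmod_ge_0 (/ s)%C); note (Cmod_ge_0 (/ (1 - s))%C); lra).
 destruct (Rpower_small_real (Re s + 1) (eps/2*(Re s + 1))) as [K1 [A1 Q1]]; [lra | nra|].
 destruct (Rpower_small_real (- Re s) (eps/(c + 1))) as [K2 [A2 Q2]]; [lra | fin|].
 exists (K1 + K2). split; [lra|]. intros a b Ha Hk Hb. assert (Ha1 : a <= 1) by nra.
 assert (Cm : cont_pos (mell sawtooth s)) by (apply cont_mell; intros; apply cont_sawtooth; auto).
 rewrite <- (CI_Chasles _ a 1 b) by (try lra; apply cont_pos_I; auto).
 assert (Hia : K2 <= / a). { apply Rmult_le_reg_r with a; auto. rewrite Rinv_l by lra. nra. }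
 specialize (Q1 b __). specialize (Q2 (/ a) Hia). specialize (HT b __).
 set (W := fun u => (RtoC (/ 2)*(- / s*Rcpow u (- s) + - / (1 - s)*Rcpow u (1 - s)))%C).
 assert (E : CI (mell sawtooth s) a 1 = (W 1 - W a)%C).
 { apply CI_FTC; [auto | | fin]. intros x Hx.
  assert (K := rder_mult _ _ _ _ _ (rder_const (RtoC (/ 2)) x) (rder_plus _ _ _ _ _ (rder_mult _ _ _ _ _ (rder_const (- / s)%C x) (rder_Rcpow (- s) x __))
   (rder_mult _ _ _ _ _ (rder_const (- / (1 - s))%C x) (rder_Rcpow (1 - s) x __)))).
  eapply (fun e => eq_ind _ (rder _ x) K _ e). unfold mell. rewrite (sawtooth_eq 0 x) by (rewrite INR_0; lra). unfold saw. rewrite INR_0.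
  set (Z := Rcpow x (-(1)*(s + 2))).
  replace (Rcpow x (- s - 1)) with (RtoC x*Z)%C by (unfold Z; rewrite <- Rcpow_sub1 by lra; f_equal; apply C_eq; unfold Re, Im; simpl; ring).
  replace (Rcpow x (1 - s - 1)) with (RtoC x*(RtoC x*Z))%C by (unfold Z; rewrite <- !Rcpow_sub1 by lra; f_equal; apply C_eq; unfold Re, Im; simpl; ring).
  replace (RtoC ((x - 0)*(0 + 1 - x)/2)) with (RtoC (/ 2)*(RtoC x - RtoC x*RtoC x))%C by (rewrite <- RtoC_mult, <- RtoC_minus, <- RtoC_mult; f_equal; field).
  field. auto. }
 rewrite E. unfold W at 1. rewrite !Rcpow_base1.
 match goal with |- Cmod (?w - W a + ?i - (?t + ?v))%C <= _ => replace (w - W a + i - (t + v))%C with (- W a - (t - i))%C by ring end.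
 ub Cmod_sub_triangle. rewrite Cmod_opp.
 assert (B1 : Cmod (T s - CI (mell sawtooth s) 1 b)%C <= eps/2).
 { ub HT. apply Rmult_le_reg_r with (Re s + 1); [lra|].
  replace (Rpower b (- (Re s + 1))/(Re s + 1)*(Re s + 1)) with (Rpower b (- (Re s + 1))) by fld. lra. }
 assert (P1 : Rpower a (- Re s) = Rpower (/ a) (- - Re s)) by (unfold Rpower; rewrite ln_Rinv by auto; f_equal; ring).
 rewrite <- P1 in Q2. set (p := Rpower a (- Re s)) in *. assert (Hp : 0 < p) by apply Rpower_pos.
 assert (B2 : Cmod (W a) <= eps/2); [|lra].
 unfold W. rewrite Cmod_mult, Cmod_R, Rabs_pos_eq by lra.
 ele; [mul_l; [lra | apply Cmod_triangle]|]. rewrite !Cmod_mult, !Cmod_opp, !Cmod_Rcpow by auto.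
 replace (Re (- s)%C) with (- Re s) by auto. fold p.
 assert (P2 : Rpower a (Re (1 - s)%C) <= p).
 { replace (Re (1 - s)%C) with (1 + - Re s) by fin. rewrite Rpower_plus, Rpower_1 by auto. fold p. nra. }
 assert (Q : p*(c + 1) <= eps). { apply Rmult_le_compat_r with (r := c + 1) in Q2; [|lra]. replace (eps/(c + 1)*(c + 1)) with eps in Q2 by fld. auto. } note (Cmod_ge_0 (/ (1 - s))%C).
 le (/ 2*(p*c)); [|nra]. unfold c. nra.
Qed.

(** Riemann's argument in the strip [-1 < Re s < 0]: the sawtooth is replaced by its Fourier sums
    and the transform is taken term by term. The error is [O(K^(-th))], so the limit [K -> infinity]
    is allowed. *)
Lemma functional_equation_left T G s : -1 < Re s < 0 ->
 (forall b, 1 <= b -> Cmod (T s - CI (mell sawtooth s) 1 b)%C <= Rpower b (- (Re s + 1))/(Re s + 1)) ->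
 improper (mell hwave s) (G s) -> (T s + RtoC (/ 2)*(- / s - / (1 - s)) = zeta (1 - s)*G s)%C.
Proof.
 (* The exponent [th] is half of the room between [Re s] and 0: one half gives the decay in [K], the
    other convergence at 0. *)
 intros Hs HT HG. assert (HS := mell_sawtooth T s Hs HT). set (Z := (T s + _)%C) in *. set (th := - Re s/2).
 set (D := 20*(/ th + / (Re s + 1))). assert (Hth : 0 < th < 1/2) by (unfold th; lra).
 assert (I1 : 0 < / th) by fin. assert (I2 : 0 < / (Re s + 1)) by fin.
 assert (Cs : cont_pos (mell sawtooth s)) by (apply cont_mell; intros; apply cont_sawtooth; auto).
 assert (Cf : forall M, cont_pos (mell (fourier M) s)) by (intros; apply cont_mell; intros; apply cont_fourier).
 assert (Close : forall K, (2 <= K)%nat -> Cmod (Z - csum (zterm (1 - s)) (K*K)*G s)%C <= D*Rpower (INR K) (- th)).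
 { intros K HK. assert (HK2 : 2 <= INR K) by (replace 2 with (INR 2) by fin; apply le_INR; auto).
  apply (improper_close (mell sawtooth s) (mell (fourier (K*K)) s)); auto; [apply mell_fourier; auto; lra|].
  intros a b Ha Hb. set (f := fun u => (mell sawtooth s u - mell (fourier (K*K)) s u)%C).
  assert (Cff : cont_pos f) by (intros u Hu; apply cont_minus; [fin | apply Cf]; auto).
  assert (Ef : forall u, 0 < u -> Cmod (f u) = Rabs (fourier (K*K) u - sawtooth u)*Rpower u (- Re s - 2)).
  { intros u Hu. unfold f, mell. replace (_ - _)%C with (RtoC (sawtooth u - fourier (K*K) u)*Rcpow u (-(1)*(s + 2)))%C by ceq.
   rewrite Cmod_mult, Cmod_R, Rabs_minus_sym, Cmod_Rcpow by auto. do 2 f_equal. unfold Re; simpl; ring. }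
  set (p := Rpower (INR K) (- th)). assert (Hp : 0 < p) by apply Rpower_pos.
  rewrite <- (CI_Chasles f a 1 b) by (try lra; apply cont_pos_I; auto; lra).
  ub Cmod_triangle.
  assert (L : Cmod (CI f a 1) <= 20*p*/ th).
  { ele; [apply (CI_power_bound f (20*p) (- th)); [lra | lra | fin |]|].
   - intros u Hu. rewrite Ef by lra. destruct (fourier_approx K 0 u HK) as [F1 F2]; [rewrite INR_0; lra|].
    assert (Es := sawtooth_eq 0 u ltac:(rewrite INR_0; lra)). unfold saw in Es. rewrite <- Es in F1, F2. rewrite INR_0, Rminus_0_r in F1.
    set (x := Rabs _) in *.
    (* Interpolation: [x <= 20*u] and [x <= 20/K] together give [x <= 20*u^(1 - th)*K^(-th)]. *)
    assert (Hx : x <= 20*(Rpower u (1 - th)*p)).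
    { apply Rnot_lt_le. intro L. assert (X0 : 0 < x) by (assert (0 < Rpower u (1 - th)*p) by fin; lra).
     set (y := x/20) in *. assert (Hy : 0 < y) by (unfold y; lra). assert (y <= u /\ y <= / INR K) by (unfold y, Rdiv in *; lra).
     assert (Rpower y (1 - th) <= Rpower u (1 - th)) by fin.
     assert (Rpower y th <= p). { unfold p. replace (Rpower (INR K) (- th)) with (Rpower (/ INR K) th) by (unfold Rpower; rewrite ln_Rinv by lra; f_equal; ring). fin. }
     assert (y = Rpower y (1 - th)*Rpower y th) by (rewrite <- Rpower_plus; replace (1 - th + th) with 1 by ring; rewrite Rpower_1; auto).
     note (Rpower_pos y (1 - th)). assert (y <= Rpower u (1 - th)*p) by nra. unfold y in *; lra. }
    le (20*(Rpower u (1 - th)*p)*Rpower u (- Re s - 2)); [fin|].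
    right. replace (Rpower u (- (1 + - th))) with (Rpower u (1 - th)*Rpower u (- Re s - 2)); [ring|]. rewrite <- Rpower_plus. f_equal. unfold th; field.
   - rewrite Rpower_base_1, Ropp_involutive. assert (0 < Rpower a th) by apply Rpower_pos.
    replace (20*p*((Rpower a th - 1) / - th)) with (20*p*/ th - 20*p*/ th*Rpower a th) by fld.
    assert (0 < 20*p*/ th) by fin. nra. }
  assert (R1 : Cmod (CI f 1 b) <= 20*/ INR K*/ (Re s + 1)).
  { ele; [apply (CI_power_bound f (20*/ INR K) (Re s + 1)); [lra | lra | fin |]|].
   - intros u Hu. rewrite Ef by lra. note (nfl_spec u __).
    destruct (fourier_approx K (nfl u) u HK) as [_ F2]; [lra|]. replace (- (1 + (Re s + 1))) with (- Re s - 2) by ring.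
    fin.
   - rewrite Rpower_base_1. note (Rpower_pos b (- (Re s + 1))). mul_l; [|nra].
    fin. }
  assert (/ INR K <= p). { rewrite <- (Rpower_1 (INR K)) at 1 by lra. rewrite <- Rpower_Ropp. apply Rpower_le_base1; lra. }
  unfold D. nra. }
 assert (Hz : ser (zterm (1 - s)) (zeta (1 - s))).
 { apply is_series_ser. apply (proj2 zeta_spec). unfold Re; simpl. unfold Re in Hs. lra. }
 apply C_eq_of_small. intros eps He. set (g := Cmod (G s)). assert (Hg : 0 <= g) by apply Cmod_ge_0.
 destruct (Hz (eps/2/(g + 1))) as [N1 H1]; [fin|].
 destruct (Rpower_small th (eps/2/D)) as [N2 H2]; [lra | apply Rdiv_lt_0_compat; [lra | unfold D; lra]|].
 set (K := S (S (N1 + N2))). specialize (Close K ltac:(unfold K; lia)). specialize (H1 (K*K)%nat ltac:(unfold K; nia)). specialize (H2 (S (N1 + N2)) ltac:(lia)). fold K in H2.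
 replace (Z - zeta (1 - s)*G s)%C with ((Z - csum (zterm (1 - s)) (K*K)*G s) + (csum (zterm (1 - s)) (K*K) - zeta (1 - s))*G s)%C by ring.
 ub Cmod_triangle. rewrite Cmod_mult. fold g.
 assert (D0 : 0 < D) by (unfold D; lra).
 assert (D*Rpower (INR K) (- th) <= eps/2). { apply Rmult_lt_compat_l with (r := D) in H2; auto. replace (D*(eps/2/D)) with (eps/2) in H2 by fld. lra. }
 set (x := Cmod (csum _ _ - _)%C) in *. assert (x*g <= eps/2); [|lra].
 le (eps/2/(g + 1)*(g + 1)); [|right; field; lra]. assert (0 <= x) by apply Cmod_ge_0. nra.
Qed.

(** The factor is left as a Mellin transform, since only its size is used. The identity is carried
    from the strip [-1 < Re s < 0] to [0 < Re s < 1/2] by discs that avoid the real axis, which is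
    where [1 <= Rabs (Im s)] enters. *)
Lemma functional_equation : exists G : C -> C, forall s, 0 < Re s < 1/2 -> 1 <= Rabs (Im s) ->
 improper (mell hwave s) (G s) /\ (zeta s = s*(s + 1)*G s*zeta (1 - s))%C.
Proof.
 destruct mell_hwave as [G [HG1 HG2]]. destruct sawtooth_tail as [T [HT1 [HT2 HT3]]]. exists G. intros s Hs Ht.
 split; [fin|]. set (t := Im s) in *.
 assert (Ne : forall z x, Rabs (Im z - t) < 1 -> z <> RtoC x).
 { intros z x Hz. intro E. rewrite E, Rminus_0_l, Rabs_Ropp in Hz. lra. }
 assert (Dim : forall z c r, Cmod (z - pt c t)%C < r -> Rabs (Im z - t) < r).
 { intros z c r Hz. replace (Im z - t) with (Im (z - pt c t)%C) by fin. eapply Rle_lt_trans; [apply Im_le_Cmod | auto]. }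
 assert (Dre : forall z c r, Cmod (z - pt c t)%C < r -> c - r < Re z < c + r).
 { intros z c r Hz. apply Re_disc in Hz. fin. }
 (* Continues the Euler-Maclaurin formula from [Re z > 0] to the left of the imaginary axis. *)
 assert (Z1 : forall z, Cmod (z - pt (1/2) t)%C < 1 -> (zeta z - (z*(z + 1)*T z - (z + 1)/(2*(1 - z))) = 0)%C).
 { apply (identity_disc (fun z => zeta z - (z*(z + 1)*T z - (z + 1)/(2*(1 - z))))%C (pt (1/2) t) 1 (1/2)); [| lra |].
  - intros z Hz. note (Dre _ _ _ Hz). note (Ne z 1 (Dim _ _ _ Hz)) as N1.
   fin.
  - intros z Hz. note (Dre _ _ _ Hz).
   rewrite (HT3 z); [ring | lra | fin]. }
 (* Continues the functional equation from a small disc in the left strip back to [Re z < 1/2]. *)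
 assert (Z2 : forall z, Cmod (z - pt (-(1/4)) t)%C < 3/4 -> (zeta z - z*(z + 1)*G z*zeta (1 - z) = 0)%C).
 { apply (identity_disc (fun z => zeta z - z*(z + 1)*G z*zeta (1 - z))%C (pt (-(1/4)) t) (3/4) (1/8)); [| lra |].
  - intros z Hz. note (Dre _ _ _ Hz). note (Dim _ _ _ Hz) as Di. note (Ne z 0 __) as N0.
   apply hol_minus; [fin|]. apply hol_mult.
   + fin.
   + apply (hol_comp (fun z => 1 - z)%C zeta); [fin|]. apply hol_zeta.
    intro E. apply N0. replace z with (1 - (1 - z))%C by ring. rewrite E. ring.
  - intros z Hz. note (Dre _ _ _ Hz). note (Dim _ _ _ Hz) as Di. note (Ne z 1 __) as N1.
   assert (Q : Cmod (z - pt (1/2) t)%C < 1).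
   { replace (z - pt (1/2) t)%C with ((z - pt (-(1/4)) t) + RtoC (-(3/4)))%C by (apply C_eq; unfold Re, Im; simpl; field).
    eapply Rle_lt_trans; [apply Cmod_triangle|]. rewrite Cmod_R, Rabs_left; lra. }
   apply Z1 in Q. assert (L := functional_equation_left T G z __ (fun b => HT2 z b __) (HG2 z __)).
   rewrite (Cmult_comm (zeta _)) in L. rewrite <- (Cmult_assoc (z*(z + 1))%C), <- L, <- Q.
   replace (RtoC (/ 2)) with (/ 2)%C by (rewrite RtoC_inv; auto; lra). field. fin. }
 assert (E := Z2 s). replace (zeta s) with (zeta s - s*(s + 1)*G s*zeta (1 - s) + s*(s + 1)*G s*zeta (1 - s))%C by ring.
 rewrite E; [ring|]. replace (s - pt (-(1/4)) t)%C with (RtoC (Re s + 1/4)).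
 - rewrite Cmod_R, Rabs_pos_eq; lra.
 - apply C_eq; unfold Re, Im, t; simpl; field_simplify; auto. unfold Im; ring.
Qed.

#[export] Hint Resolve cont_hwave cont_mell cont_pos_I cont_comp_lin : an.

(** * Stationary phase and the size of the factor *)

Definition osc (kap : R) (s : C) (v : R) : C := (ei (2*PI*kap*v)*Rcpow v (- s - 1))%C.

Lemma cont_osc kap s v : 0 < v -> cont_at dR (osc kap s) v.
Proof. intros H. apply cont_mult; [fin | fin]. Qed.

Lemma Cmod_osc kap sg t v : 0 < v -> Cmod (osc kap (pt sg t) v) = Rpower v (- (1 + sg)).
Proof. intros H. unfold osc. rewrite Cmod_mult, ei_mod, Rmult_1_l, Cmod_Rcpow by auto. f_equal. unfold Re; simpl; ring. Qed.

(* Integration by parts: away from the stationary point of the phase [2 PI kap v - t ln v], whose derivative is [D v/v]. *)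
Lemma osc_bound kap sg t a b m : kap*kap = 1 -> 0 < sg -> 0 < a <= b -> 0 < m ->
 (forall v, a <= v <= b -> m <= Rabs (2*PI*kap*v - t)) ->
 Cmod (CI (osc kap (pt sg t)) a b) <= 5*Rpower a (- sg)/m.
Proof.
 intros Hk Hsg Hab Hm HD. set (s := pt sg t : C). set (D := fun v => 2*PI*kap*v - t).
 assert (D0 : forall v, a <= v <= b -> D v <> 0). { intros v Hv E. specialize (HD v Hv). fold (D v) in HD. rewrite E, Rabs_R0 in HD. lra. }
 set (p := Rpower a (- sg)). assert (Hp : 0 < p) by apply Rpower_pos. note PI_RGT_0 as Hpi.
 assert (Ca : contI (osc kap s) a b) by (intros v Hv; apply cont_osc; lra).
 assert (CD : forall v, a <= v <= b -> cont_at dR (fun v => RtoC (/ D v)) v).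
 { intros v Hv. apply contR_continuous, (ex_derive_continuous (fun v => / D v)). unfold D. auto_derive. apply D0; auto. }
 set (W := fun v => (ei (2*PI*kap*v)*(Rcpow v (- s)*RtoC (/ D v)))%C).
 set (R := fun v => (RtoC (sg*/ D v)*osc kap s v + RtoC (2*PI*kap*(/ D v*/ D v))*(ei (2*PI*kap*v)*Rcpow v (- s)))%C).
 assert (CR : contI R a b).
 { intros v Hv. apply cont_plus; apply cont_mult.
  - fin.
  - fin.
  - fin.
  - fin. }
 assert (F : CI (fun v => Ci*osc kap s v - R v)%C a b = (W b - W a)%C).
 { apply CI_FTC; [lra | | fin].
  intros v Hv. specialize (D0 v Hv).
  assert (K3 : rder (fun v => RtoC (/ D v)) v (RtoC (- (2*PI*kap)*(/ D v*/ D v)))).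
  { apply rder_of_real. unfold D. auto_derive; [fin|]. unfold D in D0. field; lra. }
  assert (K := rder_mult _ _ _ _ _ (rder_ei (2*PI*kap) v) (rder_mult _ _ _ _ _ (rder_Rcpow (- s) v __) K3)).
  eapply (fun e => eq_ind _ (rder _ v) K _ e). unfold R, osc. set (e := ei _). set (Z := Rcpow v (- s - 1)).
  replace (Rcpow v (- s)) with (RtoC v*Z)%C by (unfold Z; rewrite <- Rcpow_sub1 by lra; f_equal; ring).
  assert (ED : (Ci*RtoC (2*PI*kap*v) = s + RtoC (- sg) + Ci*RtoC (D v))%C) by (apply C_eq; unfold s, D, Re, Im; simpl; ring).
  assert (ED2 : (RtoC (D v)*RtoC (/ D v) = 1)%C) by (rewrite <- RtoC_mult; f_equal; field; auto).
  rewrite RtoC_mult, RtoC_opp in ED. rewrite !RtoC_mult, !RtoC_opp.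
  match goal with |- ?L = ?Q => transitivity (e*Z*(((Ci*(RtoC (2*PI*kap)*RtoC v)) - s)*RtoC (/ D v)) - RtoC (2*PI*kap)*(RtoC (/ D v)*RtoC (/ D v))*(e*(RtoC v*Z)))%C end; [rewrite !RtoC_mult; ring|].
  rewrite ED. replace ((s + - RtoC sg + Ci*RtoC (D v) - s)*RtoC (/ D v))%C with (Ci*(RtoC (D v)*RtoC (/ D v)) - RtoC sg*RtoC (/ D v))%C by ring.
  rewrite ED2, !RtoC_mult. ring. }
 rewrite CI_minus, CI_cmult in F; auto; [|lra|lra|fin].
 assert (E : CI (osc kap s) a b = (- Ci*(W b - W a + CI R a b))%C).
 { rewrite <- F. ceq. }
 assert (ID : forall v, a <= v <= b -> Rabs (/ D v) <= / m). { intros v Hv. rewrite Rabs_inv. apply Rinv_le_contravar; auto. apply HD; auto. }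
 assert (BP : forall v, a <= v <= b -> Rpower v (- sg) <= p) by (intros v Hv; apply Rpower_anti_base; lra).
 assert (BW : forall v, a <= v <= b -> Cmod (W v) <= p*/ m).
 { intros v Hv. unfold W. rewrite !Cmod_mult, ei_mod, Rmult_1_l, Cmod_Rcpow, Cmod_R by lra. fin. }
 set (g := fun v => / m*sg*Rpower v (- (1 + sg)) + p*(2*PI*(/ D v*/ D v))).
 assert (Ig : is_RInt g a b (/ m*sg*((Rpower a (- sg) - Rpower b (- sg))/sg) + minus (- p*kap*/ D b) (- p*kap*/ D a))).
 { apply (is_RInt_plus (V := RN)); [apply is_RInt_Rpower; lra|].
  apply (is_RInt_derive (V := RC) (fun v => - p*kap*/ D v)); rewrite Rmin_left, Rmax_right by lra; intros x Hx.
  - specialize (D0 x Hx). unfold D. auto_derive; [fin|]. transitivity (p*(2*PI*(kap*kap))*/ ((2*PI*kap*x - t)*(2*PI*kap*x - t))); [|rewrite Hk]; field; exact D0.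
  - apply contR_continuous. fin. }
 assert (BR : Cmod (CI R a b) <= 3*(p*/ m)).
 { ele; [apply (CI_le R g); [lra | auto | eexists; exact Ig |]|].
  - intros v Hv. ub Cmod_triangle. rewrite !Cmod_mult, !Cmod_R, ei_mod, Cmod_Rcpow, Rmult_1_l by lra. replace (Cmod (osc kap s v)) with (Rpower v (- (1 + sg))) by (symmetry; apply Cmod_osc; lra). specialize (ID v Hv). note (Rpower_pos v (- (1 + sg))).
   assert (AK : Rabs kap = 1). { destruct (Rcase_abs kap); [rewrite Rabs_left by auto | rewrite Rabs_right by auto]; nra. }
   apply Rplus_le_compat.
   + mul_r; [lra|]. rewrite Rabs_mult, (Rabs_pos_eq sg) by lra. nra.
   + rewrite !Rabs_mult, AK, (Rabs_pos_eq PI), (Rabs_pos_eq 2), <- Rabs_mult by lra. rewrite (Rabs_pos_eq (/ D v*/ D v)) by nra.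
    assert (0 <= / D v*/ D v) by nra. rewrite Rmult_1_r, (Rmult_comm p). fin.
  - rewrite (is_RInt_unique _ _ _ _ Ig). unfold minus, plus, opp; simpl.
   note (ID a __) as Ia. note (ID b __) as Ib. abs_in Ia. abs_in Ib.
   assert (Hkk : kap = 1 \/ kap = -1) by nra.
   fold p. note (Rpower_pos b (- sg)).
   replace (/ m*sg*((p - Rpower b (- sg))/sg)) with (/ m*(p - Rpower b (- sg))) by fld.
   nra. }
 rewrite E, Cmod_mult. replace (Cmod (- Ci)%C) with 1 by (rewrite Cmod_opp, Cmod_Ci; auto). rewrite Rmult_1_l.
 ub Cmod_triangle. ele; [apply Rplus_le_compat_r, Cmod_sub_triangle|].
 note (BW a __). note (BW b __). lra.
Qed.

Lemma Rpower_half_sq x : 0 < x -> Rpower x (1/2)*Rpower x (1/2) = x.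
Proof. intros. rewrite <- Rpower_plus. replace (1/2 + 1/2) with 1 by field. apply Rpower_1; auto. Qed.

(** The stationary point [Y = |t|/(2 PI)] is surrounded by a window of length [|t|^(1/2)], where the
    integrand is bounded trivially; outside, the derivative of the phase is large enough for
    [osc_bound]. Both contributions are of order [|t|^(-1/2 - sg)]. *)
Lemma osc_tail sg : 0 < sg < 1/2 -> exists B, 0 <= B /\ forall kap t, kap = 1 \/ kap = -1 -> 1 <= Rabs t ->
 exists b0, 1 <= b0 /\ forall b, b0 <= b -> Cmod (CI (osc kap (pt sg t)) 1 b) <= B*Rpower (Rabs t) (- (1/2) - sg).
Proof.
 intros Hsg. note PI_4 as P4. note PI_gt_3 as H3.
 assert (Is : 0 < / sg) by fin.
 exists (3000 + 100*/ sg). split; [lra|]. intros kap t Hk Ht. set (x := Rabs t) in *.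
 assert (Hkk : kap*kap = 1) by nra.
 set (q := Rpower x (- (1/2) - sg)). assert (Hq : 0 < q) by apply Rpower_pos.
 assert (Hxq : / x <= q). { rewrite <- (Rpower_1 x) at 1 by lra. rewrite <- Rpower_Ropp. apply Rpower_le_base1; lra. }
 assert (Ci0 : forall a b, 0 < a -> contI (osc kap (pt sg t)) a b) by (intros a b Ha v Hv; apply cont_osc; lra).
 (* For bounded [t] absolute convergence is enough. Beyond 100 the point [Y/2] exceeds 1 and the
    window lies to the right of it. *)
 destruct (Rle_dec x 100) as [Hx|Hx].
 { exists 1. split; [lra|]. intros b Hb. ele; [apply (CI_power_bound _ 1 sg); [lra | lra | fin |]|].
  - intros v Hv. rewrite Cmod_osc by lra. lra.
  - rewrite Rpower_base_1. note (Rpower_pos b (- sg)). assert (/ 100 <= / x) by fin.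
   nra. }
 (* If [kap] and [t] have opposite signs there is no stationary point, and [2*PI*kap*v - t] has
    modulus at least [|t|]. *)
 destruct (Rle_dec 0 (kap*t)) as [Hs|Hs].
 2:{ exists 1. split; [lra|]. intros b Hb. ele; [apply (osc_bound kap sg t 1 b x); auto; try lra|].
  - intros v Hv. unfold x. destruct Hk as [-> | ->]; destruct (Rcase_abs t); unfold Rabs; repeat destruct (Rcase_abs _); nra.
  - rewrite Rpower_base_1. nra. }
 set (Y := x/(2*PI)). set (h := Rpower x (1/2)). assert (Hh : 0 < h) by apply Rpower_pos. assert (Hhx : h*h = x) by (apply Rpower_half_sq; lra).
 assert (HY : 2*PI*Y = x) by (unfold Y; field; lra).
 assert (HD : forall v, Rabs (2*PI*kap*v - t) = 2*PI*Rabs (v - Y)).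
 { intros v. assert (E : t = kap*x) by (unfold x; destruct Hk as [-> | ->]; unfold Rabs; destruct (Rcase_abs t); lra).
  replace (2*PI*kap*v - t) with (2*PI*(kap*(v - Y))) by nra.
  rewrite Rabs_mult, (Rabs_pos_eq (2*PI)), Rabs_mult by lra. destruct Hk as [-> | ->]; unfold Rabs; destruct (Rcase_abs _); lra. }
 assert (HY1 : x/16 <= Y/2). { nra. }
 assert (HhY : h/2 <= Y/2). { nra. }
 exists (Y + h/2). split; [lra|]. intros b Hb.
 assert (Pp : forall e, 0 <= e <= 2 -> Rpower (Y/2) (- e) <= 256*Rpower x (- e)).
 { intros e He. ele; [apply (Rpower_anti_base (x/16)); lra|]. unfold Rdiv. rewrite <- Rpower_mult_distr by lra.
  rewrite (Rpower_Ropp (/ 16)). assert (Rpower (/ 16) e >= / 256).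
  { apply Rle_ge. replace (/ 256) with (Rpower (/ 16) 2). - apply exp_le. rewrite ln_Rinv by lra. assert (0 < ln 16) by (rewrite <- ln_1; apply ln_increasing; lra). nra.
   - replace 2 with (INR 2) by fin. rewrite Rpower_pow by lra. lra. }
  assert (/ Rpower (/ 16) e <= 256). { rewrite <- (Rinv_inv 256). fin. } note (Rpower_pos x (- e)). nra. }
 rewrite <- (CI_Chasles _ 1 (Y/2) b) by (try lra; apply Ci0; lra).
 rewrite <- (CI_Chasles _ (Y/2) (Y - h/2) b) by (try lra; apply Ci0; lra).
 rewrite <- (CI_Chasles _ (Y - h/2) (Y + h/2) b) by (try lra; apply Ci0; lra).
 assert (Q1 : Rpower x (- sg)*/ h = q). { unfold h. rewrite <- Rpower_Ropp, <- Rpower_plus. unfold q. f_equal. ring. }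
 assert (Q2 : h*Rpower x (- (1 + sg)) = q). { unfold h. rewrite <- Rpower_plus. unfold q. f_equal. field. }
 assert (Ih : 0 < / h) by fin.
 assert (B1 : Cmod (CI (osc kap (pt sg t)) 1 (Y/2)) <= 10*q).
 { ele; [apply (osc_bound kap sg t 1 (Y/2) (x/2)); auto; try lra|].
  - intros v Hv. rewrite HD, Rabs_left by lra. nra.
  - rewrite Rpower_base_1. replace (5*1/(x/2)) with (10*/ x) by fld. lra. }
 assert (Pm : forall a, Y/2 <= a -> 5*Rpower a (- sg)/h <= 5*256*q).
 { intros a Ha. rewrite <- Q1, <- Rmult_assoc. mul_r; [lra|].
  assert (Rpower a (- sg) <= Rpower (Y/2) (- sg)) by (apply Rpower_anti_base; lra). specialize (Pp sg __). lra. }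
 assert (B2 : Cmod (CI (osc kap (pt sg t)) (Y/2) (Y - h/2)) <= 5*256*q).
 { ele; [apply (osc_bound kap sg t _ _ h); auto; try lra | fin].
  intros v Hv. rewrite HD, Rabs_left by lra. nra. }
 assert (B4 : Cmod (CI (osc kap (pt sg t)) (Y + h/2) b) <= 5*256*q).
 { ele; [apply (osc_bound kap sg t _ _ h); auto; try lra | fin].
  intros v Hv. rewrite HD, Rabs_right by lra. nra. }
 assert (B3 : Cmod (CI (osc kap (pt sg t)) (Y - h/2) (Y + h/2)) <= 256*q).
 { ele; [apply (CI_bound _ _ _ (256*Rpower x (- (1 + sg)))); [lra | fin |]|].
  - intros v Hv. rewrite Cmod_osc by lra. ele; [apply (Rpower_anti_base (Y/2)); lra|]. apply Pp; lra.
  - lra. }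
 ub Cmod_triangle. ele; [apply Rplus_le_compat_l, Cmod_triangle|].
 ele; [apply Rplus_le_compat_l, Rplus_le_compat_l, Cmod_triangle|]. nra.
Qed.

(** Integrating by parts turns the wave into a sine and lowers the power to [v^(-s-1)], the shape
    treated by [osc_tail]. *)
Lemma mellin_by_parts sg t a b : 0 < sg < 1 -> 0 < a <= b ->
 ((pt sg t + 1)*CI (mell hwave (pt sg t)) a b =
 CI (fun v => RtoC (sin (2*PI*v)/PI)*Rcpow v (- pt sg t - 1))%C a b - (RtoC (hwave b)*Rcpow b (- pt sg t - 1) - RtoC (hwave a)*Rcpow a (- pt sg t - 1)))%C.
Proof.
 intros Hsg Hab. set (s := pt sg t : C). note PI_RGT_0 as Hpi.
 assert (C1 : contI (fun v => RtoC (sin (2*PI*v)/PI)*Rcpow v (- s - 1))%C a b).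
 { intros v Hv. apply cont_mult; [|fin]. apply contR_continuous, (ex_derive_continuous (fun v => sin (2*PI*v)/PI)). auto_derive; auto. }
 assert (C2 : contI (fun v => (s + 1)*mell hwave s v)%C a b).
 { intros v Hv. apply cont_mult; [fin|]. apply cont_mell; [fin | lra]. }
 rewrite <- (CI_FTC (fun v => RtoC (hwave v)*Rcpow v (- s - 1))%C (fun v => RtoC (sin (2*PI*v)/PI)*Rcpow v (- s - 1) - (s + 1)*mell hwave s v)%C); [| lra | |].
 - rewrite CI_minus, CI_cmult; auto; try lra; [ring|]. intros v Hv. apply cont_mell; [intros; apply cont_hwave | lra].
 - intros v Hv. assert (K1 : rder (fun v => RtoC (hwave v)) v (RtoC (sin (2*PI*v)/PI))).
  { apply rder_of_real. unfold hwave. auto_derive; [auto|field; lra]. }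
  assert (K := rder_mult _ _ _ _ _ K1 (rder_Rcpow (- s - 1) v __)).
  eapply (fun e => eq_ind _ (rder _ v) K _ e). unfold mell. replace (-(1)*(s + 2))%C with (- s - 1 - 1)%C by (apply C_eq; unfold Re, Im; simpl; ring). ring.
 - fin.
Qed.

(** A further integration by parts absorbs the factor [s]; what is left is the integral of
    [2 cos(2 PI v) v^(-s)], absolutely convergent at 0 because [sg < 1]. So the bound is free of
    [t]. *)
Lemma mellin_near_zero sg t a : 0 < sg < 1/2 -> 0 < a <= 1 ->
 Cmod (pt sg t*CI (fun v => RtoC (sin (2*PI*v)/PI)*Rcpow v (- pt sg t - 1))%C a 1)%C <= 6.
Proof.
 intros Hsg Ha. set (s := pt sg t : C). note PI_RGT_0 as Hpi.
 assert (C1 : contI (fun v => RtoC (sin (2*PI*v)/PI)*Rcpow v (- s - 1))%C a 1).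
 { intros v Hv. apply cont_mult; [|fin]. apply contR_continuous, (ex_derive_continuous (fun v => sin (2*PI*v)/PI)). auto_derive; auto. }
 assert (C2 : contI (fun v => RtoC (2*cos (2*PI*v))*Rcpow v (- s))%C a 1).
 { intros v Hv. apply cont_mult; [|fin]. apply contR_continuous, (ex_derive_continuous (fun v => 2*cos (2*PI*v))). auto_derive; auto. }
 assert (F := CI_FTC (fun v => RtoC (sin (2*PI*v)/PI)*Rcpow v (- s))%C (fun v => RtoC (2*cos (2*PI*v))*Rcpow v (- s) - s*(RtoC (sin (2*PI*v)/PI)*Rcpow v (- s - 1)))%C a 1).
 rewrite CI_minus, CI_cmult in F; auto; try lra; [|fin].
 replace (s*_)%C with (CI (fun v => RtoC (2*cos (2*PI*v))*Rcpow v (- s))%C a 1 - (RtoC (sin (2*PI*1)/PI)*Rcpow 1 (- s) - RtoC (sin (2*PI*a)/PI)*Rcpow a (- s)))%C.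
 2:{ rewrite <- F; [ring | lra | | fin].
  intros v Hv. assert (K1 : rder (fun v => RtoC (sin (2*PI*v)/PI)) v (RtoC (2*cos (2*PI*v)))).
  { apply rder_of_real. auto_derive; [auto|field; lra]. }
  assert (K := rder_mult _ _ _ _ _ K1 (rder_Rcpow (- s) v __)).
  eapply (fun e => eq_ind _ (rder _ v) K _ e). ring. }
 replace (2*PI*1) with (2*PI) by ring. rewrite sin_2PI. replace (0/PI) with 0 by lra.
 replace (RtoC 0*Rcpow 1 (- s) - RtoC (sin (2*PI*a)/PI)*Rcpow a (- s))%C with (- (RtoC (sin (2*PI*a)/PI)*Rcpow a (- s)))%C by ring.
 ub Cmod_sub_triangle. rewrite Cmod_opp, Cmod_mult, Cmod_R, Cmod_Rcpow by lra. replace (Re (- s)%C) with (- sg) by auto.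
 assert (B1 : Cmod (CI (fun v => RtoC (2*cos (2*PI*v))*Rcpow v (- s))%C a 1) <= 4).
 { ele; [apply (CI_power_bound _ 2 (sg - 1)); [lra | lra | auto |]|].
  - intros v Hv. rewrite Cmod_mult, Cmod_R, Cmod_Rcpow by lra. replace (- (1 + (sg - 1))) with (- sg) by ring.
   mul_r; [fin|]. note (COS_bound (2*PI*v)). apply Rabs_le. lra.
  - rewrite Rpower_base_1. note (Rpower_pos a (- (sg - 1))). apply Rmult_le_reg_r with (1 - sg); [lra|].
   replace (2*((Rpower a (- (sg - 1)) - 1)/(sg - 1))*(1 - sg)) with (2 - 2*Rpower a (- (sg - 1))) by fld. nra. }
 assert (B2 : Rabs (sin (2*PI*a)/PI)*Rpower a (- sg) <= 2); [|lra].
 le (2*a*Rpower a (- sg)).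
 - mul_r; [fin|]. unfold Rdiv. rewrite Rabs_mult, (Rabs_pos_eq (/ PI)) by fin.
  note (sin_le_abs (2*PI*a)) as Q. rewrite (Rabs_pos_eq (2*PI*a)) in Q by fin.
  apply Rmult_le_reg_r with PI; [lra|]. rewrite Rmult_assoc, Rinv_l by lra. lra.
 - rewrite <- (Rpower_1 a) at 1 by lra. rewrite Rmult_assoc, <- Rpower_plus.
  assert (Rpower a (1 + - sg) <= 1); [|lra]. le (Rpower 1 (1 + - sg)); [fin | rewrite Rpower_base_1; lra].
Qed.

(** This replaces Stirling's formula for the factor of the functional equation: [s] times an
    oscillating integral of order [|t|^(-1/2 - sg)], plus bounded terms, which are admissible since
    [1/2 - sg] is positive. *)
Lemma gamma_factor_bound sg : 0 < sg < 1/2 -> exists B, 0 <= B /\ forall t l, 1 <= Rabs t -> improper (mell hwave (pt sg t)) l ->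
 Cmod (pt sg t*(pt sg t + 1)*l)%C <= B*Rpower (Rabs t) (1/2 - sg).
Proof.
 intros Hsg. destruct (osc_tail sg Hsg) as [B0 [HB0 HB]]. note PI_gt_3 as H3.
 exists (2*B0 + 11). split; [lra|]. intros t l Ht Hl. set (s := pt sg t : C). set (x := Rabs t) in *.
 assert (Hsx : Cmod s <= 2*x). { ub Cmod_le_Re_Im. unfold s, Re, Im; simpl. fold x. rewrite Rabs_pos_eq; lra. }
 assert (Hs1x : Cmod (s + 1)%C <= 3*x). { ub Cmod_triangle. rewrite Cmod_R, Rabs_R1. lra. }
 destruct (Hl (/ (6*(x*x)))) as [K1 [A1 L1]]; [fin|].
 destruct (HB 1 t ltac:(auto) Ht) as [b1 [Hb1 Q1]]. destruct (HB (-1) t ltac:(auto) Ht) as [b2 [Hb2 Q2]].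
 (* The summand [2*x*(2*x)] makes the boundary terms at [1/K] and at [K] at most [1/(2*x)], which
    compensates [Cmod s <= 2*x]. The accuracy [1/(6 x^2)] compensates [s*(s + 1)] in the same
    way. *)
 set (K := K1 + b1 + b2 + 2*x*(2*x)). assert (HK : 1 <= K) by (unfold K; nra).
 assert (HaK : / K*K = 1) by fld.
 assert (Pa : 0 < / K <= 1). { nra. }
 specialize (L1 (/ K) K (proj1 Pa)). assert (L2 : Cmod (CI (mell hwave s) (/ K) K - l)%C <= / (6*(x*x))).
 { apply L1; [|unfold K; nra]. le (/ K*K); [|lra]. mul_l; [lra|]. unfold K; nra. }
 specialize (Q1 K ltac:(unfold K; nra)). specialize (Q2 K ltac:(unfold K; nra)). set (q := Rpower x (- (1/2) - sg)) in *.
 assert (Hq : 0 < q) by apply Rpower_pos. assert (Eq : x*q = Rpower x (1/2 - sg)). { rewrite <- (Rpower_1 x) at 1 by lra. unfold q. rewrite <- Rpower_plus. f_equal. field. }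
 assert (Hq1 : 1 <= Rpower x (1/2 - sg)). { le (Rpower x 0); [rewrite Rpower_O; lra | apply Rpower_le_base1; lra]. }
 assert (MP := mellin_by_parts sg t (/ K) K __ __). fold s in MP.
 set (f := fun v => (RtoC (sin (2*PI*v)/PI)*Rcpow v (- s - 1))%C) in *.
 assert (Cf : forall a b, 0 < a -> contI f a b).
 { intros a b Ha v Hv. apply cont_mult; [|fin]. apply contR_continuous, (ex_derive_continuous (fun v => sin (2*PI*v)/PI)). auto_derive; auto. }
 rewrite <- (CI_Chasles f (/ K) 1 K) in MP by (try lra; apply Cf; lra).
 assert (MN := mellin_near_zero sg t (/ K) Hsg __).
 assert (BT : Cmod (CI f 1 K) <= B0*q).
 { assert (E : CI f 1 K = (/ (2*Ci*RtoC PI)*(CI (osc 1 s) 1 K - CI (osc (-1) s) 1 K))%C).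
  { rewrite <- CI_minus, <- CI_cmult; try lra; try (intros v Hv; try apply cont_minus; apply cont_osc; lra).
   apply CI_ext; [lra|]. intros v Hv. unfold f, osc. replace (2*PI*-1*v) with (- (2*PI*1*v)) by ring. rewrite ei_opp, !ei_eq. replace (2*PI*1*v) with (2*PI*v) by ring.
   replace (RtoC (sin (2*PI*v)/PI)) with (/ (2*Ci*RtoC PI)*(pt (cos (2*PI*v)) (sin (2*PI*v)) - Cconj (pt (cos (2*PI*v)) (sin (2*PI*v)))))%C; [ring|].
   replace (pt (cos (2*PI*v)) (sin (2*PI*v)) - Cconj (pt (cos (2*PI*v)) (sin (2*PI*v))))%C with (2*Ci*RtoC (sin (2*PI*v)))%C by ceq.
   unfold Rdiv. rewrite RtoC_mult, RtoC_inv by lra. field. repeat split; try (apply RtoC_neq0; lra). intro E. apply (f_equal Im) in E. unfold Im in E; simpl in E; lra. }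
  rewrite E, Cmod_mult, Cmod_inv.
  2:{ intro E'. apply (f_equal Im) in E'. unfold Im in E'; simpl in E'; lra. }
  rewrite !Cmod_mult, Cmod_Ci, !Cmod_R, (Rabs_pos_eq 2), (Rabs_pos_eq PI) by lra.
  assert (HQ1 : Cmod (CI (osc 1 s) 1 K) <= B0*q) by exact Q1. assert (HQ2 : Cmod (CI (osc (-1) s) 1 K) <= B0*q) by exact Q2.
  assert (Cmod (CI (osc 1 s) 1 K - CI (osc (-1) s) 1 K)%C <= 2*(B0*q)) by (ub Cmod_sub_triangle; lra).
  apply Rmult_le_reg_l with (2*1*PI); [lra|]. rewrite <- Rmult_assoc, Rinv_r by lra. assert (0 <= B0*q) by fin. nra. }
 assert (BF : forall v, 0 < v -> Cmod (RtoC (hwave v)*Rcpow v (- s - 1))%C = hwave v*Rpower v (- (1 + sg))).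
 { intros v Hv. destruct (hwave_bound v). rewrite Cmod_mult, Cmod_R, Rabs_pos_eq, Cmod_Rcpow by lra. do 2 f_equal. unfold s, Re; simpl; ring. }
 assert (BK : Cmod (RtoC (hwave K)*Rcpow K (- s - 1))%C <= / (2*x)).
 { rewrite BF by lra. destruct (hwave_bound K). le (Rpower K (- (1 + sg))); [note (Rpower_pos K (- (1 + sg))); nra|].
  le (Rpower K (- (1))); [apply Rpower_le_base1; lra|]. rewrite Rpower_Ropp, Rpower_1 by lra. apply Rinv_le_contravar; [lra|]. unfold K; nra. }
 assert (BA : Cmod (RtoC (hwave (/ K))*Rcpow (/ K) (- s - 1))%C <= / (2*x)).
 { rewrite BF by lra. destruct (hwave_bound (/ K)) as [_ B2].
  le (Rpower (/ K) (1 - sg)).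
  - replace (Rpower (/ K) (1 - sg)) with (/ K*/ K*Rpower (/ K) (- (1 + sg))). { fin. }
   rewrite <- (Rpower_1 (/ K)) at 1 2 by lra. rewrite <- !Rpower_plus. f_equal. ring.
  - le (Rpower (/ K) (1/2)).
   + apply exp_le. assert (ln (/ K) <= 0) by (rewrite <- ln_1; apply ln_le; lra). nra.
   + le (Rpower (/ (2*x*(2*x))) (1/2)).
    * apply Rle_Rpower_l; [lra|]. split; [lra|]. apply Rinv_le_contravar; [nra|]. unfold K; nra.
    * rewrite Rinv_mult, <- Rpower_mult_distr, Rpower_half_sq by fin. lra. }
 replace (s*(s + 1)*l)%C with (s*((s + 1)*CI (mell hwave s) (/ K) K) - s*(s + 1)*(CI (mell hwave s) (/ K) K - l))%C by ring.
 rewrite MP. ub Cmod_sub_triangle. rewrite (Cmod_mult (s*(s + 1))%C), (Cmod_mult s (s + 1)%C).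
 assert (Z1 : Cmod s*Cmod (s + 1)%C*Cmod (CI (mell hwave s) (/ K) K - l)%C <= 1).
 { le (6*(x*x)*/ (6*(x*x))); [|right; field; lra].
  assert (Cmod s*Cmod (s + 1)%C <= 2*x*(3*x)) by fin.
  fin. }
 set (u := CI f (/ K) 1) in *. set (w := CI f 1 K) in *.
 match goal with |- Cmod (s*(u + w - (?p - ?r)))%C + _ <= _ => replace (s*(u + w - (p - r)))%C with (s*u + s*w - (s*p - s*r))%C by ring end.
 match goal with |- Cmod (_ - (s * ?p - s * ?r))%C + _ <= _ => set (P := p) in *; set (Rr := r) in*end.
 assert (Z2 : Cmod (s*u + s*w - (s*P - s*Rr))%C <= 6 + 2*x*(B0*q) + (1 + 1)).
 { ub Cmod_sub_triangle. apply Rplus_le_compat.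
  - ub Cmod_triangle. apply Rplus_le_compat; auto. rewrite Cmod_mult. fin.
  - ub Cmod_sub_triangle. rewrite !Cmod_mult. assert (Ex : 2*x*/ (2*x) = 1) by fld. rewrite <- Ex.
   fin. }
 rewrite <- Eq. lra.
Qed.

(** * Conjugation and reflection *)

Lemma Cexp_conj z : Cexp (Cconj z) = Cconj (Cexp z).
Proof. unfold Cexp, Cconj. apply C_eq; unfold Re, Im; simpl; rewrite ?cos_neg, ?sin_neg; ring. Qed.

Lemma Rcpow_conj x s : Rcpow x (Cconj s) = Cconj (Rcpow x s).
Proof. unfold Rcpow. rewrite <- Cexp_conj. f_equal. ceq. Qed.

(** The approximating expression of [zeta_approx] commutes with conjugation, and its error tends to
    0 at both points. *)
Lemma zeta_conj s : 0 < Re s -> s <> RtoC 1 -> zeta (Cconj s) = Cconj (zeta s).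
Proof.
 intros Hs Hs1. assert (Hc1 : Cconj s <> RtoC 1). { intro E. apply Hs1. rewrite <- (Cconj_conj s), E. ceq. }
 apply C_eq_of_small. intros eps He. note (Cmod_ge_0 s) as H0.
 destruct (Rpower_small (Re s) (eps/2*Re s/(Cmod s + 1)) Hs) as [N0 HN]; [fin|].
 set (N := S N0). specialize (HN N0 (le_n _)). fold N in HN.
 assert (Z1 := zeta_approx s N Hs Hs1 ltac:(unfold N; lia)). assert (Z2 := zeta_approx (Cconj s) N Hs Hc1 ltac:(unfold N; lia)).
 assert (E : (csum (zterm (Cconj s)) N + Rcpow (INR (S N)) (1 - Cconj s)/(Cconj s - 1) = Cconj (csum (zterm s) N + Rcpow (INR (S N)) (1 - s)/(s - 1)))%C).
 { rewrite Cplus_conj, Cdiv_conj by fin. rewrite Cconj_csum. f_equal.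
  - apply csum_ext. intros i _. unfold zterm. rewrite <- Rcpow_conj. f_equal.
  - rewrite <- Rcpow_conj, !Cminus_conj. replace (Cconj 1) with (RtoC 1) by ceq. auto. }
 set (A := (csum (zterm s) N + Rcpow (INR (S N)) (1 - s)/(s - 1))%C) in *.
 rewrite <- Cmod_conj in Z1.
 replace (zeta s - csum (zterm s) N - Rcpow (INR (S N)) (1 - s)/(s - 1))%C with (zeta s - A)%C in Z1 by ceq.
 replace (zeta (Cconj s) - csum (zterm (Cconj s)) N - Rcpow (INR (S N)) (1 - Cconj s)/(Cconj s - 1))%C with (zeta (Cconj s) - Cconj A)%C in Z2 by (rewrite <- E; ring).
 rewrite Cminus_conj in Z1. rewrite Cmod_conj in Z2. replace (Re (Cconj s)) with (Re s) in Z2 by auto.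
 replace (zeta (Cconj s) - Cconj (zeta s))%C with ((zeta (Cconj s) - Cconj A) - (Cconj (zeta s) - Cconj A))%C by ring.
 ub Cmod_sub_triangle.
 assert (Cmod s*Rpower (INR N) (- Re s)/Re s <= eps/2); [|lra].
 apply Rmult_le_reg_r with (Re s); auto. replace (Cmod s*Rpower (INR N) (- Re s)/Re s*Re s) with (Cmod s*Rpower (INR N) (- Re s)) by fld.
 note (Rpower_pos (INR N) (- Re s)). le ((Cmod s + 1)*(eps/2*Re s/(Cmod s + 1))); [nra | right; field; lra].
Qed.

Lemma zeta_reflect sg : 0 < sg < 1/2 -> exists B, 0 <= B /\ forall t, 1 <= Rabs t ->
 Cmod (zeta (pt sg t)) <= B*Rpower (Rabs t) (1/2 - sg)*Cmod (zeta (pt (1 - sg) t)).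
Proof.
 intros Hsg. destruct (gamma_factor_bound sg Hsg) as [B [HB H]]. destruct functional_equation as [G FE]. exists B. split; auto. intros t Ht.
 destruct (FE (pt sg t) Hsg Ht) as [I E]. rewrite E, Cmod_mult.
 replace (1 - pt sg t)%C with (Cconj (pt (1 - sg) t)) by ceq.
 rewrite zeta_conj, Cmod_conj.
 - fin.
 - fin.
 - fin.
Qed.

#[export] Hint Resolve cont_osc : an.

(** * A Plancherel inequality *)

Lemma uniform_cont f a b : contI f a b -> forall eps, 0 < eps -> exists del, 0 < del /\
 forall x y, a <= x <= b -> a <= y <= b -> Rabs (x - y) < del -> Cmod (f x - f y)%C <= eps.
Proof.
 intros H eps He.
 assert (U := fun (g : R -> R) Hg => unifcont_1d (V := R_UniformSpace) g a b Hg (mkposreal (eps/2) __)).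
 destruct (U (fun t => Re (f t))) as [d1 D1]. { intros x Hx. apply contR_continuous, cont_Re; auto. }
 destruct (U (fun t => Im (f t))) as [d2 D2]. { intros x Hx. apply contR_continuous, cont_Im; auto. }
 exists (Rmin d1 d2). split; [apply Rmin_glb_lt; apply cond_pos|]. intros x y Hx Hy Hd.
 note (Rmin_l d1 d2). note (Rmin_r d1 d2).
 ub Cmod_le_Re_Im. rewrite Re_minus, Im_minus.
 assert (Q1 := D1 y x Hy Hx). assert (Q2 := D2 y x Hy Hx). unfold ball in Q1, Q2; simpl in Q1, Q2. unfold AbsRing_ball, abs, minus, plus, opp in Q1, Q2; simpl in Q1, Q2.
 specialize (Q1 ltac:(unfold Rminus in *; lra)). specialize (Q2 ltac:(unfold Rminus in *; lra)). unfold Rminus. lra.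
Qed.

Lemma riemann_close f a h eps n : 0 <= h -> contI f a (a + INR n*h) ->
 (forall x y, a <= x <= a + INR n*h -> a <= y <= a + INR n*h -> Rabs (x - y) <= h -> Cmod (f x - f y)%C <= eps) ->
 Cmod (CI f a (a + INR n*h) - csum (fun j => RtoC h*f (a + INR j*h)%R) n)%C <= INR n*h*eps.
Proof.
 intros Hh. induction n as [|n IH]; intros Hc Hu.
 - rewrite INR_0, Rmult_0_l, Rplus_0_r. simpl. replace (CI f a a) with (RtoC 0) by (symmetry; apply CI_unique, (is_RInt_point (V := CN))).
  replace (RtoC 0 - RtoC 0)%C with (RtoC 0) by ring. rewrite Cmod_0. lra.
 - rewrite S_INR in *. note (pos_INR n). set (b := a + INR n*h). assert (Hb : a + (INR n + 1)*h = b + h) by (unfold b; ring). rewrite Hb in *.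
  assert (Hab : a <= b) by nra.
  rewrite <- (CI_Chasles f a b (b + h)) by (auto; lra). cbn [csum].
  assert (IH' : Cmod (CI f a b - csum (fun j => RtoC h*f (a + INR j*h)%R) n)%C <= INR n*h*eps).
  { fin. }
  assert (L : Cmod (CI (fun t => f t - f b)%C b (b + h)) <= h*eps).
  { replace h with (b + h - b) at 2 by ring. apply CI_bound; [lra | | intros t Ht; apply Hu; try lra; rewrite Rabs_pos_eq; lra].
   fin. }
  rewrite CI_minus, CI_const in L; [| lra | fin | fin].
  replace (b + h - b) with h in L by ring. fold b.
  replace (_ - _)%C with ((CI f a b - csum (fun j => RtoC h*f (a + INR j*h)%R) n) + (CI f b (b + h) - RtoC h*f b))%C by ring.
  ub Cmod_triangle. lra.
Qed.

Lemma lsr_seq (f : nat -> R) a n : lsr f (seq a n) = rsum (fun i => f (a + i)%nat) n.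
Proof.
 revert a. induction n as [|n IH]; intros a; [auto|]. rewrite seq_S, lsr_app, IH. simpl. ring.
Qed.

Lemma RInt_mono (f g : R -> R) a b : a <= b -> contI (fun t => RtoC (f t)) a b -> contI (fun t => RtoC (g t)) a b ->
 (forall t, a <= t <= b -> f t <= g t) -> RInt f a b <= RInt g a b.
Proof. intros Hab Hf Hg H. apply RInt_le; auto; [fin | fin |]; auto. fin. Qed.

Lemma sq_le_2 f w e : 0 <= f -> 0 <= w -> f <= w + e -> f*f <= 2*(w*w) + 2*(e*e).
Proof.
 intros Hf Hw H. note (Rle_0_sqr (w - e)) as K. unfold Rsqr in K.
 nra.
Qed.

Definition four (g : R -> C) (T v : R) : C := CI (fun t => g t*ei (t*v))%C (- T) T.

Lemma cont_ei_l v t : cont_at dR (fun t => ei (t*v)) t.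
Proof.
 replace (fun t => ei (t*v)) with (fun t => ei (v*t)) by (apply functional_extensionality; intros; f_equal; ring). fin.
Qed.

Lemma cont_four g T v : 0 <= T -> contI g (- T) T -> cont_at dR (four g T) v.
Proof.
 intros HT Hg. assert (K := cder_CI_exp g (fun t => Ci*RtoC t)%C (- T) T (RtoC v) __ Hg).
 assert (K2 : cont_at dR (fun v => CI (fun t => g t*Cexp (Ci*RtoC t*RtoC v))%C (- T) T) v).
 { apply (cont_comp dR (fun z => CI (fun t => g t*Cexp (Ci*RtoC t*z))%C (- T) T) RtoC); [fin|]. eapply cder_cont, K.
  fin. }
 replace (four g T) with (fun v => CI (fun t => g t*Cexp (Ci*RtoC t*RtoC v))%C (- T) T); auto.
 apply functional_extensionality. intros w. apply CI_ext; [lra|]. intros t Ht. unfold ei. do 2 f_equal. ceq.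
Qed.

Lemma ei_lip x y : Cmod (ei x - ei y)%C <= Rabs (x - y)*2.
Proof.
 replace (ei x - ei y)%C with (ei y*(ei (x - y) - 1))%C.
 2:{ replace (ei y*(ei (x - y) - 1))%C with (ei y*ei (x - y) - ei y)%C by ring. rewrite <- ei_plus. do 2 f_equal. ring. }
 rewrite Cmod_mult, ei_mod, Rmult_1_l. set (d := x - y). rewrite ei_eq.
 ub Cmod_le_Re_Im. unfold Re, Im; simpl. replace (cos d + - (1)) with (- (1 - cos d)) by ring. replace (sin d + - 0) with (sin d) by ring.
 rewrite Rabs_Ropp. note (sin_le_abs d). destruct (one_minus_cos_le d) as [A B]. rewrite (Rabs_pos_eq (1 - cos d)) by auto. note (Rabs_pos d). assert (d*d = Rabs d*Rabs d) by (rewrite <- Rabs_mult; symmetry; apply Rabs_pos_eq, Rle_0_sqr).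
 note (COS_bound d). nra.
Qed.

(** A Riemann sum turns the Fourier integral into a finite exponential sum with equally spaced
    frequencies, uniformly for [v] in [[-L, L]]. There [mean_value] applies, with row sums from
    [lorentz_sum]. *)
Lemma plancherel g T L : 0 < T -> 0 < L -> contI g (- T) T ->
 RInt (fun v => Cmod (four g T v)*Cmod (four g T v)) (- L) L <= 256*RInt (fun t => Cmod (g t)*Cmod (g t)) (- T) T.
Proof.
 intros HT HL Hg. set (G := RInt (fun t => Cmod (g t)*Cmod (g t)) (- T) T).
 destruct (contI_bounded g (- T) T __ Hg) as [M HM].
 assert (M0 : 0 <= M) by (ele; [apply Cmod_ge_0 | apply (HM T); lra]).
 assert (Cgg : contI (fun t => RtoC (Cmod (g t)*Cmod (g t))) (- T) T) by fin.
 assert (G0 : 0 <= G). { apply RInt_ge_0; [lra | fin |]. fin. }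
 apply le_epsilon. intros e He.
 set (Q := 256*(2*T) + 4*L). assert (HQ : 0 < Q) by (unfold Q; lra).
 set (eps := Rmin 1 (e/Q)). assert (Heps : 0 < eps) by (apply Rmin_glb_lt; [lra | fin]).
 assert (HepsQ : Q*eps <= e). { note (Rmin_r 1 (e/Q)). le (Q*(e/Q)); [fin | right; field; lra]. }
 assert (Heps1 : eps <= 1) by apply Rmin_l.
 set (e1 := eps/(2*(2*T))). assert (He1 : 0 < e1) by (apply Rdiv_lt_0_compat; lra).
 destruct (uniform_cont g (- T) T Hg e1 He1) as [d1 [Hd1 U1]].
 destruct (uniform_cont _ (- T) T Cgg eps Heps) as [d2 [Hd2 U2]].
 set (d3 := e1/(2*(M + 1)*L)). assert (Hd3 : 0 < d3) by (apply Rdiv_lt_0_compat; [auto | nra]).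
 (* The mesh keeps [L*h] at most 8, so that [8*(L*h) + 64] is at most 128; squaring the
    approximation error doubles this to 256. *)
 set (d4 := / L*8). assert (Hd4 : 0 < d4) by (unfold d4; assert (0 < / L) by fin; lra).
 set (d := Rmin (Rmin d1 d2) (Rmin d3 d4)). assert (Hd : 0 < d) by (repeat apply Rmin_glb_lt; auto).
 assert (Hdd : d <= d1 /\ d <= d2 /\ d <= d3 /\ d <= d4).
 { unfold d. note (Rmin_l (Rmin d1 d2) (Rmin d3 d4)). note (Rmin_r (Rmin d1 d2) (Rmin d3 d4)). note (Rmin_l d1 d2). note (Rmin_r d1 d2). note (Rmin_l d3 d4). note (Rmin_r d3 d4). lra. }
 destruct (nfloor_ex (2*T/d)) as [n0 [_ Hn0]]; [fin|].
 set (n := S n0). assert (Hn : 0 < INR n) by apply INR_S_pos. set (h := 2*T/INR n).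
 assert (Hh : 0 < h) by (apply Rdiv_lt_0_compat; lra). assert (Hnh : - T + INR n*h = T) by (unfold h; field; lra).
 assert (Hhd : h < d). { apply Rmult_lt_reg_r with (INR n/d); [fin|]. replace (h*(INR n/d)) with (2*T/d) by nra.
  replace (d*(INR n/d)) with (INR n) by fld. unfold n. rewrite S_INR. lra. }
 set (a := fun j : nat => (RtoC h*g (- T + INR j*h)%R)%C). set (lam := fun j : nat => - T + INR j*h).
 assert (MV := mean_value a lam (seq 0 n) L (4*L*(1 + 8/(L*h))) HL).
 rewrite lsr_seq in MV.
 assert (HB : forall x, In x (seq 0 n) -> lsr (fun y => 4*L/(1 + (L*(lam x - lam y))*(L*(lam x - lam y)))) (seq 0 n) <= 4*L*(1 + 8/(L*h))).
 { intros x Hx. rewrite lsr_seq. rewrite (rsum_ext _ (fun m => 4*L*/ (1 + (L*h*(INR x - INR m))*(L*h*(INR x - INR m))))).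
  - rewrite rsum_mult. mul_l; [lra|]. apply lorentz_sum. nra.
  - intros i _. simpl. unfold lam, Rdiv. do 3 f_equal. ring. }
 specialize (MV HB).
 assert (SW : forall v, - L <= v <= L -> Cmod (four g T v - wave a lam (seq 0 n) v)%C <= eps).
 { intros v Hv. unfold wave. rewrite csum_seq.
  assert (R1 := riemann_close (fun t => g t*ei (t*v))%C (- T) h (2*e1) n __). rewrite Hnh in R1.
  assert (E : csum (fun j => RtoC h*(g (- T + INR j*h)%R*ei ((- T + INR j*h)*v)))%C n = csum (fun i => a (0 + i)%nat*ei (lam (0 + i)%nat*v))%C n).
  { apply csum_ext. intros i _. unfold a, lam. ceq. }
  rewrite E in R1. ub R1.
  - intros t Ht. apply cont_mult; [auto | apply cont_ei_l].
  - intros x y Hx Hy Hxy. replace (g x*ei (x*v) - g y*ei (y*v))%C with ((g x - g y)*ei (x*v) + g y*(ei (x*v) - ei (y*v)))%C by ring.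
   ub Cmod_triangle. rewrite !Cmod_mult, ei_mod, Rmult_1_r.
   assert (A1 : Cmod (g x - g y)%C <= e1) by fin.
   assert (A2 : Cmod (g y)*Cmod (ei (x*v) - ei (y*v))%C <= e1).
   { le (M*(d3*L*2)).
    - apply Rmult_le_compat; [fin | fin | auto |]. ub ei_lip. mul_r; [lra|].
     replace (x*v - y*v) with ((x - y)*v) by ring. rewrite Rabs_mult. apply Rmult_le_compat; [fin | fin | lra | apply Rabs_le; lra].
    - unfold d3. le (e1*(M/(M + 1))); [right; field; nra|]. assert (M/(M + 1) <= 1); [|nra].
     apply Rmult_le_reg_r with (M + 1); [lra|]. replace (M/(M + 1)*(M + 1)) with M by fld. lra. }
   lra.
  - replace (INR n*h) with (2*T) by lra. unfold e1. right. field. lra. }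
 assert (RG : rsum (fun i => Cmod (a (0 + i)%nat)*Cmod (a (0 + i)%nat)) n <= h*(G + 2*T*eps)).
 { assert (R1 := riemann_close (fun t => RtoC (Cmod (g t)*Cmod (g t))) (- T) h eps n __). rewrite Hnh in R1. rewrite CI_RtoC in R1 by (auto; lra).
  replace (csum (fun j => RtoC h*RtoC (Cmod (g (- T + INR j*h)%R)*Cmod (g (- T + INR j*h)%R)))%C n) with (RtoC (rsum (fun j => h*(Cmod (g (- T + INR j*h)%R)*Cmod (g (- T + INR j*h)%R))) n)) in R1.
  2:{ clearbody h. clear. induction n as [|n IH]; [auto|]. cbn [csum rsum]. rewrite RtoC_plus, RtoC_mult, IH. auto. }
  rewrite <- RtoC_minus, Cmod_R in R1. assert (R2 : Rabs (G - rsum (fun j => h*(Cmod (g (- T + INR j*h)%R)*Cmod (g (- T + INR j*h)%R))) n) <= INR n*h*eps).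
  { fin. }
  replace (INR n*h) with (2*T) in R2 by lra. abs_in R2.
  rewrite (rsum_ext _ (fun j => h*(h*(Cmod (g (- T + INR j*h)%R)*Cmod (g (- T + INR j*h)%R))))).
  - rewrite rsum_mult. fin.
  - intros i _. unfold a. rewrite Cmod_mult, Cmod_R, Rabs_pos_eq by lra. simpl. ring. }
 assert (MV2 : RInt (fun v => Cmod (wave a lam (seq 0 n) v)*Cmod (wave a lam (seq 0 n) v)) (- L) L <= 128*(G + 2*T*eps)).
 { ub MV. le (2*(4*L*(1 + 8/(L*h)))*(h*(G + 2*T*eps))).
  - fin.
  - replace (2*(4*L*(1 + 8/(L*h)))*(h*(G + 2*T*eps))) with ((8*(L*h) + 64)*(G + 2*T*eps)) by fld.
   mul_r; [nra|]. assert (L*h <= L*d4) by fin. unfold d4 in H. replace (L*(/ L*8)) with 8 in H by fld. lra. }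
 assert (Cw : contI (fun v => RtoC (Cmod (wave a lam (seq 0 n) v)*Cmod (wave a lam (seq 0 n) v))) (- L) L) by fin.
 le (RInt (fun v => 2*(Cmod (wave a lam (seq 0 n) v)*Cmod (wave a lam (seq 0 n) v)) + 2*(eps*eps)) (- L) L).
 - apply RInt_mono; [lra | | |].
  + intros v _. apply contR_mult; apply cont_Cmod, cont_four; auto; lra.
  + fin.
  + intros v Hv. specialize (SW v Hv). set (w := wave a lam (seq 0 n) v) in *. set (f := four g T v) in *.
   assert (Cmod f <= Cmod w + eps). { replace f with (w + (f - w))%C by ring. ub Cmod_triangle. lra. }
   apply sq_le_2; auto; apply Cmod_ge_0.
 - rewrite (RInt_plus (V := RC)).
  + rewrite (RInt_scal (V := RC)) by (apply contR_ex_RInt; [lra | auto]). rewrite RInt_const. match goal with |- _ <= ?B => change (2*RInt (fun v => Cmod (wave a lam (seq 0 n) v)*Cmod (wave a lam (seq 0 n) v)) (- L) L + (L - - L)*(2*(eps*eps)) <= B) end.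
   le (256*G + Q*eps); [|lra]. unfold Q. assert (eps*eps <= eps) by nra. assert (L*(eps*eps) <= L*eps) by (mul_l; lra). lra.
  + fin.
  + fin.
Qed.

Lemma mellin_cont g T c x : 0 <= T -> contI g (- T) T -> 0 < x -> cont_at dR (fun x => CI (fun t => g t*Rcpow x (pt c t))%C (- T) T) x.
Proof.
 intros HT Hg Hx. assert (K := cder_CI_exp g (fun t => pt c t : C) (- T) T (RtoC (ln x)) __ Hg).
 apply (cont_comp dR (fun z => CI (fun t => g t*Cexp (pt c t*z))%C (- T) T) (fun x => RtoC (ln x))); [fin|]. eapply cder_cont, K.
 fin.
Qed.

(** After [x = exp v] the Mellin integral is [exp (c*v)] times a Fourier integral, and the total
    weight [exp ((2*c + 1)*v)] is at most [X^(2c + 1)]. *)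
Lemma mellin_plancherel g T c X : 0 < T -> 1 <= X -> 0 <= c -> contI g (- T) T ->
 RInt (fun x => Cmod (CI (fun t => g t*Rcpow x (pt c t))%C (- T) T)^2) 1 X
 <= 256*Rpower X (2*c + 1)*RInt (fun t => Cmod (g t)*Cmod (g t)) (- T) T.
Proof.
 intros HT HX Hc Hg. set (J := fun x => CI (fun t => g t*Rcpow x (pt c t))%C (- T) T).
 assert (G0 : 0 <= RInt (fun t => Cmod (g t)*Cmod (g t)) (- T) T).
 { apply RInt_ge_0; [lra | fin |]. fin. }
 note (Rpower_pos X (2*c + 1)).
 destruct HX as [HX| <-]; [|rewrite RInt_point; unfold zero; simpl; apply Rmult_le_pos; [nra | auto]].
 set (L := ln X). assert (HL : 0 < L) by (unfold L; rewrite <- ln_1; apply ln_increasing; lra).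
 assert (S := RInt_comp (V := RC) (fun x => Cmod (J x)^2) exp exp 0 L).
 rewrite exp_0 in S. assert (EL : exp L = X) by (apply exp_ln; lra). rewrite EL in S. fold (J 1). change (RInt (fun x => Cmod (J x)^2) 1 X <= 256*Rpower X (2*c + 1)*RInt (fun t => Cmod (g t)*Cmod (g t)) (- T) T).
 assert (EJ : forall v, Cmod (J (exp v)) = exp (c*v)*Cmod (four g T v)).
 { intros v. unfold J, four. rewrite <- (Rabs_pos_eq (exp (c*v))), <- Cmod_R, <- Cmod_mult by fin.
  rewrite <- CI_cmult; [|lra|intros t Ht; apply cont_mult; [fin | apply cont_ei_l]].
  f_equal. apply CI_ext; [lra|]. intros t Ht. unfold Rcpow. rewrite ln_exp.
  replace (pt c t*RtoC v)%C with (RtoC (c*v) + Ci*RtoC (t*v))%C by ceq.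
  rewrite Cexp_plus, Cexp_RtoC. ceq. }
 rewrite <- S.
 - le (RInt (fun v => Rpower X (2*c + 1)*(Cmod (four g T v)*Cmod (four g T v))) 0 L).
  + apply RInt_mono; [lra | | |].
   * intros v Hv. apply (contR_mult exp (fun v => Cmod (J (exp v))^2)).
    -- apply contR_continuous, (ex_derive_continuous exp). auto_derive; auto.
    -- apply contR_pow. replace (fun v => RtoC (Cmod (J (exp v)))) with (fun v => RtoC (exp (c*v)*Cmod (four g T v))) by (apply functional_extensionality; intros; rewrite EJ; auto).
     apply contR_mult; [apply contR_continuous, (ex_derive_continuous (fun v => exp (c*v))); auto_derive; auto | apply cont_Cmod, cont_four; auto; lra].
   * intros v Hv. apply contR_mult; [fin|]. apply contR_mult; apply cont_Cmod, cont_four; auto; lra.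
   * intros v Hv. unfold scal; simpl. unfold mult; simpl. rewrite EJ. set (F := Cmod (four g T v)). note (Cmod_ge_0 (four g T v)) as HF. fold F in HF.
    replace (exp v*(exp (c*v)*F*(exp (c*v)*F*1))) with (exp v*(exp (c*v)*exp (c*v))*(F*F)) by ring. rewrite <- !exp_plus.
    mul_r; [nra|]. unfold Rpower. apply exp_le. fold L. nra.
  + rewrite (RInt_scal (V := RC)). 2:{ apply contR_ex_RInt; [lra|]. intros v Hv. apply contR_mult; apply cont_Cmod, cont_four; auto; lra. }
   unfold scal; simpl. unfold mult; simpl.
   assert (P := plancherel g T L HT HL Hg).
   assert (C4 : forall a b, contI (fun v => RtoC (Cmod (four g T v)*Cmod (four g T v))) a b) by (intros a b v Hv; apply contR_mult; apply cont_Cmod, cont_four; auto; lra).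
   assert (RInt (fun v => Cmod (four g T v)*Cmod (four g T v)) 0 L <= RInt (fun v => Cmod (four g T v)*Cmod (four g T v)) (- L) L).
   { rewrite <- (RInt_Chasles (V := RC) _ (- L) 0 L) by fin. unfold plus; simpl.
    assert (0 <= RInt (fun v => Cmod (four g T v)*Cmod (four g T v)) (- L) 0); [|lra]. apply RInt_ge_0; [lra | fin |].
    fin. }
   nra.
 - intros x Hx. apply contR_continuous. apply contR_pow, cont_Cmod, mellin_cont; auto; [lra | fin].
 - intros x Hx. split; [auto_derive; auto; ring|]. apply (ex_derive_continuous exp). auto_derive; auto.
Qed.

#[export] Hint Resolve cont_four cont_ei_l : an.

(** * The weighted moment on the left of the critical line *)

(** The integrand of Perron's formula on [Re s = sig], stripped of [x^(s+1)]. *)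
Definition mline (k : nat) (sig t : R) : C := (zeta (pt sig t)^k/(pt sig t*(pt sig t + 1)))%C.

Lemma mline_den sig t : 0 < sig -> (pt sig t*(pt sig t + 1))%C <> RtoC 0.
Proof.
 fin.
Qed.

Lemma cont_mline k sig t : 0 < sig < 1 -> cont_at dR (mline k sig) t.
Proof.
 intros H.
 apply cont_div; [fin | fin |].
 fin.
Qed.

Lemma Cmod_line_ge sig t x : Rabs t <= Cmod (pt sig t + RtoC x)%C.
Proof. ele; [|apply Im_le_Cmod]. unfold Im; simpl. rewrite Rplus_0_r. lra. Qed.

Lemma mline_bound k sig t : 0 < sig -> 1 <= Rabs t -> Cmod (mline k sig t)^2 <= Cmod (zeta (pt sig t))^(2*k)*/ Rabs t^4.
Proof.
 intros H Ht. unfold mline. rewrite Cmod_div, Cmod_mult by fin. rewrite Cmod_pow.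
 unfold Rdiv. rewrite Rpow_mult_distr, <- pow_mult, Nat.mul_comm. mul_l; [fin|].
 rewrite pow_inv. apply Rinv_le_contravar; [fin|]. replace (Rabs t^4) with ((Rabs t*Rabs t)^2) by ring. apply pow_incr.
 assert (Q := Cmod_line_ge sig t 0). rewrite Cplus_0_r in Q. note (Cmod_line_ge sig t 1). nra.
Qed.

Lemma rsum_geometric rho n : 0 <= rho < 1 -> rsum (fun j => rho^j) n <= / (1 - rho).
Proof.
 intros H. assert (E : rsum (fun j => rho^j) n*(1 - rho) = 1 - rho^n) by (induction n as [|n IH]; simpl; [ring | lra]).
 apply Rmult_le_reg_r with (1 - rho); [lra|]. rewrite E, Rinv_l by lra. note (pow_le rho n). lra.
Qed.

Lemma RInt_dyadic (f : R -> R) n : (forall t, cont_at dR (fun t => RtoC (f t)) t) ->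
 RInt f 1 (2^n) = rsum (fun j => RInt f (2^j) (2*2^j)) n.
Proof.
 intros H. induction n as [|n IH]; [simpl; apply (RInt_point (V := RC))|]. cbn [rsum]. rewrite <- IH.
 assert (1 <= 2^n) by (apply pow_R1_Rle; lra). symmetry. apply (RInt_Chasles (V := RC)); apply contR_ex_RInt; try (intros t _; auto); simpl; lra.
Qed.

Lemma mline_moment k eta : (3 <= k <= 6)%nat -> 0 < eta <= 1/20 -> exists B, 0 <= B /\ forall T, 1 <= T ->
 RInt (fun t => Cmod (mline k (1/2 - 3/(2*INR k) + eta) t)^2) (- T) T <= B.
Proof.
 intros Hk He. set (sig := 1/2 - 3/(2*INR k) + eta).
 assert (Kb : 3 <= INR k <= 6). { split; [replace 3 with (INR 3) by (unfold INR; ring) | replace 6 with (INR 6) by (unfold INR; ring)]; apply le_INR; lia. }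
 assert (Hk0 : 3/(2*INR k)*(2*INR k) = 3) by fld.
 assert (Hsig : 0 < sig < 1/2). { unfold sig. nra. }
 destruct (zeta_reflect sig Hsig) as [B1 [HB1 R1]].
 (* This loss gives the moment [U^(1 + 5/3 k eta)], still below the room [U^(1 + 2 k eta)] left by
    the weight. *)
 destruct (zeta_moment k eta (INR k*eta/2) Hk He ltac:(nra)) as [B2 [HB2 Z]].
 replace (1/2 + 3/(2*INR k) - eta) with (1 - sig) in Z by (unfold sig; lra).
 set (q := fun t => Cmod (mline k sig t)^2).
 assert (Cq : forall t, cont_at dR (fun t => RtoC (q t)) t) by (intros t; apply contR_pow, cont_Cmod, cont_mline; lra).
 assert (q0 : forall t, 0 <= q t) by (intros; apply pow_le, Cmod_ge_0).
 (* The ratio [2^(-k eta/3)] of the geometric series of dyadic blocks is the difference of the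
    exponents [2 k eta] and [5/3 k eta]. *)
 set (rho := exp (- (INR k*eta*(ln 2/3)))).
 assert (L2 : 0 < ln 2) by (rewrite <- ln_1; apply ln_increasing; lra).
 assert (Hrho : 0 <= rho < 1). { split; [left; apply exp_pos|]. rewrite <- exp_0. apply exp_increasing. assert (0 < INR k*eta) by nra. nra. }
 set (D := B1^(2*k)*B2). assert (HD : 0 <= D) by (apply Rmult_le_pos; auto; apply pow_le; auto).
 assert (Block : forall j, RInt q (2^j) (2*2^j) <= D*rho^j).
 { intros j. set (v := exp (INR j*(ln 2/3))). assert (Hlv : ln v = INR j*(ln 2/3)) by apply ln_exp.
  assert (Hv3 : v^3 = 2^j). { unfold v. rewrite exp_pow, (pow_exp_ln 2) by lra. f_equal. replace (INR 3) with 3 by (unfold INR; ring). field. }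
  assert (Hv : 1 <= v). { rewrite <- exp_0. apply exp_le. fin. }
  specialize (Z v Hv). rewrite Hv3 in Z. set (U := 2^j) in *. assert (HU : 1 <= U) by nra.
  assert (lnU : ln U = 3*ln v). { rewrite <- Hv3. rewrite pow_exp_ln, ln_exp by lra. replace (INR 3) with 3 by (unfold INR; ring). ring. }
  set (c := B1^(2*k)*Rpower U (- (1 + 2*INR k*eta))).
  assert (Hc : 0 <= c) by (apply Rmult_le_pos; [fin | fin]).
  le (RInt (fun t => c*Cmod (zeta (pt (1 - sig) t))^(2*k)) U (2*U)).
  - apply RInt_mono; [lra | fin | fin |].
   intros t Ht. assert (At : Rabs t = t) by (apply Rabs_pos_eq; lra). ele; [apply mline_bound; lra|].
   specialize (R1 t __). rewrite At in R1. set (z := Cmod (zeta (pt (1 - sig) t))) in *.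
   assert (Hz : 0 <= z) by apply Cmod_ge_0.
   le ((B1*Rpower t (1/2 - sig)*z)^(2*k)*/ t^4).
   + fin.
   + rewrite !Rpow_mult_distr. replace (B1^(2*k)*Rpower t (1/2 - sig)^(2*k)*z^(2*k)*/ t^4) with (B1^(2*k)*(Rpower t (1/2 - sig)^(2*k)*/ t^4)*z^(2*k)) by ring.
    mul_r; [fin|]. mul_l; [fin|].
    rewrite <- Rpower_pow, Rpower_mult, <- (Rpower_pow 4 t), <- Rpower_Ropp, <- Rpower_plus by (try apply Rpower_pos; lra).
    replace ((1/2 - sig)*INR (2*k) + - INR 4) with (- (1 + 2*INR k*eta)).
    * apply Rpower_anti_base; nra.
    * rewrite mult_INR. replace (INR 2) with 2 by fin. replace (INR 4) with 4 by (unfold INR; ring). unfold sig. lra.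
  - rewrite (RInt_scal (V := RC)) by fin.
   ele; [mul_l; [auto | apply Z]|]. right. unfold c, D, Rpower, rho. rewrite lnU, exp_pow.
   replace (B1^(2*k)*exp (- (1 + 2*INR k*eta)*(3*ln v))*(B2*exp ((3 + 4*INR k*eta + 2*(INR k*eta/2))*ln v))) with
    (B1^(2*k)*B2*(exp (- (1 + 2*INR k*eta)*(3*ln v))*exp ((3 + 4*INR k*eta + 2*(INR k*eta/2))*ln v))) by ring.
   rewrite <- exp_plus. do 2 f_equal. nra. }
 set (B := RInt q (-1) 1 + 2*(D*/ (1 - rho))).
 assert (I0 : 0 <= RInt q (-1) 1) by (apply RInt_ge_0; [lra | fin | auto]).
 assert (Ir : 0 < / (1 - rho)) by fin.
 exists B. split; [unfold B; nra|]. intros T HT.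
 assert (Pos : RInt q 1 T <= D*/ (1 - rho)).
 { destruct (dyadic_exponent T HT) as [J [HJ _]].
  le (RInt q 1 (2^J)).
  - rewrite <- (RInt_Chasles (V := RC) q 1 T (2^J)) by fin. unfold plus; simpl.
   assert (0 <= RInt q T (2^J)); [|lra]. apply RInt_ge_0; [lra | fin | auto].
  - rewrite RInt_dyadic by auto. ele; [apply rsum_le; intros i _; apply Block|]. rewrite rsum_mult. mul_l; auto. apply rsum_geometric; auto. }
 assert (Sym : RInt q (- T) (-1) = RInt q 1 T).
 { assert (C1 := CI_opp_var (fun t => RtoC (q t)) 1 T HT ltac:(intros t _; auto)).
  rewrite (CI_ext _ (fun t => RtoC (q t))) in C1; [|lra|].
  - rewrite !CI_RtoC in C1; try lra; try (intros t _; auto). apply (f_equal Re) in C1. fin.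
  - intros t _. unfold q, mline. rewrite !Cmod_div by fin. rewrite !Cmod_mult, !Cmod_pow.
   replace (pt sig (- t) + 1)%C with (Cconj (pt sig t + 1)) by ceq.
   replace (pt sig (- t)) with (Cconj (pt sig t)) by fin.
   rewrite zeta_conj, !Cmod_conj; auto; [fin | fin]. }
 rewrite <- (RInt_Chasles (V := RC) q (- T) (-1) T), <- (RInt_Chasles (V := RC) q (-1) 1 T) by fin.
 unfold plus; simpl. unfold B. lra.
Qed.

#[export] Hint Resolve cont_mline mline_den : an.

(** * The integral of the error term *)

Lemma length_eq_of_incl {A} (l1 l2 : list A) : NoDup l1 -> NoDup l2 -> (forall x, In x l1 <-> In x l2) -> length l1 = length l2.
Proof. intros H1 H2 H. apply Nat.le_antisymm; apply NoDup_incl_length; auto; intros x Hx; apply H; auto. Qed.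

Lemma d_count k n N : (1 <= n <= N)%nat -> length (filter (fun t => Nat.eqb (tprod t) n) (lists_of_length k (seq 1 N))) = d k n.
Proof.
 intros Hn. apply length_eq_of_incl; try (apply NoDup_filter, NoDup_lists, seq_NoDup).
 intros t. rewrite !filter_In, !in_lists. change (fold_right Nat.mul 1%nat t) with (tprod t). rewrite Nat.eqb_eq. split; intros [[H1 H2] H3]; repeat split; auto; intros x Hx.
 - specialize (H2 x Hx). apply in_seq in H2. apply in_seq. note (tprod_divide t x Hx) as D. apply Nat.divide_pos_le in D; lia.
 - specialize (H2 x Hx). apply in_seq in H2. apply in_seq. lia.
Qed.

(** The sum of [d_k(n) (x - n)] over [n <= x], written over k-tuples with entries up to [N], so that
    Perron's formula can be applied tuple by tuple. For [x <= N] the value does not depend on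
    [N]. *)
Definition riesz (k N : nat) (x : R) : R := lsr (fun t => Rmax (x - INR (tprod t)) 0) (lists_of_length k (seq 1 N)).

Lemma in_lists_pos k N t : In t (lists_of_length k (seq 1 N)) -> forall x, In x t -> (1 <= x <= N)%nat.
Proof. intros H x Hx. apply in_lists in H. apply (proj2 H) in Hx. apply in_seq in Hx. lia. Qed.

Lemma riesz_by_value k N x : x <= INR N ->
 riesz k N x = rsum (fun i => INR (d k (S i))*Rmax (x - INR (S i)) 0) N.
Proof.
 intros Hx. unfold riesz. rewrite (lsr_by_value tprod (fun m => Rmax (x - INR m) 0) _ (1 + N + N^k)).
 (* The products run through 0, which does not occur, the values up to [N], and larger ones, which
    contribute 0 since [x <= N]. *)
 - rewrite rsum_split, (rsum_split _ 1 N).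
  match goal with |- _ + _ + rsum ?f _ = _ => rewrite (rsum_ext f (fun _ => 0)), rsum_const end.
  2:{ intros i _. rewrite Rmax_right; [ring|]. assert (INR N <= INR (1 + N + i)) by (apply le_INR; lia). lra. }
  simpl rsum at 1. rewrite (proj2 (length_zero_iff_nil _)).
  + rewrite INR_0. rewrite (rsum_ext _ (fun i => INR (d k (S i))*Rmax (x - INR (S i)) 0)); [ring|]. intros i Hi. rewrite d_count by lia. auto.
  + apply incl_l_nil. intros t Ht. apply filter_In in Ht. destruct Ht as [Ht E]. apply Nat.eqb_eq in E.
   assert (1 <= tprod t)%nat by (apply tprod_pos; intros y Hy; apply (in_lists_pos _ _ _ Ht y Hy)). lia.
 - intros t Ht. assert (tprod t <= N^length t)%nat by (apply tprod_le; intros y Hy; apply (in_lists_pos _ _ _ Ht y Hy)).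
  apply in_lists in Ht. rewrite (proj1 Ht) in H. lia.
Qed.

Lemma divisor_sum_between k n u : INR n < u < INR n + 1 -> divisor_sum k u = rsum (fun i => INR (d k (S i))) n.
Proof.
 intros Hu. unfold divisor_sum. change (Z.to_nat (Int_part u)) with (nfl u). rewrite (nfl_unique u n) by lra.
 rewrite (sum_n_m_ext_loc _ (fun j => INR (d k j))).
 - clear. induction n as [|n IH]; [fin|]. rewrite sum_n_Sm by lia. rewrite IH. auto.
 - intros j Hj. destruct (Req_EM_T (INR j) u) as [E|_]; auto. assert (INR j <= INR n) by (apply le_INR; lia). lra.
Qed.

Lemma is_RInt_divisor_sum k n : (1 <= n)%nat -> forall x, INR n <= x <= INR n + 1 ->
 is_RInt (divisor_sum k) 1 x (rsum (fun i => INR (d k (S i))*(x - INR (S i))) n).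
Proof.
 assert (Step : forall m y, INR m <= y <= INR m + 1 -> is_RInt (divisor_sum k) (INR m) y ((y - INR m)*rsum (fun i => INR (d k (S i))) m)).
 { intros m y Hy. apply (is_RInt_ext (fun _ => rsum (fun i => INR (d k (S i))) m)); [|apply (is_RInt_const (V := RN))].
  rewrite Rmin_left, Rmax_right by lra. intros u Hu. symmetry. apply divisor_sum_between. lra. }
 induction 1 as [|n Hn IH]; intros x Hx.
 - specialize (Step 1%nat x Hx). eapply (fun e => eq_ind _ (is_RInt _ 1 x) Step _ e). simpl rsum. lra.
 - rewrite S_INR in Hx. assert (I1 := IH (INR n + 1) __). assert (I2 := Step (S n) x ltac:(rewrite S_INR; lra)). rewrite S_INR in I2.
  assert (I := is_RInt_Chasles (V := RN) _ _ _ _ _ _ I1 I2). eapply (fun e => eq_ind _ (is_RInt _ 1 x) I _ e).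
  change (rsum (fun i => INR (d k (S i))*(INR n + 1 - INR (S i))) n + (x - (INR n + 1))*(rsum (fun i => INR (d k (S i))) n + INR (d k (S n))) = rsum (fun i => INR (d k (S i))*(x - INR (S i))) n + INR (d k (S n))*(x - INR (S n))).
  rewrite (S_INR n), Rmult_plus_distr_l, <- rsum_mult, <- Rplus_assoc, <- rsum_plus. f_equal; [|ring]. apply rsum_ext. intros. ring.
Qed.

Lemma is_RInt_divisor_riesz k N x : 1 <= x <= INR N -> is_RInt (divisor_sum k) 1 x (riesz k N x).
Proof.
 intros Hx. rewrite riesz_by_value by lra. set (n := nfl x). note (nfl_spec x __) as Hn. fold n in Hn.
 assert (H1 : (0 < n)%nat) by (apply INR_lt; rewrite INR_0; lra).
 assert (HnN : (n <= N)%nat) by (apply INR_le; lra).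
 replace N with (n + (N - n))%nat by lia. rewrite rsum_split. match goal with |- is_RInt _ _ _ (_ + rsum ?f _) => rewrite (rsum_ext f (fun _ => 0)), rsum_const, Rmult_0_r, Rplus_0_r end.
 - rewrite (rsum_ext _ (fun i => INR (d k (S i))*(x - INR (S i)))); [apply is_RInt_divisor_sum; auto; lra|].
  intros i Hi. rewrite Rmax_left; auto. assert (INR (S i) <= INR n) by (apply le_INR; lia). lra.
 - intros i _. rewrite Rmax_right; [ring|]. rewrite S_INR, plus_INR. note (pos_INR i). lra.
Qed.

Lemma cont_riesz k N x : cont_at dR (fun x => RtoC (riesz k N x)) x.
Proof.
 unfold riesz. induction (lists_of_length k (seq 1 N)) as [|t l IH]; [apply (cont_const dR (RtoC 0))|]. apply contR_plus; auto.
 replace (fun v => RtoC (Rmax (v - INR (tprod t)) 0)) with (fun v => RtoC (/ 2*((v - INR (tprod t)) + Cmod (RtoC (v - INR (tprod t)))))).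
 - assert (cont_at dR (fun v => RtoC (v - INR (tprod t))) x) by (apply contR_plus; [fin | fin]).
  fin.
 - apply functional_extensionality. intros v. f_equal. rewrite Cmod_R. unfold Rmax, Rabs. destruct (Rle_dec _ _), (Rcase_abs _); lra.
Qed.

(** The residue at 1 as an integral over one fixed circle, so that it can be differentiated in [x]
    under the integral sign. *)
Definition pole_arc (f : C -> C) : C := (/ (RtoC (2*PI)*Ci)*arc f (RtoC 1) (1/4) 0 (2*PI))%C.

Lemma two_pi_i_neq : (RtoC (2*PI)*Ci)%C <> RtoC 0.
Proof. intro E. apply (f_equal Im) in E. unfold Im in E; simpl in E. note PI_RGT_0. lra. Qed.

Lemma main_term_arc k x : main_term k x = Re (pole_arc (fun s => zeta s^k*Rcpow x s/s)%C).
Proof.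
 unfold main_term. f_equal. apply residue_unique. exists (1/2). split; [lra|].
 assert (Hol : forall z, 0 < Re z < 3 -> z <> RtoC 1 -> hol (fun s => zeta s^k*Rcpow x s/s)%C z).
 { fin. }
 split.
 - intros z Hz. apply holomorphic_hol, Hol.
  + assert (Cmod (z - RtoC 1)%C < 1/2) by lra. apply Re_disc in H. change (Re (RtoC 1)) with 1 in H. lra.
  + intro E. rewrite E in Hz. replace (RtoC 1 - RtoC 1)%C with (RtoC 0) in Hz by ring. rewrite Cmod_0 in Hz. lra.
 - intros r Hr. replace (RtoC (2*PI)*Ci*_)%C with (arc (fun s => zeta s^k*Rcpow x s/s)%C (RtoC 1) r 0 (2*PI)).
  + note PI_RGT_0. apply CI_correct; [lra|]. intros t Ht. apply cont_mult.
   * apply (cont_comp dR (fun s => zeta s^k*Rcpow x s/s)%C (circ (RtoC 1) r)); [apply cont_circ|]. apply hol_cont, Hol.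
    -- rewrite Re_circ. unfold Re; simpl. note (COS_bound t). nra.
    -- intro E. assert (K := Cmod_circ (RtoC 1) r t __). rewrite E in K. replace (RtoC 1 - RtoC 1)%C with (RtoC 0) in K by ring. rewrite Cmod_0 in K. lra.
   * fin.
  + unfold pole_arc. rewrite Cmult_assoc, Cinv_r, Cmult_1_l by apply two_pi_i_neq.
   (* Circles of different radius are compared through the same rectangle. *)
   rewrite <- (rect_residue _ 0 3 1 (1/2) 2 1 r), <- (rect_residue _ 0 3 1 (1/2) 2 1 (1/4)); auto; lra.
Qed.

Definition pole_prim (k : nat) (x : R) : C := pole_arc (fun s => zeta s^k*perron_kernel x s)%C.

Lemma circ_quarter t : circ (RtoC 1) (1/4) t <> RtoC 1 /\ 3/4 <= Re (circ (RtoC 1) (1/4) t) <= 5/4.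
Proof.
 split.
 - intro E. assert (K := Cmod_circ (RtoC 1) (1/4) t __). rewrite E in K. replace (RtoC 1 - RtoC 1)%C with (RtoC 0) in K by ring. rewrite Cmod_0 in K. lra.
 - rewrite Re_circ. unfold Re; simpl. note (COS_bound t). lra.
Qed.

(** Under the circle integral [x^(s+1)/(s(s+1))] has the derivative [x^s/s], so [pole_prim] is an
    antiderivative of the complex main term. *)
Lemma pole_prim_derive k : forall x, 0 < x ->
 rder (pole_prim k) x (pole_arc (fun s => zeta s^k*Rcpow x s/s)%C) /\ cont_at dR (fun x => pole_arc (fun s => zeta s^k*Rcpow x s/s)%C) x.
Proof.
 note PI_RGT_0 as Hpi. set (w := circ (RtoC 1) (1/4)). set (e := fun t => (Ci*(RtoC (1/4)*Cexp (Ci*RtoC t)))%C).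
 assert (Hw : forall t, w t <> RtoC 0 /\ (w t + 1)%C <> RtoC 0).
 { intros t. note (circ_quarter t) as [_ Q]. fold w in Q. split; [fin|]. intro E. apply (f_equal Re) in E. rewrite Re_plus in E. change (Re (RtoC 1)) with 1 in E. change (Re (RtoC 0)) with 0 in E. lra. }
 assert (Cw : forall t, cont_at dR w t) by (intros; apply cont_circ).
 assert (Ce : forall t, cont_at dR e t) by (intros; apply cont_mult; [fin | fin]).
 assert (Cz : forall t, cont_at dR (fun t => zeta (w t)^k)%C t).
 { intros t. apply cont_pow. apply (cont_comp dR zeta w); auto. apply hol_cont, hol_zeta. apply circ_quarter. }
 set (A1 := fun t => (zeta (w t)^k/(w t*(w t + 1))*e t)%C). set (A0 := fun t => (zeta (w t)^k/w t*e t)%C).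
 assert (C1 : contI A1 0 (2*PI)).
 { intros t _. apply cont_mult; auto. apply cont_div; auto; [apply Cmult_neq_0; apply Hw|]. fin. }
 assert (C0 : contI A0 0 (2*PI)) by (intros t _; apply cont_mult; auto; apply cont_div; auto; apply Hw).
 assert (Cp : contI (fun t => w t + 1)%C 0 (2*PI)) by fin.
 assert (E1 : pole_prim k = fun x => (/ (RtoC (2*PI)*Ci)*CI (fun t => A1 t*Cexp ((w t + 1)*RtoC (ln x))) 0 (2*PI))%C).
 { apply functional_extensionality. intros x. unfold pole_prim, pole_arc, arc. f_equal. apply CI_ext; [lra|]. intros t _. fold w. ceq. }
 assert (E0 : (fun x => pole_arc (fun s => zeta s^k*Rcpow x s/s)%C) = fun x => (/ (RtoC (2*PI)*Ci)*CI (fun t => A0 t*Cexp (w t*RtoC (ln x))) 0 (2*PI))%C).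
 { apply functional_extensionality. intros x. unfold pole_arc, arc. f_equal. apply CI_ext; [lra|]. intros t _. fold w. ceq. }
 intros x Hx. split.
 - assert (K := cder_CI_exp A1 (fun t => w t + 1)%C 0 (2*PI) (RtoC (ln x)) __ C1 Cp).
  assert (Kl : rder (fun x => RtoC (ln x)) x (RtoC (/ x))) by (apply rder_of_real, is_derive_Reals, derivable_pt_lim_ln; auto).
  assert (K2 := rder_mult _ _ _ _ _ (rder_const (/ (RtoC (2*PI)*Ci))%C x) (rder_comp _ _ _ _ _ Kl K)).
  rewrite E1. eapply (fun q => eq_ind _ (rder _ x) K2 _ q). rewrite Cmult_0_l, Cplus_0_l. change (pole_arc (fun s => zeta s^k*Rcpow x s/s)%C) with ((fun x => pole_arc (fun s => zeta s^k*Rcpow x s/s)%C) x). rewrite E0.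
  f_equal. rewrite Cmult_comm, <- CI_cmult; [|lra|].
  + apply CI_ext; [lra|]. intros t _. unfold A1, A0. replace ((w t + 1)*RtoC (ln x))%C with (w t*RtoC (ln x) + RtoC (ln x))%C by ring. rewrite Cexp_plus, Cexp_RtoC, exp_ln by auto.
   rewrite RtoC_inv by lra. destruct (Hw t). assert (RtoC x <> RtoC 0) by fin. field. auto.
  + intros t Ht. apply cont_mult; [fin|]. apply (cont_comp dR Cexp); [fin | fin].
 - rewrite E0. apply cont_mult; [fin|]. assert (K := cder_CI_exp A0 w 0 (2*PI) (RtoC (ln x)) __ C0 ltac:(intros t _; auto)).
  apply (cont_comp dR (fun z => CI (fun t => A0 t*Cexp (w t*z))%C 0 (2*PI)) (fun x => RtoC (ln x))); [fin|]. exact (cder_cont _ _ _ K).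
Qed.

Lemma RInt_Delta k N x : 1 <= x <= INR N ->
 RInt (Defs.Delta k) 1 x = riesz k N x - (Re (pole_prim k x) - Re (pole_prim k 1)) - (x - 1)*Re (zeta (RtoC 0)^k)%C.
Proof.
 intros Hx. apply (is_RInt_unique (V := RC)).
 apply (is_RInt_minus (V := RN)); [|apply (is_RInt_const (V := RN))].
 apply (is_RInt_minus (V := RN)); [apply is_RInt_divisor_riesz; auto|].
 assert (C1 : contI (fun x => pole_arc (fun s => zeta s^k*Rcpow x s/s)%C) 1 x) by (intros t Ht; apply pole_prim_derive; lra).
 assert (I := CI_correct _ 1 x __ C1). rewrite (CI_FTC (pole_prim k)) in I; auto; [|lra|intros t Ht; apply pole_prim_derive; lra].
 apply is_RInt_Re_Im in I. destruct I as [I _].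
 apply (is_RInt_ext (fun t => Re (pole_arc (fun s => zeta s^k*Rcpow t s/s)%C))); auto. intros t _. symmetry. apply main_term_arc.
Qed.

#[export] Hint Resolve cont_riesz : an.

(** * Perron's formula and the shift of the contour *)

Lemma Seg_vert f x a b : a <= b -> contI (fun t => f (pt x t)) a b -> Seg f (pt x a) (pt x b) = (Ci*CI (fun t => f (pt x t)) a b)%C.
Proof.
 intros Hab Hc. unfold Seg. replace (pt x b - pt x a)%C with (Ci*RtoC (b - a))%C by ceq.
 destruct Hab as [Hab|Hab].
 - assert (Q := CI_comp_lin (fun t => f (pt x t)) (b - a) a 0 1 __ __). replace ((b - a)*0 + a) with a in Q by ring. replace ((b - a)*1 + a) with b in Q by ring.
  rewrite Q by auto. rewrite <- Cmult_assoc. do 2 f_equal. apply CI_ext; [lra|]. intros t _. f_equal. ceq.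
 - rewrite Hab. replace (CI (fun t => f (pt x t)) b b) with (RtoC 0) by (symmetry; apply CI_unique, (is_RInt_point (V := CN))).
  ceq.
Qed.

Lemma Cpow_diff (a b : C) M k : 1 <= M -> Cmod a <= M -> Cmod b <= M -> Cmod (a^k - b^k)%C <= INR k*M^k*Cmod (a - b)%C.
Proof.
 intros HM Ha Hb. induction k as [|k IH].
 - simpl. replace (RtoC 1 - RtoC 1)%C with (RtoC 0) by ring. rewrite Cmod_0, INR_0. lra.
 - rewrite S_INR. simpl Cpow. replace (a*a^k - b*b^k)%C with (a*(a^k - b^k) + (a - b)*b^k)%C by ring.
  ub Cmod_triangle. rewrite !Cmod_mult, Cmod_pow. note (Cmod_ge_0 (a - b)%C). note (Cmod_ge_0 (a^k - b^k)%C).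
  assert (P1 : 1 <= M^k) by (apply pow_R1_Rle; auto). assert (P2 : Cmod b^k <= M^k) by fin.
  simpl pow.
  assert (Cmod (a - b)%C*Cmod b^k <= Cmod (a - b)%C*(M*M^k)) by (mul_l; auto; nra). nra.
Qed.

Lemma zterm_2_bound s i : Re s = 2 -> Cmod (zterm s i) <= Rpower (INR (S i)) (- (1 + 1)).
Proof. intros H. apply zterm_bound. lra. Qed.

Lemma csum_zterm_2 s N : Re s = 2 -> Cmod (csum (zterm s) N) <= 2.
Proof.
 intros H. ub Cmod_csum. ele; [apply rsum_le; intros i _; apply zterm_2_bound; auto|].
 ele; [apply (rsum_mono _ N (1 + N)); [fin | lia]|].
 assert (Q := rsum_power_tail 1 1 (1 + N) __ ltac:(lia) ltac:(lia)). simpl (rsum _ 1) in Q. rewrite INR_1, !Rpower_base_1 in Q. lra.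
Qed.

Lemma zeta_2_approx s N : Re s = 2 -> (1 <= N)%nat -> Cmod (zeta s - csum (zterm s) N)%C <= / INR N.
Proof.
 intros H HN. assert (0 < INR N) by (apply lt_0_INR; lia).
 apply (ser_bound _ (fun i => Rpower (INR (S i)) (- (1 + 1)))).
 - apply is_series_ser. apply (proj2 zeta_spec). lra.
 - intros; apply zterm_2_bound; auto.
 - intros n Hn. ele; [apply rsum_power_tail; auto; lra|]. rewrite Rpower_Ropp, Rpower_1 by auto. lra.
Qed.

Lemma zeta_2_bound s : Re s = 2 -> Cmod (zeta s) <= 3.
Proof.
 intros H. assert (A := zeta_2_approx s 1 H ltac:(lia)). assert (B := csum_zterm_2 s 1 H). rewrite INR_1, Rinv_1 in A.
 replace (zeta s) with ((zeta s - csum (zterm s) 1) + csum (zterm s) 1)%C by ring. ub Cmod_triangle. lra.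
Qed.


Lemma Cmod_s1_ge c t : 0 <= c -> Cmod (pt c t) <= Cmod (pt c t + 1)%C /\ 1 <= Cmod (pt c t + 1)%C /\ c <= Cmod (pt c t) /\ Rabs t <= Cmod (pt c t).
Proof.
 intros Hc. repeat split.
 - apply sqrt_le_1_alt. simpl. nra.
 - ele; [|apply Re_le_Cmod]. fin.
 - ele; [|apply Re_le_Cmod]. fin.
 - ele; [|apply Im_le_Cmod]. unfold Im; simpl. lra.
Qed.

Lemma kernel_bound x c t : 0 < x -> 0 < c -> Cmod (perron_kernel x (pt c t))*Cmod (pt c t) <= Rpower x (c + 1) /\
 (1 <= Rabs t -> Cmod (perron_kernel x (pt c t)) <= Rpower x (c + 1)/(t*t)).
Proof.
 intros Hx Hc. unfold perron_kernel. rewrite Cmod_div, Cmod_mult, Cmod_Rcpow by (auto; apply mline_den; auto). replace (Re (pt c t + 1)%C) with (c + 1) by auto.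
 destruct (Cmod_s1_ge c t __) as [A [B [D E]]]. set (u := Cmod (pt c t)) in *. set (v := Cmod (pt c t + 1)%C) in *. note (Rpower_pos x (c + 1)).
 split.
 - replace (Rpower x (c + 1)/(u*v)*u) with (Rpower x (c + 1)*/ v) by fld. assert (/ v <= 1) by (rewrite <- Rinv_1; apply Rinv_le_contravar; lra). nra.
 - intros Ht. mul_l; [lra|]. assert (t*t = Rabs t*Rabs t) by (rewrite <- Rabs_mult; symmetry; apply Rabs_pos_eq, Rle_0_sqr). rewrite H0. fin.
Qed.

Lemma cont_line_hol f c t : hol f (pt c t) -> cont_at dR (fun t => f (pt c t)) t.
Proof. intros H. apply (cont_comp dR f (fun t => pt c t)); [fin | fin]. Qed.

Lemma hol_kernel_right x s : 0 < Re s -> hol (perron_kernel x) s.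
Proof. fin. Qed.

Lemma hol_zk x k s : 0 < Re s -> s <> RtoC 1 -> hol (fun s => zeta s^k*perron_kernel x s)%C s.
Proof. fin. Qed.

(** A factor [n^(-s)] rescales the kernel: it equals [n] times the kernel at [x/n]. [perron] is then
    applied to each element. *)
Lemma perron_list {A} (p : A -> nat) (l : list A) x T : (forall a, In a l -> (1 <= p a)%nat) -> 0 < x -> 1 <= T ->
 Cmod (Seg (fun s => lsum (fun a => Rcpow (INR (p a)) (- s)) l*perron_kernel x s)%C (pt 2 (- T)) (pt 2 T) - RtoC (2*PI)*Ci*RtoC (lsr (fun a => Rmax (x - INR (p a)) 0) l))%C
 <= 12*Rpower x 3/T*lsr (fun a => Rpower (INR (p a)) (- (2))) l.
Proof.
 intros Hp Hx HT. set (E := fun a => Cmod (Seg (fun s => Rcpow (INR (p a)) (- s)*perron_kernel x s)%C (pt 2 (- T)) (pt 2 T) - RtoC (2*PI)*Ci*RtoC (Rmax (x - INR (p a)) 0))%C).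
 assert (Hc : forall a t, cont_at dR (fun t => Rcpow (INR (p a)) (- pt 2 t)*perron_kernel x (pt 2 t))%C t).
 { intros a t. apply (cont_line_hol (fun s => Rcpow (INR (p a)) (- s)*perron_kernel x s)%C). fin. }
 assert (HE : forall a, In a l -> E a <= 12*Rpower x 3/T*Rpower (INR (p a)) (- (2))).
 { intros a Ha. specialize (Hp a Ha). assert (Hn : 0 < INR (p a)) by (apply lt_0_INR; lia). set (n := INR (p a)) in *. unfold E.
  assert (P := perron (x/n) 2 T ltac:(apply Rdiv_lt_0_compat; auto) __ HT).
  assert (K : forall s, (Rcpow n (- s)*perron_kernel x s = RtoC n*perron_kernel (x/n) s)%C).
  { intros s. unfold perron_kernel, Cdiv. rewrite !Cmult_assoc. f_equal. replace x with (x/n*n) at 1 by fld. rewrite Rcpow_mult by (auto; apply Rdiv_lt_0_compat; auto).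
   rewrite (Rcpow_plus n), Rcpow_1, Rcpow_opp by auto. field. apply Rcpow_neq_0. }
  rewrite Seg_vert in*by (try lra; intros t _; auto; apply cont_line_hol, hol_kernel_right; unfold Re; simpl; lra).
  rewrite (CI_ext _ (fun t => RtoC n*perron_kernel (x/n) (pt 2 t))%C) by (try lra; intros; apply K).
  rewrite CI_cmult by (try lra; intros t _; apply cont_line_hol, hol_kernel_right; unfold Re; simpl; lra).
  change (INR (p a)) with n. replace (RtoC (Rmax (x - n) 0)) with (RtoC n*RtoC (Rmax (x/n - 1) 0))%C.
  2:{ rewrite <- RtoC_mult. f_equal. rewrite <- RmaxRmult by lra. f_equal; field; lra. }
  match goal with |- Cmod ?z <= _ => replace z with (RtoC n*(Ci*CI (fun t => perron_kernel (x/n) (pt 2 t)) (- T) T - RtoC (2*PI)*Ci*RtoC (Rmax (x/n - 1) 0)))%C by ring end.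
  rewrite Cmod_mult, Cmod_R, Rabs_pos_eq by lra.
  ele; [mul_l; [lra | apply P]|]. right.
  replace (2 + 1) with 3 by ring. unfold Rdiv. rewrite <- Rpower_mult_distr by (auto; apply Rinv_0_lt_compat; auto).
  replace (Rpower (/ n) 3) with (Rpower n (- (2))*/ n); [field; lra|].
  replace (/ n) with (Rpower n (- (1))) at 1 by (rewrite Rpower_Ropp, Rpower_1; auto). rewrite <- Rpower_plus. unfold Rpower. rewrite ln_Rinv by auto. f_equal. ring. }
 le (lsr E l); [|rewrite <- lsr_mult; apply lsr_le; auto].
 rewrite Seg_vert; [|lra|intros t _; apply (cont_line_hol (fun s => lsum (fun a => Rcpow (INR (p a)) (- s)) l*perron_kernel x s)%C); apply hol_mult; [|fin]].
 2:{ clear. induction l as [|a l IH]; [apply (hol_const (RtoC 0))|]. cbn [lsum]. fin. }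
 rewrite (CI_ext _ (fun t => lsum (fun a => Rcpow (INR (p a)) (- pt 2 t)*perron_kernel x (pt 2 t)) l)%C).
 2: lra. 2:{ intros t _. rewrite Cmult_comm, <- lsum_mult. apply lsum_ext. intros; ring. }
 rewrite CI_lsum, RtoC_lsr, <- !lsum_mult by (try lra; intros a _ t _; auto).
 match goal with |- Cmod (?u - ?v)%C <= _ => replace (u - v)%C with (lsum (fun a => Ci*CI (fun t => Rcpow (INR (p a)) (- pt 2 t)*perron_kernel x (pt 2 t)) (- T) T - RtoC (2*PI)*Ci*RtoC (Rmax (x - INR (p a)) 0)) l)%C end.
 - ub Cmod_lsum. apply lsr_le. intros a Ha. unfold E. rewrite Seg_vert by (try lra; intros t _; auto). lra.
 - clear. induction l as [|a l IH]; simpl; [ring|]. rewrite IH. ring.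
Qed.

(** Both sides are the integral of [divisor_sum] from 1 to [x]. *)
Lemma riesz_stable k N N' x : 1 <= x <= INR N -> x <= INR N' -> riesz k N x = riesz k N' x.
Proof.
 intros H H'. assert (A := is_RInt_unique _ _ _ _ (is_RInt_divisor_riesz k N x H)). assert (B := is_RInt_unique _ _ _ _ (is_RInt_divisor_riesz k N' x __)). lra.
Qed.

(** On [Re s = 2] zeta is replaced by a partial sum of length [N'], whose k-th power is a sum over
    tuples. For fixed [T] this replacement costs less than any [e] once [N'] is large, while the
    Perron error is uniform in [N']. *)
Lemma perron_zeta k N x T : 1 <= x <= INR N -> 1 <= T ->
 Cmod (Seg (fun s => zeta s^k*perron_kernel x s)%C (pt 2 (- T)) (pt 2 T) - RtoC (2*PI)*Ci*RtoC (riesz k N x))%C <= 12*Rpower x 3/T*2^k.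
Proof.
 intros Hx HT. set (x3 := Rpower x 3). assert (H3 : 0 < x3) by apply Rpower_pos.
 apply le_epsilon. intros e He. set (Q := 2*T*(INR k*3^k*x3)).
 assert (HQ : 0 <= Q) by (unfold Q; note (pos_INR k); note (pow_le 3 k __); repeat apply Rmult_le_pos; lra).
 destruct (nfloor_ex (Q/e)) as [M [_ HM]]; [fin|].
 set (N' := (N + S M)%nat). assert (HN' : Q/e <= INR N' /\ x <= INR N' /\ 0 < INR N').
 { unfold N'. rewrite plus_INR, S_INR. note (pos_INR M). lra. }
 rewrite (riesz_stable k N N' x) by lra.
 assert (P := perron_list tprod (lists_of_length k (seq 1 N')) x T). fold (riesz k N' x) in P. fold x3 in P.
 assert (Hp : forall t, In t (lists_of_length k (seq 1 N')) -> (1 <= tprod t)%nat) by (intros t Ht; apply tprod_pos; intros y Hy; apply (in_lists_pos _ _ _ Ht y Hy)).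
 specialize (P Hp __ HT).
 assert (Epow : forall s, lsum (fun t => Rcpow (INR (tprod t)) (- s)) (lists_of_length k (seq 1 N')) = (csum (zterm s) N'^k)%C).
 { intros s. replace (csum (zterm s) N') with (lsum (fun n => Rcpow (INR n) (- s)) (seq 1 N')) by (rewrite csum_seq; apply csum_ext; auto).
  rewrite lsum_pow. apply lsum_ext. intros t Ht. symmetry. apply fold_power. intros y Hy. apply (in_lists_pos _ _ _ Ht y Hy). }
 assert (Hs2 : lsr (fun t => Rpower (INR (tprod t)) (- (2))) (lists_of_length k (seq 1 N')) <= 2^k).
 { ub Rle_abs. rewrite <- Cmod_R, RtoC_lsr. rewrite (lsum_ext _ (fun t => Rcpow (INR (tprod t)) (- RtoC 2))) by (intros; rewrite <- RtoC_opp, Rcpow_RtoC; auto).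
  rewrite Epow, Cmod_pow. apply pow_incr. split; [fin | apply csum_zterm_2; auto]. }
 assert (C1 : forall t, cont_at dR (fun t => zeta (pt 2 t)^k*perron_kernel x (pt 2 t))%C t).
 { intros t. apply (cont_line_hol (fun s => zeta s^k*perron_kernel x s)%C), hol_zk; [fin | fin]. }
 assert (C2 : forall t, cont_at dR (fun t => csum (zterm (pt 2 t)) N'^k*perron_kernel x (pt 2 t))%C t).
 { intros t. apply (cont_line_hol (fun s => csum (zterm s) N'^k*perron_kernel x s)%C), hol_mult; [fin | fin]. }
 rewrite (Seg_vert (fun s => _*_)%C) in P by (try lra; intros t _; rewrite (functional_extensionality _ _ (fun t => f_equal (fun z => z*perron_kernel x (pt 2 t))%C (Epow (pt 2 t)))); auto).
 rewrite (CI_ext _ (fun t => csum (zterm (pt 2 t)) N'^k*perron_kernel x (pt 2 t))%C) in P by (try lra; intros; rewrite Epow; auto).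
 rewrite Seg_vert by (try lra; intros t _; auto).
 assert (D : Cmod (CI (fun t => zeta (pt 2 t)^k*perron_kernel x (pt 2 t) - csum (zterm (pt 2 t)) N'^k*perron_kernel x (pt 2 t))%C (- T) T) <= (T - - T)*(INR k*3^k*/ INR N'*x3)).
 { apply CI_bound; [lra | fin |]. intros t Ht. assert (R2 : Re (pt 2 t) = 2) by auto.
  replace (_ - _)%C with ((zeta (pt 2 t)^k - csum (zterm (pt 2 t)) N'^k)*perron_kernel x (pt 2 t))%C by ring. rewrite Cmod_mult.
  apply Rmult_le_compat; try apply Cmod_ge_0.
  - ele; [apply (Cpow_diff _ _ 3 k); [lra | apply zeta_2_bound; auto | note (csum_zterm_2 _ N' R2); lra]|].
   mul_l; [fin|]. apply zeta_2_approx; auto. fin.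
  - destruct (kernel_bound x 2 t __ __) as [K _]. destruct (Cmod_s1_ge 2 t __) as [_ [_ [B _]]]. replace (2 + 1) with 3 in K by ring. fold x3 in K.
   nra. }
 rewrite CI_minus in D by (try lra; intros t _; auto).
 match goal with |- Cmod (Ci * ?u - ?w)%C <= _ => match type of D with Cmod (u - ?v)%C <= _ => replace (Ci*u - w)%C with (Ci*(u - v) + (Ci*v - w))%C by ring end end.
 ub Cmod_triangle. rewrite Cmod_mult, Cmod_Ci, Rmult_1_l.
 assert (F1 : (T - - T)*(INR k*3^k*/ INR N'*x3) <= e).
 { replace ((T - - T)*(INR k*3^k*/ INR N'*x3)) with (Q*/ INR N') by (unfold Q; ring). apply Rmult_le_reg_r with (INR N'); [lra|].
  le (e*(Q/e)); [right; field; lra | nra]. }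
 assert (F2 : 12*x3/T*lsr (fun t => Rpower (INR (tprod t)) (- (2))) (lists_of_length k (seq 1 N')) <= 12*x3/T*2^k).
 { fin. }
 lra.
Qed.

#[export] Hint Resolve cont_line_hol hol_kernel_right hol_zk : an.

(* A factor close to 1 on bounded sets that makes the horizontal sides of the contour negligible. *)
Definition damp (m : nat) (de : R) (s : C) : C := ((/ (1 + RtoC de*s))^m)%C.

Lemma damp_den de s : 0 <= de -> 0 <= Re s -> 1 <= Cmod (1 + RtoC de*s)%C /\ de*Rabs (Im s) <= Cmod (1 + RtoC de*s)%C /\ (1 + RtoC de*s)%C <> RtoC 0.
Proof.
 intros Hd Hs. assert (A : 1 <= Cmod (1 + RtoC de*s)%C) by (ele; [|apply Re_le_Cmod]; unfold Re in *; simpl; nra).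
 split; [auto|split].
 - ele; [|apply Im_le_Cmod]. replace (Im (1 + RtoC de*s)%C) with (de*Im s) by (unfold Im; simpl; ring). rewrite Rabs_mult, (Rabs_pos_eq de); lra.
 - intro E. rewrite E, Cmod_0 in A. lra.
Qed.

Lemma inv_le_1 x : 1 <= x -> 0 < / x <= 1.
Proof. intros H. split; [fin|]. rewrite <- Rinv_1. fin. Qed.

Lemma damp_le_1 m de s : 0 <= de -> 0 <= Re s -> Cmod (damp m de s) <= 1.
Proof.
 intros Hd Hs. destruct (damp_den de s Hd Hs) as [A [_ N]]. unfold damp. rewrite Cmod_pow, Cmod_inv by auto. le (1^m); [apply pow_incr; note (inv_le_1 _ A); lra | rewrite pow1; lra].
Qed.

Lemma damp_near_1 m de s : 0 <= de -> 0 <= Re s -> Cmod (damp m de s - 1)%C <= INR m*de*Cmod s.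
Proof.
 intros Hd Hs. destruct (damp_den de s Hd Hs) as [A [_ N]]. assert (I : Cmod (/ (1 + RtoC de*s))%C <= 1).
 { rewrite Cmod_inv by auto. apply inv_le_1; auto. }
 unfold damp. replace (RtoC 1) with (RtoC 1^m)%C at 2 by (clear; induction m; simpl; [auto | rewrite IHm; ring]).
 ele; [apply (Cpow_diff _ _ 1); [lra | auto | rewrite Cmod_1; lra]|]. rewrite pow1, Rmult_1_r, Rmult_assoc. mul_l; [fin|].
 replace (/ (1 + RtoC de*s) - 1)%C with (- (RtoC de*s*/ (1 + RtoC de*s)))%C by (field; auto). rewrite Cmod_opp, !Cmod_mult, Cmod_R, Rabs_pos_eq by auto.
 assert (0 <= de*Cmod s) by fin. nra.
Qed.

Lemma damp_decay m de s : 0 <= de -> 0 <= Re s -> 0 < de*Rabs (Im s) -> Cmod (damp m de s) <= / (de*Rabs (Im s))^m.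
Proof.
 intros Hd Hs H. destruct (damp_den de s Hd Hs) as [A [B N]]. unfold damp. rewrite Cmod_pow, Cmod_inv, pow_inv by auto.
 fin.
Qed.

Lemma hol_damp m de s : 0 <= de -> 0 <= Re s -> hol (damp m de) s.
Proof.
 intros Hd Hs. apply hol_pow, hol_inv; [apply damp_den; auto|]. fin.
Qed.

(** * The damped contour *)

Definition integrand (k : nat) (x p : R) (s : C) : C := (zeta s^k*perron_kernel x s*damp (2*k) (/ p^2) s)%C.

Lemma hol_integrand k x p s : 0 < p -> 0 < Re s -> s <> RtoC 1 -> hol (integrand k x p) s.
Proof. intros Hp H1 H2. apply hol_mult; [fin | apply hol_damp; [fin | lra]]. Qed.

(** For [|t| <= p] the damping differs from 1 by [O(|s|/p^2)], which costs [O(1/p)] altogether; for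
    larger [|t|] the kernel is [O(t^(-2))] and both tails are [O(1/p)] as well. *)
Lemma right_line k N x p : 1 <= x <= INR N -> 1 <= p ->
 Cmod (Seg (integrand k x p) (pt 2 (- p^4)) (pt 2 (p^4)) - RtoC (2*PI)*Ci*RtoC (riesz k N x))%C <= (12*2^k + (4*INR k + 2)*3^k)*(Rpower x 3/p).
Proof.
 intros Hx Hp. set (x3 := Rpower x 3). assert (H3 : 0 < x3) by apply Rpower_pos. set (T := p^4). set (de := / p^2).
 assert (Hp2 : 0 < p^2) by fin. assert (Hde : 0 < de) by (apply Rinv_0_lt_compat; auto).
 assert (HT : p <= T). { unfold T. assert (1 <= p*p) by nra. nra. }
 assert (T3 : 0 < 3^k) by fin.
 assert (P := perron_zeta k N x p Hx Hp). fold x3 in P.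
 set (F := fun t => (zeta (pt 2 t)^k*perron_kernel x (pt 2 t))%C). set (G := fun t => integrand k x p (pt 2 t)).
 assert (N1 : forall t, pt 2 t <> RtoC 1) by fin.
 assert (R2 : forall t, 0 < Re (pt 2 t)) by fin.
 assert (CF : forall t, cont_at dR F t) by (intros t; apply (cont_line_hol (fun s => zeta s^k*perron_kernel x s)%C), hol_zk; auto).
 assert (CG : forall t, cont_at dR G t) by (intros t; apply cont_line_hol, hol_integrand; auto; lra).
 rewrite Seg_vert in*by (try lra; intros t _; auto). fold F in P. fold G.
 assert (Z3 : forall t, Cmod (zeta (pt 2 t)^k)%C <= 3^k) by (intros t; rewrite Cmod_pow; apply pow_incr; split; [fin | apply zeta_2_bound; auto]).
 assert (BD : Cmod (CI (fun t => G t - F t)%C (- p) p) <= (p - - p)*(3^k*(INR (2*k)*de*x3))).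
 { apply CI_bound; [lra | fin |]. intros t _. unfold G, F, integrand. fold de.
  replace (_ - _)%C with (zeta (pt 2 t)^k*(perron_kernel x (pt 2 t)*(damp (2*k) de (pt 2 t) - 1)))%C by ring. rewrite !Cmod_mult.
  apply Rmult_le_compat; [fin | fin | auto |].
  destruct (kernel_bound x 2 t __ __) as [K _]. replace (2 + 1) with 3 in K by ring.
  assert (D := damp_near_1 (2*k) de (pt 2 t) __ ltac:(unfold Re; simpl; lra)). note (Cmod_ge_0 (perron_kernel x (pt 2 t))).
  le (Cmod (perron_kernel x (pt 2 t))*(INR (2*k)*de*Cmod (pt 2 t))); [nra|].
  replace (Cmod (perron_kernel x (pt 2 t))*(INR (2*k)*de*Cmod (pt 2 t))) with (INR (2*k)*de*(Cmod (perron_kernel x (pt 2 t))*Cmod (pt 2 t))) by ring.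
  fin. }
 assert (BG : forall t, 1 <= Rabs t -> Cmod (G t) <= 3^k*x3*/ (t*t)).
 { intros t Ht. unfold G, integrand. rewrite !Cmod_mult. destruct (kernel_bound x 2 t __ __) as [_ K]. replace (2 + 1) with 3 in K by ring. fold x3 in K.
  assert (D := damp_le_1 (2*k) de (pt 2 t) __ ltac:(unfold Re; simpl; lra)). specialize (Z3 t). fold de. note (Cmod_ge_0 (perron_kernel x (pt 2 t))).
  assert (0 <= Cmod (zeta (pt 2 t)^k)%C*Cmod (perron_kernel x (pt 2 t))) by fin. nra. }
 assert (Tail : forall f, (forall t, cont_at dR f t) -> (forall t, p <= t -> Cmod (f t) <= 3^k*x3*/ (t*t)) -> Cmod (CI f p T) <= 3^k*x3*/ p).
 { intros f Cf Bf. ele; [apply (CI_power_bound f (3^k*x3) 1); [lra | lra | fin |]|].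
  - intros t Ht. ele; [apply Bf; lra|]. right. rewrite Rpower_Ropp, Rpower_plus, Rpower_1 by lra. auto.
  - mul_l; [nra|]. note (Rpower_pos T (- (1))). rewrite (Rpower_Ropp p), Rpower_1 by lra. lra. }
 assert (T1 : Cmod (CI G p T) <= 3^k*x3*/ p). { apply Tail; auto. intros t Ht. apply BG. rewrite Rabs_pos_eq; lra. }
 assert (T2 : Cmod (CI G (- T) (- p)) <= 3^k*x3*/ p).
 { assert (Q := CI_opp_var (fun u => G (- u)) p T HT ltac:(intros t _; apply cont_opp_arg; auto)).
  rewrite <- (CI_ext (fun t => G (- - t)) G), Q by (try lra; intros; rewrite Ropp_involutive; auto).
  apply Tail; [fin|]. intros t Ht. replace (t*t) with (- t*- t) by ring. apply BG. rewrite Rabs_Ropp, Rabs_pos_eq; lra. }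
 rewrite CI_minus in BD by (try lra; intros t _; auto).
 rewrite <- (CI_Chasles G (- T) (- p) T), <- (CI_Chasles G (- p) p T) by (try lra; intros t _; auto).
 match goal with |- Cmod (Ci*(?a + (?b + ?c)) - ?w)%C <= _ => replace (Ci*(a + (b + c)) - w)%C with ((Ci*(a + c + (b - CI F (- p) p))) + (Ci*CI F (- p) p - w))%C by ring end.
 ub Cmod_triangle. rewrite Cmod_mult, Cmod_Ci, Rmult_1_l.
 assert (E1 : (p - - p)*(3^k*(INR (2*k)*de*x3)) = 4*INR k*3^k*(x3/p)). { unfold de. rewrite mult_INR. replace (INR 2) with 2 by fin. field. lra. }
 match goal with |- Cmod (?a + ?c + ?e)%C + _ <= _ => assert (Cmod (a + c + e)%C <= Cmod a + Cmod c + Cmod e) by (ub Cmod_triangle; apply Rplus_le_compat_r, Cmod_triangle) end.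
 lra.
Qed.

(** [zeta_approx] with a single term; the damping makes this linear growth sufficient. *)
Lemma zeta_growth sig : 0 < sig < 1 -> exists B, 1 <= B /\ forall s, sig <= Re s <= 2 -> 1 <= Rabs (Im s) -> Cmod (zeta s) <= B*Rabs (Im s).
Proof.
 intros Hs. assert (I : 0 < / sig) by fin. exists (3 + 3*/ sig). split; [lra|]. intros s H Ht.
 assert (Hs1 : s <> RtoC 1) by (apply neq_of_Im; intro E; rewrite E, Rabs_R0 in Ht; lra).
 assert (A := zeta_approx s 1 __ Hs1 ltac:(lia)). set (t := Rabs (Im s)) in *. rewrite INR_1, Rpower_base_1, Rmult_1_r in A. replace (csum (zterm s) 1) with (RtoC 1) in A by (simpl; unfold zterm; rewrite INR_1, Rcpow_base1; ring).
 set (w := (Rcpow (INR 2) (1 - s)/(s - 1))%C) in *.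
 assert (Bw : Cmod w <= 2).
 { unfold w. rewrite Cmod_div by fin. rewrite Cmod_Rcpow by fin. replace (INR 2) with 2 by fin.
  assert (D : 1 <= Cmod (s - 1)%C). { ub Ht. replace t with (Rabs (Im (s - 1)%C)); [apply Im_le_Cmod|]. unfold t. f_equal. unfold Im; simpl; ring. }
  assert (Rpower 2 (Re (1 - s)%C) <= 2). { rewrite <- (Rpower_1 2) at 2 by lra. apply Rpower_le_base1; [lra|]. rewrite Re_minus. change (Re (RtoC 1)) with 1. lra. }
  apply Rmult_le_reg_r with (Cmod (s - 1)%C); [lra|]. unfold Rdiv. rewrite Rmult_assoc, Rinv_l by lra. lra. }
 assert (Bs : Cmod s <= 3*t). { ub Cmod_le_Re_Im. fold t. rewrite Rabs_pos_eq; lra. }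
 assert (Cmod s/Re s <= 3*t*/ sig). { unfold Rdiv. fin. }
 replace (zeta s) with ((zeta s - 1 - w) + (1 + w))%C by ring. ub Cmod_triangle. assert (Cmod (1 + w)%C <= 1 + Cmod w) by (ub Cmod_triangle; rewrite Cmod_1; lra). nra.
Qed.

Definition left_integrand (k : nat) (sig p t : R) : C := (mline k sig t*damp (2*k) (/ p^2) (pt sig t))%C.

(** Only the pole at 1 is crossed between the two vertical lines. Its damped residue differs from
    [pole_prim] by [O(1/p)], so the whole error vanishes as [p] grows, uniformly in [N]. *)
Lemma contour_shift k sig : 0 < sig < 1 -> exists B, 0 <= B /\ forall N x p, 1 <= x <= INR N -> 1 <= p ->
 Cmod (RtoC (2*PI)*Ci*(RtoC (riesz k N x) - pole_prim k x) - Ci*CI (fun t => left_integrand k sig p t*Rcpow x (pt (sig + 1) t)) (- p^4) (p^4))%C <= B*(Rpower x 3/p).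
Proof.
 intros Hs. destruct (zeta_growth sig Hs) as [B1 [HB1 Gr]].
 destruct (circle_bounded (fun s => zeta s^k)%C (RtoC 1) (1/4)) as [B2 H2]. { intros t. apply cont_pow. apply hol_cont, hol_zeta, circ_quarter. }
 note PI_RGT_0 as Hpi. note PI_4 as Hpi4. set (c1 := 12*2^k + (4*INR k + 2)*3^k). note (pos_INR k) as Hk0.
 assert (B20 : 0 <= B2) by (ele; [apply Cmod_ge_0 | apply (H2 0)]).
 assert (c10 : 0 <= c1). { unfold c1. fin. }
 assert (B1k : 0 < B1^k) by fin.
 exists (c1 + 4*B1^k + 4*(B2*(2*INR k))). split; [nra|]. intros N x p Hx Hp.
 set (x3 := Rpower x 3). assert (H3 : 0 < x3) by apply Rpower_pos. set (T := p^4). set (de := / p^2).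
 assert (Hp2 : 0 < p^2) by fin. assert (Hde : 0 < de) by (apply Rinv_0_lt_compat; auto).
 assert (HT : p <= T). { unfold T. assert (1 <= p*p) by nra. nra. }
 set (f := integrand k x p).
 assert (Hol : forall z, sig/2 < Re z < 3 -> z <> RtoC 1 -> hol f z) by (intros; apply hol_integrand; auto; lra).
 assert (Rt := right_line k N x p Hx Hp). fold c1 x3 T f in Rt.
 assert (RR := rect_residue f (sig/2) 3 1 sig 2 T (1/4) Hol __ __ __ __ __ __). unfold rect in RR.
 assert (Hor : forall y u, Rabs y = T -> sig <= u <= 2 -> hol f (pt u y) /\ Cmod (f (pt u y)) <= B1^k*(x3/p)).
 { intros y u Hy Hu. split; [apply Hol; [fin | apply neq_of_Im; unfold Im; simpl; intro E; rewrite E, Rabs_R0 in Hy; lra]|].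
  unfold f, integrand. rewrite !Cmod_mult, Cmod_pow. assert (G := Gr (pt u y) Hu ltac:(unfold Im; simpl; lra)). unfold Im in G; simpl in G. rewrite Hy in G.
  destruct (kernel_bound x u y __ __) as [_ K]. specialize (K __). assert (Hyy : y*y = T*T) by (rewrite <- Hy, <- Rabs_mult; symmetry; apply Rabs_pos_eq, Rle_0_sqr).
  assert (Kx : Rpower x (u + 1) <= x3) by (apply Rpower_le_base1; lra).
  assert (D := damp_decay (2*k) de (pt u y) __ ltac:(unfold Re; simpl; lra)). unfold Im in D; simpl snd in D. rewrite Hy in D.
  assert (EdT : de*T = p^2) by (unfold de, T; field; lra). rewrite EdT in D.
  (* At height [T = p^4] the damping is at most [T^(-k)], which cancels the growth of [zeta^k]
     exactly; the kernel then supplies the decay. *)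
  assert (E4 : (p^2)^(2*k) = T^k) by (unfold T; rewrite <- !pow_mult; f_equal; lia). rewrite E4 in D.
  assert (Tk : 0 < T^k) by fin. assert (HTT : p <= T*T) by nra.
  assert (K2 : Cmod (perron_kernel x (pt u y)) <= x3/p).
  { ub K. unfold Rdiv. fin. }
  assert (Z1 : Cmod (zeta (pt u y))^k <= B1^k*T^k) by (rewrite <- Rpow_mult_distr; apply pow_incr; split; [fin | auto]).
  le (B1^k*T^k*(x3/p)*/ T^k); [|right; field; lra].
  fin. }
 assert (Hb : Cmod (Seg f (pt sig (- T)) (pt 2 (- T))) <= 2*(B1^k*(x3/p))).
 { ub (Seg_bound_h f sig 2 (- T) (B1^k*(x3/p))).
  - rewrite Rmin_left, Rmax_right by lra. intros u Hu. apply Hor; auto. rewrite Rabs_Ropp, Rabs_pos_eq; lra.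
  - mul_r; [|rewrite Rabs_pos_eq; lra]. fin. }
 assert (Ht : Cmod (Seg f (pt 2 T) (pt sig T)) <= 2*(B1^k*(x3/p))).
 { ub (Seg_bound_h f 2 sig T (B1^k*(x3/p))).
  - rewrite Rmin_right, Rmax_left by lra. intros u Hu. apply Hor; auto. rewrite Rabs_pos_eq; lra.
  - mul_r; [|rewrite Rabs_left; lra]. fin. }
 assert (HolL : forall t, hol f (pt sig t)) by fin.
 rewrite (Seg_rev f (pt sig (- T)) (pt sig T)) in RR.
 2:{ intros t _. fin. }
 rewrite (Seg_vert f sig) in RR by (try lra; intros t _; apply cont_line_hol; auto).
 rewrite (CI_ext (fun t => f (pt sig t)) (fun t => left_integrand k sig p t*Rcpow x (pt (sig + 1) t))%C) in RR; [|lra|].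
 2:{ intros t _. unfold f, integrand, left_integrand, mline, perron_kernel. replace (pt sig t + 1)%C with (pt (sig + 1) t : C) by ceq. ceq. }
 set (L := (Ci*CI (fun t => left_integrand k sig p t*Rcpow x (pt (sig + 1) t)) (- T) T)%C) in *.
 set (f0 := fun s => (zeta s^k*perron_kernel x s)%C). set (w := circ (RtoC 1) (1/4)). set (e := fun t => (Ci*(RtoC (1/4)*Cexp (Ci*RtoC t)))%C).
 assert (Cw : forall g t, hol g (w t) -> cont_at dR (fun t => g (w t)*e t)%C t).
 { intros g t Hg. apply cont_mult; [apply (cont_comp dR g w); [apply cont_circ | fin] | apply cont_mult; [fin | fin]]. }
 assert (Hw : forall t, w t <> RtoC 1 /\ 3/4 <= Re (w t) <= 5/4) by (intros; apply circ_quarter).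
 assert (Cf : forall t, cont_at dR (fun t => f (w t)*e t)%C t) by (intros t; destruct (Hw t); apply Cw, Hol; auto; lra).
 assert (Cf0 : forall t, cont_at dR (fun t => f0 (w t)*e t)%C t) by (intros t; destruct (Hw t); apply Cw, hol_zk; auto; lra).
 assert (HA : Cmod (arc f (RtoC 1) (1/4) 0 (2*PI) - arc f0 (RtoC 1) (1/4) 0 (2*PI))%C <= 4*(B2*(2*INR k))*(x3/p)).
 { unfold arc. fold w. rewrite <- CI_minus; [|lra|fin|fin].
  ele; [apply (CI_bound _ _ _ (B2*(INR (2*k)*de*x3)*(1/4))); [lra | fin |]|].
  - intros t _. destruct (Hw t) as [_ Rw]. unfold f, f0, integrand. fold de.
   match goal with |- Cmod (_ * ?u - _)%C <= _ => replace (Cmod _) with (Cmod (zeta (w t)^k*(perron_kernel x (w t)*(damp (2*k) de (w t) - 1))*u)%C) by (f_equal; ring) end.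
   rewrite !Cmod_mult, Cmod_Ci, Cmod_expi, Cmod_R, Rabs_pos_eq by lra. replace (1*(1/4*1)) with (1/4) by ring. mul_r; [lra|].
   apply Rmult_le_compat; [fin | fin | fin |].
   destruct (kernel_bound x (Re (w t)) (Im (w t)) __ __) as [K _]. replace (pt (Re (w t)) (Im (w t))) with (w t) in K by fin.
   assert (Kx : Rpower x (Re (w t) + 1) <= x3) by (apply Rpower_le_base1; lra).
   assert (D := damp_near_1 (2*k) de (w t) __ __). note (Cmod_ge_0 (perron_kernel x (w t))).
   ele; [mul_l; [auto | apply D]|]. replace (Cmod (perron_kernel x (w t))*(INR (2*k)*de*Cmod (w t))) with (INR (2*k)*de*(Cmod (perron_kernel x (w t))*Cmod (w t))) by ring.
   fin.
  - rewrite mult_INR. replace (INR 2) with 2 by fin. assert (Hdp : de <= / p) by (apply Rinv_le_contravar; [lra | nra]). unfold Rdiv.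
   replace ((2*PI - 0)*(B2*(2*INR k*de*x3)*(1*/ 4))) with (B2*(2*INR k)*x3*(PI/2*de)) by field.
   replace (4*(B2*(2*INR k))*(x3*/ p)) with (B2*(2*INR k)*x3*(4*/ p)) by ring. fin. }
 assert (EP : (RtoC (2*PI)*Ci*pole_prim k x)%C = arc f0 (RtoC 1) (1/4) 0 (2*PI)).
 { unfold pole_prim, pole_arc. rewrite Cmult_assoc, Cinv_r by apply two_pi_i_neq. apply Cmult_1_l. }
 set (P := Seg f (pt 2 (- T)) (pt 2 T)) in *. set (bot := Seg f (pt sig (- T)) (pt 2 (- T))) in *. set (top := Seg f (pt 2 T) (pt sig T)) in *.
 replace (RtoC (2*PI)*Ci*(RtoC (riesz k N x) - pole_prim k x) - L)%C with
  ((arc f (RtoC 1) (1/4) 0 (2*PI) - arc f0 (RtoC 1) (1/4) 0 (2*PI)) - (P - RtoC (2*PI)*Ci*RtoC (riesz k N x)) - (bot + top))%C by (rewrite <- RR, <- EP; ring).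
 ub Cmod_sub_triangle. ele; [apply Rplus_le_compat; [apply Cmod_sub_triangle | apply Cmod_triangle]|]. lra.
Qed.

Lemma cont_left_integrand k sig p t : 0 < sig < 1 -> 0 < p -> cont_at dR (left_integrand k sig p) t.
Proof.
 intros H Hp. apply cont_mult; [fin|]. apply (cont_line_hol (damp (2*k) (/ p^2))), hol_damp; [fin | fin].
Qed.

Lemma contR_minus_Re (f : R -> R) (g : R -> C) x : cont_at dR (fun x => RtoC (f x)) x -> cont_at dR g x -> cont_at dR (fun x => RtoC (f x - Re (g x))) x.
Proof. intros Hf Hg. apply (contR_plus f (fun x => - Re (g x))); auto. replace (fun x => RtoC (- Re (g x))) with (fun x => - RtoC (Re (g x)))%C by (apply functional_extensionality; intros; rewrite RtoC_opp; auto). fin. Qed.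

Lemma cont_pole_prim k x : 0 < x -> cont_at dR (pole_prim k) x.
Proof. intros H. eapply rder_cont, pole_prim_derive; auto. Qed.

Lemma mean_square k eta : (3 <= k <= 6)%nat -> 0 < eta <= 1/20 -> exists B, 0 <= B /\ forall X N, 1 <= X <= INR N ->
 RInt (fun x => (riesz k N x - Re (pole_prim k x))^2) 1 X <= B*Rpower X (4 - 3/INR k + 2*eta).
Proof.
 intros Hk He. destruct (mline_moment k eta Hk He) as [B0 [HB0 HM]]. set (sig := 1/2 - 3/(2*INR k) + eta) in *.
 assert (Kb : 3 <= INR k <= 6). { split; [replace 3 with (INR 3) by (unfold INR; ring) | replace 6 with (INR 6) by (unfold INR; ring)]; apply le_INR; lia. }
 assert (Hk0 : 3/(2*INR k)*(2*INR k) = 3) by fld.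
 assert (Hsig : 0 < sig < 1). { unfold sig. nra. }
 destruct (contour_shift k sig Hsig) as [B1 [HB1 Sh]].
 (* The constant 256 of [mellin_plancherel], doubled when the contour error is separated from the
    square. *)
 exists (512*B0). split; [lra|]. intros X N HX. apply le_epsilon. intros e Hpe.
 set (x3 := Rpower X 3). assert (H3 : 0 < x3) by apply Rpower_pos. set (Q := 2*X*((B1*x3)*(B1*x3))).
 assert (HQ : 0 <= Q) by (unfold Q; apply Rmult_le_pos; [lra | fin]).
 (* So large, depending on [X] and [e], that the squared contour error integrated over [[1, X]] is
    at most [e]. *)
 set (p := 1 + Q/e). assert (Hqe : 0 <= Q/e) by fin. assert (Hp : 1 <= p) by (unfold p; lra).
 set (T := p^4). assert (HT : 1 <= T) by (apply pow_R1_Rle; auto).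
 set (g := left_integrand k sig p). assert (Cg : forall t, cont_at dR g t) by (intros; apply cont_left_integrand; auto; lra).
 set (J := fun x => CI (fun t => g t*Rcpow x (pt (sig + 1) t))%C (- T) T).
 assert (MP := mellin_plancherel g T (sig + 1) X __ __ __ ltac:(intros t _; auto)). fold J in MP || idtac.
 assert (Hg : RInt (fun t => Cmod (g t)*Cmod (g t)) (- T) T <= B0).
 { ele; [|apply (HM T HT)]. apply RInt_mono; [lra | fin | fin |].
  intros t _. unfold g, left_integrand. rewrite Cmod_mult. assert (D := damp_le_1 (2*k) (/ p^2) (pt sig t)). assert (0 < / p^2) by fin.
  specialize (D __ ltac:(unfold Re; simpl; lra)). note (Cmod_ge_0 (mline k sig t)). note (Cmod_ge_0 (damp (2*k) (/ p^2) (pt sig t))).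
  set (a := Cmod (mline k sig t)) in *. set (b := Cmod (damp _ _ _)) in *. assert (a*b <= a) by nra. assert (0 <= a*b) by nra. nra. }
 assert (CJ : forall x, 1 <= x -> cont_at dR (fun x => RtoC (Cmod (J x)^2)) x) by (intros x Hx; apply contR_pow, cont_Cmod, mellin_cont; auto; [lra | fin | lra]).
 set (E := B1*(x3/p)). assert (HE : 0 <= E) by (unfold E; apply Rmult_le_pos; auto; apply Rdiv_le_0_compat; lra).
 le (RInt (fun x => 2*Cmod (J x)^2 + 2*(E*E)) 1 X).
 - apply RInt_mono; [lra | | |].
  + intros x Hx. apply contR_pow, contR_minus_Re; [apply cont_riesz | apply cont_pole_prim; lra].
  + fin.
  + intros x Hx. specialize (Sh N x p __ Hp). fold T in Sh. fold g in Sh. change (CI (fun t => g t*Rcpow x (pt (sig + 1) t))%C (- T) T) with (J x) in Sh.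
   assert (Hx3 : Rpower x 3 <= x3) by (apply Rle_Rpower_l; lra). assert (Ip : 0 < / p) by fin.
   assert (ShE : Cmod (RtoC (2*PI)*Ci*(RtoC (riesz k N x) - pole_prim k x) - Ci*J x)%C <= E) by (ub Sh; unfold E, Rdiv; mul_l; auto; nra).
   set (z := (RtoC (riesz k N x) - pole_prim k x)%C) in *.
   assert (Hz : 2*PI*Cmod z <= Cmod (J x) + E).
   { assert (A := Cmod_triangle (RtoC (2*PI)*Ci*z - Ci*J x)%C (Ci*J x)%C). replace (RtoC (2*PI)*Ci*z - Ci*J x + Ci*J x)%C with (RtoC (2*PI)*Ci*z)%C in A by ring.
    rewrite !Cmod_mult, Cmod_Ci, Cmod_R, Rabs_pos_eq in A by (note PI_RGT_0; lra). lra. }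
   assert (Hr : Rabs (riesz k N x - Re (pole_prim k x)) <= Cmod z).
   { replace (riesz k N x - Re (pole_prim k x)) with (Re z) by fin. apply re_le_Cmod. }
   note PI_gt_3 as H3pi. note (Cmod_ge_0 z). note (Cmod_ge_0 (J x)).
   rewrite <- (pow2_abs (riesz k N x - Re (pole_prim k x))). set (a := Rabs _) in *. assert (0 <= a) by apply Rabs_pos.
   replace (a^2) with (a*a) by ring. replace (Cmod (J x)^2) with (Cmod (J x)*Cmod (J x)) by ring. apply sq_le_2; auto. nra.
 - rewrite (RInt_plus (V := RC)), (RInt_scal (V := RC)), RInt_const.
  + match goal with |- _ <= ?B => change (2*RInt (fun x => Cmod (J x)^2) 1 X + (X - 1)*(2*(E*E)) <= B) end.
   change (RInt (fun x => Cmod (J x)^2) 1 X <= 256*Rpower X (2*(sig + 1) + 1)*RInt (fun t => Cmod (g t)*Cmod (g t)) (- T) T) in MP.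
   replace (2*(sig + 1) + 1) with (4 - 3/INR k + 2*eta) in MP by (unfold sig; field; lra).
   note (Rpower_pos X (4 - 3/INR k + 2*eta)). set (R := Rpower X (4 - 3/INR k + 2*eta)) in *.
   assert (RInt (fun x => Cmod (J x)^2) 1 X <= 256*R*B0) by (ele; [apply MP | mul_l; lra]).
   assert (EE : X*(2*(E*E)) <= e).
   { replace (X*(2*(E*E))) with (Q*/ (p*p)) by (unfold E, Q; field; lra). apply Rmult_le_reg_r with (p*p); [nra|]. rewrite Rmult_assoc, Rinv_l, Rmult_1_r by nra.
    assert (Q <= e*p) by (unfold p; replace (e*(1 + Q/e)) with (e + Q) by fld; lra). nra. }
   note (Rle_0_sqr E). unfold Rsqr in *. nra.
  + fin.
  + fin.
  + fin.
Qed.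

Lemma admissible k eta : (3 <= k <= 6)%nat -> 0 < eta <= 1/20 -> admissible_exponent k (4 - 3/INR k + 2*eta).
Proof.
 intros Hk He. assert (Kb : 3 <= INR k) by (replace 3 with (INR 3) by (unfold INR; ring); apply le_INR; lia).
 assert (K1 : 3/INR k <= 1). { apply Rmult_le_reg_r with (INR k); [lra|]. replace (3/INR k*INR k) with 3 by fld. lra. }
 split; [lra|]. destruct (mean_square k eta Hk He) as [B [HB H]]. set (rh := 4 - 3/INR k + 2*eta) in *.
 (* The lower limit of integration contributes a constant and [zeta(0)^k] a multiple of [x - 1].
    Their mean square is [O(X^3)], which fits because [3/k <= 1] makes the exponent at least 3. *)
 set (V := Rabs (Re (pole_prim k 1)) + Rabs (Re (zeta (RtoC 0)^k)%C)). exists (2*B + 2*(V*V)). intros X HX.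
 destruct (nfloor_ex X __) as [N0 [_ HN0]]. set (N := S N0). assert (HN : X <= INR N) by (unfold N; rewrite S_INR; lra).
 set (u := fun x => riesz k N x - Re (pole_prim k x)). set (v := fun x => Re (pole_prim k 1) - (x - 1)*Re (zeta (RtoC 0)^k)%C).
 assert (Cu : contI (fun x => RtoC (u x)) 1 X) by (intros x Hx; apply contR_minus_Re; [fin | apply cont_pole_prim; lra]).
 assert (Cv : contI (fun x => RtoC (v x)) 1 X) by (intros x Hx; apply contR_continuous, (ex_derive_continuous v); unfold v; auto_derive; auto).
 assert (Cuv : contI (fun x => RtoC ((u x + v x)^2)) 1 X) by fin.
 assert (Cu2 : contI (fun x => RtoC (u x^2)) 1 X) by fin.
 rewrite (RInt_ext _ (fun x => (u x + v x)^2)).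
 2:{ rewrite Rmin_left, Rmax_right by lra. intros x Hx. rewrite (RInt_Delta k N x) by lra. f_equal. unfold u, v. ring. }
 rewrite Rabs_pos_eq by (apply RInt_ge_0; [lra | fin | intros; apply pow2_ge_0]).
 le (RInt (fun x => 2*u x^2 + 2*((V*X)*(V*X))) 1 X).
 - apply RInt_mono; auto; [fin|].
  intros x Hx. assert (Hv : Rabs (v x) <= V*X).
  { unfold v. unfold Rminus at 1. ub Rabs_triang. rewrite Rabs_Ropp, Rabs_mult, (Rabs_pos_eq (x - 1)) by lra. unfold V.
   note (Rabs_pos (Re (pole_prim k 1))). note (Rabs_pos (Re (zeta (RtoC 0)^k)%C)). nra. }
  assert (T1 := Rabs_triang (u x) (v x)). rewrite <- (pow2_abs (u x + v x)), <- (pow2_abs (u x)).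
  replace (Rabs (u x + v x)^2) with (Rabs (u x + v x)*Rabs (u x + v x)) by ring. replace (Rabs (u x)^2) with (Rabs (u x)*Rabs (u x)) by ring.
  apply sq_le_2; [fin | fin | lra].
 - rewrite (RInt_plus (V := RC)), (RInt_scal (V := RC)), RInt_const.
  + match goal with |- _ <= ?B => change (2*RInt (fun x => u x^2) 1 X + (X - 1)*(2*((V*X)*(V*X))) <= B) end.
   specialize (H X N __). fold u in H. assert (X3 : X*(X*X) <= Rpower X rh).
   { replace (X*(X*X)) with (X^3) by ring. rewrite <- Rpower_pow by lra. apply Rpower_le_base1; auto. replace (INR 3) with 3 by (unfold INR; ring). unfold rh; lra. }
   assert (V2 : 0 <= V*V) by apply Rle_0_sqr. assert (VX : V*V*(X*(X*X)) <= V*V*Rpower X rh) by (mul_l; auto).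
   assert (0 <= V*X*(V*X)) by apply Rle_0_sqr.
   le (2*(B*Rpower X rh) + X*(2*(V*X*(V*X)))); [|lra].
   apply Rplus_le_compat; [mul_l; [lra | exact H] | mul_r; lra].
  + fin.
  + fin.
  + fin.
Qed.

(** Here [eta] tends to 0. The value [p_infty] contradicts a single admissible exponent, and
    [m_infty] satisfies the bound at once. *)
Lemma rho_le k : (3 <= k <= 6)%nat -> Rbar_le (rho k) (Finite (4 - 3/INR k)).
Proof.
 intros Hk. assert (L : forall eta, 0 < eta <= 1/20 -> Rbar_le (rho k) (Finite (4 - 3/INR k + 2*eta))).
 { intros eta He. apply (proj1 (Glb_Rbar_correct (admissible_exponent k))). apply admissible; auto. }
 destruct (rho k) as [g | |]; [| exact (L (1/20) __) | exact I].
 simpl in *. apply le_epsilon. intros e He. assert (M := L (Rmin (e/2) (1/20))).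
 note (Rmin_l (e/2) (1/20)). note (Rmin_r (e/2) (1/20)). assert (0 < Rmin (e/2) (1/20)) by fin. lra.
Qed.

Theorem theorem2 :
  Rbar_le (rho 3) (Finite 3) /\
  Rbar_le (rho 4) (Finite (13 / 4)) /\
  Rbar_le (rho 5) (Finite (17 / 5)) /\
  Rbar_le (rho 6) (Finite (7 / 2)).
Proof.
 assert (H : forall k r, (3 <= k <= 6)%nat -> r = 4 - 3/INR k -> Rbar_le (rho k) (Finite r)) by (intros k r Hk ->; apply rho_le; auto).
 repeat split; apply H; try lia; unfold INR; field.
Qed.
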